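(* Let $k\ge1$ and $d\ge2$. The property of being of small topological degree on some attracting set is open in the set of holomorphic endomorphisms of $\mathbb{P}^k$ of algebraic degree $d$. That is, if $f$ is an endomorphism of $\mathbb{P}^k$ of algebraic degree $d$ which is of small topological degree on some attracting set of $f$, then every endomorphism $g$ of algebraic degree $d$ sufficiently close to $f$ is of small topological degree on some attracting set of $g$.
   Context: $\mathbb{P}^k=\mathbb{P}^k(\mathbb{C})$. The algebraic degree $d$ of an endomorphism is the common degree of the homogeneous polynomials defining it; the set of endomorphisms of degree $d$ carries the usual (Euclidean) topology, e.g. that of coefficients, equivalently uniform convergence. Attracting set: a set $\mathscr{A}\subset\mathbb{P}^k$ is an attracting set for $f$ if there is an open set $U$ (called a trapping region of $\mathscr{A}$) with $f(U)\Subset U$ and $\mathscr{A}=\bigcap_{n\ge0}f^n(U)$. Dimension: an attracting set in $\mathbb{P}^k$ is of dimension $k-m$ if it supports (i.e. contains the support of) a nonzero positive closed current of bidimension $(k-m,k-m)$, but none of bidimension $(l,l)$ with $l>k-m$. Small topological degree: let $U$ be a trapping region for an attracting set $\mathscr{A}$ of dimension $k-m$. $f$ is asymptotically of small topological degree on $U$ if for all $p\in f(U)$, $\limsup_{n\to\infty}\big(\operatorname{card}(f^{-n}(p)\cap U)\big)^{1/n}<d^{k-m}$, preimages being counted with multiplicity. $f$ is of small topological degree on $\mathscr{A}$ if it is asymptotically of small topological degree on some trapping region of $\mathscr{A}$. *)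

(* Defs.v *)
From HB Require Import structures.
From mathcomp Require Import all_boot all_order all_algebra.
From mathcomp Require Import all_classical all_reals all_analysis.
From mathcomp Require Import complex.
(* [mpoly] is not imported: its notations clash with those of analysis *)
From mathcomp.multinomials Require mpoly.

Set Implicit Arguments.
Unset Strict Implicit.
Unset Printing Implicit Defensive.

Import Order.TTheory GRing.Theory Num.Theory.
Import numFieldNormedType.Exports.

Local Open Scope classical_set_scope.
Local Open Scope quotient_scope.
Local Open Scope complex_scope.
Local Open Scope ring_scope.

HB.instance Definition _ (R : rcfType) := NormedModule.copy R[i] R[i]^o.

(* P^k is the topological quotient of C^(k+1) \ {0} by colinearity *)

Section ProjectiveSpace.
Context (R : realType) (k : nat).

Definition punctured : Type := set_type [set z : 'rV[R[i]]_k.+1 | z != 0].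

HB.instance Definition _ := Topological.on punctured.

Definition colinear (z w : punctured) : bool :=
  `[< exists2 c : R[i], c != 0 & val z = c *: val w >].

Lemma colinear_refl : reflexive colinear.
Proof. by move=> z; apply/asboolP; exists 1; rewrite ?oner_neq0 ?scale1r. Qed.

Lemma colinear_sym : symmetric colinear.
Proof.
suff h z w : colinear z w -> colinear w z.
  by move=> z w; apply/idP/idP; exact: h.
move=> /asboolP[c c0 zw]; apply/asboolP; exists c^-1; rewrite ?invr_neq0//.
by rewrite zw scalerA mulVf// scale1r.
Qed.

Lemma colinear_trans : transitive colinear.
Proof.
move=> w z t /asboolP[a a0 zw] /asboolP[b b0 wt]; apply/asboolP.
by exists (a * b); rewrite ?mulf_neq0// zw wt scalerA.
Qed.

Canonical colinear_equiv :=
  EquivRel colinear colinear_refl colinear_sym colinear_trans.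

Definition projective_space : Type := quotient_topology {eq_quot colinear}.

HB.instance Definition _ := Topological.on projective_space.

Definition pclass (z : punctured) : projective_space :=
  \pi_(quotient_topology {eq_quot colinear}) z.

End ProjectiveSpace.

Section Endomorphisms.
Context (R : realType) (k : nat).
Local Notation Pk := (projective_space R k).

Definition homogeneous_map (d : nat) : Type :=
  'I_k.+1 -> mpoly.dhomog k.+1 R[i] d.

Definition component d (F : homogeneous_map d) (j : 'I_k.+1) :
  mpoly.mpoly k.+1 R[i] := mpoly.mpoly_of_dhomog (F j).

Definition eval_map d (F : homogeneous_map d) (z : 'rV[R[i]]_k.+1) :
  'rV[R[i]]_k.+1 := \row_j mpoly.meval (z ord0) (component F j).

(* In particular [F] has no zero outside the origin *)
Definition is_lift d (F : homogeneous_map d) (f : Pk -> Pk) : Prop :=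
  forall z : punctured R k, exists2 w : punctured R k,
    val w = eval_map F (val z) & f (pclass z) = pclass w.

Definition endomorphism (d : nat) (f : Pk -> Pk) : Prop :=
  exists F : homogeneous_map d, is_lift F f.

(* The set of endomorphisms of degree [d] carries the quotient topology of the
   topology of the coefficients of the lifts (two lifts of the same map are
   proportional): a set is open when its preimage in the space of lifts is. *)
Definition open_endomorphisms (d : nat) (S : set (Pk -> Pk)) : Prop :=
  S `<=` endomorphism d /\
  forall (f : Pk -> Pk) (F : homogeneous_map d), S f -> is_lift F f ->
  exists2 e : R, 0 < e &
    forall (g : Pk -> Pk) (G : homogeneous_map d), is_lift G g ->
      (forall j m, `|mpoly.mcoeff m (component G j)
                     - mpoly.mcoeff m (component F j)| < e%:C) ->
      S g.

End Endomorphisms.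

(* A differential form on P^k is represented by its pull-back to
   C^(k+1) \ {0}; the values at the origin are irrelevant. A form of degree n
   takes a point z and n tangent vectors, the rows of an n x (k+1) matrix. *)

Section Forms.
Context (R : realType) (k : nat).
Local Notation C := R[i].
Local Notation V := 'rV[R[i]]_k.+1.

Definition difference_quotient (F : V -> C) (z v : V) (h : R) : C :=
  h%:C^-1 * (F (z + h%:C *: v) - F z).

Definition real_derivable (F : V -> C) (z v : V) : Prop :=
  cvg (difference_quotient F z v h @[h --> 0^']).

Definition real_derive (v : V) (F : V -> C) : V -> C :=
  fun z => lim (difference_quotient F z v h @[h --> 0^']).

Definition iter_derive (vs : seq V) (F : V -> C) : V -> C :=
  foldr real_derive F vs.

Definition smooth (F : V -> C) : Prop :=
  forall (vs : seq V) (z : V), z != 0 ->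
    {for z, continuous (iter_derive vs F)} /\
    forall v, real_derivable (iter_derive vs F) z v.

Definition preform (n : nat) : Type := V -> 'M[C]_(n, k.+1) -> C.

Record is_form n (phi : preform n) : Prop := IsForm {
  form_smooth : forall W, smooth (phi^~ W);
  form_multilinear : forall z W X Y (i : 'I_n) (b c : R), z != 0 ->
    row i W = b%:C *: row i X + c%:C *: row i Y ->
    row' i X = row' i W -> row' i Y = row' i W ->
    phi z W = b%:C * phi z X + c%:C * phi z Y;
  form_alternating : forall z W (i j : 'I_n), z != 0 ->
    i != j -> row i W = row j W -> phi z W = 0;
  (* the two conditions for descending to the quotient P^k *)
  form_invariant : forall z W (c : C), z != 0 -> c != 0 ->
    phi (c *: z) (c *: W) = phi z W;
  form_horizontal : forall z W (i : 'I_n) (c : C), z != 0 ->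
    row i W = c *: z -> phi z W = 0
}.

Definition ext_derivative n (phi : preform n) : preform n.+1 :=
  fun z W => \sum_(i < n.+1)
    (-1) ^+ i * real_derive (row i W) (phi^~ (row' i W)) z.

Definition bidegree n (a b : nat) (phi : preform n) : Prop :=
  (a + b)%N = n /\
  forall z W (c : C), z != 0 -> phi z (c *: W) = c ^+ a * conjc c ^+ b * phi z W.

(* Pointwise, a combination with nonnegative coefficients of
     (i alpha_1 /\ conj alpha_1) /\ ... /\ (i alpha_l /\ conj alpha_l)
     = i^(l^2) alpha_1 /\ ... /\ alpha_l /\ conj alpha_1 /\ ... /\ conj alpha_l
   where the covectors alpha_j of type (1,0), the columns of [A s], vanish on
   the line through z *)
Definition strongly_positive l (phi : preform (l + l)) : Prop :=
  forall z, z != 0 ->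
  exists (N : nat) (c : 'I_N -> R) (A : 'I_N -> 'M[C]_(k.+1, l)),
  [/\ forall s, 0 <= c s,
      forall s, z *m A s = 0 &
      forall W, phi z W = \sum_(s < N) (c s)%:C *
        ('i%C ^+ (l ^ 2) * \det (row_mx (W *m A s) (map_mx conjc (W *m A s))))].

Definition form_support n (phi : preform n) : set (projective_space R k) :=
  closure [set pclass z | z in [set z : punctured R k |
                                 exists W, phi (val z) W != 0]].

End Forms.

Section Currents.
Context (R : realType) (k : nat).
Local Notation C := R[i].
Local Notation V := 'rV[R[i]]_k.+1.
Local Notation functional n := (preform R k n -> R[i]).

(* The derivatives of order at most [N] of the coefficients of [phi] are
   bounded by [M] on the unit sphere, a compact set that meets every line:
   these bounds define the C^oo topology on forms. *)
Definition derivatives_bounded n (N : nat) (M : R) (phi : preform R k n)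
    : Prop :=
  forall (z : V) (vs : seq V) (W : 'M[C]_(n, k.+1)),
    `|z| = 1 -> (size vs <= N)%N -> all (fun v => `|v| <= 1) vs -> `|W| <= 1 ->
    `|iter_derive vs (phi^~ W) z| <= M%:C.

(* Only the values of [T] on forms matter *)
Record is_current n (T : functional n) : Prop := IsCurrent {
  current_linear : forall (c : C) phi psi, is_form phi -> is_form psi ->
    T (fun z W => c * phi z W + psi z W) = c * T phi + T psi;
  current_continuous : exists (N : nat) (K : R), forall phi (M : R),
    is_form phi -> derivatives_bounded N M phi -> `|T phi| <= (K * M)%:C
}.

Definition bidimension l (T : functional (l + l)) : Prop :=
  forall a b phi, is_form phi -> bidegree a b phi -> (a, b) <> (l, l) ->
    T phi = 0.

Definition positive l (T : functional (l + l)) : Prop :=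
  forall phi, is_form phi -> strongly_positive phi -> 0 <= T phi.

Definition current_closed n : functional n -> Prop :=
  match n with
  | 0 => fun _ => True
  | n'.+1 => fun T => forall psi : preform R k n', is_form psi ->
      T (ext_derivative psi) = 0
  end.

Definition current_support n (T : functional n) : set (projective_space R k) :=
  [set p | forall U, open U -> U p ->
    exists phi, [/\ is_form phi, form_support phi `<=` U & T phi != 0]].

Definition supports_current (A : set (projective_space R k)) (l : nat)
    : Prop :=
  exists T : functional (l + l),
    [/\ is_current T, bidimension T, positive T & current_closed T] /\
    (exists2 phi, is_form phi & T phi != 0) /\ current_support T `<=` A.

End Currents.

Section AttractingSets.
Context (R : realType) (k : nat).
Local Notation Pk := (projective_space R k).

Definition trapping_region (f : Pk -> Pk) (A U : set Pk) : Prop :=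
  [/\ open U, compact (closure (f @` U)), closure (f @` U) `<=` U &
      A = \bigcap_n (iter n f @` U)].

Definition attracting_set (f : Pk -> Pk) (A : set Pk) : Prop :=
  exists U, trapping_region f A U.

Definition attracting_dim (A : set Pk) (s : nat) : Prop :=
  supports_current A s /\ forall l, (s < l)%N -> ~ supports_current A l.

(* Local topological degree: the maximal number of preimages near [q] of the
   points near [h q] *)
Definition multiplicity (h : Pk -> Pk) (q : Pk) : \bar R :=
  ereal_inf [set limf_esup
      (fun p => \esum_(x in W `&` h @^-1` [set p]) 1%E) (nbhs (h q))
    | W in nbhs q].

Definition preimage_card (h : Pk -> Pk) (U : set Pk) (p : Pk) : \bar R :=
  \esum_(q in h @^-1` [set p] `&` U) multiplicity h q.

Definition asymptotically_small_topological_degree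
    (f : Pk -> Pk) (d s : nat) (U : set Pk) : Prop :=
  forall p, (f @` U) p ->
    (limn_esup (fun n => preimage_card (iter n f) U p `^ n%:R^-1)
       < (d ^ s)%:R%:E)%E.

Definition small_topological_degree (f : Pk -> Pk) (d : nat) (A : set Pk)
    : Prop :=
  exists (m : nat) (U : set Pk),
    [/\ (m <= k)%N, attracting_dim A (k - m), trapping_region f A U &
        asymptotically_small_topological_degree f d (k - m) U].

End AttractingSets.

(* Main.v *)
(* Let U be a trapping region on which f has small topological degree, and
   let U' be open with f(U) relatively compact in U' and U' in U. For g near f,
   U' is a trapping region of g.

   Dimension. Let h, of degree d, map a trapping region into itself and let T
   be a nonzero positive closed current of bidimension (l, l) on its attracting
   set, or merely on the trapping region. The pull-back by h of the Levi form
   of log |z|^2 is d times that form modulo an exact form, so by Stokes the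
   push-forward multiplies the mass by d^l; hence the limits of
   d^(-ln) (h^n)_* T along an ultrafilter are nonzero, and they are carried by
   the attracting set. These limits exist since a positive current T satisfies
   |T phi| <= C |phi| T(Theta) for a standard positive form Theta. Applied to
   g and U', and to f and U, this shows that the attracting sets of f in U and
   of g in U' support currents of the same bidimensions.

   Degree. Multiplicities are local degrees of the lifts, so the number of
   preimages in a compact set is upper semicontinuous in the map and in the
   point, and it is submultiplicative along orbits. By compactness, finitely
   many iterates of f control the growth of the preimages for every g near f. *)

Require Import Defs.
From mathcomp Require Import fingroup perm all_boot all_order all_algebra.
From mathcomp Require Import all_classical all_reals all_analysis.
From mathcomp Require Import complex.
From mathcomp.multinomials Require Import -(notations) mpoly.
From mathcomp Require Import ring lra zify.

Set Implicit Arguments.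
Unset Strict Implicit.
Unset Printing Implicit Defensive.
Import Order.TTheory GRing.Theory Num.Theory.
Import numFieldNormedType.Exports.
Local Open Scope complex_scope.
Local Open Scope classical_set_scope.
Local Open Scope ring_scope.

(** * Nullstellensatz *)

(** The multiplicity of the definition is a limsup of numbers of preimages, so the part on degrees
    rests on one fact: the number of zeros of a polynomial system in a small ball is stable under
    perturbation. Following the zeros along a path of systems proves it as long as all zeros met are
    nondegenerate. The obstacle is to find such a path, and it is overcome by algebra: on a line of
    systems, degenerate zeros occur only at the roots of a polynomial in the parameter, a
    determinant equal to 1 at the start, and an arc in the complex line avoids them. Zeros are
    counted in C^(k+1) near one representative; e-th roots of unity other than 1 stay away from 1,
    so lifts and maps of P^k have the same counts. For currents, the proof works with functionals
    that are linear, positive, closed and of the right bidimension; the inequality for positive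
    currents gives their continuity back. The powers of Levi forms are alternated products of
    kernels in two vectors, and a kernel symmetric in its two vectors contributes nothing: their
    comparison modulo exact forms is a chain of such cancellations. *)

Lemma mpoly_ring_ind n (R : nzRingType) (P : mpoly n R -> Prop) :
  (forall c, P (mpolyC n c)) -> (forall i, P (mpolyX R (mnm1 i))) ->
  (forall p q, P p -> P q -> P (p + q)) -> (forall p q, P p -> P q -> P (p * q)) ->
  forall p, P p.
Proof.
move=> PC PX PD PM; elim/mpolyind => [|c m p _ _ Pp]; first by rewrite -mpolyC0.
have P1 : P 1 by rewrite -mpolyC1.
apply: PD => //; rewrite -mul_mpolyC; apply: (PM) => //.
rewrite mpolyXE_id; apply: (big_ind P); [exact: P1|exact: (PM)|move=> i _].
by elim: (m i) => [|e IHe]; [rewrite expr0|rewrite exprS; apply: (PM)].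
Qed.

Section Nullstellensatz.
Variables (K : closedFieldType) (n : nat).
Hypothesis K_uncountable : ~ countable [set: K].
Local Notation A := (mpoly n K).

Definition is_ideal (I : A -> Prop) : Prop :=
  [/\ I 0, forall p q, I p -> I q -> I (p + q) & forall a p, I p -> I (a * p)].

(** Uncountability enters here: if every sublevel set of [g] were finite, [K] would be a countable
    union of finite sets. *)
Lemma unbounded_fibre (g : K -> nat) :
  exists N, forall M, exists s : seq K,
    [/\ uniq s, size s = M & all (fun a => (g a <= N)%N) s].
Proof.
apply: contrapT => /forallNP noN; apply: K_uncountable.
have -> : [set: K] = \bigcup_(N : nat) [set a | (g a <= N)%N].
  by apply/seteqP; split=> // a _; exists (g a) => //=.
apply: bigcup_countable => [|N _]; first exact: countableP.
apply: finite_set_countable; apply: contrapT => inf.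
apply: (noN N) => M.
have [B BA MB] := infinite_set_fset M inf.
exists (take M (finmap.enum_fset B)); split.
- by rewrite take_uniq ?finmap.fset_uniq.
- by rewrite size_takel.
- by apply/allP => a /mem_take aB; apply: BA.
Qed.

(** [msize] is the degree plus one, so the [u i] lie in the span of the monomials of degree less
    than [N], whose number is the cardinal of [bmultinom n N]. *)
Lemma linear_dependency N m (u : 'I_m -> A) :
  (forall i, msize (u i) <= N)%N -> (#|{: bmultinom n N}| < m)%N ->
  exists2 c : 'I_m -> K, exists i, c i != 0 & \sum_i c i *: u i = 0.
Proof.
move=> uN ltm.
pose M := \matrix_(i < m, j < #|{: bmultinom n N}|) mcoeff (bmnm (enum_val j)) (u i).
have /rowV0Pn[v /sub_kermxP vM v0] : kermx M != 0.
  by rewrite kermx_eq0 /row_free ltn_eqF // (leq_ltn_trans (rank_leq_col _)).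
exists (fun i => v ord0 i).
  apply: contrapT => /forallNP h; move/eqP: v0; apply.
  by apply/rowP => i; rewrite mxE; apply/eqP; move: (h i) => /negP; rewrite negbK.
apply/mpolyP => mm; rewrite mcoeff0 raddf_sum /=.
have [lt|le] := ltnP (mdeg mm) N.
  move/rowP: vM => /(_ (enum_rank (BMultinom lt))); rewrite !mxE => h.
  rewrite -[RHS]h; apply: eq_bigr => i _; rewrite mcoeffZ mxE enum_rankK //.
apply: big1 => i _; rewrite mcoeffZ memN_msupp_eq0 ?mulr0 //.
by apply: mmeasure_mnm_ge; apply: leq_trans le; apply: uN.
Qed.

Definition adjoin (I : A -> Prop) (p : A) : A -> Prop :=
  fun q => exists u v, I u /\ q = u + v * p.

Lemma adjoin_ideal I p : is_ideal I -> is_ideal (adjoin I p).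
Proof.
move=> [I0 ID IM]; split.
- by exists 0, 0; rewrite mul0r addr0.
- move=> q r [u [v [Iu ->]]] [u' [v' [Iu' ->]]].
  by exists (u + u'), (v + v'); split; [exact: ID|ring].
- move=> a q [u [v [Iu ->]]]; exists (a * u), (a * v); split; [exact: IM|ring].
Qed.

Lemma sub_adjoin (I : A -> Prop) p q : I q -> adjoin I p q.
Proof. by move=> Iq; exists q, 0; rewrite mul0r addr0. Qed.

Lemma adjoin_gen (I : A -> Prop) p : I 0 -> adjoin I p p.
Proof. by move=> I0; exists 0, 1; rewrite mul1r add0r. Qed.

(** Suppose that every [x - a] has an inverse [u a] modulo [I]. Arbitrarily many of these inverses
    have a common bound on their degrees, hence some are linearly dependent. Clearing denominators
    in the dependency gives a nonzero polynomial [q] in one variable with [q(x)] in [I]; as [q]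
    splits into factors [x - z], all invertible modulo [I], the ideal would contain 1. *)
Lemma adjoin_proper I (x : A) : is_ideal I -> ~ I 1 ->
  exists a : K, ~ adjoin I (x - a%:A) 1.
Proof.
move=> idI I1; have [I0 ID IM] := idI; apply: contrapT => /forallNP noa.
have IB p q : I p -> I q -> I (p - q).
  by move=> Ip Iq; apply: ID => //; rewrite -mulN1r; apply: IM.
have Isum (J : finType) (P : pred J) (F : J -> A) :
    (forall i, P i -> I (F i)) -> I (\sum_(i | P i) F i).
  by move=> h; apply: (big_ind I).
have inv a : exists u : A, I (1 - u * (x - a%:A)).
  have := noa a => /contrapT[u [v [Iu e]]]; exists v.
  by rewrite [X in X - _]e addrK.
have [u Iu] := choice inv.
have [N hN] := unbounded_fibre (fun a => msize (u a)).
have [s [us ss sN]] := hN (#|{: bmultinom n N}|.+1).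
pose m := size s.
have [||c [i0 ci0] csum] := @linear_dependency N m (fun i => u s`_i).
- by move=> i; apply: (allP sN); apply: mem_nth.
- by rewrite /m ss.
(* The numerator of the sum of the fractions [c i / ('X - s_i)]; at [s_i0] only the term of index
   [i0] survives. *)
pose q : {poly K} := \sum_(i < m) c i *: \prod_(j < m | j != i) ('X - (s`_j)%:P).
have q0 : q != 0.
  apply/eqP => /(congr1 (fun p => p.[s`_i0])); rewrite horner0 horner_sum.
  rewrite (bigD1 i0) //= [X in _ + X]big1 ?addr0 => [|i ni0]; last first.
    by rewrite hornerZ horner_prod (bigD1 i0) 1?eq_sym //= hornerXsubC subrr mul0r mulr0.
  rewrite hornerZ horner_prod => /eqP; rewrite mulf_eq0 (negPf ci0) /= => /prodf_eq0[j nj].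
  rewrite hornerXsubC subr_eq0 nth_uniq ?ltn_ord // => /eqP/val_inj e.
  by rewrite e eqxx in nj.
have Iq : I (horner_alg x q).
  rewrite /q rmorph_sum /=.
  (* The factor missing in the term [i] is supplied by its inverse [u s_i]: up to elements of [I],
     [q(x)] is the vanishing combination times the full product. *)
  have -> : \sum_(i < m) horner_alg x (c i *: \prod_(j < m | j != i) ('X - (s`_j)%:P)) =
    \sum_(i < m) ((c i)%:A * \prod_(j < m | j != i) (x - (s`_j)%:A)) * (1 - u s`_i * (x - (s`_i)%:A))
     + (\sum_(i < m) c i *: u s`_i) * \prod_(j < m) (x - (s`_j)%:A).
    rewrite mulr_suml -big_split /=; apply: eq_bigr => i _.
    rewrite linearZ /= rmorph_prod /= (bigD1 i (P := predT)) //=.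
    under eq_bigr do rewrite rmorphB /= horner_algC horner_algX.
    set P := \prod_(j < m | _) _.
    by rewrite -!mul_mpolyC; change (in_alg _ ?a) with (a%:A : A); rewrite -?mul_mpolyC; ring.
  rewrite csum mul0r addr0; apply: Isum => i _; exact: IM.
have [r er] := closed_field_poly_normal q.
have lc0 : lead_coef q != 0 by rewrite lead_coef_eq0.
have Ir : I (\prod_(z <- r) (x - z%:A)).
  have -> : \prod_(z <- r) (x - z%:A) = (lead_coef q)^-1%:A * horner_alg x q.
    have -> : horner_alg x q = lead_coef q *: \prod_(z <- r) (x - z%:A).
      have := congr1 (horner_alg x) er; rewrite linearZ /= rmorph_prod /= => ->.
      rewrite mulr_algl (eq_bigr (fun z => x - z%:A)) // => z _.
      by rewrite rmorphB /= horner_algC horner_algX.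
    by rewrite mulr_algl scalerA mulVf // scale1r.
  exact: IM.
have [h Ih] : exists h, I (1 - h * \prod_(z <- r) (x - z%:A)).
  elim: (r) => [|z r' [h Ih]]; first by exists 1; rewrite big_nil mul1r subrr.
  exists (h * u z); rewrite big_cons.
  have -> : 1 - h * u z * ((x - z%:A) * \prod_(j <- r') (x - j%:A)) =
     (1 - h * \prod_(j <- r') (x - j%:A)) + (h * \prod_(j <- r') (x - j%:A)) * (1 - u z * (x - z%:A)) by ring.
  by apply: ID => //; apply: IM.
by apply: I1; rewrite -[1](subrK (h * \prod_(z <- r) (x - z%:A))); apply: ID => //; apply: IM.
Qed.

(** The coordinates of the zero are found one variable at a time. Modulo the resulting proper ideal
    every polynomial is congruent to its value at [a], so a nonzero value of an element of [I] would
    put 1 into the ideal. *)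
Lemma proper_ideal_zero I : is_ideal I -> ~ I 1 ->
  exists a : 'I_n -> K, forall p, I p -> meval a p = 0.
Proof.
move=> idI I1.
have [a [J [idJ J1 IJ Ja]]] : exists (a : 'I_n -> K) (J : A -> Prop),
    [/\ is_ideal J, ~ J 1, forall p, I p -> J p & forall i, J (mpolyX K (mnm1 i) - (a i)%:A)].
  suff H m : (m <= n)%N -> exists (a : 'I_n -> K) (J : A -> Prop),
    [/\ is_ideal J, ~ J 1, forall p, I p -> J p &
        forall i : 'I_n, (i < m)%N -> J (mpolyX K (mnm1 i) - (a i)%:A)].
    by have [a [J [? ? ? h]]] := H n (leqnn n); exists a, J; split=> // i; exact: h.
  elim: m => [_|m IHm ltm]; first by exists (fun=> 0), I; split.
  have [a [J [idJ J1 IJ Ja]]] := IHm (ltnW ltm).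
  pose im := Ordinal ltm.
  have [b Jb] := adjoin_proper (mpolyX K (mnm1 im)) idJ J1.
  exists (fun i => if i == im then b else a i), (adjoin J (mpolyX K (mnm1 im) - b%:A)).
  split=> //; first exact: adjoin_ideal.
    by move=> p Ip; apply: sub_adjoin; apply: IJ.
  move=> i; rewrite ltnS leq_eqVlt => /orP[/eqP ei|lti].
    have -> : i = im by apply: val_inj.
    by rewrite eqxx; apply: adjoin_gen; case: idJ.
  rewrite ifN; last by apply: contraTneq lti => ->; rewrite ltnn.
  exact/sub_adjoin/Ja.
exists a => p Ip; have [J0 JD JM] := idJ.
have JB q r : J q -> J r -> J (q - r).
  by move=> Iq Ir; apply: JD => //; rewrite -mulN1r; apply: JM.
have Jev q : J (q - (meval a q)%:A).
  elim/mpoly_ring_ind: q => [c|i|p1 p2 J1' J2|p1 p2 J1' J2].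
  - by rewrite mevalC -mul_mpolyC mulr1 subrr.
  - by rewrite mevalXU.
  - by rewrite mevalD scalerDl opprD addrACA; apply: JD.
  - rewrite mevalM.
    have -> : p1 * p2 - (meval a p1 * meval a p2)%:A =
        p2 * (p1 - (meval a p1)%:A) + (meval a p1)%:A * (p2 - (meval a p2)%:A).
      by rewrite -!mul_mpolyC mpolyCM; ring.
    by apply: JD; apply: JM.
apply: contrapT => /eqP pa; apply: J1.
have : J ((meval a p)^-1%:A * (p - (p - (meval a p)%:A))) by apply: JM; apply: JB => //; apply: IJ.
by rewrite subKr mulr_algl scalerA mulVf // scale1r.
Qed.

Lemma weak_nullstellensatz (J : finType) (p : J -> A) :
  (forall a : 'I_n -> K, exists j, meval a (p j) != 0) ->
  exists h : J -> A, \sum_j h j * p j = 1.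
Proof.
move=> nz; apply: contrapT => no.
have [||a ha] := @proper_ideal_zero (fun q => exists h : J -> A, \sum_j h j * p j = q).
- split.
  + by exists (fun=> 0); apply: big1 => j _; rewrite mul0r.
  + move=> _ _ [h <-] [h' <-]; exists (fun j => h j + h' j).
    by rewrite -big_split /=; apply: eq_bigr => j _; rewrite mulrDl.
  + move=> b _ [h <-]; exists (fun j => b * h j).
    by rewrite mulr_sumr; apply: eq_bigr => j _; rewrite mulrA.
- exact: no.
have [j /eqP] := nz a; apply; apply: ha; exists (fun i => (i == j)%:R).
rewrite (bigD1 j) //= eqxx mul1r big1 ?addr0 // => i /negPf ->.
by rewrite mul0r.
Qed.
End Nullstellensatz.

(** * Finite fibres and critical values *)

Section PolynomialMaps.
Variables (K : numClosedFieldType) (n : nat).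
Hypothesis K_uncountable : ~ countable [set: K].
Local Notation A := (mpoly n K).
Local Notation ev z p := (meval (fun_of_matrix z ord0) p).
Local Notation XU i := (mpolyX K (mnm1 i)).

(** If [p] vanishes everywhere, [p - 1] takes only the value -1; by the Nullstellensatz it is a
    unit, hence a constant. *)
Lemma meval_all_eq0 (p : A) : (forall z : 'rV[K]_n, ev z p = 0) -> p = 0.
Proof.
move=> p0; have pz a : meval a p = 0.
  by rewrite -(p0 (\row_i a i)); apply: meval_eq => i; rewrite mxE.
have [|h] := @weak_nullstellensatz K n K_uncountable unit (fun=> p - 1).
  by move=> a; exists tt; rewrite mevalB pz meval1 sub0r oppr_eq0 oner_eq0.
rewrite (bigD1 tt) //= big1 ?addr0 => [hp|[]//].
have : msize (h tt * (p - 1)) == 1%N by rewrite hp msize1.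
have h0 : h tt != 0 by apply/eqP => h0; move/eqP: hp; rewrite h0 mul0r eq_sym oner_eq0.
have q0 : p - 1 != 0 by apply/eqP => q0; move/eqP: hp; rewrite q0 mulr0 eq_sym oner_eq0.
rewrite msizeM // => sz.
have : (msize (p - 1) <= 1)%N.
  move: sz; have : (0 < msize (h tt))%N by rewrite lt0n msize_poly_eq0.
  move: (msize (h tt)) (msize (p - 1)) => u v; lia.
move=> /msize1_polyC e; have := p0 0; rewrite -[p](subrK 1) [p - 1]e.
rewrite mevalD mevalC meval1 => c0.
by rewrite -mpolyC1 -mpolyCD c0 mpolyC0.
Qed.

Lemma meval_dhomog d (p : A) (c : K) (a : 'I_n -> K) : p \is ishomog1 d mdeg ->
  meval (fun i => c * a i) p = c ^+ d * meval a p.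
Proof.
move=> /dhomogP hp; rewrite !mevalE mulr_sumr !big_seq; apply: eq_bigr => m /hp <-.
have -> : c ^+ mdeg m = \prod_i c ^+ m i.
  by rewrite prodrXr; congr (c ^+ _); exact: mdegE.
rewrite mulrCA; congr (_ * _); rewrite -big_split /=.
by apply: eq_bigr => i _; rewrite exprMn.
Qed.

Lemma pihomogM_dhomog d e (p q : A) : q \is ishomog1 e mdeg ->
  pihomog mdeg (d + e) (p * q) = pihomog mdeg d p * q.
Proof.
move=> hq; rewrite [in LHS](pihomog_partitionE (leqnn (msize p))) mulr_suml raddf_sum /=.
have [lt|ge] := ltnP d (msize p).
  rewrite (bigD1 (Ordinal lt)) //= big1 ?addr0.
    by apply: pihomog_dE; apply: dhomogM => //; apply: pihomogP.
  move=> i ni; apply: (@pihomog_ne0 _ _ _ (i + e)%N).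
    by rewrite eqn_add2r; apply: contra ni => /eqP ei; apply/eqP/val_inj.
  by apply: dhomogM => //; apply: pihomogP.
rewrite big1 => [|i _].
  suff -> : pihomog mdeg d p = 0 by rewrite mul0r.
  rewrite pihomogE big_seq_cond big1 // => m /andP[/msize_mdeg_lt mp /eqP md].
  by move: ge; rewrite -md leqNgt mp.
apply: (@pihomog_ne0 _ _ _ (i + e)%N).
  by rewrite eqn_add2r ltn_eqF // (leq_trans (ltn_ord i)).
by apply: dhomogM => //; apply: pihomogP.
Qed.

Lemma msize_pihomog d (p : A) : (msize (pihomog mdeg d p) <= d.+1)%N.
Proof.
rewrite msizeE; apply/bigmax_leqP_seq => m mp _.
by rewrite (dhomogP _ _ _ (pihomogP _ _ _) m mp).
Qed.

Variables (e : nat) (F : 'I_n -> A).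
Hypothesis e_gt0 : (0 < e)%N.
Hypothesis F_homog : forall j, F j \is ishomog1 e mdeg.
Hypothesis F_nondeg : forall z : 'rV[K]_n, (forall j, ev z (F j) = 0) -> z = 0.

(** The [F j] and [X_i - 1] have no common zero, so some combination [q] of the [F j] equals 1 on
    the hyperplane [X_i = 1]. Homogenising [q] by powers of [X_i] gives a combination of the [F j]
    equal to a power of [X_i]. *)
Lemma var_power i : exists N (h : 'I_n -> A),
  [/\ (e <= N)%N, XU i ^+ N = \sum_j h j * F j &
      forall j, (msize (h j) + e <= N.+1)%N].
Proof.
pose p (j : option 'I_n) := if j is Some j then F j else XU i - 1.
have [a|h hp] := @weak_nullstellensatz K n K_uncountable _ p.
  apply: contrapT => /forallNP no.
  have /rowP/(_ i) : (\row_l a l) = 0.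
    apply: F_nondeg => j; rewrite (meval_eq (v2 := a)); last by move=> l; rewrite mxE.
    by move: (no (Some j)) => /negP; rewrite negbK => /eqP.
  rewrite !mxE => ai; apply: (no None).
  by rewrite /= mevalB mevalXU ai meval1 sub0r oppr_eq0 oner_eq0.
pose q := \sum_j h (Some j) * F j.
pose D := (msize q + e)%N.
(* The components of [q] of degree less than [e] vanish, since the [F j] have degree [e]. *)
pose g j := \sum_(d < msize q | (e <= d)%N) pihomog mdeg (d - e) (h (Some j)) * XU i ^+ (D - d).
pose P := \sum_j g j * F j.
have PE : P = \sum_(d < msize q) pihomog mdeg d q * XU i ^+ (D - d).
  rewrite /P /g; under eq_bigr do rewrite mulr_suml.
  rewrite exchange_big /= [RHS](bigID (fun d : 'I__ => (e <= d)%N)) /=.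
  rewrite [X in _ = _ + X]big1 ?addr0.
    apply: eq_bigr => d ed; rewrite /q raddf_sum mulr_suml /=.
    by apply: eq_bigr => j _; rewrite -[in RHS](subnK ed) pihomogM_dhomog // subnK // mulrAC.
  move=> d ed; rewrite /q raddf_sum big1 ?mul0r // => j _ /=.
  rewrite [h _](pihomog_partitionE (leqnn (msize (h (Some j))))) mulr_suml raddf_sum big1 //= => l _.
  apply: (@pihomog_ne0 _ _ _ (l + e)%N); last by apply: dhomogM => //; apply: pihomogP.
  by apply: contra ed => /eqP <-; rewrite leq_addl.
exists D, (fun j => pihomog mdeg (D - e) (g j)); split; first by rewrite leq_addl.
  have XD : XU i ^+ D \is ishomog1 D mdeg.
    by rewrite -[X in ishomog1 X _]mul1n; apply: dhomogMn; rewrite dhomogX; exact/eqP/mdeg1.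
  have XDP : XU i ^+ D = P.
    (* The extra factor [X_i] makes the identity trivial on the hyperplane [X_i = 0]; elsewhere the
       coordinates can be divided by [z_i]. *)
    apply: (mulfI (x := XU i)); first by rewrite -msize_poly_eq0 msizeX.
    apply/eqP; rewrite -subr_eq0; apply/eqP/meval_all_eq0 => z.
    rewrite mevalB !mevalM mevalXU.
    have [->|zi] := eqVneq (z ord0 i) 0; first by rewrite !mul0r subrr.
    suff -> : ev z P = ev z (XU i ^+ D) by rewrite subrr.
    pose a l := (z ord0 i)^-1 * z ord0 l.
    have az : z ord0 =1 (fun l => z ord0 i * a l) by move=> l; rewrite /a mulVKf.
    have ai : meval a (XU i) = 1 by rewrite mevalXU /a mulVf.
    have aq : meval a q = 1.
      have := congr1 (meval a) hp; rewrite meval1 raddf_sum /= (bigD1 None) //=.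
      rewrite mevalM mevalB ai meval1 subrr mulr0 add0r => <-.
      rewrite (reindex_omap Some id) //=; last by case.
      by rewrite /q raddf_sum /=; apply: eq_bigl => j; rewrite eqxx.
    have -> : ev z P = \sum_(d < msize q) z ord0 i ^+ D * meval a (pihomog mdeg d q).
      rewrite PE raddf_sum /=; apply: eq_bigr => d _.
      rewrite mevalM (meval_eq _ az) (meval_dhomog _ _ (pihomogP _ _ _)).
      rewrite rmorphXn /= mevalXU mulrAC -exprD subnKC //.
      by rewrite /D (leq_trans (ltnW (ltn_ord d))) ?leq_addr.
    rewrite -mulr_sumr.
    have -> : \sum_(d < msize q) meval a (pihomog mdeg d q) = 1.
      by rewrite -[RHS]aq [in RHS](pihomog_partitionE (leqnn (msize q))) raddf_sum.
    rewrite mulr1.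
    by rewrite rmorphXn /= mevalXU.
  transitivity (pihomog mdeg (D - e + e) P); last first.
    by rewrite /P raddf_sum /=; apply: eq_bigr => j _; rewrite pihomogM_dhomog.
  by rewrite subnK ?leq_addl // -XDP pihomog_dE.
by move=> j; have := msize_pihomog (D - e) (g j); rewrite /D; move: (msize _) => u; lia.
Qed.

(** A monomial of large degree is divisible by one of the powers of variables given by
    [var_power]. *)
Lemma monomial_reduction : exists D, forall m : multinom n, (D <= mdeg m)%N ->
  exists h : 'I_n -> A, mpolyX K m = \sum_j h j * F j /\
    forall j, (msize (h j) + e <= (mdeg m).+1)%N.
Proof.
have [N hN] := choice var_power.
exists (\sum_i N i).+1 => m Dm.
have [i Nm] : exists i, (N i <= m i)%N.
  apply: contrapT => /forallNP no; move: Dm; rewrite ltnNge => /negP; apply.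
  rewrite (mdegE m); apply: leq_sum => i _; apply: ltnW; rewrite ltnNge; exact/negP.
have [h [eN Xh hsz]] := hN i.
pose m' := mnm_sub m (mnm_muln (mnm1 i) (N i)).
have em : m = mnm_add (mnm_muln (mnm1 i) (N i)) m'.
  apply/mnmP => j; rewrite mnmDE mnmBE mulmnE mnm1E.
  by case: eqVneq => [<-|_]; rewrite ?mul1n ?mul0n ?subn0 ?add0n // subnKC.
have dm : mdeg m = (N i + mdeg m')%N by rewrite {1}em mdegD mdegMn mdeg1 mul1n.
exists (fun j => h j * mpolyX K m'); split.
  rewrite {1}em mpolyXD -mpolyXn Xh mulr_suml; apply: eq_bigr => j _.
  by rewrite mulrAC.
move=> j; have [->|hj0] := eqVneq (h j) 0.
  by rewrite mul0r msize0 dm; lia.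
have : (0 < msize (h j))%N by rewrite lt0n msize_poly_eq0.
have := hsz j; rewrite dm msizeM // -?msize_poly_eq0 msizeX //.
move: (msize _) => u; lia.
Qed.

Local Notation phi := (comp_mpoly [tuple F i | i < n]).

(** The polynomial ring is a finite module over the subring generated by the [F j], the image of
    [phi]. The monomials of degree less than [D] generate it, because larger ones reduce to
    cofactors [h j] of smaller degree, as [e] is positive. *)
Lemma module_finite : exists D, forall p : A,
  exists c : bmultinom n D -> A, p = \sum_m phi (c m) * mpolyX K (bmnm m).
Proof.
have [D hD] := monomial_reduction; exists D => p.
elim: {p}(msize p).+1 {-2}p (ltnSn (msize p)) => // s IHs p ps.
pose S := fun q => exists c : bmultinom n D -> A, q = \sum_m phi (c m) * mpolyX K (bmnm m).
have SD q r : S q -> S r -> S (q + r).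
  move=> [c ->] [c' ->]; exists (fun m => c m + c' m).
  by rewrite -big_split /=; apply: eq_bigr => m _; rewrite rmorphD mulrDl.
have SM a q : S q -> S (phi a * q).
  move=> [c ->]; exists (fun m => a * c m).
  by rewrite mulr_sumr; apply: eq_bigr => m _; rewrite rmorphM mulrA.
have S0 : S 0 by exists (fun=> 0); rewrite big1 // => m _; rewrite rmorph0 mul0r.
rewrite [p]mpolyE -/(S _) big_seq; apply: (big_ind S) => // m mp.
rewrite -mul_mpolyC -(comp_mpolyC (mcoeff m p) [tuple F i | i < n]); apply: (SM).
have [lt|le] := ltnP (mdeg m) D.
  exists (fun m' => (m' == BMultinom lt)%:R).
  rewrite (bigD1 (BMultinom lt)) //= eqxx rmorph1 mul1r big1 ?addr0 // => m' /negPf ->.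
  by rewrite rmorph0 mul0r.
have [h [-> hs]] := hD m le; apply: (big_ind S) => // j _.
have -> : h j * F j = phi (XU j) * h j.
  by rewrite comp_mpolyXU mulrC -tnth_nth tnth_mktuple.
apply: (SM); apply: IHs; have := hs j.
have := leq_trans (msize_mdeg_lt mp) ps.
move: (msize _) => u; lia.
Qed.

(** The determinant trick: multiplication by [p] is given on the generators of the module by a
    matrix [X] over the subring, and the characteristic polynomial of [X] kills [p]. *)
Lemma integral_over_comp (p : A) :
  exists2 Q : {poly A}, Q \is monic & (map_poly phi Q).[p] = 0.
Proof.
have [D hD] := module_finite.
have [c hc] := choice (fun m : bmultinom n D => hD (p * mpolyX K (bmnm m))).
have [c1 hc1] := hD 1.
pose b := #|{: bmultinom n D}|.
pose X : 'M[A]_b := \matrix_(i, j) c (enum_val i) (enum_val j).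
exists (char_poly X); first exact: char_poly_monic.
pose M : 'M[A]_b := p%:M - map_mx phi X.
have detM : (map_poly phi (char_poly X)).[p] = \det M.
  rewrite map_char_poly /char_poly -horner_evalE -det_map_mx; congr (\det _).
  apply/matrixP => i j; rewrite !mxE /= /horner_eval hornerD hornerN hornerC.
  by rewrite hornerMn hornerX.
pose v : 'cV[A]_b := \col_i mpolyX K (bmnm (enum_val i)).
have Mv : M *m v = 0.
  apply/colP => i; rewrite mulmxBl mul_scalar_mx !mxE hc.
  rewrite [X in _ - X](reindex (@enum_rank _)) /=; last first.
    by exists (@enum_val _ _) => ? _; rewrite ?enum_rankK ?enum_valK.
  by apply/eqP; rewrite subr_eq0; apply/eqP/eq_bigr => m _; rewrite !mxE enum_rankK.
have dv : \det M *: v = 0.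
  by rewrite -mul_scalar_mx -mul_adj_mx -mulmxA Mv mulmx0.
rewrite detM -[LHS]mulr1 hc1 mulr_sumr big1 // => m _.
move/colP: dv => /(_ (enum_rank m)); rewrite !mxE enum_rankK mulrCA => ->.
by rewrite mulr0.
Qed.

(** Each coordinate of a point of the fibre over [w] is a root of an integral equation specialised
    at [w], whose degree does not depend on [w]. A point is encoded by the positions of its
    coordinates in the lists of roots. *)
Lemma finite_fibres : exists D, forall (w : 'rV[K]_n) (s : seq 'rV[K]_n),
  uniq s -> {in s, forall z j, ev z (F j) = w ord0 j} -> (size s <= D)%N.
Proof.
have /choice[Q hQ] : forall i, exists Q : {poly A}, Q \is monic /\ (map_poly phi Q).[XU i] = 0.
  by move=> i; have [Q ? ?] := integral_over_comp (XU i); exists Q.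
pose D := \sum_i size (Q i); exists (D.+1 ^ n)%N => w s us sw.
pose q i : {poly K} := map_poly (meval (w ord0)) (Q i).
have qm i : q i \is monic by rewrite monic_map //; case: (hQ i).
have /choice[r hr] : forall i, exists r : seq K, q i = \prod_(z <- r) ('X - z%:P).
  move=> i; have [r er] := closed_field_poly_normal (q i); exists r.
  by rewrite [LHS]er (monicP (qm i)) scale1r.
have szr i : (size (r i) < size (Q i))%N.
  have : size (q i) = (size (r i)).+1 by rewrite hr size_prod_XsubC.
  move=> <-; exact: size_poly.
have zr z i : z \in s -> z ord0 i \in r i.
  move=> zs; rewrite -root_prod_XsubC -hr rootE.
  have := congr1 (meval (z ord0)) (proj2 (hQ i)); rewrite meval0 => e0.
  rewrite -{}[X in _ == X]e0 /q.
  rewrite -horner_map /= mevalXU -map_poly_comp; apply/eqP; congr (_.[_]).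
  apply: eq_map_poly => p /=; rewrite comp_mpoly_meval; apply: meval_eq => j.
  by rewrite tnth_mktuple sw.
pose f (z : 'rV[K]_n) : {ffun 'I_n -> 'I_D.+1} := [ffun i => inord (index (z ord0 i) (r i))].
have idx z i : z \in s -> (index (z ord0 i) (r i) < D.+1)%N.
  move=> zs; apply: (@leq_trans (size (Q i))).
    by apply: leq_ltn_trans (szr i); rewrite ltnW // index_mem zr.
  by rewrite ltnW // ltnS /D (bigD1 i) //= leq_addr.
have fi : {in s &, injective f}.
  move=> z z' zs z's /ffunP ff; apply/rowP => i; have := ff i; rewrite !ffunE.
  move=> /(congr1 val); rewrite /= !inordK ?idx // => eidx.
  by rewrite -(nth_index 0 (zr z i zs)) eidx nth_index ?zr.
rewrite -(size_map f) -(card_uniqP _) ?map_inj_in_uniq //.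
by apply: leq_trans (max_card _) _; rewrite card_ffun !card_ord.
Qed.

Lemma mderiv_comp j (p : A) :
  mderiv j (phi p) = \sum_l phi (mderiv l p) * mderiv j (F l).
Proof.
elim/mpoly_ring_ind: p => [c|i|p q IHp IHq|p q IHp IHq].
- rewrite comp_mpolyC mderivC big1 // => l _; by rewrite mderivC rmorph0 mul0r.
- rewrite comp_mpolyXU -tnth_nth tnth_mktuple (bigD1 i) //= big1 ?addr0.
    by rewrite mderivX mnm1E eqxx scale1r -{1}[mnm1 i]addm0 addmC addmK mpolyX0 rmorph1 mul1r.
  by move=> l li; rewrite mderivX mnm1E eq_sym (negPf li) scale0r rmorph0 mul0r.
- rewrite !(rmorphD, mderivD) /= IHp IHq -big_split /=; apply: eq_bigr => l _.
  by rewrite mderivD rmorphD mulrDl.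
- rewrite rmorphM !mderivM IHp IHq mulr_suml mulr_sumr -big_split /=.
  by apply: eq_bigr => l _; rewrite mderivM rmorphD !rmorphM /=; ring.
Qed.

Lemma mderiv_horner j (p : A) (Q : {poly A}) :
  mderiv j (map_poly phi Q).[p] =
    \sum_l (map_poly phi (map_poly (mderiv l) Q)).[p] * mderiv j (F l)
    + (map_poly phi Q^`()).[p] * mderiv j p.
Proof.
elim/poly_ind: Q => [|Q c IH].
  rewrite deriv0 !map_poly0 horner0 mderiv0 mul0r addr0 big1 // => l _.
  by rewrite !map_poly0 horner0 mul0r.
rewrite rmorphD rmorphM /= map_polyX map_polyC hornerMXaddC mderivD mderivM IH.
rewrite derivMXaddC rmorphD rmorphM /= map_polyX hornerD hornerM hornerX mderiv_comp.
have E l : (map_poly phi (map_poly (mderiv l) (Q * 'X + c%:P))).[p] =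
    (map_poly phi (map_poly (mderiv l) Q)).[p] * p + phi (mderiv l c).
  rewrite raddfD /= map_polyC /= -[Q * 'X]/(Q * 'X^1).
  have -> : map_poly (mderiv l) (Q * 'X) = map_poly (mderiv l) Q * 'X.
    apply/polyP => i; rewrite coef_map_id0 ?mderiv0 // !coefMX coef_map_id0 ?mderiv0 //.
    by case: ifP; rewrite ?mderiv0.
  by rewrite rmorphD rmorphM /= map_polyX map_polyC hornerMXaddC.
under [X in _ = X + _]eq_bigr do rewrite E mulrDl.
rewrite big_split /= mulrDl mulr_suml.
rewrite [X in _ = X + _ + _](eq_bigr (fun l =>
   (map_poly phi (map_poly (mderiv l) Q)).[p] * mderiv j (F l) * p)); last by move=> l _; ring.
ring.
Qed.

(* The leading coefficient is only required to be a nonzero constant, so that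
   the class is stable under the formal derivative. *)
Lemma minimal_integral (p : A) : exists Q : {poly A},
  [/\ exists2 c, c != 0 & lead_coef Q = mpolyC n c, (map_poly phi Q).[p] = 0 &
      forall Q' : {poly A}, (exists2 c, c != 0 & lead_coef Q' = mpolyC n c) ->
        (map_poly phi Q').[p] = 0 -> (size Q <= size Q')%N].
Proof.
pose P s := exists Q : {poly A}, [/\ exists2 c, c != 0 & lead_coef Q = mpolyC n c,
  (map_poly phi Q).[p] = 0 & size Q = s].
have exP : exists s, `[< P s >].
  have [Q Qm Q0] := integral_over_comp p; exists (size Q); apply/asboolP.
  by exists Q; split=> //; exists 1; rewrite ?oner_eq0 // (monicP Qm) mpolyC1.
case: (ex_minnP exP) => s /asboolP[Q [lQ Q0 <-]] smin.
exists Q; split=> // Q' lQ' Q'0; apply: smin; apply/asboolP.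
by exists Q'.
Qed.

Definition jacobian : A := \det (\matrix_(i, j) mderiv j (F i)).

Lemma size_minimal_gt1 (p : A) (Q : {poly A}) :
  (exists2 c, c != 0 & lead_coef Q = mpolyC n c) -> (map_poly phi Q).[p] = 0 ->
  (1 < size Q)%N.
Proof.
move=> [c c0 lQ] Q0; rewrite ltnNge; apply/negP => /size1_polyC Qc.
move: Q0 lQ; rewrite Qc map_polyC hornerC lead_coefC /= => + ec.
by rewrite ec comp_mpolyC => /eqP; rewrite mpolyC_eq0 (negPf c0).
Qed.

(** Differentiating the minimal equation of each variable over the subring of the [F j] expresses a
    diagonal matrix as a multiple of the Jacobian matrix. Its diagonal entries are, up to sign, the
    derived equations at the variables, which are nonzero by minimality. *)
Lemma jacobian_neq0 : jacobian != 0.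
Proof.
have /choice[Q hQ] := fun i => minimal_integral (XU i).
pose d i := (map_poly phi (Q i)^`()).[XU i].
have d0 i : d i != 0.
  have [[c c0 lQ] Q0 Qmin] := hQ i.
  have s1 : (1 < size (Q i))%N by apply: (@size_minimal_gt1 (XU i)) => //; exists c.
  apply/eqP => di.
  (* In characteristic 0 the derivative of [Q i] still has a nonzero constant as leading
     coefficient, so minimality applies to it. *)
  have co : (Q i)^`()`_(size (Q i)).-2 = mpolyC n (c *+ (size (Q i)).-1).
    rewrite coef_deriv -[(size _).-2.+1]/((size (Q i)).-2.+1) prednK ?mpolyCMn; last by lia.
    by rewrite -lQ lead_coefE.
  have cn0 : c *+ (size (Q i)).-1 != 0 by rewrite mulrn_eq0 negb_or c0 andbT; lia.
  have sd : size (Q i)^`() = (size (Q i)).-1.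
    apply/eqP; rewrite eqn_leq; apply/andP; split.
      by rewrite -ltnS prednK; [apply: lt_size_deriv; rewrite -size_poly_gt0; lia|lia].
    rewrite leqNgt; apply/negP => lts; move/eqP: co; rewrite nth_default; last first.
      by move: lts s1; move: (size (Q i)^`()) (size (Q i)) => u v; lia.
    by rewrite eq_sym mpolyC_eq0 (negPf cn0).
  have := Qmin (Q i)^`() _ di; rewrite sd => h.
  suff : (size (Q i) <= (size (Q i)).-1)%N by lia.
  apply: h; exists (c *+ (size (Q i)).-1) => //.
  by rewrite lead_coefE sd co.
pose M : 'M[A]_n := \matrix_(i, l) (map_poly phi (map_poly (mderiv l) (Q i))).[XU i].
have MD : M *m (\matrix_(i, j) mderiv j (F i)) = diag_mx (\row_i - d i).
  apply/matrixP => i j; rewrite !mxE.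
  have [_ Q0 _] := hQ i; have := mderiv_horner j (XU i) (Q i).
  rewrite Q0 mderiv0 => /esym/eqP; rewrite addr_eq0 => /eqP e1.
  under eq_bigr do rewrite !mxE.
  rewrite e1 /d mderivX mnm1E; case: eqVneq => [->|_]; last by rewrite scale0r mulr0 oppr0 mulr0n.
  have -> : mnm_sub (mnm1 j) (mnm1 j) = mnm0 by apply/mnmP => l; rewrite mnmBE subnn mnm0E.
  by rewrite scale1r mpolyX0 mulr1.
apply/eqP => J0; have := congr1 determinant MD.
rewrite det_mulmx -/jacobian J0 mulr0 det_diag => /esym/eqP/prodf_eq0[i _].
by rewrite mxE oppr_eq0 (negPf (d0 i)).
Qed.

(** [delta] is the constant term of a minimal equation of the Jacobian: where the Jacobian vanishes,
    so does [delta] at the image point. Its composition with [F] is nonzero, otherwise the equation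
    could be divided by the Jacobian. *)
Lemma critical_value_equation : exists2 delta : A, phi delta != 0 &
  forall z : 'rV[K]_n, ev z jacobian = 0 -> meval (fun j => ev z (F j)) delta = 0.
Proof.
have [Q []] := minimal_integral jacobian.
elim/poly_ind: Q => [|Q delta _] lQ Q0 Qmin.
  by case: lQ => c c0 /eqP; rewrite lead_coef0 eq_sym mpolyC_eq0 (negPf c0).
have := size_minimal_gt1 lQ Q0; have [->|Qn0] := eqVneq Q 0.
  by rewrite mul0r add0r size_polyC; case: eqP.
move=> _; have sQ : size (Q * 'X + delta%:P) = (size Q).+1.
  by rewrite size_MXaddC (negPf Qn0).
exists delta; last first.
  move=> z Jz; have := congr1 (meval (z ord0)) Q0.
  rewrite rmorphD rmorphM /= map_polyX map_polyC hornerMXaddC mevalD mevalM Jz mulr0 add0r meval0.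
  by rewrite comp_mpoly_meval => <-; apply: meval_eq => j; rewrite tnth_mktuple.
apply/eqP => d0; move: Q0; rewrite rmorphD rmorphM /= map_polyX map_polyC hornerMXaddC /= d0 addr0.
move=> /eqP; rewrite mulf_eq0 (negPf jacobian_neq0) orbF => /eqP Q0.
have := Qmin Q _ Q0; rewrite sQ ltnn => h; suff : false by [].
apply: h; case: lQ => c c0 lQ; exists c => //; rewrite -lQ lead_coefDl.
  by rewrite lead_coefMX.
by rewrite size_mulX // (leq_ltn_trans (size_polyC_leq1 _)) // ltnS size_poly_gt0.
Qed.

End PolynomialMaps.

(** * Degenerate zeros on a line of polynomial systems *)

Lemma msizeM_idomain (R : idomainType) n (p q : mpoly n R) a b :
  (msize p <= a.+1)%N -> (msize q <= b.+1)%N -> (msize (p * q) <= (a + b).+1)%N.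
Proof.
have [->|p0] := eqVneq p 0; first by rewrite mul0r msize0.
have [->|q0] := eqVneq q 0; first by rewrite mulr0 msize0.
move=> pa qb; rewrite msizeM //.
move: pa qb; move: (msize p) (msize q) => u v; lia.
Qed.

Lemma mderiv_map_mpoly n (R S : nzRingType) (f : {rmorphism R -> S}) j (p : mpoly n R) :
  mderiv j (map_mpoly f p) = map_mpoly f (mderiv j p).
Proof.
by apply/mpolyP => m; rewrite mcoeff_mderiv !mcoeff_map_mpoly mcoeff_mderiv raddfMn.
Qed.

Lemma msize_map_mpoly n (R S : nzRingType) (f : {rmorphism R -> S}) (p : mpoly n R) :
  (msize (map_mpoly f p) <= msize p)%N.
Proof.
rewrite [X in (X <= _)%N]msizeE; apply/bigmax_leqP_seq => m mp _; apply: msize_mdeg_lt.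
move: mp; rewrite !mcoeff_msupp mcoeff_map_mpoly; apply: contra => /eqP ->.
by rewrite raddf0.
Qed.

Section GenericRegularity.
Variables (K : numClosedFieldType) (n : nat).
Hypothesis K_uncountable : ~ countable [set: K].
Local Notation A := (mpoly n K).
Local Notation ev z p := (meval (fun_of_matrix z ord0) p).
Variables (e : nat) (F : 'I_n -> A).
Hypothesis e_gt0 : (0 < e)%N.
Hypothesis F_homog : forall j, F j \is ishomog1 e mdeg.
Hypothesis F_nondeg : forall z : 'rV[K]_n, (forall j, ev z (F j) = 0) -> z = 0.
Variable w0 : 'rV[K]_n.
Hypothesis w0_regular :
  forall z : 'rV[K]_n, (forall j, ev z (F j) = w0 ord0 j) -> ev z (jacobian F) != 0.
Local Notation F0 j := (F j - mpolyC n (w0 ord0 j)).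

(** Over a regular value, the Jacobian and the [F j - w0_j] have no common zero, hence generate the
    unit ideal. Monomials of high degree are reduced by the [F j] first, which keeps the degrees of
    the cofactors under control. The slack [s] leaves room for multiplying [u] by a polynomial of
    size [s]. *)
Lemma bounded_unit_ideal s : exists L0, forall L, (L0 <= L)%N -> forall p : A,
  (msize p <= L)%N -> exists u (h : 'I_n -> A),
  [/\ p = u * jacobian F + \sum_j h j * F0 j, (msize u + s <= L)%N &
      forall j, (msize (h j) + e <= L)%N].
Proof.
have [D hD] := monomial_reduction K_uncountable e_gt0 F_homog F_nondeg.
pose p0 (j : option 'I_n) := if j is Some j then F0 j else jacobian F.
have [a|g] := @weak_nullstellensatz K n K_uncountable _ p0.
  apply: contrapT => /forallNP no; pose z : 'rV[K]_n := \row_l a l.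
  have za q : ev z q = meval a q by apply: meval_eq => l; rewrite mxE.
  have /w0_regular : forall j, ev z (F j) = w0 ord0 j.
    move=> j; apply/eqP; rewrite -subr_eq0 za; move: (no (Some j)) => /negP.
    by rewrite negbK /= mevalB mevalC.
  by rewrite za => /negP; apply; move: (no None) => /negP; rewrite negbK.
rewrite (bigD1 None) //= (reindex_omap Some id) /=; last by case.
under eq_bigl do rewrite eqxx.
move=> g1; pose S := \sum_j msize (g j).
exists (D + S + s + e + 1)%N => L hL p.
pose rep q := exists u (h : 'I_n -> A),
  [/\ q = u * jacobian F + \sum_j h j * F0 j, (msize u + s <= L)%N &
      forall j, (msize (h j) + e <= L)%N].
have rep0 : rep 0.
  exists 0, (fun=> 0); rewrite mul0r add0r big1; last by move=> j _; rewrite mul0r.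
  by split=> // [|j]; rewrite msize0; lia.
have repD q r : rep q -> rep r -> rep (q + r).
  move=> [u [h [-> hu hh]]] [u' [h' [-> hu' hh']]].
  exists (u + u'), (fun j => h j + h' j); split.
  - rewrite mulrDl addrACA; congr (_ + _); rewrite -big_split /=.
    by apply: eq_bigr => j _; rewrite mulrDl.
  - by have := mmeasureD_le mdeg u u'; move: (msize (u + u')) hu hu' => x; lia.
  - move=> j; have := mmeasureD_le mdeg (h j) (h' j).
    by move: (hh j) (hh' j); move: (msize (_ + _)) => x; lia.
have repZ c q : rep q -> rep (c *: q).
  move=> [u [h [-> hu hh]]]; exists (c *: u), (fun j => c *: h j); split.
  - rewrite scalerDr scalerAl scaler_sumr; congr (_ + _).
    by apply: eq_bigr => j _; rewrite scalerAl.
  - by apply: leq_trans hu; rewrite leq_add2r msizeZ_le.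
  - by move=> j; apply: leq_trans (hh j); rewrite leq_add2r msizeZ_le.
rewrite -/(rep p).
elim: {p}(msize p).+1 {-2}p (ltnSn (msize p)) => // k IHk p pk pL.
rewrite [p]mpolyE big_seq; apply: (big_ind rep) => // m mp; apply: (repZ).
have mm := msize_mdeg_lt mp.
have [lt|le] := ltnP (mdeg m) D.
  have szm (q : A) : (msize q <= S)%N -> (msize (mpolyX K m * q) <= D + S)%N.
    move=> qS; have [->|q0] := eqVneq q 0; first by rewrite mulr0 msize0.
    rewrite msizeM // -?msize_poly_eq0 msizeX //.
    by move: (msize q) qS => x; lia.
  have gS j : (msize (g j) <= S)%N by rewrite /S (bigD1 j) //= leq_addr.
  exists (mpolyX K m * g None), (fun j => mpolyX K m * g (Some j)); split.
  - rewrite -{1}[mpolyX K m]mulr1 -g1 mulrDr mulrA; congr (_ + _); rewrite mulr_sumr.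
    by apply: eq_bigr => j _; rewrite mulrA.
  - by have := szm _ (gS None); move: (msize _) => x; lia.
  - by move=> j; have := szm _ (gS (Some j)); move: (msize _) => x; lia.
have [h [Xm hh]] := hD m le.
(* [F j] is [F0 j] plus a constant; the constants leave terms of lower degree, for which the
   induction hypothesis holds. *)
have -> : mpolyX K m = \sum_j h j * F0 j + \sum_j w0 ord0 j *: h j.
  rewrite -big_split Xm /=; apply: eq_bigr => j _.
  by rewrite -mul_mpolyC; ring.
apply: (repD).
  exists 0, h; rewrite mul0r add0r msize0; split=> //; first by lia.
  by move=> j; have := hh j; move: (msize (h j)) (msize p) mm pL => x y; lia.
apply: (big_ind rep) => // j _; apply: (repZ); apply: IHk.
  by have := hh j; move: (msize (h j)) (msize p) mm pk => x y; lia.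
by have := hh j; move: (msize (h j)) (msize p) mm pL => x y; lia.
Qed.

Variables (G : 'I_n -> A) (w1 : 'rV[K]_n).
Hypothesis G_size : forall j, (msize (G j) <= e.+1)%N.
Local Notation G0 j := (G j - mpolyC n (w1 ord0 j)).

(** Write each monomial of degree less than [L] as a combination of the Jacobian and of the
    equations at t = 0, then replace these by the Jacobian and the equations at a general t. The
    difference [g m] between the monomial and the new combination still has degree less than [L],
    and it vanishes at t = 0. At a degenerate zero [z] with parameter [t] the combination vanishes,
    so [g m] and the monomial agree there: the vector of monomials at [z] is in the kernel of
    [1 - Ga] taken at [t]. This vector has an entry 1, so the determinant [delta] vanishes at [t],
    whereas [delta.[0]] is 1. *)
Lemma generic_regularity : exists2 delta : {poly K}, delta.[0] != 0 &
  forall t (z : 'rV[K]_n), (forall j, (1 - t) * ev z (F0 j) + t * ev z (G0 j) = 0) ->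
   \det (\matrix_(i, j) ((1 - t) * ev z (mderiv j (F i)) + t * ev z (mderiv j (G i)))) = 0 ->
   delta.[t] = 0.
Proof.
pose mapP (p : A) : mpoly n {poly K} := map_mpoly polyC p.
pose H j := mapP (F0 j) + mpolyC n 'X * mapP (G0 j - F0 j).
pose JJ := \det (\matrix_(i, j) mderiv j (H i)).
have [L0 hL0] := bounded_unit_ideal (msize JJ).
(* Positivity of [L] puts the monomial 1 among those considered. *)
pose L := L0.+1.
have /choice[uh huh] : forall m : bmultinom n L, exists uh : A * ('I_n -> A),
    [/\ mpolyX K (bmnm m) = uh.1 * jacobian F + \sum_j uh.2 j * F0 j,
        (msize uh.1 + msize JJ <= L)%N & forall j, (msize (uh.2 j) + e <= L)%N].
  move=> m; have [|u [h [? ? ?]]] := hL0 L (leqnSn _) (mpolyX K (bmnm m)).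
    by rewrite msizeX bmdeg.
  by exists (u, h).
pose g m : mpoly n {poly K} := mpolyX _ (bmnm m) - mapP (uh m).1 * JJ
   - \sum_j mapP ((uh m).2 j) * H j.
pose ht t : {rmorphism {poly K} -> K} := horner_eval t.
pose evt t : {rmorphism mpoly n {poly K} -> A} := map_mpoly (ht t).
have evtc t m p : horner_eval t (mcoeff m p) = mcoeff m (evt t p).
  by rewrite /evt /= mcoeff_map_mpoly.
have evtX t m : evt t (mpolyX _ m) = mpolyX K m by rewrite /evt /= map_mpolyX.
have evtd t j p : evt t (mderiv j p) = mderiv j (evt t p).
  by rewrite /evt /= mderiv_map_mpoly.
have evtT t : evt t (mpolyC n 'X) = mpolyC n t.
  by rewrite /evt /= map_mpolyC /ht /= /horner_eval hornerX.
have evtP t p : evt t (mapP p) = p.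
  apply/mpolyP => m; rewrite -evtc /mapP mcoeff_map_mpoly.
  by rewrite /= /horner_eval hornerC.
have evtH t j : evt t (H j) = (1 - t) *: F0 j + t *: G0 j.
  rewrite rmorphD rmorphM !evtP evtT mul_mpolyC.
  by rewrite scalerBr scalerBl scale1r addrA addrAC.
have evtJ t : evt t JJ = \det (\matrix_(i, j) ((1 - t) *: mderiv j (F i) + t *: mderiv j (G i))).
  rewrite -det_map_mx; congr (\det _); apply/matrixP => i j; rewrite !mxE.
  rewrite evtd evtH mderivD !mderivZ !mderivB !mderivC.
  by rewrite !subr0.
have evt0J : evt 0 JJ = jacobian F.
  rewrite evtJ /jacobian; congr (\det _); apply/matrixP => i j; rewrite !mxE.
  by rewrite subr0 scale1r scale0r addr0.
have evtg t m : evt t (g m) = mpolyX K (bmnm m) - (uh m).1 * evt t JJ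
    - \sum_j (uh m).2 j * evt t (H j).
  rewrite /g rmorphB [evt t (_ - _)]rmorphB [evt t (_ * JJ)]rmorphM evtX evtP.
  by congr (_ - _); rewrite rmorph_sum; apply: eq_bigr => j _; rewrite rmorphM evtP.
have g0 m : evt 0 (g m) = 0.
  have [e1 _ _] := huh m.
  rewrite evtg evt0J e1 [X in _ - _ - X](_ : _ = \sum_j (uh m).2 j * F0 j).
    by rewrite addrAC addrK subrr.
  apply: eq_bigr => j _; rewrite evtH.
  by rewrite subr0 scale1r scale0r addr0.
have gL m : (msize (g m) <= L)%N.
  have [_ e2 e3] := huh m.
  have szB (p q : mpoly n {poly K}) : (msize p <= L)%N -> (msize q <= L)%N -> (msize (p - q) <= L)%N.
    move=> pL qL; apply: leq_trans (mmeasureD_le _ _ _) _.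
    by rewrite mmeasureN geq_max pL qL.
  have szM (p q : mpoly n {poly K}) a b : (msize p <= a)%N -> (msize q <= b.+1)%N -> (a + b <= L)%N -> (msize (p * q) <= L)%N.
    have [->|p0] := eqVneq p 0; first by rewrite mul0r msize0.
    case: a => [|a]; first by rewrite leqn0 msize_poly_eq0 (negPf p0).
    by move=> pa qb abL; apply: leq_trans (msizeM_idomain pa qb) _; lia.
  apply: (szB); first apply: (szB).
  - by rewrite msizeX bmdeg.
  - apply: (szM _ _ (msize (uh m).1) (msize JJ)) => //; exact: msize_map_mpoly.
  - apply: leq_trans (mmeasure_sum _ _ _ _) _; apply/bigmax_leqP => j _.
    apply: (szM _ _ (msize ((uh m).2 j)) e) => //; first exact: msize_map_mpoly.
    have FGe (p : A) c : (msize p <= e.+1)%N -> (msize (p - mpolyC n c) <= e.+1)%N.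
      move=> pe; apply: leq_trans (mmeasureD_le _ _ _) _; rewrite geq_max pe mmeasureN msizeC.
      by case: (c != 0).
    have Fe : (msize (F j) <= e.+1)%N.
      by rewrite msizeE; apply/bigmax_leqP_seq => l lp _; rewrite (dhomogP _ _ _ (F_homog j) l lp).
    apply: leq_trans (mmeasureD_le _ _ _) _; rewrite geq_max; apply/andP; split.
      exact: leq_trans (msize_map_mpoly _ _) (FGe _ _ Fe).
    rewrite mul_mpolyC; apply: leq_trans (msizeZ_le _ _) _.
    apply: leq_trans (msize_map_mpoly _ _) _; apply: leq_trans (mmeasureD_le _ _ _) _.
    by rewrite geq_max mmeasureN !FGe.
pose b := #|{: bmultinom n L}|.
pose Ga : 'M[{poly K}]_b := \matrix_(i, j) mcoeff (bmnm (enum_val j)) (g (enum_val i)).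
exists (\det (1%:M - Ga)).
  rewrite -/(horner_eval 0 _) -det_map_mx.
  rewrite (_ : map_mx _ _ = 1%:M) ?det1 ?oner_eq0 //.
  apply/matrixP => i j; rewrite !mxE rmorphB rmorphMn rmorph1 /= evtc g0 mcoeff0.
  by rewrite subr0.
move=> t z Hz Jz; rewrite -/(horner_eval t _) -det_map_mx.
pose v : 'cV[K]_b := \col_i ev z (mpolyX K (bmnm (enum_val i))).
set M := map_mx _ _.
have Mv : M *m v = 0.
  rewrite /M; apply/colP => i; rewrite !mxE.
  under eq_bigr do rewrite !mxE rmorphB rmorphMn rmorph1 /= evtc mulrBl.
  rewrite sumrB (bigD1 i) //= eqxx mul1r big1 ?addr0; last first.
    by move=> j /negPf ji; rewrite eq_sym ji mul0r.
  apply/eqP; rewrite subr_eq0; apply/eqP.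
  have -> : ev z (mpolyX K (bmnm (enum_val i))) = ev z (evt t (g (enum_val i))).
    rewrite evtg !mevalB mevalM [ev z (\sum_j _)]raddf_sum [X in _ - _ - X]big1 ?subr0.
      suff -> : ev z (evt t JJ) = 0 by rewrite mulr0 subr0.
      rewrite evtJ -det_map_mx -[RHS]Jz; congr (\det _); apply/matrixP => i' j'.
      by rewrite !mxE /= mevalD !mevalZ.
    move=> j _ /=; rewrite mevalM evtH mevalD !mevalZ Hz.
    by rewrite mulr0.
  have -> : evt t (g (enum_val i)) =
     \sum_(m : bmultinom n L) mcoeff (bmnm m) (evt t (g (enum_val i))) *: mpolyX K (bmnm m).
    by apply: mpolywE; apply: leq_trans (gL (enum_val i)); apply: msize_map_mpoly.
  rewrite raddf_sum /= (reindex (@enum_val _ (mem {: bmultinom n L}))) /=; last first.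
    by exists (@enum_rank _) => ? _; rewrite ?enum_rankK ?enum_valK.
  by apply: eq_bigr => j _; rewrite mevalZ.
have dv : \det M *: v = 0 by rewrite -mul_scalar_mx -mul_adj_mx -mulmxA Mv mulmx0.
have lt0 : (mdeg (@mnm0 n) < L)%N by rewrite mdeg0.
move/colP: dv => /(_ (enum_rank (BMultinom lt0))); rewrite !mxE enum_rankK /= mpolyX0.
by rewrite meval1 mulr1.
Qed.

End GenericRegularity.

(** * Norms and compactness *)

Section RealNorm.
Variable R : realType.
Local Notation C := R[i].

(** A countable set has Lebesgue measure zero, unlike the real line. *)
Lemma complex_uncountable : ~ countable [set: C].
Proof.
move=> cC; have cR : countable [set: R].
  have [f fi] := @countable_injP _ _ cC; apply/countable_injP; exists (fun x : R => f x%:C).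
  by move=> x y _ _ e; apply: (@complexI R); apply: (fi _ _ _ _ e); rewrite inE.
have := countable_lebesgue_measure0 cR.
have -> : [set: R] = `]-oo, +oo[%classic by rewrite set_itvE.
by rewrite lebesgue_measure_itv.
Qed.

(** Norms of modules over C take values in C; [rn] takes them to [R], where the order is total. *)
Definition rn (T : normedModType C) (x : T) : R := complex.Re `|x|.

Section Abstract.
Variable T : normedModType C.
Implicit Types x y : T.

Lemma rnE x : `|x| = (rn x)%:C.
Proof. by have /ger0_Im := normr_ge0 x; rewrite /rn; case: `|x| => a b /= ->. Qed.

Lemma rn_ge0 x : 0 <= rn x.
Proof. by rewrite -lecR -rnE normr_ge0. Qed.

Lemma rn_eq0 x : (rn x == 0) = (x == 0).
Proof. by rewrite -[RHS]normr_eq0 rnE (inj_eq (@complexI R)). Qed.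

Lemma rn0 : rn (0 : T) = 0.
Proof. by apply/eqP; rewrite rn_eq0. Qed.

Lemma rn_gt0 x : (0 < rn x) = (x != 0).
Proof. by rewrite lt_def rn_ge0 rn_eq0 andbT. Qed.

Lemma rnD x y : rn (x + y) <= rn x + rn y.
Proof. by rewrite -lecR -rnE (le_trans (ler_normD _ _)) // !rnE rmorphD. Qed.

Lemma rnN x : rn (- x) = rn x.
Proof. by rewrite /rn normrN. Qed.

Lemma rnB x y : rn (x - y) = rn (y - x).
Proof. by rewrite /rn distrC. Qed.

Lemma rn_triangle y x z : rn (x - z) <= rn (x - y) + rn (y - z).
Proof. by have := rnD (x - y) (y - z); rewrite addrA subrK. Qed.

Lemma rn_le_sub x y : rn x <= rn y + rn (x - y).
Proof. by have := rnD y (x - y); rewrite addrC subrK addrC. Qed.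

Lemma nbhs_rnP x (A : set T) :
  nbhs x A <-> exists2 e : R, 0 < e & forall y, rn (x - y) < e -> A y.
Proof.
split => [/nbhs_ballP[e /= e0 eA]|[e e0 eA]]; last apply/nbhs_ballP.
  have ee : e = (complex.Re e)%:C.
    by have := ger0_Im (ltW e0); case: (e) => a b /= ->.
  exists (complex.Re e); first by rewrite -ltcR -ee.
  by move=> y xy; apply: eA; rewrite -ball_normE /ball_ /= rnE ee ltcR.
exists e%:C; first by rewrite /= ltcR.
by move=> y; rewrite -ball_normE /ball_ /= rnE ltcR; apply: eA.
Qed.

End Abstract.

Lemma rnZ (T : normedModType C) (c : C) (x : T) : rn (c *: x) = rn c * rn x.
Proof. by apply: (@complexI R); rewrite rmorphM -rnE normrZ (rnE x); congr (_ * _); exact: rnE. Qed.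

Lemma rnM (a b : C) : rn (a * b) = rn a * rn b.
Proof. exact: rnZ. Qed.

Lemma rn1 : rn (1 : C) = 1.
Proof. by rewrite /rn normr1. Qed.

Lemma rnX (a : C) m : rn (a ^+ m) = rn a ^+ m.
Proof. by elim: m => [|m IH]; rewrite ?expr0 ?rn1 // !exprS rnM IH. Qed.

Lemma rn_real (x : R) : rn (x%:C : C) = `|x|.
Proof. by rewrite /rn normc_def /= expr0n addr0 sqrtr_sqr. Qed.

Lemma rn_sum (T : normedModType C) (I : Type) (r : seq I) (P : pred I) (F : I -> T) :
  rn (\sum_(i <- r | P i) F i) <= \sum_(i <- r | P i) rn (F i).
Proof.
elim/big_rec2: _ => [|i y x _ xy]; first by rewrite rn0.
by apply: le_trans (rnD _ _) _; rewrite lerD2l.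
Qed.

Lemma rn_ltP m n (M : 'M[C]_(m, n)) (e : R) : 0 < e ->
  rn M < e <-> forall i j, rn (M i j) < e.
Proof.
move=> e0; have -> : (rn M < e) = `[< ball (0 : 'M[C]_(m, n)) e%:C M >].
  by rewrite -ball_normE /ball_ /= sub0r normrN -ltcR -rnE asboolb.
split => [/asboolP h i j|h].
  have := proj2 h i j; rewrite -ball_normE /ball_ /= mxE sub0r normrN -ltcR -rnE; exact.
apply/asboolP; split=> [|i j]; rewrite ?ltcR // -ball_normE /ball_ /= mxE sub0r normrN rnE ltcR; exact: h.
Qed.

Lemma rn_coord m n (M : 'M[C]_(m, n)) i j : rn (M i j) <= rn M.
Proof.
apply/ler_addgt0Pr => e e0; have e1 : 0 < rn M + e by have := rn_ge0 M; lra.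
by apply: ltW; apply: (proj1 (rn_ltP M e1)); lra.
Qed.

Lemma rn_leP m n (M : 'M[C]_(m, n)) (e : R) : 0 <= e ->
  rn M <= e <-> forall i j, rn (M i j) <= e.
Proof.
move=> e0; split=> [h i j|h]; first exact: le_trans (rn_coord _ _ _) h.
apply/ler_addgt0Pr => e' e0'; have e1 : 0 < e + e' by lra.
by apply/ltW/(rn_ltP _ e1) => i j; apply: le_lt_trans (h i j) _; lra.
Qed.

Lemma continuousDC (T : topologicalType) (f g : T -> C) x :
  {for x, continuous f} -> {for x, continuous g} -> {for x, continuous (fun y => f y + g y)}.
Proof. by move=> cf cg; exact: (cvgD cf cg). Qed.

Lemma continuousMC (T : topologicalType) (f g : T -> C) x :
  {for x, continuous f} -> {for x, continuous g} -> {for x, continuous (fun y => f y * g y)}.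
Proof. by move=> cf cg; exact: (cvgM cf cg). Qed.

Lemma positive_lower_bound (I : finType) (d : I -> R) : (forall i, 0 < d i) ->
  exists2 e, 0 < e & forall i, e <= d i.
Proof.
move=> d0; suff [e e0 he] : exists2 e, 0 < e & forall i, i \in enum I -> e <= d i.
  by exists e => // i; apply: he; rewrite mem_enum.
elim: (enum I) => [|i s [e e0 he]]; first by exists 1.
exists (Num.min e (d i)); first by rewrite lt_min e0 d0.
move=> j; rewrite inE ge_min => /orP[/eqP ->|/he ->//]; by rewrite lexx orbT.
Qed.

Lemma rn_continuous (T : normedModType C) : continuous (fun x : T => rn x).
Proof.
move=> x A /nbhs_ballP[e /= e0 eA]; apply/nbhs_rnP; exists e => // y xy.
apply: eA; rewrite /ball /= ltr_norml; have := rn_le_sub x y; have := rn_le_sub y x.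
by rewrite (rnB y); lra.
Qed.

Lemma disk_compact (c : C) (r : R) : compact [set z : C | rn (z - c) <= r].
Proof.
pose f (p : R * R) : C := (p.1 +i* p.2)%C.
have cf : continuous f.
  move=> [x y] A /nbhs_rnP[e e0 eA].
  exists (ball x (e / 2), ball y (e / 2)) => /=.
    by split; apply: nbhsx_ballx; rewrite divr_gt0.
  move=> [x' y'] /= [bx by_]; apply: eA.
  have -> : f (x, y) - f (x', y') = (x - x')%:C + 'i%C * (y - y')%:C.
    by rewrite /f /=; simpc.
  apply: le_lt_trans (rnD _ _) _; rewrite rnM !rn_real.
  have -> : rn ('i%C : C) = 1 by rewrite /rn normc_def /= expr0n expr1n add0r sqrtr1.
  by move: bx by_; rewrite /ball /= mul1r; lra.
have : compact (f @` (`[complex.Re c - r, complex.Re c + r] `*` `[complex.Im c - r, complex.Im c + r])%classic).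
  apply: continuous_compact; first exact: continuous_subspaceT.
  by apply: compact_setX; apply: segment_compact.
move=> cpt; apply: (subclosed_compact _ cpt).
  apply: (@preimage_closed _ _ (fun z : C => rn (z - c)) [set x | x <= r]); last exact: closed_le.
  move=> x _; apply: (@continuous_comp _ _ _ (fun z : C => z - c) (fun z : C => rn z)).
    by apply: continuousDC; [exact: cvg_id|exact: cst_continuous].
  exact: rn_continuous.
move=> [x y] /= xy; exists (x, y) => //=.
have h1 : `|x - complex.Re c| <= r.
  apply: le_trans xy; rewrite -lecR -rnE; apply: le_trans (normc_ge_Re _); case: (c) => //.
have h2 : `|y - complex.Im c| <= r.
  apply: le_trans xy; rewrite -lecR -rnE; case: (c) => a b.
  rewrite normc_def /= lecR -sqrtr_sqr ler_sqrt ?addr_ge0 ?sqr_ge0 //.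
  by rewrite lerDr sqr_ge0.
by rewrite !in_itv /=; move: h1 h2; rewrite !ler_norml; split; lra.
Qed.

Lemma closed_ball_compact n (c : 'rV[C]_n) (r : R) :
  compact [set z : 'rV[C]_n | rn (z - c) <= r].
Proof.
have [r0|r0] := leP 0 r; last first.
  rewrite (_ : [set _ | _] = set0); first exact: compact0.
  by apply/seteqP; split=> // z /= h; have := rn_ge0 (z - c); lra.
rewrite (_ : [set _ | _] = [set z : 'rV[C]_n | forall i, [set x | rn (x - c ord0 i) <= r] (z ord0 i)]).
  by apply: (@rV_compact C n (fun i => [set x | rn (x - c ord0 i) <= r])) => i; apply: disk_compact.
apply/seteqP; split=> z /=.
  by move=> /(rn_leP _ r0) h i; have := h ord0 i; rewrite !mxE.
by move=> h; apply/(rn_leP _ r0) => i j; rewrite (ord1 i) !mxE.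
Qed.

Section Polynomials.
Variable n : nat.
Local Notation V := 'rV[C]_n.
Local Notation ev z p := (meval (fun_of_matrix z ord0) p).

Lemma meval_continuous (p : mpoly n C) : continuous (fun z : V => ev z p).
Proof.
elim/mpoly_ring_ind: p => [c|i|p q cp cq|p q cp cq] z.
- have -> : (fun z : V => ev z (mpolyC n c)) = fun=> c by apply/funext => x; rewrite mevalC.
  exact: cst_continuous.
- have -> : (fun z : V => ev z (mpolyX C (mnm1 i))) = fun z => z ord0 i.
    by apply/funext => x; rewrite mevalXU.
  exact: coord_continuous.
- have -> : (fun z : V => ev z (p + q)) = fun z => ev z p + ev z q.
    by apply/funext => x; rewrite mevalD.
  by apply: continuousDC; [exact: cp|exact: cq].
- have -> : (fun z : V => ev z (p * q)) = fun z => ev z p * ev z q.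
    by apply/funext => x; rewrite mevalM.
  by apply: continuousMC; [exact: cp|exact: cq].
Qed.

(** Hadamard's lemma, by induction on the construction of [p]. *)
Lemma meval_difference (p : mpoly n C) (a : V) : exists q : 'I_n -> V * V -> C,
  [/\ forall j, continuous (q j), forall j, q j (a, a) = ev a (mderiv j p) &
      forall x y, ev x p - ev y p = \sum_j q j (x, y) * (x ord0 j - y ord0 j)].
Proof.
have c1 q : continuous (fun z : V * V => ev z.1 q).
  by move=> z; apply: (@continuous_comp _ _ _ fst (fun z : V => ev z q)); [exact: cvg_fst|exact: meval_continuous].
have c2 q : continuous (fun z : V * V => ev z.2 q).
  by move=> z; apply: (@continuous_comp _ _ _ snd (fun z : V => ev z q)); [exact: cvg_snd|exact: meval_continuous].
elim/mpoly_ring_ind: p => [c|i|p1 p2 [q1 [c1' d1 e1]] [q2 [c2' d2 e2]]|p1 p2 [q1 [c1' d1 e1]] [q2 [c2' d2 e2]]].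
- exists (fun _ _ => 0); split=> [j|j|x y]; first exact: cst_continuous.
    by rewrite mderivC meval0.
  by rewrite !mevalC subrr big1 // => j _; rewrite mul0r.
- exists (fun j _ => (j == i)%:R); split=> [j|j|x y]; first exact: cst_continuous.
    rewrite mderivX mevalZ mnm1E eq_sym; case: eqVneq => [->|_]; last by rewrite mul0r.
    have -> : mnm_sub (mnm1 j) (mnm1 j) = mnm0 by apply/mnmP => l; rewrite mnmBE subnn mnm0E.
    by rewrite mpolyX0 meval1 mulr1.
  by rewrite !mevalXU (bigD1 i) //= eqxx mul1r big1 ?addr0 // => j /negPf ->; rewrite mul0r.
- exists (fun j z => q1 j z + q2 j z); split=> [j z|j|x y].
  + by apply: continuousDC; [exact: c1'|exact: c2'].
  + by rewrite mderivD mevalD d1 d2.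
  + rewrite !mevalD opprD addrACA e1 e2 -big_split /=.
    by apply: eq_bigr => j _; rewrite mulrDl.
- exists (fun j z => q1 j z * ev z.1 p2 + ev z.2 p1 * q2 j z); split=> [j z|j|x y].
  + have h1 : {for z, continuous (fun z : V * V => q1 j z * ev z.1 p2)}.
      by apply: continuousMC; [exact: c1'|exact: c1].
    have h2 : {for z, continuous (fun z : V * V => ev z.2 p1 * q2 j z)}.
      by apply: continuousMC; [exact: c2|exact: c2'].
    exact: (continuousDC h1 h2).
  + by rewrite mderivM mevalD !mevalM d1 d2.
  + transitivity ((ev x p1 - ev y p1) * ev x p2 + ev y p1 * (ev x p2 - ev y p2)).
      by rewrite !mevalM; ring.
    rewrite e1 e2 mulr_suml mulr_sumr -big_split /=.
    by apply: eq_bigr => j _; ring.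
Qed.

Lemma strictly_differentiable (p : mpoly n C) (a : V) (eps : R) : 0 < eps ->
  exists2 del, 0 < del & forall x y, rn (x - a) < del -> rn (y - a) < del ->
   rn (ev x p - ev y p - \sum_j ev a (mderiv j p) * (x ord0 j - y ord0 j)) <= eps * rn (x - y).
Proof.
move=> eps0; have [q [cq qa qE]] := meval_difference p a.
(* [n.+1] rather than [n], so that the division makes sense in dimension 0 too. *)
pose e1 := eps / n.+1%:R; have e10 : 0 < e1 by rewrite divr_gt0.
have /choice[del hdel] : forall j, exists del, 0 < del /\ forall x y,
    rn (x - a) < del -> rn (y - a) < del -> rn (q j (x, y) - q j (a, a)) < e1.
  move=> j; have : nbhs (q j (a, a)) [set c | rn (c - q j (a, a)) < e1].
    by apply/nbhs_rnP; exists e1 => // y; rewrite rnB.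
  move=> /(cq j (a, a))[[A B] /= [/nbhs_rnP[eA eA0 hA] /nbhs_rnP[eB eB0 hB]] AB].
  exists (Num.min eA eB); split; first by rewrite lt_min eA0.
  move=> x y; rewrite !lt_min => /andP[xa _] /andP[_ yb].
  by apply: (AB (x, y)); split; [apply: hA|apply: hB]; rewrite rnB.
have [d d0 dd] := positive_lower_bound (fun j => proj1 (hdel j)).
exists d => // x y xa ya; rewrite qE -sumrB.
apply: le_trans (rn_sum _ _ _) _.
have -> : eps * rn (x - y) = \sum_(j < n.+1) e1 * rn (x - y).
  by rewrite sumr_const card_ord -mulr_natl mulrA /e1 mulrCA divff ?mulr1 // pnatr_eq0.
rewrite big_ord_recr /=; apply: ler_wpDr; first by rewrite mulr_ge0 ?rn_ge0 // ltW.
apply: ler_sum => j _; rewrite -mulrBl rnM -qa.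
apply: ler_pM; rewrite ?rn_ge0 //.
  by apply/ltW; apply: (proj2 (hdel j)); apply: lt_le_trans (dd j).
by have := rn_coord (x - y) ord0 j; rewrite !mxE.
Qed.
End Polynomials.
End RealNorm.

(* Monomorphic versions: the structure instances of the terms they produce
   are those found by elaboration, so that terms can be compared syntactically. *)
Section Monomorphic.
Variable R : realType.
Local Notation C := R[i].

Definition cn (c : C) : R := rn c.
Definition vn m n (x : 'M[C]_(m, n)) : R := rn x.

Lemma cn_ge0 (x : C) : 0 <= cn x. Proof. exact: rn_ge0. Qed.
Lemma cn0 : cn 0 = 0. Proof. exact: rn0. Qed.
Lemma cn1 : cn 1 = 1. Proof. exact: rn1. Qed.
Lemma cn_eq0 (x : C) : (cn x == 0) = (x == 0). Proof. exact: rn_eq0. Qed.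
Lemma cn_gt0 (x : C) : (0 < cn x) = (x != 0). Proof. exact: rn_gt0. Qed.
Lemma cnD (x y : C) : cn (x + y) <= cn x + cn y. Proof. exact: rnD. Qed.
Lemma cnN (x : C) : cn (- x) = cn x. Proof. exact: rnN. Qed.
Lemma cnB (x y : C) : cn (x - y) = cn (y - x). Proof. exact: rnB. Qed.
Lemma cnM (x y : C) : cn (x * y) = cn x * cn y. Proof. exact: rnM. Qed.
Lemma cnX (x : C) m : cn (x ^+ m) = cn x ^+ m. Proof. exact: rnX. Qed.
Lemma cn_real (x : R) : cn x%:C = `|x|. Proof. exact: rn_real. Qed.
Lemma cn_triangle (y x z : C) : cn (x - z) <= cn (x - y) + cn (y - z).
Proof. exact: rn_triangle. Qed.
Lemma cn_le_sub (x y : C) : cn x <= cn y + cn (x - y). Proof. exact: rn_le_sub. Qed.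
Lemma cn_sum (I : Type) (r : seq I) (P : pred I) (F : I -> C) :
  cn (\sum_(i <- r | P i) F i) <= \sum_(i <- r | P i) cn (F i).
Proof. exact: rn_sum. Qed.
Lemma cnE (x : C) : `|x| = (cn x)%:C. Proof. exact: rnE. Qed.
Lemma nbhs_cnP (x : C) (A : set C) :
  nbhs x A <-> exists2 e : R, 0 < e & forall y : C, cn (x - y) < e -> A y.
Proof. exact: nbhs_rnP. Qed.
Section Matrices.
Variables m n : nat.
Implicit Types x y z : 'M[C]_(m, n).
Lemma vn_ge0 x : 0 <= vn x. Proof. exact: rn_ge0. Qed.
Lemma vn0 : vn (0 : 'M[C]_(m, n)) = 0. Proof. exact: rn0. Qed.
Lemma vn_eq0 x : (vn x == 0) = (x == 0). Proof. exact: rn_eq0. Qed.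
Lemma vn_gt0 x : (0 < vn x) = (x != 0). Proof. exact: rn_gt0. Qed.
Lemma vnD x y : vn (x + y) <= vn x + vn y. Proof. exact: rnD. Qed.
Lemma vnN x : vn (- x) = vn x. Proof. exact: rnN. Qed.
Lemma vnB x y : vn (x - y) = vn (y - x). Proof. exact: rnB. Qed.
Lemma vnZ (c : C) x : vn (c *: x) = cn c * vn x. Proof. exact: rnZ. Qed.
Lemma vn_triangle y x z : vn (x - z) <= vn (x - y) + vn (y - z).
Proof. exact: rn_triangle. Qed.
Lemma vn_le_sub x y : vn x <= vn y + vn (x - y). Proof. exact: rn_le_sub. Qed.
Lemma vnE x : `|x| = (vn x)%:C. Proof. exact: rnE. Qed.
Lemma nbhs_vnP x (A : set 'M[C]_(m, n)) :
  nbhs x A <-> exists2 e : R, 0 < e & forall y : 'M[C]_(m, n), vn (x - y) < e -> A y.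
Proof. exact: nbhs_rnP. Qed.
Lemma vn_ltP x (e : R) : 0 < e -> vn x < e <-> forall i j, cn (x i j) < e.
Proof. exact: rn_ltP. Qed.
Lemma vn_leP x (e : R) : 0 <= e -> vn x <= e <-> forall i j, cn (x i j) <= e.
Proof. exact: rn_leP. Qed.
Lemma vn_coord x i j : cn (x i j) <= vn x. Proof. exact: rn_coord. Qed.
Lemma vn_continuous : continuous (fun x : 'M[C]_(m, n) => vn x).
Proof. exact: rn_continuous. Qed.
End Matrices.

Lemma vn_ball_compact n (c : 'rV[C]_n) (r : R) : compact [set z : 'rV[C]_n | vn (z - c) <= r].
Proof. exact: closed_ball_compact. Qed.

Lemma polynomial_strictly_differentiable n (p : mpoly n C) (a : 'rV[C]_n) (eps : R) : 0 < eps ->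
  exists2 del, 0 < del & forall x y : 'rV[C]_n, vn (x - a) < del -> vn (y - a) < del ->
   cn (meval (x ord0) p - meval (y ord0) p
     - \sum_j meval (a ord0) (mderiv j p) * (x ord0 j - y ord0 j)) <= eps * vn (x - y).
Proof. exact: strictly_differentiable. Qed.
End Monomorphic.

Ltac norm_lra :=
  repeat match goal with H : ?P |- _ => match type of P with Prop => clear H end end;
  repeat match goal with
    | |- context [@vn ?R ?m ?n ?x] => generalize (@vn R m n x)
    | |- context [@cn ?R ?x] => generalize (@cn R x) end;
  intros; lra.

(** * Zeros of perturbed maps *)

(** Otherwise the sets containing some [A] minus [S] with [P S] form a proper filter, and the local
    hypothesis at a cluster point gives a contradiction. Many covering arguments below take this
    form. *)
Lemma compact_ind (T : topologicalType) (A : set T) (P : set T -> Prop) :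
  compact A -> P set0 -> (forall B B', P B -> P B' -> P (B `|` B')) ->
  (forall B B', B `<=` B' -> P B' -> P B) ->
  (forall x, A x -> exists2 U, nbhs x U & P U) -> P A.
Proof.
move=> cA P0 PU PS loc; apply: contrapT => nPA.
pose F : set_system T := [set B | exists2 S, P S & A `\` S `<=` B].
have FF : ProperFilter F.
  split; first by move=> [S PS' AS]; apply: nPA; apply: PS PS' => x Ax; apply: contrapT => nS; exact: (AS x).
  split.
  - by exists set0.
  - move=> B B' [S PS1 hB] [S' PS2 hB']; exists (S `|` S'); first exact: PU.
    by move=> x [Ax nS]; split; [apply: hB|apply: hB']; split=> // h; apply: nS; [left|right].
  - by move=> B B' BB' [S PS1 hB]; exists S => //; exact: subset_trans BB'.
have [|x [Ax cl]] := cA F FF; first by exists set0 => // x [].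
have [U xU PUx] := loc x Ax.
by have [|y [[_ nUy] Uy]] := cl (A `\` U) U _ xU; first by exists U.
Qed.

Section LocalZeros.
Variable R : realType.
Local Notation C := R[i].
Variable n : nat.
Local Notation V := 'rV[C]_n.
Local Notation ev z p := (meval (fun_of_matrix z ord0) p).

Definition pmap (Q : 'I_n -> mpoly n C) (z : V) : V := \row_j ev z (Q j).

Lemma pmap_continuous Q : continuous (pmap Q).
Proof.
move=> z A /nbhs_vnP[e e0 eA].
have /choice[d hd] : forall j, exists d, 0 < d /\ forall y : V, vn (z - y) < d -> cn (ev z (Q j) - ev y (Q j)) < e.
  move=> j; have : nbhs (ev z (Q j)) [set c | cn (ev z (Q j) - c) < e] by apply/nbhs_cnP; exists e.
  by move=> /(@meval_continuous R n (Q j) z)/nbhs_vnP[d d0 hd]; exists d.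
have [d0 d00 hd0] := positive_lower_bound (fun j => proj1 (hd j)).
apply/nbhs_vnP; exists d0 => // y zy; apply: eA; apply/(vn_ltP _ e0) => i j.
by rewrite (ord1 i) !mxE; apply: (proj2 (hd j)); apply: lt_le_trans (hd0 j).
Qed.

Lemma half_contraction (x y : V) : vn (x - y) <= 2^-1 * vn (x - y) -> x = y.
Proof.
move=> h; have e : vn (x - y) = 0 by have := vn_ge0 (x - y); move: h; norm_lra.
by apply/eqP; rewrite -subr_eq0 -vn_eq0; apply/eqP.
Qed.

(** The zero is a minimum of the norm of [Psi] on the closed ball: from a minimum [x], the step to
    [x - Psi x] at least halves the norm. The bound [r / 8] keeps [x] within [r / 2] of the centre
    and the new point inside the ball. *)
Lemma newton_zero (Psi : V -> V) (z0 : V) (r : R) : 0 < r -> continuous Psi ->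
  (forall x y : V, vn (x - z0) <= r -> vn (y - z0) <= r ->
     vn (Psi x - Psi y - (x - y)) <= 2^-1 * vn (x - y)) ->
  vn (Psi z0) < r / 8 ->
  exists2 x : V, vn (x - z0) <= r / 2 & Psi x = 0.
Proof.
move=> r0 cPsi est small.
have [x xB xmin] : exists2 x : V, vn (x - z0) <= r & forall y : V, vn (y - z0) <= r -> vn (Psi x) <= vn (Psi y).
  have [||x] := @compact_EVT_min _ R (fun x => vn (Psi x)) _ _ (@vn_ball_compact R n z0 r).
  - by exists z0; rewrite /= subrr vn0 ltW.
  - apply: continuous_subspaceT => x.
    by apply: (@continuous_comp _ _ _ Psi (fun x : V => vn x)); [exact: cPsi|exact: vn_continuous].
  - rewrite inE /= => xB h; exists x => // y yB; apply: h; by rewrite inE.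
have z0B : vn (z0 - z0) <= r by rewrite subrr vn0 ltW.
have m1 := xmin _ z0B.
have xz : vn (x - z0) <= r / 2.
  have h1 := est _ _ xB z0B; have h2 := vnD (Psi x) (- Psi z0).
  have h3 := vn_le_sub (x - z0) (Psi x - Psi z0).
  by move: h1 h2 h3 m1 small; rewrite vnN (vnB (x - z0)); norm_lra.
exists x => //; apply/eqP; rewrite -vn_eq0.
pose y : V := x - Psi x.
have yB : vn (y - z0) <= r.
  have -> : y - z0 = (x - z0) + - Psi x by rewrite /y addrAC.
  by have := vnD (x - z0) (- Psi x); rewrite vnN; move: xz m1 small r0; norm_lra.
have := est _ _ yB xB; rewrite /y [x - Psi x - x]addrAC subrr add0r opprK subrK vnN => h.
have := xmin _ yB; have := vn_ge0 (Psi x); rewrite /y => h1 h2; apply/eqP; move: h h1 h2; norm_lra.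
Qed.

Lemma mulmx_bound m (M : 'M[C]_(n, m)) : exists2 c, 0 < c & forall v : V, vn (v *m M) <= c * vn v.
Proof.
pose c := \sum_(i < n) vn M.
have c0 : 0 <= c by apply: sumr_ge0 => i _; exact: vn_ge0.
exists (c + 1); first by lra.
move=> v; have v0 := vn_ge0 v; apply/vn_leP; first by rewrite mulr_ge0 //; lra.
move=> i j; rewrite mxE; apply: le_trans (cn_sum _ _ _) _.
apply: (@le_trans _ _ (\sum_(k < n) vn M * vn v)).
  apply: ler_sum => k _; rewrite cnM mulrC.
  by apply: ler_pM; rewrite ?cn_ge0 // ?(ord1 i) vn_coord.
by rewrite -mulr_suml -/c; lra.
Qed.

Section Family.
Variables A B : 'I_n -> mpoly n C.
Definition hmap (t : C) (x : V) : V := pmap A x + t *: pmap B x.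
Definition hjac (t : C) (x : V) : 'M[C]_n :=
  \matrix_(i, j) (ev x (mderiv j (A i)) + t * ev x (mderiv j (B i))).

Lemma hmap_continuous t : continuous (hmap t).
Proof.
have -> : hmap t = pmap (fun j => A j + t *: B j).
  by apply/funext => x; apply/rowP => j; rewrite !mxE mevalD mevalZ.
exact: pmap_continuous.
Qed.

Lemma pmap_strict (Q : 'I_n -> mpoly n C) (a : V) (eps : R) : 0 < eps ->
  exists2 del, 0 < del & forall x y : V, vn (x - a) < del -> vn (y - a) < del ->
   vn (pmap Q x - pmap Q y - (x - y) *m (\matrix_(i, j) ev a (mderiv j (Q i)))^T) <= eps * vn (x - y).
Proof.
move=> eps0.
have /choice[d hd] : forall j, exists d, 0 < d /\ forall x y : V, vn (x - a) < d -> vn (y - a) < d ->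
   cn (ev x (Q j) - ev y (Q j) - \sum_l ev a (mderiv l (Q j)) * (x ord0 l - y ord0 l)) <= eps * vn (x - y).
  by move=> j; have [d d0 h] := polynomial_strictly_differentiable (Q j) a eps0; exists d.
have [d0 d00 hd0] := positive_lower_bound (fun j => proj1 (hd j)).
exists d0 => // x y xa ya; apply/vn_leP; first by rewrite mulr_ge0 ?vn_ge0 // ltW.
move=> i j; rewrite (ord1 i) !mxE; under eq_bigr do rewrite !mxE mulrC.
by apply: (proj2 (hd j)); apply: lt_le_trans (hd0 j).
Qed.

(** [M] inverts the derivative at [t0] and [z0], acting on row vectors. Followed by [M], the maps of
    nearby parameters are close to the identity, in the form required by [newton_zero]. *)
Lemma regular_zero_estimate t0 z0 : \det (hjac t0 z0) != 0 ->
  exists (M : 'M[C]_n) (rho eta : R), [/\ M \in unitmx, 0 < rho, 0 < eta &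
   forall (t : C) (x y : V), cn (t - t0) < eta -> vn (x - z0) <= rho -> vn (y - z0) <= rho ->
    vn (hmap t x *m M - hmap t y *m M - (x - y)) <= 2^-1 * vn (x - y)].
Proof.
move=> dJ; pose L := (hjac t0 z0)^T.
have uL : L \in unitmx by rewrite unitmxE det_tr unitfE.
have [c c0 hc] := mulmx_bound (invmx L).
pose DB := (\matrix_(i, j) ev z0 (mderiv j (B i)))^T.
have [b b0 hb] := mulmx_bound DB.
pose T := cn t0 + 1; have T0 : 0 < T by rewrite /T; have := cn_ge0 t0; lra.
(* With this [eps] and the bound on [t - t0], each of the three error terms of the decomposition
   below is at most an eighth of [vn (x - y)]. *)
pose eps := (8 * c * T)^-1; have eps0 : 0 < eps by rewrite invr_gt0 !mulr_gt0.
have [dA dA0 hA] := pmap_strict A z0 eps0.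
have [dB dB0 hB] := pmap_strict B z0 eps0.
exists (invmx L), (Num.min dA dB / 2), (Num.min 1 (8 * c * b)^-1).
have m0 : 0 < Num.min dA dB by rewrite lt_min dA0.
split; [by rewrite unitmx_inv|exact: divr_gt0|by rewrite lt_min ltr01 invr_gt0 !mulr_gt0|].
move=> t x y; rewrite lt_min => /andP[t1 t2] xz yz.
have mA : Num.min dA dB <= dA by rewrite ge_min lexx.
have mB : Num.min dA dB <= dB by rewrite ge_min lexx orbT.
have [[xA xB] [yA yB]] : ((vn (x - z0) < dA) /\ (vn (x - z0) < dB)) /\ ((vn (y - z0) < dA) /\ (vn (y - z0) < dB)).
  by move: xz yz mA mB m0; move: (Num.min _ _) => u; norm_lra.
have {}hA := hA x y xA yA; have {}hB := hB x y xB yB.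
set DA := (\matrix_(i, j) ev z0 (mderiv j (A i)))^T in hA; rewrite -/DB in hB.
have eL : L = DA + t0 *: DB by apply/matrixP => i j; rewrite !mxE.
have -> : hmap t x *m invmx L - hmap t y *m invmx L - (x - y) =
   ((pmap A x - pmap A y - (x - y) *m DA) + t *: (pmap B x - pmap B y - (x - y) *m DB)
    + (t - t0) *: ((x - y) *m DB)) *m invmx L.
  rewrite -[X in _ - X = _](mulmxK uL) -!mulmxBl; congr (_ *m _).
  rewrite eL mulmxDr -scalemxAr /hmap !scalerBr scalerBl.
  move: (pmap A x) (pmap B x) (pmap A y) (pmap B y) ((x - y) *m DA) ((x - y) *m DB) => a1 a2 a3 a4 a5 a6.
  by apply/rowP => j; rewrite !mxE; ring.
apply: le_trans (hc _) _; set v := vn (x - y) in hA hB *.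
have v0 : 0 <= v := vn_ge0 _.
have h1 : cn (t : C) <= T by have := cn_le_sub t t0; rewrite /T; move: t1; norm_lra.
have h3 := hb (x - y); rewrite -/v in h3.
have h : vn (pmap A x - pmap A y - (x - y) *m DA + t *: (pmap B x - pmap B y - (x - y) *m DB)
    + (t - t0) *: ((x - y) *m DB)) <= eps * v + T * (eps * v) + (8 * c * b)^-1 * (b * v).
  apply: le_trans (vnD _ _) _; apply: lerD.
    apply: le_trans (vnD _ _) _; apply: lerD; first exact: hA.
    rewrite vnZ.
    by apply: ler_pM; rewrite ?vn_ge0 ?cn_ge0.
  by rewrite vnZ; apply: ler_pM; rewrite ?vn_ge0 ?cn_ge0 // ltW.
apply: le_trans (ler_wpM2l (ltW c0) h) _.
have -> : c * (eps * v + T * (eps * v) + (8 * c * b)^-1 * (b * v)) = v * (8^-1 * T^-1 + 8^-1 + 8^-1).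
  by rewrite /eps; field; rewrite !gt_eqF.
rewrite mulrC; apply: ler_wpM2r => //.
have : T^-1 <= 1 by rewrite invf_le1 // /T; have := cn_ge0 t0; norm_lra.
by move: (T^-1) => u; norm_lra.
Qed.

Definition zeros (t : C) (z0 : V) (r : R) : set V := [set x | vn (x - z0) <= r /\ hmap t x = 0].

Lemma regular_zeros_finite t z0 r :
  (forall x, zeros t z0 r x -> \det (hjac t x) != 0) -> finite_set (zeros t z0 r).
Proof.
move=> reg.
have -> : zeros t z0 r = zeros t z0 r `&` [set x | vn (x - z0) <= r].
  by apply/seteqP; split=> x // [].
apply: (@compact_ind _ _ (fun S => finite_set (zeros t z0 r `&` S)) (@vn_ball_compact R n z0 r)).
- by rewrite setI0.
- by move=> S S' h h'; rewrite setIUr finite_setU.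
- by move=> S S' SS'; apply: sub_finite_set; exact: setIS.
move=> x xB; have [H0|H0] := eqVneq (hmap t x) 0; last first.
  exists [set y | hmap t y != 0].
    have : nbhs (hmap t x) [set c | c != 0].
      by apply/nbhs_vnP; exists (vn (hmap t x)); rewrite ?vn_gt0 // => y; apply: contraTneq => ->; rewrite subr0 ltxx.
    exact: hmap_continuous.
  by rewrite (_ : _ `&` _ = set0) //; apply/seteqP; split=> // y [[_ Hy]] /=; rewrite Hy eqxx.
have [M [rho [eta [uM rho0 eta0 est]]]] := regular_zero_estimate (reg x (conj xB H0)).
exists [set y : V | vn (y - x) <= rho].
  by apply/nbhs_vnP; exists rho => // y; rewrite vnB => /ltW.
apply: (@sub_finite_set _ _ [set x]); last exact: finite_set1.
move=> y [[_ Hy] /= yx]; apply: half_contraction.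
have := est t y x; rewrite subrr cn0 => /(_ eta0 yx).
rewrite subrr vn0 Hy H0 !mul0mx subrr sub0r vnN; apply; exact: ltW.
Qed.

Definition counts (S : set V) N := exists s : seq V, [/\ uniq s, size s = N & forall x, x \in s <-> S x].

Lemma counts_unique S N N' : counts S N -> counts S N' -> N = N'.
Proof.
move=> [s [us <- hs]] [s' [us' <- hs']]; apply: perm_size; apply: uniq_perm => // x.
by apply/idP/idP => [/(proj1 (hs x))/(proj2 (hs' x))|/(proj1 (hs' x))/(proj2 (hs x))].
Qed.

Lemma finite_counts S : finite_set S -> exists N, counts S N.
Proof.
move=> /finite_seqP[s ->]; exists (size (undup s)), (undup s); split=> //; first exact: undup_uniq.
by move=> x; rewrite mem_undup.
Qed.

(* Newton's lemma follows each zero, compactness forbids new ones. *)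
Lemma zeros_locally_constant t0 z0 r N :
  (forall x, zeros t0 z0 r x -> \det (hjac t0 x) != 0) ->
  (forall x : V, vn (x - z0) = r -> hmap t0 x != 0) ->
  counts (zeros t0 z0 r) N ->
  exists2 eta, 0 < eta & forall t : C, cn (t - t0) < eta -> counts (zeros t z0 r) N.
Proof.
move=> reg bd [s [us sN hs]].
have sreg x : x \in s -> exists q : 'M[C]_n * R * R, [/\ q.1.1 \in unitmx, 0 < q.1.2, 0 < q.2 &
   forall (t : C) (y y' : V), cn (t - t0) < q.2 -> vn (y - x) <= q.1.2 -> vn (y' - x) <= q.1.2 ->
    vn (hmap t y *m q.1.1 - hmap t y' *m q.1.1 - (y - y')) <= 2^-1 * vn (y - y')].
  by move=> /hs/reg/regular_zero_estimate[M [rho [eta ?]]]; exists (M, rho, eta).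
pose I := seq_sub s.
have /choice[q hq] : forall i : I, exists q : 'M[C]_n * R * R, [/\ q.1.1 \in unitmx, 0 < q.1.2, 0 < q.2 &
   forall (t : C) (y y' : V), cn (t - t0) < q.2 -> vn (y - ssval i) <= q.1.2 -> vn (y' - ssval i) <= q.1.2 ->
    vn (hmap t y *m q.1.1 - hmap t y' *m q.1.1 - (y - y')) <= 2^-1 * vn (y - y')].
  by move=> [x xs]; exact: sreg.
have [rho1 rho10 hrho1] := @positive_lower_bound R I (fun i => (q i).1.2) (fun i => let: And4 _ h _ _ := hq i in h).
have [eta1 eta10 heta1] := @positive_lower_bound R I (fun i => (q i).2) (fun i => let: And4 _ _ h _ := hq i in h).
have d2 (i : I) : 0 < r - vn (ssval i - z0).
  case: i => x xs /=; have [xr x0] := proj1 (hs x) xs; rewrite subr_gt0 lt_neqAle xr andbT.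
  by apply/eqP => /bd; rewrite x0 eqxx.
have [rho2 rho20 hrho2] := @positive_lower_bound R I _ d2.
have d3 (ij : I * I) : 0 < (if ij.1 == ij.2 then 1 else vn (ssval ij.1 - ssval ij.2)).
  by case: eqVneq => // ne; rewrite vn_gt0 subr_eq0 (inj_eq (@val_inj _ _ I)).
have [rho3 rho30 hrho3] := @positive_lower_bound R (I * I)%type _ d3.
have {}hrho3 (i j : I) : i != j -> rho3 <= vn (ssval i - ssval j).
  by move=> ne; have := hrho3 (i, j); rewrite /= (negPf ne).
(* Within [rho] of the old zeros the estimates hold and the points stay in the large ball, and
   different old zeros keep disjoint neighbourhoods; the factor 3 leaves room for triangle
   inequalities. *)
pose rho := Num.min (Num.min rho1 rho2) rho3 / 3.
have m0 : 0 < Num.min (Num.min rho1 rho2) rho3 by rewrite !lt_min rho10 rho20.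
have rho0 : 0 < rho by rewrite divr_gt0.
have [r1 r2 r3] : [/\ 3 * rho <= rho1, 3 * rho <= rho2 & 3 * rho <= rho3].
  rewrite /rho mulrCA divff ?mulr1 ?pnatr_eq0 //.
  by split; rewrite !ge_min lexx ?orbT.
have v0 (i : I) : hmap t0 (ssval i) = 0 by case: i => x xs /=; case: (proj1 (hs x) xs).
have [eta2 eta20 near] : exists2 eta, 0 < eta & forall t : C, cn (t - t0) < eta ->
    forall x : V, vn (x - z0) <= r -> hmap t x = 0 -> exists i : I, vn (x - ssval i) < rho.
  apply: (@compact_ind _ _ (fun S => exists2 eta, 0 < eta & forall t : C, cn (t - t0) < eta ->
     forall x, S x -> hmap t x = 0 -> exists i : I, vn (x - ssval i) < rho)
     (@vn_ball_compact R n z0 r)).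
  - by exists 1.
  - move=> S S' [e e0 he] [e' e0' he']; exists (Num.min e e'); first by rewrite lt_min e0.
    by move=> t; rewrite lt_min => /andP[te te'] x [Sx|Sx]; [apply: (he t)|apply: (he' t)].
  - by move=> S S' SS' [e e0 he]; exists e => // t te x /SS'; apply: he.
  move=> x xB; have [H0|H0] := eqVneq (hmap t0 x) 0.
    have xs : x \in s by apply/hs.
    exists [set y | vn (y - x) < rho].
      by apply/nbhs_vnP; exists rho => // y; rewrite vnB.
    by exists 1 => // t _ y yx _; exists (SeqSub xs).
  pose c0 := vn (hmap t0 x); have c00 : 0 < c0 by rewrite vn_gt0.
  pose b := vn (pmap B x) + 1; have b0 : 0 < b by have := vn_ge0 (pmap B x); rewrite /b; norm_lra.
  have /nbhs_vnP[d1 d10 hd1] : nbhs x [set y | vn (hmap t0 x - hmap t0 y) < c0 / 2].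
    apply: (@hmap_continuous t0 x [set c | vn (hmap t0 x - c) < c0 / 2]).
    by apply/nbhs_vnP; exists (c0 / 2) => //; rewrite divr_gt0.
  have /nbhs_vnP[d2' d20 hd2] : nbhs x [set y | vn (pmap B x - pmap B y) < 1].
    apply: (@pmap_continuous B x [set c | vn (pmap B x - c) < 1]).
    by apply/nbhs_vnP; exists 1.
  exists [set y | vn (x - y) < Num.min d1 d2'].
    by apply/nbhs_vnP; exists (Num.min d1 d2') => //; rewrite lt_min d10.
  exists (c0 / 2 / b); first by rewrite !divr_gt0.
  move=> t tt y; rewrite /= lt_min => /andP[/hd1 /= h1 /hd2 /= h2] Hy; exfalso.
  have e1 : hmap t0 y = - ((t - t0) *: pmap B y).
    move/eqP: Hy; rewrite /hmap addr_eq0 => /eqP ->.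
    by rewrite scalerBl opprB addrC.
  have e2 : vn (hmap t0 y) <= c0 / 2.
    rewrite e1 vnN vnZ; have h3 : vn (pmap B y) <= b.
      by have := vn_le_sub (pmap B y) (pmap B x); rewrite (vnB (pmap B y)) /b; move: h2; norm_lra.
    have := ler_pM (cn_ge0 _) (vn_ge0 _) (ltW tt) h3; by rewrite divfK ?gt_eqF.
  by have := vn_le_sub (hmap t0 x) (hmap t0 y); move: h1 e2 c00; rewrite -/c0; norm_lra.
(* Below this threshold for [t - t0], the values at the old zeros are small enough for
   [newton_zero]; the added 1 keeps the denominator positive. *)
have d4 (i : I) : 0 < rho / 8 / (vn (pmap B (ssval i) *m (q i).1.1) + 1).
  by rewrite !divr_gt0 //; have := vn_ge0 (pmap B (ssval i) *m (q i).1.1); norm_lra.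
have [eta3 eta30 heta3] := @positive_lower_bound R I _ d4.
exists (Num.min (Num.min eta1 eta2) eta3); first by rewrite !lt_min eta10 eta20.
move=> t; rewrite !lt_min => /andP[/andP[t1 t2] t3].
have est (i : I) (y y' : V) : vn (y - ssval i) <= rho -> vn (y' - ssval i) <= rho ->
    vn (hmap t y *m (q i).1.1 - hmap t y' *m (q i).1.1 - (y - y')) <= 2^-1 * vn (y - y').
  have [_ _ _ h] := hq i; move=> yi y'i; apply: h; first exact: lt_le_trans (heta1 i).
    by apply: le_trans yi _; move: (hrho1 i) r1 rho0; norm_lra.
  by apply: le_trans y'i _; move: (hrho1 i) r1 rho0; norm_lra.
have /choice[g hg] : forall i : I, exists x : V, vn (x - ssval i) <= rho / 2 /\ hmap t x = 0.
  move=> i; have [uM _ _ _] := hq i.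
  have [||x xi xM] := @newton_zero (fun x => hmap t x *m (q i).1.1) (ssval i) rho rho0 _ (est i).
  - move=> x U /nbhs_vnP[e e0 eU]; have [c c0 hc] := mulmx_bound (q i).1.1.
    have /nbhs_vnP[d dd0 hd] : nbhs x [set y | vn (hmap t x - hmap t y) < e / c].
      apply: (@hmap_continuous t x [set z | vn (hmap t x - z) < e / c]).
      by apply/nbhs_vnP; exists (e / c) => //; rewrite divr_gt0.
    apply/nbhs_vnP; exists d => // y /hd /= h; apply: eU; rewrite -(mulmxBl (hmap t x)).
    by apply: le_lt_trans (hc _) _; rewrite mulrC -ltr_pdivlMr.
  - have -> : hmap t (ssval i) = (t - t0) *: pmap B (ssval i).
      by have /eqP := v0 i; rewrite /hmap addr_eq0 => /eqP ->; rewrite scalerBl addrC.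
    rewrite -scalemxAl vnZ; have b0 := vn_ge0 (pmap B (ssval i) *m (q i).1.1).
    have := lt_le_trans t3 (heta3 i); rewrite ltr_pdivlMr; last by move: b0; norm_lra.
    apply: le_lt_trans; apply: ler_wpM2l; rewrite ?cn_ge0 //; move: b0; norm_lra.
  exists x; split=> //.
  by have := congr1 (fun v => v *m invmx (q i).1.1) xM; rewrite mulmxK // mul0mx.
have guniq (i : I) (x : V) : vn (x - ssval i) <= rho -> hmap t x = 0 -> x = g i.
  move=> xi x0; have [gi g0] := hg i; apply: half_contraction.
  have gi' : vn (g i - ssval i) <= rho by move: gi rho0; norm_lra.
  by have := est i x (g i) xi gi'; rewrite x0 g0 mul0mx subrr sub0r vnN.
exists (map g (enum {: I})); split.
- rewrite map_inj_uniq ?enum_uniq // => i j gij; apply/eqP; apply: contraT => ne.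
  have [gi _] := hg i; have [gj _] := hg j.
  have h := hrho3 i j ne; rewrite -gij in gj.
  by have := vn_triangle (g i) (ssval i) (ssval j); rewrite (vnB (ssval i) (g i)); move: gi gj h r3 rho0; norm_lra.
- by rewrite size_map -cardT card_seq_sub.
move=> x; split.
  move=> /mapP[i _ ->]; have [gi g0] := hg i; split=> //.
  suff h : vn (g i - z0) <= r by [].
  by have := vn_triangle (ssval i) (g i) z0; move: (hrho2 i) gi r2 rho0; norm_lra.
move=> [xr x0]; have [i xi] := near t t2 x xr x0.
by apply/mapP; exists i; rewrite ?mem_enum //; apply: guniq => //; exact: ltW.
Qed.

End Family.
End LocalZeros.

(** * Local degree *)

Section LocalDegree.
Variable R : realType.
Local Notation C := R[i].
Variable n : nat.
Local Notation V := 'rV[C]_n.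
Local Notation ev z p := (meval (fun_of_matrix z ord0) p).

(** The number of zeros is locally constant along the path, hence a continuous function with
    integral values; by the intermediate value theorem it takes the same value at both ends. *)
Lemma counts_constant_on_path (A B : 'I_n -> mpoly n C) (gam : R -> C) (z0 : V) (r : R) N :
  continuous gam ->
  (forall (u : R) (x : V), 0 <= u <= 1 -> zeros A B (gam u) z0 r x -> \det (hjac A B (gam u) x) != 0) ->
  (forall (u : R) (x : V), 0 <= u <= 1 -> vn (x - z0) = r -> hmap A B (gam u) x != 0) ->
  counts (zeros A B (gam 0) z0 r) N -> counts (zeros A B (gam 1) z0 r) N.
Proof.
move=> cg reg bd c0.
(* [tau] retracts the line onto the unit interval, so that the number of zeros is a function on all
   of [R]. *)
pose tau (u : R) := Num.min (Num.max u 0) 1.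
have tauI u : 0 <= tau u <= 1
  by rewrite /tau; apply/andP; split; [rewrite le_min le_max lexx ler01 orbT|rewrite ge_min lexx orbT].
have ctau : continuous tau.
  apply: (@min_fun_continuous _ R R (fun u => Num.max u 0) (fun=> 1)); last exact: cst_continuous.
  by apply: (@max_fun_continuous _ R R id (fun=> 0)) => u; [exact: cvg_id|exact: cvg_cst].
have /choice[M hM] : forall u, exists M, counts (zeros A B (gam (tau u)) z0 r) M.
  by move=> u; apply: finite_counts; apply: regular_zeros_finite => x; exact: reg.
pose f (u : R) : R := (M u)%:R.
have cf : continuous f.
  move=> u S /nbhs_singleton Su.
  have [eta eta0 heta] := zeros_locally_constant (fun x => reg _ x (tauI u)) (fun x => bd _ x (tauI u)) (hM u).
  have : nbhs (gam (tau u)) [set t | cn (t - gam (tau u)) < eta].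
    by apply/nbhs_cnP; exists eta => // t; rewrite cnB.
  move=> /(cg (tau u))/(ctau u) h; apply: (@filterS _ (nbhs u) _ _ _ _ h) => v /= /heta cv.
  by rewrite /f (counts_unique (hM v) cv).
have t0 : tau 0 = 0 by rewrite /tau maxxx min_l.
have t1 : tau 1 = 1 by rewrite /tau max_l // minxx.
have M0 : M 0 = N by apply: counts_unique (hM 0) _; rewrite t0.
suff -> : N = M 1 by have := hM 1; rewrite t1.
rewrite -M0; apply: contrapT => ne.
have [m mm] : exists m : R, Num.min (f 0) (f 1) <= m <= Num.max (f 0) (f 1) /\ forall k : nat, m != k%:R.
  (* Half a unit above the smaller count: between the two counts, and not an integer. *)
  exists ((minn (M 0) (M 1))%:R + 2^-1); split.
    have [lt|gt|//] := ltngtP (M 0) (M 1).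
      have : (M 0).+1%:R <= (M 1)%:R :> R by rewrite ler_nat.
      by rewrite -natr1 => h; rewrite min_l ?max_r ?ler_nat ?(ltnW lt) // /f; lra.
    have : (M 1).+1%:R <= (M 0)%:R :> R by rewrite ler_nat.
    by rewrite -natr1 => h; rewrite min_r ?max_l ?ler_nat ?(ltnW gt) // /f; lra.
  move=> k; apply/eqP => e; set j := minn _ _ in e.
  have [kj|jk] := leqP k j.
    have : k%:R <= j%:R :> R by rewrite ler_nat.
    by move: e; move: (j%:R) (k%:R) => a b; lra.
  have : j.+1%:R <= k%:R :> R by rewrite ler_nat.
  by rewrite -natr1; move: e; move: (j%:R) (k%:R) => a b; lra.
have [||v _ fv] := @IVT R f 0 1 m ler01; [exact: continuous_subspaceT|by case: mm|].
by case: mm => _ /(_ (M v)); rewrite -fv eqxx.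
Qed.

Lemma avoid_small (s : seq R) : exists2 e, 0 < e <= 1 & e \notin s.
Proof.
have h (x : R) : exists2 e, 0 < e & (0 < x -> e <= x).
  by have [x0|x0] := ltP 0 x; [exists x|exists 1].
have [e e0 he] : exists2 e : R, 0 < e & forall x, x \in s -> 0 < x -> e <= x.
  elim: s => [|x s [e e0 he]]; first by exists 1.
  have [e' e0' he'] := h x; exists (Num.min e e'); first by rewrite lt_min e0.
  move=> y; rewrite inE => /orP[/eqP ->|ys] y0; rewrite ge_min.
    by rewrite he' ?orbT.
  by rewrite (he y).
have [m1 m2] : Num.min e 1 <= e /\ Num.min e 1 <= 1 by split; rewrite ge_min lexx ?orbT.
have m0 : 0 < Num.min e 1 by rewrite lt_min e0 ltr01.
exists (Num.min e 1 / 2); first by apply/andP; split; lra.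
by apply/negP => /he; lra.
Qed.

(** On the complex line through [z] and a point where [q] does not vanish, [q] is a nonzero
    polynomial in one variable; a small real parameter avoids its finitely many roots. *)
Lemma nonvanishing_nearby (q : mpoly n C) (z : V) (rho : R) : q != 0 -> 0 < rho ->
  exists2 y : V, vn (y - z) < rho & ev y q != 0.
Proof.
move=> q0 rho0.
have [z1 z1q] : exists z1 : V, ev z1 q != 0.
  apply: contrapT => /forallNP no; move/eqP: q0; apply.
  apply: (meval_all_eq0 (@complex_uncountable R)) => y.
  by apply/eqP; move: (no y) => /negP; rewrite negbK.
have [P hP] : exists P : {poly C}, forall t : C, P.[t] = ev (z + t *: (z1 - z)) q.
  elim/mpoly_ring_ind: q {q0 z1q} => [c|i|p q [P hP] [Q hQ]|p q [P hP] [Q hQ]].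
  - by exists c%:P => t; rewrite hornerC mevalC.
  - exists ((z ord0 i)%:P + (z1 ord0 i - z ord0 i) *: 'X) => t.
    by rewrite hornerD hornerC hornerZ hornerX mevalXU !mxE mulrC.
  - by exists (P + Q) => t; rewrite hornerD mevalD hP hQ.
  - by exists (P * Q) => t; rewrite hornerM mevalM hP hQ.
have P0 : P != 0.
  apply/eqP => P0; have := hP 1; rewrite P0 horner0 scale1r addrC subrK => /esym/eqP.
  exact/negP.
have [rs ers] := closed_field_poly_normal P.
have D0 : 0 < vn (z1 - z) + 1 by have := vn_ge0 (z1 - z); norm_lra.
pose k := rho / (vn (z1 - z) + 1).
have k0 : 0 < k by rewrite divr_gt0.
(* If the real parameter [e * k] were a root [x], then [e] would be the real part of [x] divided by
   [k]. *)
have [e /andP[e0 e1] ers'] := avoid_small [seq complex.Re x / k | x <- rs].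
exists (z + (e * k)%:C *: (z1 - z)).
  rewrite addrC addKr vnZ cn_real ger0_norm; last by apply/ltW/mulr_gt0.
  have h1 : k * (vn (z1 - z) + 1) = rho by rewrite divfK ?gt_eqF.
  have h2 : e * k <= k by rewrite ger_pMl.
  have h3 := vn_ge0 (z1 - z).
  apply: (@le_lt_trans _ _ (k * vn (z1 - z))); first exact: ler_wpM2r.
  by rewrite -[X in _ < X]h1 mulrDr mulr1 ltrDl.
rewrite -hP; apply/negP; rewrite -/(root P _) ers rootZ ?lead_coef_eq0 // root_prod_XsubC => h.
by move/negP: ers'; apply; apply/mapP; exists (e * k)%:C; rewrite //= mulfK ?gt_eqF.
Qed.

Section Nondegenerate.
Variables (e : nat) (F : 'I_n -> mpoly n C).
Hypothesis e_gt0 : (0 < e)%N.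
Hypothesis F_homog : forall j, F j \is ishomog1 e mdeg.
Hypothesis F_nondeg : forall z : V, pmap F z = 0 -> z = 0.

Lemma pmap_nondeg (z : V) : (forall j, ev z (F j) = 0) -> z = 0.
Proof. by move=> h; apply: F_nondeg; apply/rowP => j; rewrite !mxE. Qed.

Definition regular_value (w : V) : Prop := forall x, pmap F x = w -> ev x (jacobian F) != 0.

(** Critical values satisfy an equation whose composition with [F] is not zero, so it fails at
    points arbitrarily close to [z]. *)
Lemma regular_value_nearby (z : V) (rho : R) : 0 < rho ->
  exists2 y : V, vn (y - z) < rho & regular_value (pmap F y).
Proof.
move=> rho0.
have [delta d0 hd] := critical_value_equation (@complex_uncountable R) e_gt0 F_homog pmap_nondeg.
have [y yz yd] := nonvanishing_nearby z d0 rho0.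
exists y => // x xy; apply: contraNneq yd => /hd.
rewrite comp_mpoly_meval => <-; apply/eqP; apply: meval_eq => j.
by rewrite tnth_mktuple; move/rowP: xy => /(_ j); rewrite !mxE.
Qed.

Lemma fibre_finite (w : V) : finite_set [set x | pmap F x = w].
Proof.
have [D hD] := finite_fibres (@complex_uncountable R) e_gt0 F_homog pmap_nondeg.
apply: contrapT => /(infinite_set_fset D.+1)[B BA DB].
have : (size (finmap.enum_fset B) <= D)%N; last by rewrite leqNgt DB.
apply: (hD w); first exact: finmap.fset_uniq.
by move=> z zB j; have /rowP/(_ j) := BA z zB; rewrite !mxE.
Qed.

Lemma isolated_in_ball (z : V) (r1 : R) : 0 < r1 -> exists r : R,
  [/\ 0 < r, r <= r1 & forall x : V, vn (x - z) <= r -> pmap F x = pmap F z -> x = z].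
Proof.
move=> r10; have /finite_seqP[s hs] := fibre_finite (pmap F z).
have [r r0 hr] : exists2 r, 0 < r & forall x, x \in s -> x != z -> r <= vn (x - z).
  elim: (s) => [|x s' [r r0 hr]]; first by exists 1.
  have [->|xz] := eqVneq x z.
    by exists r => // y; rewrite inE => /orP[/eqP ->|/hr//]; rewrite eqxx.
  exists (Num.min r (vn (x - z))); first by rewrite lt_min r0 vn_gt0 subr_eq0.
  move=> y; rewrite inE => /orP[/eqP -> _|/hr h /h]; rewrite ge_min; first by rewrite lexx orbT.
  by move=> ->.
have m0 : 0 < Num.min r r1 by rewrite lt_min r0.
exists (Num.min r r1 / 2); split; first by rewrite divr_gt0.
  have : Num.min r r1 <= r1 by rewrite ge_min lexx orbT. lra.
move=> x xz Fx; apply/eqP; apply: contraT => ne.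
have xs : x \in s by have : [set x | pmap F x = pmap F z] x by []; rewrite hs.
have := hr x xs ne; have : Num.min r r1 <= r by rewrite ge_min lexx.
by move: (Num.min r r1) m0 xz => u; norm_lra.
Qed.

Local Notation line_source w0 := (fun j => F j - mpolyC n (w0 ord0 j)).
Local Notation line_direction w0 G w1 :=
  (fun j => (G j - mpolyC n (w1 ord0 j)) - (F j - mpolyC n (w0 ord0 j))).

Lemma hmap_lineE (G : 'I_n -> mpoly n C) (w0 w1 x : V) (t : C) :
  hmap (line_source w0) (line_direction w0 G w1) t x =
    (1 - t) *: (pmap F x - w0) + t *: (pmap G x - w1).
Proof. by apply/rowP => j; rewrite !mxE !mevalB !mevalC; ring. Qed.

Lemma hjac_lineE (G : 'I_n -> mpoly n C) (w0 w1 x : V) (t : C) :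
  hjac (line_source w0) (line_direction w0 G w1) t x =
    \matrix_(i, j) ((1 - t) * ev x (mderiv j (F i)) + t * ev x (mderiv j (G i))).
Proof.
apply/matrixP => i j; rewrite !mxE !mderivB !mderivC !subr0 mevalB.
by move: (ev x _) (ev x _) => a b; ring.
Qed.

(* (F, w0) is joined to (G, w1) by an arc of a complex line which avoids the
   finitely many parameters where the system is degenerate. *)
Lemma count_invariance (G : 'I_n -> mpoly n C) (w0 w1 z : V) (r eps : R) N :
  (forall j, (msize (G j) <= e.+1)%N) -> regular_value w0 ->
  (forall x : V, vn (x - z) <= r -> vn (pmap G x - pmap F x) <= eps) ->
  (forall x : V, vn (x - z) = r -> 8 * eps < vn (pmap F x - pmap F z)) ->
  0 < eps -> vn (w0 - pmap F z) <= eps -> vn (w1 - pmap F z) <= eps ->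
  (forall x : V, vn (x - z) <= r -> pmap G x = w1 -> ev x (jacobian G) != 0) ->
  counts [set x : V | vn (x - z) <= r /\ pmap F x = w0] N ->
  counts [set x : V | vn (x - z) <= r /\ pmap G x = w1] N.
Proof.
move=> sG reg GF bd eps0 w0z w1z Greg c0.
have [|delta d0 hd] := @generic_regularity C n (@complex_uncountable R) e F e_gt0 F_homog pmap_nondeg w0 _ G w1 sG.
  by move=> x hx; apply: reg; apply/rowP => j; rewrite mxE.
have delta0 : delta != 0 by apply: contraNneq d0 => ->; rewrite horner0.
have [rs ers] := closed_field_poly_normal delta.
(* The arc will be [u + i sg u (1 - u)]. If it met a root [x] of [delta] at an interior time, [u]
   would be the real part of [x] and [sg] the quotient excluded here. *)
have [sg /andP[sg0 sg1] hsg] :=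
  avoid_small [seq complex.Im x / (complex.Re x * (1 - complex.Re x)) | x <- rs].
pose gam (u : R) : C := u%:C + 'i%C * (sg * (u * (1 - u)))%:C.
have gamE u : gam u = (u +i* (sg * (u * (1 - u))))%C by rewrite /gam; simpc.
have g0 : gam 0 = 0 by rewrite gamE mul0r mulr0.
have g1 : gam 1 = 1 by rewrite gamE subrr !mulr0.
have cni : cn ('i%C : C) = 1 by rewrite /cn /rn normc_def /= expr0n expr1n add0r sqrtr1.
have cgam : continuous gam.
  have ci (f : R -> R) : continuous f -> continuous (fun u => (f u)%:C : C).
    move=> cf u S /nbhs_cnP[d dd0 hS].
    have h : nbhs (f u) [set y | `|f u - y| < d].
      by apply/nbhs_ballP; exists d => //= y; rewrite /ball /=.
    apply: (@filterS _ (nbhs u) _ _ _ _ (cf u _ h)) => v /= fv; apply: hS.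
    by rewrite -rmorphB cn_real.
  move=> u; apply: continuousDC; first by apply: ci => v; exact: cvg_id.
  apply: continuousMC; first exact: cst_continuous.
  apply: (ci (fun u => sg * (u * (1 - u)))) => v.
  apply: (@cvgM _ _ (nbhs v)); first exact: cvg_cst.
  apply: (@cvgM _ _ (nbhs v)); first exact: cvg_id.
  by apply: (@cvgB _ _ _ (nbhs v)); [exact: cvg_cst|exact: cvg_id].
have gnorm u : 0 <= u <= 1 -> cn (gam u) <= 2 /\ cn (1 - gam u) <= 2.
  move=> /andP[u0 u1]; have h0 : 0 <= u * (1 - u) by rewrite mulr_ge0 // subr_ge0.
  have h1 : u * (1 - u) <= 1 by rewrite -[1]mulr1 ler_pM // ?subr_ge0 //; lra.
  have h2 : `|sg * (u * (1 - u))| <= 1.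
    by rewrite ger0_norm; [apply: mulr_ile1 => //; exact: ltW|apply: mulr_ge0 => //; exact: ltW].
  split.
    apply: le_trans (cnD _ _) _; rewrite cnM cni mul1r !cn_real ger0_norm //; lra.
  rewrite /gam opprD addrA -rmorphB; apply: le_trans (cnD _ _) _.
  rewrite cnN cnM cni mul1r !cn_real ger0_norm ?subr_ge0 //; lra.
have groot u : 0 < u < 1 -> delta.[gam u] != 0.
  move=> /andP[u0 u1]; apply/negP; rewrite -/(root delta _) ers rootZ ?lead_coef_eq0 // root_prod_XsubC => h.
  move/negP: hsg; apply; apply/mapP; exists (gam u) => //.
  by rewrite gamE /= mulfK // mulf_neq0 ?subr_eq0 ?gt_eqF.
pose A := line_source w0; pose B := line_direction w0 G w1.
have S0 : zeros A B (gam 0) z r = [set x : V | vn (x - z) <= r /\ pmap F x = w0].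
  apply/seteqP; split=> x [xr]; rewrite /zeros /= g0 hmap_lineE subr0 scale1r scale0r addr0.
    by move=> /eqP; rewrite subr_eq0 => /eqP.
  by move=> <-; rewrite subrr.
have S1 : zeros A B (gam 1) z r = [set x : V | vn (x - z) <= r /\ pmap G x = w1].
  apply/seteqP; split=> x [xr]; rewrite /zeros /= g1 hmap_lineE subrr scale1r scale0r add0r.
    by move=> /eqP; rewrite subr_eq0 => /eqP.
  by move=> <-; rewrite subrr.
rewrite -S1; apply: (@counts_constant_on_path A B gam z r N) => //; last by rewrite S0.
- move=> u x u01 [xr]; rewrite hmap_lineE hjac_lineE => Hx.
  have Hj j : (1 - gam u) * ev x (F j - mpolyC n (w0 ord0 j)) + gam u * ev x (G j - mpolyC n (w1 ord0 j)) = 0.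
    by move/rowP: Hx => /(_ j); rewrite !mxE !mevalB !mevalC.
  (* At the end of the arc [delta] may vanish, but there regularity is a hypothesis; at the start
     [delta] is nonzero. *)
  have [u1|nu1] := eqVneq u 1.
    move: Hx; rewrite u1 g1 subrr scale0r add0r scale1r => /eqP; rewrite subr_eq0 => /eqP /Greg h.
    apply: contra_neq (h xr) => <-; rewrite -det_map_mx; congr (\det _).
    by apply/matrixP => i j; rewrite !mxE /= mul0r add0r mul1r.
  suff dg : delta.[gam u] != 0 by apply: contra_neq dg; exact: hd.
  have [u0|nu0] := eqVneq u 0; first by rewrite u0 g0.
  by apply: groot; move/andP: u01 => [? ?]; rewrite !lt_neqAle eq_sym nu0 nu1; apply/andP.
- move=> u x u01 xr; have [h1 h2] := gnorm u u01; apply/negP => /eqP; rewrite hmap_lineE => Hx.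
  have := bd x xr; have xr' : vn (x - z) <= r by rewrite xr.
  have := GF x xr'; set a := pmap F x in Hx *; set b := pmap F z in w0z w1z *; set c := pmap G x in Hx *.
  move=> ca.
  (* A zero on the sphere would put [F x] within [6 * eps] of [F z], because [gam u] and [1 - gam u]
     have modulus at most 2. *)
  have e1 : a - b = (1 - gam u) *: (w0 - b) + gam u *: ((w1 - b) - (c - a)).
    have -> : a - b = a - b - ((1 - gam u) *: (a - w0) + gam u *: (c - w1)) by rewrite Hx subr0.
    by apply/rowP => j; rewrite !mxE; ring.
  have k1 : vn ((1 - gam u) *: (w0 - b)) <= 2 * eps.
    by rewrite vnZ; apply: ler_pM; [exact: cn_ge0|exact: vn_ge0|exact: h2|exact: w0z].
  have k2 : vn (gam u *: ((w1 - b) - (c - a))) <= 2 * (2 * eps).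
    rewrite vnZ ler_pM ?cn_ge0 ?vn_ge0 //.
    by have := vnD (w1 - b) (- (c - a)); rewrite vnN; move: w1z ca; norm_lra.
  have := vnD ((1 - gam u) *: (w0 - b)) (gam u *: ((w1 - b) - (c - a))); rewrite -e1.
  by move: k1 k2 eps0; norm_lra.
Qed.

(** [N] counts the preimages, in the ball, of one regular value close to [F z]; [count_invariance]
    carries this number to all perturbations. The ball isolates [z] in its fibre, and [eps] is an
    eighth of a lower bound for the distance from [F] to [F z] on the sphere. *)
Lemma local_degree (z : V) (r1 : R) : 0 < r1 -> exists (r eps : R) (N : nat),
  [/\ 0 < r <= r1, 0 < eps, (0 < N)%N,
   forall x : V, vn (x - z) <= r -> pmap F x = pmap F z -> x = z &
   forall (G : 'I_n -> mpoly n C) (w : V), (forall j, (msize (G j) <= e.+1)%N) ->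
    (forall x : V, vn (x - z) <= r -> vn (pmap G x - pmap F x) <= eps) ->
    vn (w - pmap F z) <= eps ->
    (forall x : V, vn (x - z) <= r -> pmap G x = w -> ev x (jacobian G) != 0) ->
    counts [set x : V | vn (x - z) <= r /\ pmap G x = w] N].
Proof.
move=> r10; have [r [r0 rr1 iso]] := isolated_in_ball z r10.
have [c c0 hc] : exists2 c, 0 < c & forall x : V, vn (x - z) = r -> c < vn (pmap F x - pmap F z).
  have [c c0 hc] : exists2 c, 0 < c & forall x : V, vn (x - z) <= r -> vn (x - z) = r -> c < vn (pmap F x - pmap F z).
    apply: (@compact_ind _ _ (fun S => exists2 c, 0 < c & forall x : V, S x -> vn (x - z) = r -> c < vn (pmap F x - pmap F z)) (@vn_ball_compact R n z r)).
    - by exists 1.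
    - move=> S S' [c c0 h] [c' c0' h']; exists (Num.min c c'); first by rewrite lt_min c0.
      by move=> x [Sx|Sx] xr; rewrite gt_min; [rewrite (h x Sx xr)|rewrite (h' x Sx xr) orbT].
    - by move=> S S' SS' [c c0 h]; exists c => // x /SS'; exact: h.
    move=> x xB; have [xz|xz] := eqVneq x z.
      exists [set y : V | vn (x - y) < r]; first by apply/nbhs_vnP; exists r.
      by exists 1 => // y /=; rewrite xz vnB => + yr; rewrite yr ltxx.
    pose c0 := vn (pmap F x - pmap F z).
    have c00 : 0 < c0 by rewrite vn_gt0 subr_eq0; apply: contra_neq xz => /iso; exact.
    have /nbhs_vnP[d d0 hd] : nbhs x [set y | vn (pmap F x - pmap F y) < c0 / 2].
      apply: (@pmap_continuous R n F x [set c | vn (pmap F x - c) < c0 / 2]).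
      by apply/nbhs_vnP; exists (c0 / 2) => //; rewrite divr_gt0.
    exists [set y | vn (x - y) < d]; first by apply/nbhs_vnP; exists d.
    exists (c0 / 2); first by rewrite divr_gt0.
    move=> y /hd /= h _.
    by have := vn_triangle (pmap F y) (pmap F x) (pmap F z); rewrite -/c0; move: h; norm_lra.
  by exists c => // x xr; apply: hc => //; rewrite xr.
pose eps := c / 8; have eps0 : 0 < eps by rewrite divr_gt0.
have bd x : vn (x - z) = r -> 8 * eps < vn (pmap F x - pmap F z).
  by move=> xr; rewrite /eps mulrC divfK ?pnatr_eq0 //; exact: hc.
have /nbhs_vnP[d d0 hd] : nbhs z [set y | vn (pmap F z - pmap F y) < eps].
  apply: (@pmap_continuous R n F z [set c | vn (pmap F z - c) < eps]).
  by apply/nbhs_vnP; exists eps.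
have m0 : 0 < Num.min d r by rewrite lt_min d0.
have [y yz yreg] := regular_value_nearby z m0.
have yr : vn (y - z) <= r by apply: le_trans (ltW yz) _; rewrite ge_min lexx orbT.
have w0z : vn (pmap F y - pmap F z) <= eps.
  rewrite vnB; apply/ltW/hd; rewrite vnB; apply: lt_le_trans yz _; by rewrite ge_min lexx.
have [N cN] : exists N, counts [set x : V | vn (x - z) <= r /\ pmap F x = pmap F y] N.
  apply: finite_counts; apply: sub_finite_set (fibre_finite (pmap F y)) => x; by case.
exists r, eps, N; split=> //; first exact/andP.
  case: cN => s [us <- /(_ y)[_ /(_ (conj yr erefl))]].
  by case: s us.
move=> G w sG GF wz Greg.
exact: (@count_invariance G (pmap F y) w z r eps N).
Qed.
End Nondegenerate.
End LocalDegree.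

(** * Additivity of the local degree, and roots near 1 *)

Section DegreeSums.
Variable R : realType.
Local Notation C := R[i].
Variable n : nat.
Local Notation V := 'rV[C]_n.
Local Notation ev z p := (meval (fun_of_matrix z ord0) p).

Record nondegenerate (e : nat) (F : 'I_n -> mpoly n C) : Prop := Nondegenerate {
  nondeg_gt0 : (0 < e)%N;
  nondeg_homog : forall j, F j \is ishomog1 e mdeg;
  nondeg_zero : forall z : V, pmap F z = 0 -> z = 0
}.

(* [N] is the number of solutions of [F x = w] near [z], for [w] a regular
   value close to [F z], and this number is stable under perturbations of [F]. *)
Record degree_at (e : nat) (F : 'I_n -> mpoly n C) (z : V) (r eps : R) (N : nat) : Prop := DegreeAt {
  degree_r : 0 < r;
  degree_eps : 0 < eps;
  degree_gt0 : (0 < N)%N;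
  degree_isolated : forall x : V, vn (x - z) <= r -> pmap F x = pmap F z -> x = z;
  degree_count : forall (G : 'I_n -> mpoly n C) (w : V), (forall j, (msize (G j) <= e.+1)%N) ->
    (forall x : V, vn (x - z) <= r -> vn (pmap G x - pmap F x) <= eps) ->
    vn (w - pmap F z) <= eps ->
    (forall x : V, vn (x - z) <= r -> pmap G x = w -> ev x (jacobian G) != 0) ->
    counts [set x : V | vn (x - z) <= r /\ pmap G x = w] N
}.

Lemma degree_exists e F z (r1 : R) : nondegenerate e F -> 0 < r1 ->
  exists r eps N, r <= r1 /\ degree_at e F z r eps N.
Proof.
move=> [e0 hF F0] r10; have [r [eps [N [/andP[? ?] ? ? ? ?]]]] := local_degree e0 hF F0 z r10.
by exists r, eps, N.
Qed.

Lemma nondeg_size e F j : nondegenerate e F -> (msize (F j) <= e.+1)%N.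
Proof.
move=> [_ hF _]; rewrite msizeE; apply/bigmax_leqP_seq => m mp _.
by rewrite (dhomogP _ _ _ (hF j) m mp).
Qed.

(** On the part of the ball at distance at least [rho] from [z], the values of [F] stay away from
    [F z], by isolation and compactness. *)
Lemma solutions_close e F z r eps N (rho : R) : degree_at e F z r eps N -> 0 < rho ->
  exists2 d : R, 0 < d & forall x : V, vn (x - z) <= r -> vn (pmap F x - pmap F z) < d -> vn (x - z) < rho.
Proof.
move=> [r0 eps0 N0 iso _] rho0.
have [d d0 hd] : exists2 d : R, 0 < d & forall x : V, vn (x - z) <= r -> vn (x - z) <= r ->
   vn (pmap F x - pmap F z) < d -> vn (x - z) < rho.
  apply: (@compact_ind _ _ (fun S => exists2 d : R, 0 < d & forall x : V, S x -> vn (x - z) <= r ->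
     vn (pmap F x - pmap F z) < d -> vn (x - z) < rho) (@vn_ball_compact R n z r)).
  - by exists 1.
  - move=> S S' [c c0 h] [c' c0' h']; exists (Num.min c c'); first by rewrite lt_min c0.
    by move=> x [Sx|Sx] xr; rewrite lt_min => /andP[? ?]; [apply: h|apply: h'].
  - by move=> S S' SS' [c c0 h]; exists c => // x /SS'; exact: h.
  move=> x xB; have [xz|xz] := eqVneq x z.
    exists [set y : V | vn (x - y) < rho]; first by apply/nbhs_vnP; exists rho.
    by exists 1 => // y /=; rewrite xz vnB.
  pose c0 := vn (pmap F x - pmap F z).
  have c00 : 0 < c0 by rewrite vn_gt0 subr_eq0; apply: contra_neq xz => /iso; exact.
  have /nbhs_vnP[d d0 hd] : nbhs x [set y | vn (pmap F x - pmap F y) < c0 / 2].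
    apply: (@pmap_continuous R n F x [set c | vn (pmap F x - c) < c0 / 2]).
    by apply/nbhs_vnP; exists (c0 / 2) => //; rewrite divr_gt0.
  exists [set y | vn (x - y) < d]; first by apply/nbhs_vnP; exists d.
  exists (c0 / 2); first by rewrite divr_gt0.
  move=> y /hd /= h _ h'; exfalso; move: h h'.
  by have := vn_triangle (pmap F y) (pmap F x) (pmap F z); rewrite -/c0; norm_lra.
by exists d; [exact: d0|move=> x xr; exact: (hd x xr xr)].
Qed.

Lemma regular_value_close e F (z : V) (d : R) : nondegenerate e F -> 0 < d ->
  exists2 w : V, vn (w - pmap F z) < d & regular_value F w.
Proof.
move=> [e0 hF F0] d0.
have /nbhs_vnP[d' d0' hd] : nbhs z [set y | vn (pmap F z - pmap F y) < d].
  apply: (@pmap_continuous R n F z [set c | vn (pmap F z - c) < d]).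
  by apply/nbhs_vnP; exists d.
have [y yz yreg] := regular_value_nearby e0 hF F0 z d0'.
by exists (pmap F y) => //; rewrite vnB; apply: hd; rewrite vnB.
Qed.

Lemma degree_attained e F z r eps N (rho d : R) : nondegenerate e F -> degree_at e F z r eps N ->
  0 < rho -> 0 < d -> exists (w : V) (s : seq V), [/\ vn (w - pmap F z) < d, uniq s, size s = N &
   forall x, x \in s -> vn (x - z) < rho /\ pmap F x = w].
Proof.
move=> nd deg rho0 d0; have [d' d0' hd'] := solutions_close deg rho0.
have m0 : 0 < Num.min d (Num.min d' eps) by rewrite !lt_min d0 d0' (degree_eps deg).
have [w wz wreg] := regular_value_close z nd m0.
move: wz; rewrite !lt_min => /andP[wd /andP[wd' we]].
have [||s [us sN hs]] := degree_count deg (G := F) (w := w) (fun j => nondeg_size j nd) _ (ltW we).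
- by move=> x _; rewrite subrr vn0 ltW // (degree_eps deg).
- by move=> x _; exact: wreg.
exists w, s; split=> // x /hs[xr Fx]; split=> //.
by apply: hd' => //; rewrite Fx.
Qed.

(** Move [w] to a regular value [w2] of [G]. Each [x] of [s] then yields [N' x] solutions of
    [G = w2] close to it; those of different points are different, and all of them are among the [N]
    solutions in the large ball. *)
Lemma degree_sum e F G z r eps N (w : V) (s : seq V) (r' eps' : V -> R) (N' : V -> nat) :
  degree_at e F z r eps N -> nondegenerate e G ->
  (forall x : V, vn (x - z) <= r -> vn (pmap G x - pmap F x) <= eps) ->
  vn (w - pmap F z) < eps -> uniq s ->
  (forall x, x \in s -> [/\ vn (x - z) < r, pmap G x = w & degree_at e G x (r' x) (eps' x) (N' x)]) ->
  (\sum_(x <- s) N' x <= N)%N.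
Proof.
move=> deg ndG GF wz us hs.
have [/size0nil ->|s0] := posnP (size s); first by rewrite big_nil.
(* Balls of radius [rho] around the points of [s] are disjoint and contained in the large ball. *)
have [rho rho0 hrho] : exists2 rho : R, 0 < rho & forall x, x \in s -> vn (x - z) + rho <= r /\
    forall y, y \in s -> x != y -> 2 * rho <= vn (x - y).
  have d1 (x : seq_sub s) : 0 < r - vn (ssval x - z).
    by case: x => x xs /=; have [h _ _] := hs x xs; rewrite subr_gt0.
  have [d1' d10 hd1] := positive_lower_bound d1.
  have d2 (xy : seq_sub s * seq_sub s) : 0 < (if xy.1 == xy.2 then 1 else vn (ssval xy.1 - ssval xy.2)).
    by case: eqVneq => // ne; rewrite vn_gt0 subr_eq0 (inj_eq (@val_inj _ _ (seq_sub s))).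
  have [d2' d20 hd2] := positive_lower_bound d2.
  have m0 : 0 < Num.min d1' d2' by rewrite lt_min d10.
  have [m1 m2] : Num.min d1' d2' <= d1' /\ Num.min d1' d2' <= d2' by split; rewrite ge_min lexx ?orbT.
  exists (Num.min d1' d2' / 2); first by rewrite divr_gt0.
  move=> x xs; split.
    by have := hd1 (SeqSub xs); rewrite /=; move: m0 m1; move: (Num.min _ _) => u; norm_lra.
  move=> y ys xy; have := hd2 (SeqSub xs, SeqSub ys); rewrite /= ifN; last by apply: contra xy => /eqP[->].
  by move: m0 m2; move: (Num.min _ _) => u; norm_lra.
have [d d0 hd] : exists2 d : R, 0 < d & forall x, x \in s -> d <= eps' x /\
   forall y : V, vn (y - x) <= r' x -> vn (pmap G y - pmap G x) < d -> vn (y - x) < rho.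
  have /choice[dd hdd] : forall x : seq_sub s, exists d, 0 < d /\ (d <= eps' (ssval x) /\
   forall y : V, vn (y - ssval x) <= r' (ssval x) -> vn (pmap G y - pmap G (ssval x)) < d -> vn (y - ssval x) < rho).
    move=> [x xs] /=; have [_ _ dx] := hs x xs; have [d d0 hd] := solutions_close dx rho0.
    exists (Num.min d (eps' x)); split; first by rewrite lt_min d0 (degree_eps dx).
    split; first by rewrite ge_min lexx orbT.
    by move=> y yr; rewrite lt_min => /andP[h _]; exact: hd.
  have [d d0 hd] := positive_lower_bound (fun x => proj1 (hdd x)).
  exists d => // x xs; have [_ [h1 h2]] := hdd (SeqSub xs); have le := hd (SeqSub xs).
  split; first exact: le_trans le h1.
  by move=> y yr yd; apply: h2 => //; apply: lt_le_trans yd le.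
have [x0 x0s] : exists x, x \in s by case: (s) s0 => // x s' _; exists x; rewrite mem_head.
have m0 : 0 < Num.min d (eps - vn (w - pmap F z)) by rewrite lt_min d0 subr_gt0.
have [w2 w2x w2reg] := regular_value_close x0 ndG m0.
move: w2x; have [_ -> _] := hs x0 x0s; rewrite lt_min => /andP[w2d w2e].
have w2F : vn (w2 - pmap F z) <= eps.
  by have := vn_triangle w w2 (pmap F z); move: w2e; norm_lra.
have [|t [ut tN ht]] := degree_count deg (fun j => nondeg_size j ndG) GF w2F.
  by move=> x _; exact: w2reg.
have /choice[sx hsx] : forall x : V, exists sx : seq V, x \in s -> [/\ uniq sx, size sx = N' x &
    forall y, y \in sx -> vn (y - x) < rho /\ pmap G y = w2].
  move=> x; case: (boolP (x \in s)) => xs; last by exists [::].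
  have [xz Gx dx] := hs x xs; have [de hdx] := hd x xs.
  have [|||sx [usx sxN hsx]] := degree_count dx (G := G) (w := w2) (fun j => nondeg_size j ndG).
  - by move=> y _; rewrite subrr vn0 ltW // (degree_eps dx).
  - by rewrite Gx; apply: le_trans (ltW w2d) _.
  - by move=> y _; exact: w2reg.
  exists sx => _; split=> // y /hsx[yr Gy]; split=> //.
  by apply: hdx => //; rewrite Gy Gx.
rewrite -tN; apply: (@leq_trans (size (flatten [seq sx x | x <- s]))).
  rewrite size_flatten /shape -map_comp sumnE big_map big_seq [X in (_ <= X)%N]big_seq.
  by apply: leq_sum => x xs /=; have [_ -> _] := hsx x xs.
apply: uniq_leq_size; last first.
  move=> y /flatten_mapP[x xs /(fun h => let: And3 _ _ hh := hsx x xs in hh y h)[yx Gy]].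
  apply/ht; split=> //; have [h _] := hrho x xs.
  by have := vn_triangle x y z; move: h yx; norm_lra.
suff H s' : uniq s' -> {subset s' <= s} -> uniq (flatten [seq sx x | x <- s']) by apply: H.
elim: s' => //= x s' IH /andP[xs' us'] sub.
rewrite cat_uniq IH //; last by move=> y ys'; apply: sub; rewrite inE ys' orbT.
have xs : x \in s by apply: sub; rewrite mem_head.
have [-> _ hx] := hsx x xs; rewrite andbT /=; apply/hasPn => y /flatten_mapP[x' x's' yx'].
apply/negP => /hx[yx _]; have x's : x' \in s by apply: sub; rewrite inE x's' orbT.
have [_ _ hx'] := hsx x' x's; have [yx'' _] := hx' y yx'.
have ne : x != x' by apply: contraNneq xs' => ->.
have [_ /(_ x' x's ne)] := hrho x xs.
by have := vn_triangle y x x'; rewrite (vnB x y); move: yx yx''; norm_lra.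
Qed.

Lemma solutions_bound e F G z r eps N (w : V) (s : seq V) :
  degree_at e F z r eps N -> nondegenerate e G ->
  (forall x : V, vn (x - z) <= r -> vn (pmap G x - pmap F x) <= eps) ->
  vn (w - pmap F z) < eps -> uniq s ->
  (forall x, x \in s -> vn (x - z) < r /\ pmap G x = w) -> (size s <= N)%N.
Proof.
move=> deg ndG GF wz us hs.
have /choice[q hq] : forall x : V, exists q : R * R * nat, degree_at e G x q.1.1 q.1.2 q.2.
  by move=> x; have [r' [eps' [N' [_ h]]]] := degree_exists x ndG ltr01; exists (r', eps', N').
apply: leq_trans (degree_sum (r' := fun x => (q x).1.1) (eps' := fun x => (q x).1.2) (N' := fun x => (q x).2) deg ndG GF wz us _).
  rewrite -sum1_size; apply: leq_sum => x _; exact: degree_gt0 (hq x).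
by move=> x /hs[].
Qed.

(** The product of the distances to 1 of the [e]-th roots of [c] is [cn (c - 1)], so these distances
    cannot all be at least [eta] when this number is less than [eta ^+ e]. *)
Lemma root_near_one (e : nat) (eta : R) : (0 < e)%N -> 0 < eta ->
  exists2 th : R, 0 < th & forall c : C, cn (c - 1) < th -> exists2 b : C, b ^+ e = c & cn (b - 1) < eta.
Proof.
move=> e0 eta0; exists (eta ^+ e); first exact: exprn_gt0.
move=> c c1; apply: contrapT => no.
have [rs ers] := closed_field_poly_normal ('X^e - c%:P : {poly C}).
have lc : lead_coef ('X^e - c%:P : {poly C}) = 1 by apply/monicP; exact: monicXnsubC.
rewrite lc scale1r in ers.
have szrs : size rs = e by have := congr1 (fun p : {poly C} => size p) ers; rewrite size_XnsubC // size_prod_XsubC => -[].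
have hr b : b \in rs -> eta <= cn (b - 1).
  move=> brs; rewrite leNgt; apply/negP => b1; apply: no; exists b => //.
  have : root ('X^e - c%:P) b by rewrite ers root_prod_XsubC.
  by rewrite rootE !hornerE subr_eq0 => /eqP.
move: c1; apply/negP; rewrite -leNgt.
have := congr1 (fun p : {poly C} => cn p.[1]) ers.
rewrite /= !hornerE expr1n (cnB 1) => ->; rewrite horner_prod -szrs.
elim: (rs) hr => [|b rs' IH] hr; first by rewrite big_nil expr0 cn1.
rewrite big_cons cnM /= exprS hornerXsubC (cnB 1); apply: ler_pM.
- exact: ltW.
- by apply: ltW; exact: exprn_gt0.
- by apply: hr; rewrite mem_head.
- by apply: IH => b' b's; apply: hr; rewrite inE b's orbT.
Qed.

(** The powers of [c] sum to 0, so [e] is the modulus of the sum of the [c ^+ j - 1], and each of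
    these is at most [j] times [cn (c - 1)]. *)
Lemma root_of_unity_gap (e : nat) (c : C) : (0 < e)%N -> c ^+ e = 1 -> c != 1 -> 1 <= e%:R * cn (c - 1).
Proof.
move=> e0 ce c1.
have cc : cn c = 1.
  have : cn c ^+ e = 1 by rewrite -cnX ce cn1.
  by move=> /eqP; rewrite pexpr_eq1 ?cn_ge0 // => /eqP.
have cj j : cn (c ^+ j - 1) <= j%:R * cn (c - 1).
  elim: j => [|j IH]; first by rewrite expr0 subrr cn0 mul0r.
  have -> : c ^+ j.+1 - 1 = c * (c ^+ j - 1) + (c - 1) by rewrite exprS; ring.
  apply: le_trans (cnD _ _) _; rewrite cnM cc mul1r -natr1 mulrDl mul1r.
  by rewrite lerD2r.
have s0 : \sum_(j < e) c ^+ j = 0.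
  apply: (mulfI (x := c - 1)); first by rewrite subr_eq0.
  by rewrite mulr0 -subrX1 ce subrr.
have : cn (e%:R : C) <= \sum_(j < e) e%:R * cn (c - 1).
  have -> : (e%:R : C) = - \sum_(j < e) (c ^+ j - 1).
    by rewrite sumrB s0 sub0r opprK sumr_const card_ord.
  rewrite cnN; apply: le_trans (cn_sum _ _ _) _; apply: ler_sum => j _.
  by apply: le_trans (cj j) _; rewrite ler_wpM2r ?cn_ge0 // ler_nat ltnW.
rewrite sumr_const card_ord -[X in _ <= X]mulr_natl.
have -> : cn (e%:R : C) = e%:R.
  have -> : (e%:R : C) = (e%:R : R)%:C by rewrite rmorph_nat.
  by rewrite cn_real ger0_norm.
by rewrite -[X in X <= _]mulr1 ler_pM2l // ltr0n.
Qed.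
End DegreeSums.

(** * Topology of projective space *)

Section ProjectiveTopology.
Variables (R : realType) (k : nat).
Local Notation C := R[i].
Local Notation V := 'rV[C]_k.+1.
Local Notation Pk := (projective_space R k).

Definition pval (z : punctured R k) : V := val z.

Lemma punctured_neq0 (z : punctured R k) : pval z != 0.
Proof. by have := valP z; rewrite inE. Qed.

Definition mkpunctured (z : V) (z0 : z != 0) : punctured R k :=
  SigSub (mem_set (z0 : [set z : V | z != 0] z)).

Lemma pclass_eq (z w : punctured R k) :
  pclass z = pclass w <-> exists2 c : C, c != 0 & pval z = c *: pval w.
Proof.
have h : reflect (pclass z = pclass w) (colinear z w) by exact: eqmodP.
by split=> [/h/asboolP|/asboolP/h].
Qed.

Lemma pclass_surj (p : Pk) : exists z, pclass z = p.
Proof. by exists (repr p); exact: reprK. Qed.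

Lemma unit_representative (p : Pk) : exists2 z : punctured R k, vn (pval z) = 1 & pclass z = p.
Proof.
have [w <-] := pclass_surj p; have w0 := punctured_neq0 w.
have n0 : 0 < vn (pval w) by rewrite vn_gt0.
have c0 : ((vn (pval w))^-1)%:C != 0 :> C by rewrite fmorph_eq0 invr_eq0 gt_eqF.
have z0 : ((vn (pval w))^-1)%:C *: pval w != 0 by rewrite scaler_eq0 negb_or c0.
exists (mkpunctured z0); last by apply/pclass_eq; exists ((vn (pval w))^-1)%:C.
by rewrite /= vnZ cn_real ger0_norm ?invr_ge0 ?ltW // mulVf // gt_eqF.
Qed.

Lemma nbhs_puncturedP (z : punctured R k) (A : set (punctured R k)) :
  nbhs z A <-> exists2 e : R, 0 < e & forall w : punctured R k, vn (pval z - pval w) < e -> A w.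
Proof.
split=> [h|[e e0 eA]].
  case: h => B [] [] O oO OB zB BA.
  have /nbhs_vnP[e e0 he] : nbhs (pval z) O by apply: open_nbhs_nbhs; split=> //; move: zB; rewrite -OB.
  by exists e => // w /he Ow; apply: BA; rewrite -OB.
exists (set_val @^-1` (interior [set y : V | vn (pval z - y) < e])); split.
- by exists (interior [set y : V | vn (pval z - y) < e]) => //; exact: open_interior.
- by apply/nbhs_vnP; exists e.
- by move=> w /interior_subset; exact: eA.
Qed.

(** The projection is an open map: the vectors colinear to some vector of a ball form an open set,
    since multiplication by a nonzero scalar only rescales distances. *)
Lemma nbhs_pclassP (z : punctured R k) (A : set Pk) :
  nbhs (pclass z) A <-> exists2 e : R, 0 < e & forall w : punctured R k, vn (pval z - pval w) < e -> A (pclass w).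
Proof.
split=> [zA|[e e0 eA]].
  have : nbhs z (@pclass R k @^-1` A) by exact: pi_continuous zA.
  by move=> /nbhs_puncturedP.
pose B : set Pk := [set p | exists2 w : punctured R k, vn (pval z - pval w) < e & pclass w = p].
apply: (@filterS _ (nbhs (pclass z)) _ B); first by move=> _ [w zw <-]; exact: eA.
apply: open_nbhs_nbhs; split; last by exists z => //; rewrite subrr vn0.
rewrite /open /= /quotient_open openE => w [w' zw' /pclass_eq[c c0 ww']].
have c1 : 0 < cn c by rewrite cn_gt0.
apply/nbhs_puncturedP; exists ((cn c)^-1 * (e - vn (pval z - pval w'))) => [|v wv].
  by rewrite mulr_gt0 ?subr_gt0 // invr_gt0.
have v0 : c *: pval v != 0 by rewrite scaler_eq0 negb_or c0 punctured_neq0.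
exists (mkpunctured v0); last by apply/pclass_eq; exists c.
have h1 : vn (pval w' - c *: pval v) < e - vn (pval z - pval w').
  by rewrite ww' -scalerBr vnZ mulrC -ltr_pdivlMr // mulrC -ww'.
have := vn_triangle (pval w') (pval z) (c *: pval v).
change (vn (pval z - c *: pval v) <= vn (pval z - pval w') + vn (pval w' - c *: pval v) -> vn (pval z - c *: pval v) < e).
by move: h1; norm_lra.
Qed.

(** A choice of unit representatives carries a filter on P^k to the compact unit sphere. *)
Lemma projective_compact : compact [set: Pk].
Proof.
move=> F PF FT.
have /choice[u hu] : forall p : Pk, exists x : V, vn x = 1 /\ exists2 z, pval z = x & pclass z = p.
  by move=> p; have [z z1 <-] := unit_representative p; exists (pval z); split=> //; exists z.
have [x [x1 clx]] : [set x : V | vn x = 1] `&` cluster (u @ F) !=set0.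
  have cS : compact [set x : V | vn x = 1].
    apply: (@subclosed_compact _ _ [set x : V | vn (x - 0) <= 1]) => [||x /= x1]; last by rewrite subr0 x1.
      apply: (@closed_comp _ _ (fun x : V => vn x) [set y : R | y = 1]); last exact: closed_eq.
      by move=> y _; exact: vn_continuous.
    exact: vn_ball_compact.
  apply: cS; apply: (@filterS _ F _ setT) => // p _; exact: (hu p).1.
have x0 : x != 0 by rewrite -vn_gt0 x1 ltr01.
exists (pclass (mkpunctured x0)); split=> // A B FA /nbhs_pclassP[e e0 eB].
have [|_ [[p Ap <-] /=]] := clx (u @` A) [set y | vn (x - y) < e] _ (proj2 (nbhs_vnP _ _) (ex_intro2 _ _ e e0 (fun y h => h))).
  by apply: (@filterS _ F _ A) => // p Ap; exists p.
have [_ [z <- zp]] := hu p => /eB zB; exists p; split=> //; by rewrite -zp.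
Qed.

(* The 2 x 2 minors of two representatives separate points. *)
Lemma projective_hausdorff : hausdorff_space Pk.
Proof.
move=> p q; have [z <-] := pclass_surj p; have [w <-] := pclass_surj q => cl.
have minors i j : pval z 0 i * pval w 0 j = pval z 0 j * pval w 0 i.
  apply/eqP; rewrite -subr_eq0 -cn_eq0; apply/negPn/negP => m0.
  set mu := cn _ in m0; have {}m0 : 0 < mu by rewrite lt_def m0 cn_ge0.
  (* Moving the representatives by less than [del] changes the minor by at most [del * M]. This is
     less than [mu], so the minor cannot become 0, as it would for colinear vectors. *)
  pose M := 2 * (vn (pval z) + vn (pval w) + 1).
  have M0 : 0 < M by have := vn_ge0 (pval z); have := vn_ge0 (pval w); rewrite /M; norm_lra.
  pose del := Num.min 1 (mu / (2 * M)).
  have del0 : 0 < del by rewrite lt_min ltr01 divr_gt0 // mulr_gt0.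
  have del1 : del <= 1 by rewrite ge_min lexx.
  have delM : del * M <= mu / 2.
    rewrite -ler_pdivlMr // -mulrA -invfM; by rewrite ge_min lexx orbT.
  pose nb (v : punctured R k) : set Pk := [set p | exists2 x : punctured R k, vn (pval v - pval x) < del & pclass x = p].
  have nbP v : nbhs (pclass v) (nb v) by apply/nbhs_pclassP; exists del => // x vx; exists x.
  have [_ [[x zx <-] [y wy /pclass_eq[c c0 yx]]]] := cl _ _ (nbP z) (nbP w).
  have e : pval z 0 i * pval w 0 j - pval z 0 j * pval w 0 i =
    pval z 0 i * (pval w - pval y) 0 j + (pval z - pval x) 0 i * pval y 0 j
    + (pval z 0 j * (pval y - pval w) 0 i + (pval x - pval z) 0 j * pval y 0 i).
    by rewrite yx !mxE; ring.
  have b (a : V) (b : V) i' j' : cn (a 0 i' * b 0 j') <= vn a * vn b.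
    by rewrite cnM; apply: ler_pM; rewrite ?cn_ge0 ?vn_coord.
  have yw : vn (pval y) <= vn (pval w) + 1.
    by have := vn_le_sub (pval y) (pval w); rewrite vnB; move: wy del1; norm_lra.
  have h1 (a : V) (c' : V) i' j' : vn c' <= del -> cn (a 0 i' * c' 0 j') <= del * vn a.
    by move=> hc; apply: le_trans (b _ _ _ _) _; rewrite mulrC ler_wpM2r ?vn_ge0.
  have h2 (a : V) (c' : V) i' j' : vn c' <= del -> vn a <= vn (pval w) + 1 -> cn (c' 0 i' * a 0 j') <= del * (vn (pval w) + 1).
    by move=> hc ha; apply: le_trans (b _ _ _ _) _; apply: ler_pM; rewrite ?vn_ge0.
  have : mu <= del * M.
    rewrite /mu e; apply: le_trans (cnD _ _) _.
    apply: (@le_trans _ _ (del * vn (pval z) + del * (vn (pval w) + 1) + (del * vn (pval z) + del * (vn (pval w) + 1)))).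
      apply: lerD; apply: le_trans (cnD _ _) _; apply: lerD; [apply: h1|apply: h2|apply: h1|apply: h2] => //; by rewrite ?(vnB (pval y)) ?(vnB (pval x)) ltW.
    by rewrite /M le_eqVlt; apply/orP; left; apply/eqP; ring.
  by move: delM m0; norm_lra.
have [i zi] : exists i, pval z 0 i != 0.
  apply: contrapT => no; have := punctured_neq0 z; apply/negP/negPn/eqP/rowP => i; rewrite mxE.
  by apply/eqP/negPn/negP => zi; apply: no; exists i.
have wi : pval w 0 i != 0.
  apply/eqP => w0; have := punctured_neq0 w; apply/negP/negPn/eqP/rowP => j; rewrite mxE.
  by apply: (mulfI zi); rewrite minors w0 !mulr0.
apply/pclass_eq; exists (pval z 0 i / pval w 0 i); first by rewrite mulf_neq0 ?invr_eq0.
by apply/rowP => j; rewrite mxE mulrAC minors mulfK.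
Qed.

End ProjectiveTopology.

(** * Multiplicities *)

Section Esum.
Variables (R : realType) (T : choiceType).
Local Open Scope ereal_scope.

Lemma esum_le_seq (S : set T) (a : T -> \bar R) (M : \bar R) :
  (forall s : seq T, uniq s -> {in s, forall x, S x} -> \sum_(x <- s) a x <= M) -> \esum_(x in S) a x <= M.
Proof.
move=> h; apply: ub_ereal_sup => _ [X [finX XS] <-].
rewrite fsbig_finite //=; apply: h => [|x]; first exact: finmap.fset_uniq.
by rewrite in_fset_set // inE => /XS.
Qed.

Lemma esum_ge_seq (S : set T) (a : T -> \bar R) (s : seq T) :
  uniq s -> {in s, forall x, S x} -> \sum_(x <- s) a x <= \esum_(x in S) a x.
Proof.
move=> us sS; apply: ereal_sup_ubound; exists [set` s]; last by rewrite -fsbig_seq.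
by split=> [|x /= xs]; [exact: finite_seq|exact: sS].
Qed.

Lemma sum_one_seq (s : seq T) : \sum_(x <- s) (1 : \bar R) = (size s)%:R%:E.
Proof. by elim: s => [|x s IH]; rewrite ?big_nil // big_cons IH /= -EFinD -natr1 addrC. Qed.

End Esum.

(** * Lifts of maps of projective space and their perturbations *)

Section Lifts.
Variables (R : realType) (k : nat).
Local Notation C := R[i].
Local Notation V := 'rV[C]_k.+1.
Local Notation Pk := (projective_space R k).
Local Notation poly := (mpoly k.+1 C).
Implicit Types (Q : 'I_k.+1 -> poly) (h : Pk -> Pk).

(** The notion [is_lift] for an arbitrary family of polynomials, so that it also covers the lifts of
    iterates. *)
Definition lifts Q h := forall z : punctured R k,
  exists2 w : punctured R k, pval w = pmap Q (pval z) & h (pclass z) = pclass w.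

Definition near_maps (rad del : R) Q Q' :=
  forall x : V, vn x <= rad -> vn (pmap Q' x - pmap Q x) <= del.

Lemma near_maps_refl rad del Q : 0 <= del -> near_maps rad del Q Q.
Proof. by move=> del0 x _; rewrite subrr vn0. Qed.

Lemma near_maps_le rad del del' Q Q' : del <= del' -> near_maps rad del Q Q' -> near_maps rad del' Q Q'.
Proof. by move=> dd nr x /nr h; exact: le_trans dd. Qed.

Lemma pmap_homog e Q : (forall j, Q j \is ishomog1 e mdeg) ->
  forall (c : C) (x : V), pmap Q (c *: x) = c ^+ e *: pmap Q x.
Proof.
move=> hQ c x; apply/rowP => j; rewrite !mxE -(meval_dhomog _ _ (hQ j)).
by apply: meval_eq => i; rewrite mxE.
Qed.

Lemma lifts_nondegenerate e Q h : (0 < e)%N -> (forall j, Q j \is ishomog1 e mdeg) -> lifts Q h -> nondegenerate e Q.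
Proof.
move=> e0 hQ Qh; split=> // z Qz; apply/eqP/negPn/negP => z0.
have [w wQ _] := Qh (mkpunctured z0); have := punctured_neq0 w.
by rewrite wQ Qz eqxx.
Qed.

(** Closeness of lifts on the ball of radius 2 suffices, here and below: points have unit
    representatives, of which neighbourhoods of radius at most 1 are considered. *)
Lemma near_image Q h (z : punctured R k) (O : set Pk) : lifts Q h -> vn (pval z) = 1 -> nbhs (h (pclass z)) O ->
  exists2 W, nbhs (pclass z) W & exists2 del : R, 0 < del & forall Q' h', lifts Q' h' -> near_maps 2 del Q Q' ->
   forall x, W x -> O (h' x).
Proof.
move=> Qh z1; have [w wz ->] := Qh z => /nbhs_pclassP[e e0 eO].
have /nbhs_vnP[d d0 hd] : nbhs (pval z) [set y | vn (pmap Q (pval z) - pmap Q y) < e / 2].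
  apply: (@pmap_continuous R _ Q (pval z) [set c | vn (pmap Q (pval z) - c) < e / 2]).
  by apply/nbhs_vnP; exists (e / 2) => //; rewrite divr_gt0.
pose rho : R := Num.min d 1; have rho0 : 0 < rho by rewrite lt_min d0 ltr01.
exists [set p | exists2 x : punctured R k, vn (pval z - pval x) < rho & pclass x = p].
  by apply/nbhs_pclassP; exists rho => // x zx; exists x.
exists (e / 3); first by rewrite divr_gt0.
move=> Q' h' Qh' nr _ [x zx <-]; have [w' wx' ->] := Qh' x; apply: eO.
rewrite wz wx'; have xd : vn (pval z - pval x) < d by apply: lt_le_trans zx _; rewrite ge_min lexx.
have x1 : vn (pval z - pval x) < 1 by apply: lt_le_trans zx _; rewrite ge_min lexx orbT.
have x2 : vn (pval x) <= 2 by have := vn_le_sub (pval x) (pval z); rewrite vnB z1; move: x1; norm_lra.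
have h1 : vn (pmap Q (pval z) - pmap Q (pval x)) < e / 2 := hd _ xd.
have h2 := nr _ x2; rewrite (vnB (pmap Q' _)) in h2; move: h1 h2 e0.
by have := vn_triangle (pmap Q (pval x)) (pmap Q (pval z)) (pmap Q' (pval x)); norm_lra.
Qed.

Lemma lifts_continuous Q h : lifts Q h -> continuous h.
Proof.
move=> Qh p O; have [z z1 <-] := unit_representative p => hO.
have [W zW [del del0 hW]] := near_image Qh z1 hO.
by apply: (@filterS _ _ _ _ _ _ zW) => x Wx; apply: (hW Q h) => //; apply: near_maps_refl; exact: ltW.
Qed.

Lemma near_compact_image Q h (K O : set Pk) : lifts Q h -> compact K -> open O -> (forall x, K x -> O (h x)) ->
  exists2 del : R, 0 < del & forall Q' h', lifts Q' h' -> near_maps 2 del Q Q' ->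
    forall x, K x -> O (h' x).
Proof.
move=> Qh cK oO KO.
apply: (@compact_ind _ _ (fun B => exists2 del : R, 0 < del & forall Q' h', lifts Q' h' -> near_maps 2 del Q Q' -> forall x, B x -> O (h' x)) cK).
- by exists 1.
- move=> B B' [d d0 hd] [d' d0' hd']; exists (Num.min d d'); first by rewrite lt_min d0.
  move=> Q' h' Qh' nr x [Bx|Bx].
    by apply: (hd Q' h') => //; apply: near_maps_le nr; rewrite ge_min lexx.
  by apply: (hd' Q' h') => //; apply: near_maps_le nr; rewrite ge_min lexx orbT.
- by move=> B B' BB [d d0 hd]; exists d => // Q' h' Qh' nr x /BB Bx; apply: (hd Q' h').
move=> p Kp; have [z z1 zp] := unit_representative p.
have hO : nbhs (h (pclass z)) O by apply: open_nbhs_nbhs; split=> //; rewrite zp; exact: KO.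
have [W zW [del del0 hW]] := near_image Qh z1 hO.
exists W; first by rewrite -zp.
by exists del => // Q' h' Qh' nr x Wx; apply: (hW Q' h').
Qed.

(* By homogeneity the lifts can be rescaled by an [e]-th root near 1, hence
   the common [w]. *)
Lemma lift_solutions e Q h (z : punctured R k) (r eps : R) : nondegenerate e Q -> lifts Q h ->
  0 < r -> 0 < eps ->
  exists W O del, [/\ nbhs (pclass z) W, nbhs (h (pclass z)) O, 0 < del &
   forall Q' h' p, nondegenerate e Q' -> lifts Q' h' -> near_maps (vn (pval z) + 1) del Q Q' -> O p ->
   exists2 w : V, vn (w - pmap Q (pval z)) < eps & forall q, W q -> h' q = p ->
     exists2 x : punctured R k, pclass x = q & vn (pval x - pval z) < r /\ pmap Q' (pval x) = w].
Proof.
move=> ndQ Qh r0 eps0; have e0 := nondeg_gt0 ndQ.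
have y0 : 0 < vn (pmap Q (pval z)).
  rewrite vn_gt0; apply/eqP => /(nondeg_zero ndQ)/eqP; exact/negP/punctured_neq0.
set y := pmap Q (pval z) in y0 *; set mu := vn y in y0.
have rad0 : 0 < vn (pval z) + 1 by have := vn_ge0 (pval z); lra.
have [th th0 hth] := root_near_one e0 (divr_gt0 r0 (mulr_gt0 (ltr0n R 2) rad0)).
(* The first bound keeps the images away from 0; the second brings the factor between colinear
   images within [th] of 1. *)
pose tau : R := Num.min (mu / 8) (th * mu / 8).
have tau0 : 0 < tau by rewrite lt_min !divr_gt0 // mulr_gt0.
have tau1 : tau <= mu / 8 by rewrite ge_min lexx.
have tau2 : tau <= th * mu / 8 by rewrite ge_min lexx orbT.
have /nbhs_vnP[d d0 hd] : nbhs (pval z) [set x | vn (y - pmap Q x) < tau].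
  apply: (@pmap_continuous R _ Q (pval z) [set c | vn (y - c) < tau]).
  by apply/nbhs_vnP; exists tau.
pose rho : R := Num.min d (Num.min 1 (r / 2)).
have rho0 : 0 < rho by rewrite !lt_min d0 ltr01 divr_gt0.
exists [set p | exists2 x : punctured R k, vn (pval z - pval x) < rho & pclass x = p].
have [w0 w0z hz] := Qh z.
pose eta : R := Num.min tau eps; have eta0 : 0 < eta by rewrite lt_min tau0.
exists [set p | exists2 x : punctured R k, vn (y - pval x) < eta & pclass x = p], tau.
split=> //.
- by apply/nbhs_pclassP; exists rho => // x zx; exists x.
- by rewrite hz; apply/nbhs_pclassP; rewrite w0z; exists eta => // x zx; exists x.
move=> Q' h' _ ndQ' Qh' nr [y' yy' <-]; exists (pval y').
  by rewrite vnB; apply: lt_le_trans yy' _; rewrite ge_min lexx orbT.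
move=> _ [x zx <-]; have [v vx ->] := Qh' x => /esym/pclass_eq[c c0 yv].
move: zx; rewrite !lt_min => /and3P[zxd zx1 zxr].
have x2 : vn (pval x) <= vn (pval z) + 1 by have := vn_le_sub (pval x) (pval z); rewrite vnB; move: zx1; norm_lra.
have h1 := nr _ x2; have h2 : vn (y - pmap Q (pval x)) < tau := hd _ zxd.
have h3 : vn (y - pval y') < tau by apply: lt_le_trans yy' _; rewrite ge_min lexx.
have h4 : vn (y - pval v) < 2 * tau.
  rewrite vx; move: h1 h2; rewrite (vnB (pmap Q' _)).
  by have := vn_triangle (pmap Q (pval x)) y (pmap Q' (pval x)); norm_lra.
have h5 : 3 * mu / 4 <= vn (pval v) by have := vn_le_sub y (pval v); rewrite -/mu; move: h4 tau1; norm_lra.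
have h6 : cn (c - 1) * vn (pval v) < 3 * tau.
  have e1 : (c - 1) *: pval v = pval y' - pval v by rewrite scalerBl scale1r -yv.
  rewrite -vnZ e1.
  have h0 : vn (pval y' - pval v) <= vn (y - pval y') + vn (y - pval v).
    by rewrite (vnB y (pval y')); exact: vn_triangle.
  by move: h3 h4 h0; norm_lra.
have h7 : cn (c - 1) < th.
  rewrite ltNge; apply/negP => thc.
  have : th * (3 * mu / 4) <= cn (c - 1) * vn (pval v).
    by apply: ler_pM => //; [exact: ltW|rewrite divr_ge0 // mulr_ge0 // ltW].
  by have := mulr_gt0 th0 y0; move: h6 tau2; norm_lra.
have [b bc b1] := hth _ h7.
have b0 : b != 0 by apply: contra_neq c0 => b0; rewrite -bc b0 expr0n eqn0Ngt e0.
have bx0 : b *: pval x != 0 by rewrite scaler_eq0 negb_or b0 punctured_neq0.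
exists (mkpunctured bx0); first by apply/pclass_eq; exists b.
change (vn (b *: pval x - pval z) < r /\ pmap Q' (b *: pval x) = pval y').
rewrite (pmap_homog (nondeg_homog ndQ')) bc -vx yv; split=> //.
have -> : b *: pval x - pval z = (b - 1) *: pval x + (pval x - pval z) by rewrite scalerBl scale1r addrA subrK.
have h8 : cn (b - 1) * vn (pval x) <= r / 2.
  have -> : r / 2 = r / (2 * (vn (pval z) + 1)) * (vn (pval z) + 1).
    by rewrite invfM mulrA divfK // gt_eqF.
  by apply: ler_pM => //; [exact: cn_ge0|exact: vn_ge0|exact: ltW].
have h9 : vn ((b - 1) *: pval x + (pval x - pval z)) <= vn ((b - 1) *: pval x) + vn (pval z - pval x).
  by rewrite (vnB (pval z)); exact: vnD.
have h10 : vn ((b - 1) *: pval x) <= r / 2 by rewrite vnZ.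
by move: h10 h9 zxr; norm_lra.
Qed.

End Lifts.

Section Multiplicity.
Variables (R : realType) (k : nat).
Local Notation C := R[i].
Local Notation V := 'rV[C]_k.+1.
Local Notation Pk := (projective_space R k).
Local Notation poly := (mpoly k.+1 C).
Implicit Types (Q : 'I_k.+1 -> poly) (h : Pk -> Pk).

Section Local.
Variables (e : nat) (Q : 'I_k.+1 -> poly) (h : Pk -> Pk) (z : punctured R k) (r eps : R) (N : nat).
Hypotheses (ndQ : nondegenerate e Q) (Qh : lifts Q h).
Hypotheses (r1 : r <= 1) (deg : degree_at e Q (pval z) r eps N).

Lemma near_on_ball Q' : near_maps (vn (pval z) + 1) eps Q Q' ->
  forall x : V, vn (x - pval z) <= r -> vn (pmap Q' x - pmap Q x) <= eps.
Proof.
move=> nr x xz; apply: nr.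
have h1 : vn x <= vn (pval z) + vn (x - pval z) by exact: vn_le_sub.
by apply: le_trans h1 _; rewrite lerD2l; exact: le_trans xz r1.
Qed.

(** Distinct preimages have distinct representatives, and [lift_solutions] chooses these as
    solutions of one and the same system. *)
Lemma local_preimages_le : exists W O, [/\ nbhs (pclass z) W, nbhs (h (pclass z)) O &
  forall p (s : seq Pk), O p -> uniq s -> {in s, forall q, W q /\ h q = p} -> (size s <= N)%N].
Proof.
have [W [B [del [hW hB del0 hyp]]]] := lift_solutions z ndQ Qh (degree_r deg) (degree_eps deg).
exists W, B; split=> // p s Op us hs.
have nr : near_maps (vn (pval z) + 1) del Q Q by apply: near_maps_refl; exact: ltW.
have [w wz hw] := hyp Q h p ndQ Qh nr Op.
have /choice[x hx] : forall q : Pk, exists x : punctured R k, q \in s ->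
    pclass x = q /\ (vn (pval x - pval z) < r /\ pmap Q (pval x) = w).
  move=> q; have [/hs[Wq hq]|_] := boolP (q \in s); last by exists z.
  by have [x xq hx] := hw q Wq hq; exists x.
rewrite -(size_map (@pval R k \o x)).
apply: (solutions_bound (G := Q) (w := w) deg ndQ).
- by apply: near_on_ball; apply: near_maps_refl; exact: ltW (degree_eps deg).
- exact: wz.
- rewrite map_inj_in_uniq // => q q' qs q's /= /val_inj exx.
  by rewrite -(hx q qs).1 -(hx q' q's).1 exx.
by move=> _ /mapP[q qs ->]; exact: (hx q qs).2.
Qed.

(** Colinear solutions of [Q x = w] differ by an [e]-th root of unity. By [root_of_unity_gap],
    solutions that close to [z] are too near each other for a root other than 1, so the [N]
    solutions give [N] distinct points of P^k. *)
Lemma local_preimages_ge W O : nbhs (pclass z) W -> nbhs (h (pclass z)) O ->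
  exists p s, [/\ O p, uniq s, size s = N & {in s, forall q, W q /\ h q = p}].
Proof.
have [y yz ->] := Qh z => /nbhs_pclassP[eW eW0 hW] /nbhs_pclassP[eO eO0 hO].
have e0 := nondeg_gt0 ndQ.
have ylt : 0 < vn (pval y) by rewrite vn_gt0 punctured_neq0.
have e1 : 1 <= e%:R :> R by rewrite ler1n.
set nz := vn (pval z); have nz0 : 0 < nz by rewrite vn_gt0 punctured_neq0.
have m0 : (0 < (8 * e)%N%:R :> R) by rewrite ltr0n muln_gt0.
(* With [8 * e], two solutions are less than [nz / (4 e)] apart, whereas a root of unity other than
   1 would separate them by at least [7 nz / (8 e)]. *)
pose rho : R := Num.min eW (nz / (8 * e)%N%:R).
have rho0 : 0 < rho by rewrite lt_min eW0 divr_gt0.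
pose d : R := Num.min eO (vn (pval y)).
have d0 : 0 < d by rewrite lt_min eO0.
have [w [s [wz us ss hs]]] := degree_attained ndQ deg rho0 d0.
rewrite lt_min -yz in wz; have /andP[wz1 wz2] := wz.
have w0 : w != 0.
  by apply/eqP => w0; move: wz2; rewrite w0 sub0r vnN ltxx.
have rho2 : rho * e%:R <= nz / 8.
  rewrite -ler_pdivlMr ?ltr0n // -mulrA -invfM -natrM; by rewrite ge_min lexx orbT.
have rho3 : rho <= nz / 8.
  by apply: le_trans rho2; rewrite -[X in X <= _]mulr1 ler_pM2l.
have hx0 x : x \in s -> x != 0.
  move=> /hs[xz _]; apply/eqP => x0; move: xz; rewrite x0 sub0r vnN -/nz; move: rho3 nz0; lra.
pose c (x : V) : Pk := if pselect (x != 0) is left x0 then pclass (mkpunctured x0) else pclass z.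
have cE (x : V) (x0 : x != 0) : c x = pclass (mkpunctured x0).
  by rewrite /c; case: pselect => [x0'|//]; congr pclass; exact: val_inj.
exists (pclass (mkpunctured w0)), (map c s); split.
- by apply: hO; rewrite vnB.
- rewrite map_inj_in_uniq // => x1 x2 x1s x2s.
  rewrite (cE _ (hx0 _ x1s)) (cE _ (hx0 _ x2s)) => /pclass_eq[b b0 x12].
  have {}x12 : x1 = b *: x2 by exact: x12.
  have [h1 Q1] := hs _ x1s; have [h2 Q2] := hs _ x2s.
  have be : b ^+ e = 1.
    apply/eqP; rewrite -subr_eq0; apply/eqP.
    have : (b ^+ e - 1) *: w = 0.
      by rewrite scalerBl scale1r -{1}Q2 -(pmap_homog (nondeg_homog ndQ)) -x12 Q1 subrr.
    by move=> /eqP; rewrite scaler_eq0 (negPf w0) orbF => /eqP.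
  have [b1|b1] := eqVneq b 1; first by rewrite x12 b1 scale1r.
  have := root_of_unity_gap e0 be b1.
  have x1x2 : x1 - x2 = (b - 1) *: x2 by rewrite scalerBl scale1r -x12.
  have g1 : vn (x1 - x2) < 2 * rho.
    have := vn_triangle (pval z) x1 x2; rewrite (vnB (pval z)); move: h1 h2; norm_lra.
  have g2 : nz * 7 / 8 <= vn x2.
    by have := vn_le_sub (pval z) x2; rewrite -/nz vnB; move: h2 rho3; norm_lra.
  have g3 : cn (b - 1) * (nz * 7 / 8) <= vn (x1 - x2).
    by rewrite x1x2 vnZ ler_wpM2l ?cn_ge0.
  have g4 : e%:R * cn (b - 1) * (nz * 7 / 8) <= e%:R * (2 * rho).
    rewrite -mulrA ler_pM2l ?ltr0n //; exact: ltW (le_lt_trans g3 g1).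
  move=> g5; exfalso; move: g4 rho2 (nz0); rewrite (mulrCA e%:R 2) (mulrC rho).
  have : nz * 7 / 8 <= e%:R * cn (b - 1) * (nz * 7 / 8).
    by apply: ler_peMl => //; rewrite divr_ge0 // mulr_ge0 // ltW.
  by generalize (e%:R * cn (b - 1) * (nz * 7 / 8)) (e%:R * rho) => a1 a2; lra.
- by rewrite size_map.
move=> _ /mapP[x xs ->]; have [xz Qx] := hs _ xs.
rewrite (cE _ (hx0 _ xs)); split.
  apply: hW; rewrite vnB; apply: lt_le_trans xz _; by rewrite ge_min lexx.
have [w' w'Q ->] := Qh (mkpunctured (hx0 _ xs)); congr pclass; apply: val_inj.
by change (pval w' = w); rewrite -Qx -w'Q.
Qed.

Lemma multiplicity_degree : multiplicity h (pclass z) = (N%:R)%:E.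
Proof.
apply/eqP; rewrite eq_le; apply/andP; split.
  have [W [B [hW hB hyp]]] := local_preimages_le.
  apply: le_trans; first by apply: ereal_inf_lbound; exists W.
  apply: le_trans; first by apply: ereal_inf_lbound; exists B.
  apply: ub_ereal_sup => _ [p Op <-]; apply: esum_le_seq => s us hs.
  by rewrite sum_one_seq lee_fin ler_nat; apply: (hyp p) => // q /hs[].
apply: le_ereal_inf_tmp => _ [W hW <-]; apply: le_ereal_inf_tmp => _ [B hB <-].
have [p [s [Bp us ss hs]]] := local_preimages_ge hW hB.
apply: le_trans; last by apply: ereal_sup_ubound; exists p.
by rewrite -ss -sum_one_seq; apply: esum_ge_seq.
Qed.

End Local.

Lemma local_degree_unit e Q (z : punctured R k) : nondegenerate e Q ->
  exists r eps N, r <= 1 /\ degree_at e Q (pval z) r eps N.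
Proof. by move=> ndQ; exact: degree_exists ndQ ltr01. Qed.

Lemma multiplicity_nat e Q h q : nondegenerate e Q -> lifts Q h -> exists2 N,
  multiplicity h q = (N%:R)%:E &
  exists W O, [/\ nbhs q W, nbhs (h q) O &
   forall p (s : seq Pk), O p -> uniq s -> {in s, forall x, W x /\ h x = p} -> (size s <= N)%N].
Proof.
move=> ndQ Qh; have [z z1 <-] := unit_representative q.
have [r [eps [N [r1 deg]]]] := local_degree_unit z ndQ.
exists N; first exact: multiplicity_degree deg.
exact: local_preimages_le deg.
Qed.

Lemma multiplicity_ge0 e Q h q : nondegenerate e Q -> lifts Q h -> (0 <= multiplicity h q)%E.
Proof. by move=> ndQ Qh; have [N -> _] := multiplicity_nat q ndQ Qh; rewrite lee_fin ler0n. Qed.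

(** The preimages under the perturbed map lift to solutions of one system [Q' x = w] close to a
    representative of [q], and [degree_sum] applies to them. *)
Lemma multiplicity_semicontinuous e Q h q : nondegenerate e Q -> lifts Q h ->
  exists W O (del : R), [/\ nbhs q W, nbhs (h q) O, 0 < del &
   forall Q' h' p (s : seq Pk), nondegenerate e Q' -> lifts Q' h' -> near_maps 2 del Q Q' -> O p ->
     uniq s -> {in s, forall x, W x /\ h' x = p} ->
     (\sum_(x <- s) multiplicity h' x <= multiplicity h q)%E].
Proof.
move=> ndQ Qh; have [z z1 <-] := unit_representative q.
have [r [eps [N [r1 deg]]]] := local_degree_unit z ndQ.
rewrite (multiplicity_degree ndQ Qh r1 deg).
have [W [B [del [hW hB del0 hyp]]]] := lift_solutions z ndQ Qh (degree_r deg) (degree_eps deg).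
exists W, B, (Num.min del eps); split=> //; first by rewrite lt_min del0 (degree_eps deg).
move=> Q' h' p s ndQ' Qh' nr Bp us hs.
have nr1 : near_maps (vn (pval z) + 1) del Q Q' by rewrite z1; apply: near_maps_le nr; rewrite ge_min lexx.
have nr2 : near_maps (vn (pval z) + 1) eps Q Q' by rewrite z1; apply: near_maps_le nr; rewrite ge_min lexx orbT.
have [w wz hw] := hyp Q' h' p ndQ' Qh' nr1 Bp.
have /choice[x hx] : forall y : Pk, exists x : punctured R k, y \in s ->
    pclass x = y /\ (vn (pval x - pval z) < r /\ pmap Q' (pval x) = w).
  move=> y; have [/hs[Wq hq]|_] := boolP (y \in s); last by exists z.
  by have [x xq hx] := hw y Wq hq; exists x.
have /choice[t ht] : forall v : V, exists t : R * R * nat, t.1.1 <= 1 /\ degree_at e Q' v t.1.1 t.1.2 t.2.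
  by move=> v; have [r' [eps' [N' [? ?]]]] := degree_exists v ndQ' ltr01; exists (r', eps', N').
have mE y : y \in s -> multiplicity h' y = ((t (pval (x y))).2%:R)%:E.
  move=> ys; rewrite -{1}(hx y ys).1; have [t1 dt] := ht (pval (x y)).
  exact: multiplicity_degree dt.
rewrite (eq_big_seq _ mE) -(big_morph EFin EFinD erefl) lee_fin -natr_sum ler_nat.
rewrite -(big_map (@pval R k \o x) xpredT (fun v => (t v).2)).
apply: (degree_sum (G := Q') (w := w) (r' := fun v => (t v).1.1) (eps' := fun v => (t v).1.2) (N' := fun v => (t v).2) deg ndQ').
- exact: near_on_ball.
- exact: wz.
- rewrite map_inj_in_uniq // => y y' ys y's /= /val_inj exx.
  by rewrite -(hx y ys).1 -(hx y' y's).1 exx.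
by move=> _ /mapP[y ys ->]; have [_ [? ?]] := hx y ys; split=> //; exact: (ht _).2.
Qed.

End Multiplicity.

Section SeqTools.
Variables (T : choiceType).

Lemma bounded_finite (S : set T) (N : nat) :
  (forall s : seq T, uniq s -> {in s, forall x, S x} -> (size s <= N)%N) -> finite_set S.
Proof.
elim: N S => [|N IH] S hS.
  suff -> : S = set0 by exact: finite_set0.
  apply/seteqP; split=> // x Sx; suff : (size [:: x] <= 0)%N by []; by apply: hS => // y; rewrite inE => /eqP ->.
have [[x Sx]|S0] := pselect (S !=set0); last first.
  suff -> : S = set0 by exact: finite_set0.
  by apply/seteqP; split=> // x Sx; apply: S0; exists x.
have fS : finite_set (S `\ x).
  apply: IH => s us sS; have := hS (x :: s); rewrite /= us andbT ltnS; apply.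
    by apply/negP => /sS[_ /=]; exact.
  by move=> y; rewrite inE => /orP[/eqP -> //|/sS[]].
apply: (@sub_finite_set _ _ (x |` (S `\ x))); last by rewrite finite_setU.
by move=> y Sy; have [->|yx] := eqVneq y x; [left|right; split=> // e; rewrite e eqxx in yx].
Qed.

Lemma sum_fibres (A : Type) (idx : A) (op : Monoid.com_law idx) (T' : choiceType) (g : T -> T') (s : seq T)
    (t : seq T') (f : T -> A) : uniq t -> {in s, forall x, g x \in t} ->
  \big[op/idx]_(x <- s) f x = \big[op/idx]_(y <- t) \big[op/idx]_(x <- [seq x <- s | g x == y]) f x.
Proof.
move=> ut gt; under [RHS]eq_bigr => y _ do rewrite big_filter big_mkcond.
rewrite exchange_big /=; apply: eq_big_seq => x xs.
rewrite (bigD1_seq (g x)) ?gt //= eqxx big1 ?Monoid.mulm1 // => y.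
by rewrite eq_sym => /negPf ->.
Qed.

Lemma lee_sum_seq (R : realType) (s : seq T) (f g : T -> \bar R) : {in s, forall x, f x <= g x}%E ->
  (\sum_(x <- s) f x <= \sum_(x <- s) g x)%E.
Proof.
elim: s => [|x s IH] fg; first by rewrite !big_nil.
rewrite !big_cons leeD // ?fg ?mem_head //; apply: IH => y ys; by rewrite fg // inE ys orbT.
Qed.

End SeqTools.

(** * Semicontinuity and submultiplicativity of the number of preimages *)

Section PreimageCard.
Variables (R : realType) (k : nat).
Local Notation C := R[i].
Local Notation V := 'rV[C]_k.+1.
Local Notation Pk := (projective_space R k).
Local Notation poly := (mpoly k.+1 C).
Implicit Types (Q : 'I_k.+1 -> poly) (h : Pk -> Pk).

Definition stable (e : nat) Q (p0 : Pk) (H : (Pk -> Pk) -> Pk -> Prop) :=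
  exists B (del : R), [/\ nbhs p0 B, 0 < del & forall Q' h' p, nondegenerate e Q' -> lifts Q' h' ->
    near_maps 2 del Q Q' -> B p -> H h' p].

Lemma stable_and e Q p0 H H' : stable e Q p0 H -> stable e Q p0 H' -> stable e Q p0 (fun h p => H h p /\ H' h p).
Proof.
move=> [B [del [hB del0 hyp]]] [B' [del' [hB' del0' hyp']]].
exists (B `&` B'), (Num.min del del'); split=> [||Q' h' p nd Qh' nr [Bp B'p]].
- exact: filterI.
- by rewrite lt_min del0.
split; [apply: (hyp Q')|apply: (hyp' Q')] => //; apply: near_maps_le nr; rewrite ge_min lexx ?orbT //.
Qed.

Lemma stable_true e Q p0 : stable e Q p0 (fun _ _ => True).
Proof. by exists setT, 1; split=> //; exact: filterT. Qed.

Lemma stable_mono e Q p0 (H H' : (Pk -> Pk) -> Pk -> Prop) :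
  (forall Q' h p, nondegenerate e Q' -> lifts Q' h -> H h p -> H' h p) -> stable e Q p0 H -> stable e Q p0 H'.
Proof.
move=> HH [B [del [hB del0 hyp]]]; exists B, del; split=> // Q' h' p nd Qh' nr Bp.
by apply: (HH Q') => //; apply: (hyp Q').
Qed.

Lemma stable_seq e Q p0 (T : eqType) (t : seq T) (H : T -> (Pk -> Pk) -> Pk -> Prop) :
  (forall q, q \in t -> stable e Q p0 (H q)) -> stable e Q p0 (fun h p => forall q, q \in t -> H q h p).
Proof.
elim: t => [|q t IH] hyp; first by apply: stable_mono (stable_true e Q p0).
have h1 : stable e Q p0 (H q) by apply: hyp; rewrite mem_head.
have h2 : stable e Q p0 (fun h p => forall q, q \in t -> H q h p).
  by apply: IH => q' q't; apply: hyp; rewrite inE q't orbT.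
apply: stable_mono (stable_and h1 h2) => Q' h p _ _ [Hq Ht] q'; rewrite inE => /orP[/eqP -> //|]; exact: Ht.
Qed.

Lemma preimage_card_ge0 e Q h U p : nondegenerate e Q -> lifts Q h -> (0 <= preimage_card h U p)%E.
Proof. by move=> ndQ Qh; apply: esum_ge0 => q _; exact: multiplicity_ge0 ndQ Qh. Qed.

Lemma fibre_finite_compact e Q h K p0 : nondegenerate e Q -> lifts Q h -> compact K ->
  finite_set (K `&` h @^-1` [set p0]).
Proof.
move=> ndQ Qh cK.
apply: (@compact_ind _ _ (fun B => finite_set (B `&` h @^-1` [set p0])) cK).
- by rewrite set0I; exact: finite_set0.
- by move=> B B' fB fB'; rewrite setIUl finite_setU.
- by move=> B B' BB fB'; apply: sub_finite_set fB'; exact: setSI.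
move=> x Kx; have [hx|hx] := eqVneq (h x) p0.
  have [N _ [W [B [hW hB hyp]]]] := multiplicity_nat x ndQ Qh.
  exists W => //; apply: (@bounded_finite _ _ N) => s us hs.
  apply: (hyp p0) => //; rewrite -hx; exact: nbhs_singleton hB.
exists (h @^-1` [set p | p != p0]).
  have cx : h y @[y --> x] --> h x := lifts_continuous Qh (x := x).
  apply: cx; apply: open_nbhs_nbhs; split; last exact: hx.
  suff -> : [set p | p != p0] = ~` [set p0].
    apply: closed_openC; apply: accessible_closed_set1; apply: hausdorff_accessible; exact: projective_hausdorff.
  by apply/seteqP; split=> p /= pp0; apply/eqP.
suff -> : h @^-1` [set p | p != p0] `&` h @^-1` [set p0] = set0 by exact: finite_set0.
by apply/seteqP; split=> // y [/= /eqP].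
Qed.

(** [M] is the sum of the multiplicities of the finitely many points of [K] over [p0]. By
    compactness, preimages in [K] under nearby maps of nearby points lie close to these points,
    where [multiplicity_semicontinuous] bounds them. *)
Lemma preimage_card_semicontinuous e Q h (K U : set Pk) p0 : nondegenerate e Q -> lifts Q h -> compact K -> K `<=` U ->
  exists2 M : nat, ((M%:R)%:E <= preimage_card h U p0)%E &
    stable e Q p0 (fun h' p => (preimage_card h' K p <= (M%:R)%:E)%E).
Proof.
move=> ndQ Qh cK KU.
have /finite_seqP[t0 et0] := fibre_finite_compact p0 ndQ Qh cK.
pose t := undup t0; have ut : uniq t by exact: undup_uniq.
have tP x : x \in t <-> K x /\ h x = p0.
  by rewrite mem_undup; have := congr1 (fun S : set Pk => S x) et0; rewrite /= => <-.
have /choice[Nq hNq] : forall q : Pk, exists N : nat, multiplicity h q = (N%:R)%:E.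
  by move=> q; have [N -> _] := multiplicity_nat q ndQ Qh; exists N.
exists (\sum_(q <- t) Nq q)%N.
  rewrite natr_sum (big_morph EFin EFinD erefl) -(eq_bigr _ (fun q _ => hNq q)).
  by apply: esum_ge_seq => // q /tP[Kq hq]; split=> //; exact: KU.
have /choice[W hW] : forall q : Pk, exists W, q \in t -> nbhs q W /\ stable e Q p0 (fun h' p =>
    forall s : seq Pk, uniq s -> {in s, forall x, W x /\ h' x = p} ->
     (\sum_(x <- s) multiplicity h' x <= (Nq q)%:R%:E)%E).
  move=> q; have [/tP[Kq hq]|_] := boolP (q \in t); last by exists setT.
  have [W [B [del [hW hB del0 hyp]]]] := multiplicity_semicontinuous q ndQ Qh.
  exists W => _; split=> //; exists B, del; split=> //; first by rewrite -hq.
  by move=> Q' h' p nd' Qh' nr Bp s us hs; rewrite -hNq; apply: (hyp Q' h' p).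
have h1 := stable_seq (fun q qt => (hW q qt).2).
have h2 : stable e Q p0 (fun h' p => forall x, K x -> h' x = p -> exists2 q, q \in t & W q x).
  apply: (@compact_ind _ _ (fun B => stable e Q p0 (fun h' p => forall x, B x -> h' x = p -> exists2 q, q \in t & W q x)) cK).
  - by apply: stable_mono (stable_true e Q p0).
  - move=> B B' hB hB'; apply: stable_mono (stable_and hB hB') => Q' h' p _ _ [H1 H2] x [Bx|Bx]; [exact: H1|exact: H2].
  - by move=> B B' BB; apply: stable_mono => Q' h' p _ _ H1 x /BB; exact: H1.
  move=> x Kx; have [hx|hx] := eqVneq (h x) p0.
    have xt : x \in t by apply/tP.
    exists (W x); first by have [] := hW x xt.
    by apply: stable_mono (stable_true e Q p0) => Q' h' p _ _ _ y Wy _; exists x.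
  have : hausdorff_space Pk by exact: projective_hausdorff.
  rewrite open_hausdorff => hd; have [[A B] /= [xA pB] [oA oB /eqP AB]] := hd _ _ hx.
  have [z z1 zx] := unit_representative x.
  have nA : nbhs (h (pclass z)) A by apply: open_nbhs_nbhs; split=> //; rewrite zx; exact: set_mem xA.
  have [W' hW' [del del0 hyp]] := near_image Qh z1 nA.
  exists W'; first by rewrite -zx.
  exists B, del; split=> //; first by apply: open_nbhs_nbhs; split=> //; exact: set_mem pB.
  move=> Q' h' p nd' Qh' nr Bp y Wy hy; exfalso.
  suff : (A `&` B) p by rewrite AB.
  by split=> //; rewrite -hy; exact: (hyp Q' h').
apply: stable_mono (stable_and h1 h2) => Q' h' p nd' Qh' [H1 H2].
apply: esum_le_seq => s us hs.
have /choice[c hc] : forall x : Pk, exists q, x \in s -> q \in t /\ W q x.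
  move=> x; have [xs|_] := boolP (x \in s); last by exists x.
  by have [hx Kx] := hs x xs; have [q qt Wq] := H2 x Kx hx; exists q.
rewrite (sum_fibres _ (g := c) (t := t)) //; last by move=> x /hc[].
rewrite natr_sum (big_morph EFin EFinD erefl).
apply: lee_sum_seq => q qt; apply: H1 => //; first exact: filter_uniq.
move=> x; rewrite mem_filter => /andP[/eqP <- xs]; have [hx _] := hs x xs.
by have [_ Wx] := hc x xs.
Qed.

(** Near [x], a fibre of the composition projects by [h2] to at most [N1] points, each with at most
    [N2] preimages. *)
Lemma multiplicity_comp e1 Q1 h1 e2 Q2 h2 x : nondegenerate e1 Q1 -> lifts Q1 h1 ->
  nondegenerate e2 Q2 -> lifts Q2 h2 ->
  (multiplicity (h1 \o h2) x <= multiplicity h1 (h2 x) * multiplicity h2 x)%E.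
Proof.
move=> nd1 Qh1 nd2 Qh2.
have [N1 -> [W1 [B1 [hW1 hB1 hyp1]]]] := multiplicity_nat (h2 x) nd1 Qh1.
have [N2 -> [W2 [B2 [hW2 hB2 hyp2]]]] := multiplicity_nat x nd2 Qh2.
pose W := W2 `&` h2 @^-1` (W1 `&` B2).
have hW : nbhs x W by apply: filterI => //; apply: (lifts_continuous Qh2); exact: filterI.
apply: le_trans; first by apply: ereal_inf_lbound; exists W.
apply: le_trans; first by apply: ereal_inf_lbound; exists B1.
apply: ub_ereal_sup => _ [p Bp <-]; apply: esum_le_seq => s us hs.
rewrite sum_one_seq -EFinM lee_fin -natrM ler_nat -sum1_size.
rewrite (sum_fibres _ (g := h2) (t := undup (map h2 s))) ?undup_uniq //; last first.
  by move=> y ys; rewrite mem_undup map_f.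
have sz : (size (undup (map h2 s)) <= N1)%N.
  apply: (hyp1 p) => //; first exact: undup_uniq.
  by move=> y; rewrite mem_undup => /mapP[y' /hs[[_ [Wy' _]] hy'] ->].
apply: (@leq_trans (\sum_(y <- undup (map h2 s)) N2)%N); last by rewrite big_const_seq count_predT iter_addn_0 mulnC leq_mul2r sz orbT.
rewrite [leqLHS]big_seq [leqRHS]big_seq; apply: leq_sum => y; rewrite mem_undup => /mapP[y' y's ->].
rewrite sum1_size; apply: (hyp2 (h2 y')).
- by have [[_ []]] := hs y' y's.
- exact: filter_uniq.
by move=> w; rewrite mem_filter => /andP[/eqP -> /hs[[? _] _]].
Qed.

(** The bound for [h2] is asked only at points of [h2(U)], because the condition of small
    topological degree bears on points of the image. *)
Lemma preimage_card_comp e1 Q1 h1 e2 Q2 h2 U p (M1 M2 : R) : nondegenerate e1 Q1 -> lifts Q1 h1 ->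
  nondegenerate e2 Q2 -> lifts Q2 h2 -> (forall x, U x -> U (h2 x)) -> 0 <= M2 ->
  (preimage_card h1 U p <= M1%:E)%E ->
  (forall x, U x -> (h2 @` U) x -> h1 x = p -> (preimage_card h2 U x <= M2%:E)%E) ->
  (preimage_card (h1 \o h2) U p <= (M1 * M2)%:E)%E.
Proof.
move=> nd1 Qh1 nd2 Qh2 hU M20 b1 b2; apply: esum_le_seq => s us hs.
pose t := undup (map h2 s).
apply: (@le_trans _ _ (\sum_(x <- s) multiplicity h1 (h2 x) * multiplicity h2 x)%E).
  by apply: lee_sum_seq => x _; exact: (multiplicity_comp x nd1 Qh1 nd2 Qh2).
rewrite (sum_fibres _ (g := h2) (t := t)) ?undup_uniq //; last by move=> y ys; rewrite mem_undup map_f.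
apply: (@le_trans _ _ (\sum_(y <- t) multiplicity h1 y * M2%:E)%E).
  apply: lee_sum_seq => y; rewrite mem_undup => /mapP[x xs ->].
  have [/= hx Ux] := hs x xs.
  apply: (@le_trans _ _ (\sum_(i <- [seq i <- s | h2 i == h2 x]) multiplicity h1 (h2 x) * multiplicity h2 i)%E).
    apply: lee_sum_seq => i; by rewrite mem_filter => /andP[/eqP -> _].
  rewrite -ge0_sume_distrr; last by move=> i _; exact: multiplicity_ge0 nd2 Qh2.
  apply: lee_pmul => //; [exact: multiplicity_ge0 nd1 Qh1|by apply: sume_ge0 => i _; exact: multiplicity_ge0 nd2 Qh2|].
  apply: le_trans (b2 (h2 x) (hU _ Ux) _ hx); last by exists x.
  apply: esum_ge_seq; first exact: filter_uniq.
  by move=> i; rewrite mem_filter => /andP[/eqP hi /hs[_ Ui]].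
rewrite -ge0_sume_distrl; last by move=> i _; exact: multiplicity_ge0 nd1 Qh1.
rewrite EFinM; apply: lee_pmul => //; first by apply: sume_ge0 => i _; exact: multiplicity_ge0 nd1 Qh1.
apply: le_trans b1; apply: esum_ge_seq; first exact: undup_uniq.
by move=> y; rewrite mem_undup => /mapP[x /hs[hx Ux] ->]; split=> //; exact: hU.
Qed.

Lemma preimage_card_id U (p : Pk) : (preimage_card id U p <= 1)%E.
Proof.
have m1 x : (multiplicity (id : Pk -> Pk) x <= 1)%E.
  apply: le_trans; first by apply: ereal_inf_lbound; exists setT => //; exact: filterT.
  apply: le_trans; first by apply: ereal_inf_lbound; exists setT => //; exact: filterT.
  apply: ub_ereal_sup => _ [y _ <-]; apply: esum_le_seq => s us hs.
  rewrite sum_one_seq lee_fin -[leRHS]/1%:R ler_nat.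
  case: s us hs => [//|a [//|b s]] /= /andP[+ _] hs.
  have [_ /= ->] : setT a /\ a = y by apply: hs; rewrite mem_head.
  have [_ /= ->] : setT b /\ b = y by apply: hs; rewrite !inE eqxx orbT.
  by rewrite mem_head.
apply: esum_le_seq => s us hs.
case: s us hs => [|a [|b s]] /=; first by rewrite big_nil.
  by rewrite big_seq1.
move=> /andP[+ _] hs.
have [/= -> _] : a = p /\ U a by apply: hs; rewrite mem_head.
have [/= -> _] : b = p /\ U b by apply: hs; rewrite !inE eqxx orbT.
by rewrite mem_head.
Qed.

End PreimageCard.

(** * Lifts of iterates and their dependence on the coefficients *)

Section Iterates.
Variables (R : realType) (k : nat).
Local Notation C := R[i].
Local Notation V := 'rV[C]_k.+1.
Local Notation Pk := (projective_space R k).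
Local Notation poly := (mpoly k.+1 C).
Implicit Types (Q : 'I_k.+1 -> poly) (h : Pk -> Pk).

Fixpoint iter_poly Q (n : nat) : 'I_k.+1 -> poly :=
  if n is n'.+1 then fun j => comp_mpoly [tuple iter_poly Q n' i | i < k.+1] (Q j)
  else fun j => mpolyX C (mnm1 j).

Lemma pmap_iter Q n (x : V) : pmap (iter_poly Q n) x = iter n (pmap Q) x.
Proof.
elim: n => [|n IH]; first by apply/rowP => j; rewrite mxE mevalXU.
rewrite iterS -IH; apply/rowP => j; rewrite !mxE comp_mpoly_meval.
by apply: meval_eq => i; rewrite tnth_mktuple mxE.
Qed.

Lemma pmap_iterS Q n (x : V) : pmap (iter_poly Q n.+1) x = pmap Q (pmap (iter_poly Q n) x).
Proof. by rewrite !pmap_iter. Qed.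

Lemma comp_homog (d e : nat) Q (p : poly) : (forall j, Q j \is ishomog1 e mdeg) -> p \is ishomog1 d mdeg ->
  comp_mpoly [tuple Q i | i < k.+1] p \is ishomog1 (d * e)%N mdeg.
Proof.
move=> hQ /dhomogP hp; rewrite comp_mpolyE big_seq; apply: rpred_sum => m mp; apply: dhomogZ.
have -> : (d * e = \sum_(i < k.+1) m i * e)%N by have <- : mdeg m = d := hp m mp; rewrite -big_distrl /= mdegE.
elim/big_ind2: _ => [|a n b m' ha hb|i _]; first exact: dhomog1.
  exact: dhomogM.
by rewrite tnth_mktuple mulnC; exact: dhomogMn.
Qed.

Lemma iter_poly_homog d Q n : (forall j, Q j \is ishomog1 d mdeg) ->
  forall j, iter_poly Q n j \is ishomog1 (d ^ n)%N mdeg.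
Proof.
move=> hQ; elim: n => [|n IH] j /=; first by rewrite dhomogX; exact/eqP/mdeg1.
by rewrite expnS; exact: comp_homog.
Qed.

Lemma lifts_iter Q h n : lifts Q h -> lifts (iter_poly Q n) (iter n h).
Proof.
move=> Qh; elim: n => [|n IH] z.
  by exists z => //; rewrite pmap_iter.
have [w wz hw] := IH z; have [w' w'w hw'] := Qh w.
exists w'; last by rewrite iterS hw.
change (pval w' = pmap (iter_poly Q n.+1) (pval z)); rewrite pmap_iterS.
apply: etrans w'w _; congr pmap; exact: wz.
Qed.

Lemma lifts_iter_nondegenerate d Q h n : (0 < d)%N -> (forall j, Q j \is ishomog1 d mdeg) -> lifts Q h ->
  nondegenerate (d ^ n) (iter_poly Q n).
Proof.
move=> d0 hQ Qh; apply: (@lifts_nondegenerate _ _ _ _ (iter n h)); first by rewrite expn_gt0 d0.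
  exact: iter_poly_homog.
exact: lifts_iter.
Qed.

Definition coef_near (e : R) Q Q' := forall j m, cn (mcoeff m (Q' j) - mcoeff m (Q j)) < e.

Lemma coef_near_maps d Q (rad del : R) : 0 <= rad -> 0 < del -> (forall j, Q j \is ishomog1 d mdeg) ->
  exists2 e : R, 0 < e & forall Q', (forall j, Q' j \is ishomog1 d mdeg) -> coef_near e Q Q' -> near_maps rad del Q Q'.
Proof.
move=> rad0 del0 hQ.
(* The number of monomials of degree at most [d], times a bound for them on the ball; the final 1
   makes [c] positive. *)
pose c : R := #|{: bmultinom k.+1 d.+1}|%:R * (1 + rad) ^+ d + 1.
have rad1 : 1 <= 1 + rad by rewrite lerDl.
have c0 : 0 < c by rewrite ltr_wpDl ?ltr01 // mulr_ge0 // exprn_ge0 //; lra.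
exists (del / c); first by rewrite divr_gt0.
move=> Q' hQ' nr x xr; apply/vn_leP => [|i j]; first exact: ltW.
rewrite !mxE -mevalB.
have sz : (mmeasure mdeg (Q' j - Q j) <= d.+1)%N.
  have hN : - Q j \is ishomog1 d mdeg by rewrite dhomogN; exact: hQ.
  have /dhomogP h := dhomogD (hQ' j) hN.
  by rewrite mmeasureE; apply/bigmax_leqP_seq => m mp _; rewrite (h m mp).
rewrite (mpolywE sz) raddf_sum /=; apply: le_trans (cn_sum _ _ _) _.
apply: (@le_trans _ _ (\sum_(m : bmultinom k.+1 d.+1) del / c * (1 + rad) ^+ d)).
  apply: ler_sum => m _; rewrite mevalZ cnM; apply: ler_pM; rewrite ?cn_ge0 //.
    by rewrite mcoeffB; exact: ltW.
  rewrite mevalX; apply: (@le_trans _ _ ((1 + rad) ^+ mdeg m)); last first.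
    by rewrite ler_weXn2l // -ltnS; exact: bmdeg.
  rewrite mdegE -prodrXr; elim/big_ind2: _ => [|a a' b b' ha hb|l _]; first by rewrite cn1.
    by rewrite cnM; apply: ler_pM; rewrite ?cn_ge0.
  rewrite cnX; apply: lerXn2r; rewrite ?nnegrE ?cn_ge0 //; first lra.
  by apply: le_trans (vn_coord x 0 l) _; lra.
rewrite sumr_const -[X in X <= _]mulr_natl mulrCA [X in _ * X]mulrC -mulrA [X in del * X]mulrC mulrA.
rewrite -[leRHS]mulr1 -mulrA ler_pM2l // ler_pdivrMr // mul1r /c; lra.
Qed.

Lemma pmap_bounded Q (rad : R) : exists2 M : R, 0 <= M & forall x : V, vn x <= rad -> vn (pmap Q x) <= M.
Proof.
have := @compact_ind _ _ (fun S => exists2 M : R, 0 <= M & forall x : V, S x -> vn (pmap Q x) <= M)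
  (@vn_ball_compact R k.+1 0 rad).
case=> [|B B' [M M0 h] [M' M0' h']|B B' BB [M M0 h]|x _|M M0 hM].
- by exists 0.
- exists (M + M'); first by rewrite addr_ge0.
  by move=> x [/h Bx|/h' Bx]; apply: le_trans Bx _; rewrite ?lerDl ?lerDr.
- by exists M => // x /BB; exact: h.
- have /nbhs_vnP[d d0 hd] : nbhs x [set y | vn (pmap Q x - pmap Q y) < 1].
    apply: (@pmap_continuous R _ Q x [set c | vn (pmap Q x - c) < 1]).
    by apply/nbhs_vnP; exists 1.
  exists [set y | vn (x - y) < d]; first by apply/nbhs_vnP; exists d.
  exists (vn (pmap Q x) + 1); first by rewrite addr_ge0 ?vn_ge0.
  move=> y /hd h1; have h2 : vn (pmap Q x - pmap Q y) < 1 by exact: h1.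
  have h3 : vn (pmap Q y) <= vn (pmap Q x) + vn (pmap Q x - pmap Q y) by rewrite (vnB (pmap Q x)); exact: vn_le_sub.
  by move: h2 h3; norm_lra.
by exists M => // x xr; apply: hM; change (vn (x - 0) <= rad); rewrite subr0.
Qed.

Lemma pmap_uniformly_continuous Q (rad del : R) : 0 < del -> exists2 e : R, 0 < e &
  forall x y : V, vn x <= rad -> vn (x - y) <= e -> vn (pmap Q x - pmap Q y) <= del.
Proof.
move=> del0; have := @compact_ind _ _ (fun S => exists2 e : R, 0 < e &
  forall x y : V, S x -> vn (x - y) <= e -> vn (pmap Q x - pmap Q y) <= del) (@vn_ball_compact R k.+1 0 rad).
case=> [|B B' [e e0 h] [e' e0' h']|B B' BB [e e0 h]|x _|e e0 he].
- by exists 1.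
- exists (Num.min e e'); first by rewrite lt_min e0.
  by move=> x y [Bx|Bx]; rewrite le_min => /andP[xy xy']; [exact: h|exact: h'].
- by exists e => // x y /BB; exact: h.
- have /nbhs_vnP[d d0 hd] : nbhs x [set y | vn (pmap Q x - pmap Q y) < del / 2].
    apply: (@pmap_continuous R _ Q x [set c | vn (pmap Q x - c) < del / 2]).
    by apply/nbhs_vnP; exists (del / 2) => //; rewrite divr_gt0.
  exists [set y | vn (x - y) < d / 2]; first by apply/nbhs_vnP; exists (d / 2) => //; rewrite divr_gt0.
  exists (d / 3); first by rewrite divr_gt0.
  move=> y y' xy yy'; have {}xy : vn (x - y) < d / 2 by exact: xy.
  have h1 : vn (pmap Q x - pmap Q y) < del / 2 by apply: hd; apply: lt_trans xy _; lra.
  have h2 : vn (pmap Q x - pmap Q y') < del / 2.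
    apply: hd; apply: le_lt_trans (vn_triangle y x y') _.
    by apply: le_lt_trans (lerD (ltW xy) yy') _; lra.
  have h3 : vn (pmap Q y - pmap Q y') <= vn (pmap Q x - pmap Q y) + vn (pmap Q x - pmap Q y').
    by rewrite (vnB (pmap Q x) (pmap Q y)); exact: vn_triangle.
  by move: h1 h2 h3; norm_lra.
have he' (x y : V) : vn (x - 0) <= rad -> vn (x - y) <= e -> vn (pmap Q x - pmap Q y) <= del := he x y.
exists e; first exact: e0.
move=> x y xr xy; have xr' : vn (x - 0) <= rad by rewrite subr0.
exact: (he' x y xr' xy).
Qed.

(** The [n]-th iterate is bounded on the ball, and [Q] is uniformly continuous on bounded sets. The
    minimum with 1 keeps the perturbed iterate in the ball of radius [M + 1]. *)
Lemma coef_near_iter d Q n (rad del : R) : 0 <= rad -> 0 < del -> (forall j, Q j \is ishomog1 d mdeg) ->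
  exists2 e : R, 0 < e & forall Q', (forall j, Q' j \is ishomog1 d mdeg) -> coef_near e Q Q' ->
    near_maps rad del (iter_poly Q n) (iter_poly Q' n).
Proof.
move=> rad0 + hQ; elim: n del => [|n IH] del del0.
  by exists 1 => // Q' _ _ x _; rewrite subrr vn0 ltW.
have [M M0 hM] := pmap_bounded (iter_poly Q n) rad.
have [e1 e10 he1] := pmap_uniformly_continuous Q M (divr_gt0 del0 (ltr0n R 2)).
have e1' : 0 < Num.min e1 1 by rewrite lt_min e10 ltr01.
have [e2 e20 he2] := IH _ e1'.
have M1 : 0 <= M + 1 by lra.
have [e3 e30 he3] := coef_near_maps M1 (divr_gt0 del0 (ltr0n R 2)) hQ.
exists (Num.min e2 e3); first by rewrite lt_min e20.
move=> Q' hQ' nr x xr.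
have nr2 : coef_near e2 Q Q' by move=> j m; apply: lt_le_trans (nr j m) _; rewrite ge_min lexx.
have nr3 : coef_near e3 Q Q' by move=> j m; apply: lt_le_trans (nr j m) _; rewrite ge_min lexx orbT.
have h0 := hM _ xr.
have h1 := he2 _ hQ' nr2 _ xr; rewrite le_min in h1; case/andP: h1 => h1 h1'.
have h2 := he3 _ hQ' nr3.
have -> : pmap (iter_poly Q' n.+1) x - pmap (iter_poly Q n.+1) x =
    pmap Q' (pmap (iter_poly Q' n) x) - pmap Q (pmap (iter_poly Q n) x).
  by congr (_ - _); exact: pmap_iterS.
move: h0 h1 h1'.
move: (pmap (iter_poly Q n) x) (pmap (iter_poly Q' n) x) => a b h0 h1 h1'.
have b1 : vn b <= M + 1.
  have h3 : vn b <= vn a + vn (b - a) by exact: vn_le_sub.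
  by move: h0 h1' h3; norm_lra.
have h4 : vn (pmap Q a - pmap Q b) <= del / 2 by apply: he1 => //; rewrite vnB.
have h5 := h2 _ b1.
have h6 : vn (pmap Q' b - pmap Q a) <= vn (pmap Q' b - pmap Q b) + vn (pmap Q a - pmap Q b).
  by rewrite (vnB (pmap Q a)); exact: vn_triangle.
by move: h4 h5 h6; norm_lra.
Qed.

End Iterates.

(** * Stability of the topological degree *)

Section Growth.
Variable R : realType.

(** Bernoulli's inequality for the powers of [mu / lam]. *)
Lemma geometric_dominates (B lam mu : R) : 0 < lam -> lam < mu ->
  exists n0 : nat, forall n, (n0 <= n)%N -> B * lam ^+ n <= mu ^+ n.
Proof.
move=> lam0 lm; pose q := mu / lam - 1.
have q0 : 0 < q by rewrite subr_gt0 ltr_pdivlMr // mul1r.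
have bern n : n%:R * q <= (mu / lam) ^+ n.
  have qE : mu / lam = 1 + q by rewrite /q; ring.
  rewrite qE; elim: n => [|n IH]; first by rewrite mul0r expr0 ler01.
  have h1 : 1 <= (1 + q) ^+ n by rewrite exprn_ege1 // lerDl ltW.
  rewrite exprS -natr1; move: IH h1; generalize ((1 + q) ^+ n) => a; nra.
pose n0 := Num.bound (B / q).
have [B0|B0] := leP B 0.
  exists 0%N => n _; apply: (@le_trans _ _ 0); last by apply: exprn_ge0; lra.
  by apply: mulr_le0_ge0 => //; apply: exprn_ge0; exact: ltW.
exists n0 => n nn.
have h : B <= n%:R * q.
  rewrite -ler_pdivrMr //; apply: le_trans (ltW (archi_boundP _)) _.
    by rewrite divr_ge0 // ltW.
  by rewrite ler_nat.
by have := le_trans h (bern n); rewrite expr_div_n ler_pdivlMr // exprn_gt0.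
Qed.

(** A constant factor disappears in the limit of [n]-th roots: compare with a ratio [mu] strictly
    between [lam] and [D]. *)
Lemma limn_esup_lt (a : (\bar R)^nat) (B lam D : R) : 0 < lam -> lam < D -> (forall n, 0 <= a n)%E ->
  (forall n, a n <= (B * lam ^+ n)%:E)%E -> (limn_esup (fun n => a n `^ n%:R^-1) < D%:E)%E.
Proof.
move=> lam0 lamD a0 ha; pose mu := (lam + D) / 2.
have lm : lam < mu by rewrite /mu; lra.
have mD : mu < D by rewrite /mu; lra.
have [n0 hn0] := geometric_dominates B lam0 lm.
apply: (@le_lt_trans _ _ mu%:E); last by rewrite lte_fin.
apply: le_trans; first by apply: ereal_inf_lbound; exists [set n | (n0.+1 <= n)%N] => //; exists n0.+1.
apply: ub_ereal_sup => _ [n /= nn <-].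
have n1 : (0 < n)%N by apply: leq_ltn_trans nn.
have mu0 : 0 <= mu by lra.
have h : (a n <= (mu ^+ n)%:E)%E.
  by apply: le_trans (ha n) _; rewrite lee_fin; apply: hn0; exact: ltnW.
have -> : mu%:E = ((mu ^+ n)%:E `^ n%:R^-1)%E.
  rewrite poweR_EFin -powR_mulrn // -powRrM mulfV ?powRr1 // pnatr_eq0 -lt0n //.
apply: gt0_ler_poweR => //.
- by rewrite in_itv /= a0 leey.
- by rewrite in_itv /= lee_fin exprn_ge0 // leey.
Qed.

(** A single index is extracted, because submultiplicativity recovers the growth rate from one
    iterate; it is taken positive for the [n]-th root to be meaningful. *)
Lemma limn_esup_lt_inv (a : (\bar R)^nat) (D : R) : (forall n, 0 <= a n)%E ->
  (limn_esup (fun n => a n `^ n%:R^-1) < D%:E)%E ->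
  exists (lam : R) (n : nat), [/\ 0 < lam, lam < D, (0 < n)%N & (a n <= (lam ^+ n)%:E)%E].
Proof.
move=> a0 /ereal_inf_lt[_ [A [N _ hN] <-] hA].
pose n := N.+1; have n0 : (0 < n)%N by [].
have An : A n by apply: hN; exact: leqnSn.
have h : (a n `^ n%:R^-1 < D%:E)%E by apply: le_lt_trans hA; apply: ereal_sup_ubound; exists n.
have nr0 : n%:R^-1 != 0 :> R by rewrite invr_eq0 pnatr_eq0.
have [x ax] : exists x, a n = x%:E.
  case: (a n) (a0 n) h => [x _ _|_|//]; first by exists x.
  by rewrite poweRyr.
have x0 : 0 <= x by rewrite -lee_fin -ax.
move: h; rewrite ax poweR_EFin lte_fin => h.
set b := x `^ n%:R^-1 in h; have b0 : 0 <= b by exact: powR_ge0.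
exists ((b + D) / 2), n; split=> //; [lra|lra|].
have xb : x = b ^+ n by rewrite -powR_mulrn // -powRrM mulVf ?powRr1 // pnatr_eq0.
rewrite ax lee_fin xb; apply: lerXn2r; rewrite ?nnegrE; lra.
Qed.

End Growth.

Section SmallDegree.
Variables (R : realType) (k : nat).
Local Notation C := R[i].
Local Notation Pk := (projective_space R k).
Local Notation poly := (mpoly k.+1 C).
Implicit Types (Q : 'I_k.+1 -> poly) (h : Pk -> Pk).

Lemma le_preimage_card e Q h (U K : set Pk) p : nondegenerate e Q -> lifts Q h -> U `<=` K ->
  (preimage_card h U p <= preimage_card h K p)%E.
Proof.
move=> nd Qh UK; apply: esum_le_seq => s us hs; apply: esum_ge_seq => // x xs.
by have [? Ux] := hs x xs; split=> //; exact: UK.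
Qed.

Variable d : nat.
Hypothesis d0 : (0 < d)%N.

(* Splitting an orbit of length [n] into blocks, each of which has few preimages. *)
Lemma preimage_card_growth Q g (U : set Pk) (lam B : R) : (forall j, Q j \is ishomog1 d mdeg) -> lifts Q g ->
  (forall x, U x -> U (g x)) -> 0 < lam -> 1 <= B ->
  (forall p, (g @` U) p -> exists2 n, (0 < n)%N & (preimage_card (iter n g) U p <= (lam ^+ n)%:E)%E /\
     forall j, (j < n)%N -> (preimage_card (iter j g) U p <= (B * lam ^+ j)%:E)%E) ->
  forall n p, (g @` U) p -> (preimage_card (iter n g) U p <= (B * lam ^+ n)%:E)%E.
Proof.
move=> hQ Qg gU lam0 B1 hyp n; elim/ltn_ind: n => n IH p gUp.
have [m m0 [hm hj]] := hyp p gUp.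
have [nm|mn] := ltnP n m; first exact: hj.
have iU j x : U x -> U (iter j g x) by elim: j => [//|j IHj] Ux; rewrite iterS; apply: gU; exact: IHj.
(* The last [m] steps of an orbit, those that end at [p], form the block with few preimages; the
   induction hypothesis bears on the [n - m] steps before. *)
have -> : iter n g = iter m g \o iter (n - m) g.
  by apply/funext => x; rewrite /= -iterD subnKC.
have nd j := lifts_iter_nondegenerate j d0 hQ Qg.
have Bl : 0 <= B * lam ^+ (n - m) by rewrite mulr_ge0 ?exprn_ge0 ?ltW //; lra.
have -> : B * lam ^+ n = lam ^+ m * (B * lam ^+ (n - m)).
  by rewrite mulrCA -exprD subnKC.
apply: (preimage_card_comp (nd m) (lifts_iter m Qg) (nd (n - m)%N) (lifts_iter (n - m) Qg)) => //.
  exact: iU.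
(* When nothing remains, the other map is the identity, with a count of at most 1: here [1 <= B] is
   used. *)
move=> x Ux [y Uy yx] _; case e : (n - m)%N yx Bl => [|l] yx Bl.
  apply: le_trans (preimage_card_id _ _) _; by rewrite expr0 mulr1 lee_fin.
rewrite -e; apply: IH; first by rewrite -subn_gt0 subKn.
by rewrite -yx iterS; exists (iter l g y) => //; exact: iU.
Qed.

Lemma stable_iter Q (n : nat) (p0 : Pk) H : (forall j, Q j \is ishomog1 d mdeg) ->
  stable (d ^ n) (iter_poly Q n) p0 H ->
  exists B (e : R), [/\ nbhs p0 B, 0 < e & forall Q' g p, (forall j, Q' j \is ishomog1 d mdeg) -> lifts Q' g ->
    coef_near e Q Q' -> B p -> H (iter n g) p].
Proof.
move=> hQ [B [del [hB del0 hyp]]].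
have [e e0 he] := coef_near_iter n (ler0n R 2) del0 hQ.
exists B, e; split=> // Q' g p hQ' Qg nr Bp; apply: (hyp (iter_poly Q' n)) => //.
- exact: lifts_iter_nondegenerate Qg.
- exact: lifts_iter.
- exact: he.
Qed.

(** At each point of [f(K)] some iterate has at most [lam ^+ n] preimages in [U]. By semicontinuity
    this bounds the preimages in [K] for maps near [f] and nearby points, and compactness of [f(K)]
    makes [lam] and [B] uniform. A map [g] near [f] sends [K] into the open set where these bounds
    hold, so [preimage_card_growth] applies to [U']. *)
Lemma small_degree_stable Q f (U U' K : set Pk) (D : R) : 0 < D -> (forall j, Q j \is ishomog1 d mdeg) -> lifts Q f ->
  compact K -> U' `<=` K -> K `<=` U ->
  (forall p, (f @` U) p -> (limn_esup (fun n => preimage_card (iter n f) U p `^ n%:R^-1) < D%:E)%E) ->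
  exists2 e : R, 0 < e & forall Q' g, (forall j, Q' j \is ishomog1 d mdeg) -> lifts Q' g -> coef_near e Q Q' ->
    (forall x, U' x -> U' (g x)) ->
    forall p, (g @` U') p -> (limn_esup (fun n => preimage_card (iter n g) U' p `^ n%:R^-1) < D%:E)%E.
Proof.
move=> D0 hQ Qf cK U'K KU hyp.
have nd n := lifts_iter_nondegenerate n d0 hQ Qf.
pose good (lam B : R) g p := exists2 n, (0 < n)%N & (preimage_card (iter n g) K p <= (lam ^+ n)%:E)%E /\
     forall j, (j < n)%N -> (preimage_card (iter j g) K p <= (B * lam ^+ j)%:E)%E.
have good_le lam lam' B B' g p : 0 < lam -> lam <= lam' -> 0 <= B -> B <= B' -> good lam B g p -> good lam' B' g p.
  move=> l0 ll B0 BB [n n0 [h1 h2]]; exists n => //; split=> [|j jn].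
    by apply: le_trans h1 _; rewrite lee_fin; apply: lerXn2r; rewrite ?nnegrE //; lra.
  apply: le_trans (h2 j jn) _; rewrite lee_fin; apply: ler_pM => //; first by rewrite exprn_ge0 // ltW.
  by apply: lerXn2r; rewrite ?nnegrE //; lra.
(* The open set [W] leaves room for passing from [f(K)] to [g(K)]. *)
pose P (S : set Pk) := exists (lam B e : R) (W : set Pk), [/\ 0 < lam < D, 1 <= B, 0 < e, open W /\ S `<=` W &
  forall Q' g p, (forall j, Q' j \is ishomog1 d mdeg) -> lifts Q' g -> coef_near e Q Q' -> W p -> good lam B g p].
have cont_f : continuous f by exact: lifts_continuous Qf.
have cfK : compact (f @` K) by apply: continuous_compact => //; exact: continuous_subspaceT.
have [lam [B [e [W [/andP[lam0 lamD] B1 e0 [oW KW] hW]]]]] : P (f @` K).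
  apply: (@compact_ind _ _ P cfK).
  - by exists (D / 2), 1, 1, set0; split=> //; [apply/andP; split; lra|split=> //; exact: open0].
  - move=> S S' [lam [B [e [W [/andP[l0 lD] B1 e0 [oW SW] hW]]]]] [lam' [B' [e' [W' [/andP[l0' lD'] B1' e0' [oW' SW'] hW']]]]].
    exists (Num.max lam lam'), (Num.max B B'), (Num.min e e'), (W `|` W'); split.
    + by rewrite lt_max l0 gt_max lD lD'.
    + by rewrite le_max B1.
    + by rewrite lt_min e0.
    + by split; [exact: openU|exact: setUSS].
    move=> Q' g p hQ' Qg nr [Wp|Wp].
      apply: (good_le lam _ B) => //; [by rewrite le_max lexx|lra|by rewrite le_max lexx|].
      by apply: (hW Q') => // j m; apply: lt_le_trans (nr j m) _; rewrite ge_min lexx.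
    apply: (good_le lam' _ B') => //; [by rewrite le_max lexx orbT|lra|by rewrite le_max lexx orbT|].
    by apply: (hW' Q') => // j m; apply: lt_le_trans (nr j m) _; rewrite ge_min lexx orbT.
  - by move=> S S' SS [lam [B [e [W [? ? ? [oW SW] ?]]]]]; exists lam, B, e, W; split=> //; split=> //; apply: subset_trans SW.
  move=> p0 [x Kx xp0].
  have fUp : (f @` U) p0 by exists x => //; exact: KU.
  have [lam [n [lam0 lamD n0 hn]]] := limn_esup_lt_inv (fun n => preimage_card_ge0 _ _ (nd n) (lifts_iter n Qf)) (hyp _ fUp).
  have /choice[M hM] : forall j, exists M : nat, ((M%:R)%:E <= preimage_card (iter j f) U p0)%E /\
      stable (d ^ j) (iter_poly Q j) p0 (fun h' p => (preimage_card h' K p <= (M%:R)%:E)%E).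
    by move=> j; have [M h1 h2] := preimage_card_semicontinuous p0 (nd j) (lifts_iter j Qf) cK KU; exists M.
  have /choice[B0 hB0] := fun j => stable_iter hQ (hM j).2.
  have [Bs [es [hBs es0 hBes]]] : exists Bs (es : R), [/\ nbhs p0 Bs, 0 < es & forall Q' g p j, (j <= n)%N ->
      (forall j, Q' j \is ishomog1 d mdeg) -> lifts Q' g ->
      coef_near es Q Q' -> Bs p -> (preimage_card (iter j g) K p <= ((M j)%:R)%:E)%E].
    elim: (n) => [|m [Bs [es [hBs es0 IH]]]].
      have [es [hBs es0 IH]] := hB0 0%N; exists (B0 0%N), es; split=> // Q' g p j; rewrite leqn0 => /eqP ->; exact: IH.
    have [es' [hBs' es0' IH']] := hB0 m.+1; exists (Bs `&` B0 m.+1), (Num.min es es'); split.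
    - exact: filterI.
    - by rewrite lt_min es0.
    move=> Q' g p j + hQ' Qg nr [Bp Bp']; rewrite leq_eqVlt => /orP[/eqP ->|].
      by apply: (IH' Q') => // i l; apply: lt_le_trans (nr i l) _; rewrite ge_min lexx orbT.
    rewrite ltnS => jm; apply: (IH Q') => // i l; apply: lt_le_trans (nr i l) _; by rewrite ge_min lexx.
  exists (interior Bs); first by exact: nbhs_interior.
  (* Large enough for [M j <= B * lam ^+ j] at every [j < n]. *)
  pose B := 1 + \sum_(j < n) (M j)%:R / lam ^+ j.
  have B1 : 1 <= B by rewrite lerDl; apply: sumr_ge0 => j _; rewrite divr_ge0 // exprn_ge0 // ltW.
  exists lam, B, es, (interior Bs); split=> //; [exact/andP|by split=> //; exact: open_interior|].
  move=> Q' g p hQ' Qg nr /interior_subset Bp; exists n; [exact: n0|split=> [|j jn]].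
    apply: le_trans (hBes Q' g p n (leqnn _) hQ' Qg nr Bp) _; apply: le_trans hn; exact: (hM n).1.
  apply: le_trans (hBes Q' g p j (ltnW jn) hQ' Qg nr Bp) _; rewrite lee_fin -ler_pdivrMr ?exprn_gt0 //.
  rewrite /B (bigD1 (Ordinal jn)) //= addrCA lerDl addr_ge0 // sumr_ge0 // => i _.
  by rewrite divr_ge0 // exprn_ge0 // ltW.
have [del del0 hdel] := near_compact_image Qf cK oW (fun x Kx => KW _ (ex_intro2 _ _ x Kx erefl)).
have [e' e0' he'] := coef_near_maps (ler0n R 2) del0 hQ.
exists (Num.min e e'); first by rewrite lt_min e0.
move=> Q' g hQ' Qg nr gU' p gp.
have nr1 : coef_near e Q Q' by move=> j m; apply: lt_le_trans (nr j m) _; rewrite ge_min lexx.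
have nr2 : coef_near e' Q Q' by move=> j m; apply: lt_le_trans (nr j m) _; rewrite ge_min lexx orbT.
have gK := hdel Q' g Qg (he' _ hQ' nr2).
have nd' n := lifts_iter_nondegenerate n d0 hQ' Qg.
apply: (limn_esup_lt (B := B) lam0 lamD) => n; first exact: preimage_card_ge0 (nd' n) (lifts_iter n Qg).
apply: (preimage_card_growth hQ' Qg gU' lam0 B1) => // q [x U'x <-].
have [m m0 [h1 h2]] := hW Q' g _ hQ' Qg nr1 (gK _ (U'K _ U'x)).
exists m => //; split=> [|j jm]; (apply: le_trans; first exact: (le_preimage_card _ (nd' _) (lifts_iter _ Qg) U'K)) => //.
exact: h2.
Qed.

End SmallDegree.

(** * Smooth functions *)

Section Limits.
Variables (R : realType) (T : Type) (A : set_system T).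
Context {FA : Filter A}.
Local Notation C := R[i].
Implicit Types (f g : T -> C) (a b : C).

Lemma limD f g a b : f @ A --> a -> g @ A --> b -> (fun x => f x + g x) @ A --> a + b.
Proof. by move=> fa gb; exact: (cvgD fa gb). Qed.

Lemma limM f g a b : f @ A --> a -> g @ A --> b -> (fun x => f x * g x) @ A --> a * b.
Proof. by move=> fa gb; exact: (cvgM fa gb). Qed.

Lemma limN f a : f @ A --> a -> (fun x => - f x) @ A --> - a.
Proof. by move=> fa; exact: (cvgN fa). Qed.

Lemma lim_cst a : (fun _ : T => a) @ A --> a.
Proof. exact: cvg_cst. Qed.

Lemma limV f a : a != 0 -> f @ A --> a -> (fun x => (f x)^-1) @ A --> a^-1.
Proof. by move=> a0 fa; exact: (cvgV a0 fa). Qed.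

Lemma conj_continuous : continuous (fun x : C => conjc x).
Proof.
move=> x B /nbhs_cnP[e e0 he]; apply/nbhs_cnP; exists e => // y xy; apply: he.
suff -> : cn (conjc x - conjc y) = cn (x - y) by [].
rewrite -rmorphB; apply: (@complexI R); rewrite -!cnE.
by case: (x - y) => u v; rewrite !normc_def /= sqrrN.
Qed.

Lemma lim_conj f a : f @ A --> a -> (fun x => conjc (f x)) @ A --> conjc a.
Proof. by move=> fa; exact: (continuous_cvg _ (@conj_continuous a) fa). Qed.

Lemma lim_near f g a : (\forall x \near A, f x = g x) -> f @ A --> a -> g @ A --> a.
Proof. by move=> fg; apply: cvg_trans; exact: near_eq_cvg. Qed.

End Limits.

Section DirectionalDerivatives.
Variables (R : realType) (k : nat).
Local Notation C := R[i].
Local Notation V := 'rV[C]_k.+1.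
Implicit Types (F G : V -> C) (z v : V) (l m : C).

(** A relation that includes the convergence of the quotients, whereas the limit [real_derive] has a
    value in any case. *)
Definition has_derive F z v l := difference_quotient F z v h @[h --> 0^'] --> l.

Lemma has_deriveP F z v l : has_derive F z v l <-> forall e : R, 0 < e -> exists2 d : R, 0 < d &
  forall h : R, h != 0 -> `|h| < d -> cn (difference_quotient F z v h - l) < e.
Proof.
split=> [Fl e e0|h A /nbhs_cnP[e e0 he]].
  have : nbhs l [set y : C | cn (y - l) < e] by apply/nbhs_cnP; exists e => // y; rewrite cnB.
  move=> /Fl; rewrite /nbhs /= => -[d /= d0 hd]; exists d => // h h0 hd'; apply: hd => //.
  by rewrite /ball_ /= sub0r normrN.
have [d d0 hd] := h e e0; rewrite /nbhs /=; exists d => //= x; rewrite /ball_ /= sub0r normrN => xd x0.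
by apply: he; rewrite cnB; exact: hd.
Qed.

Lemma has_derive_unique F z v l m : has_derive F z v l -> has_derive F z v m -> l = m.
Proof.
move=> /has_deriveP hl /has_deriveP hm; apply/eqP; rewrite -subr_eq0 -cn_eq0; apply/negPn/negP => lm.
have e0 : 0 < cn (l - m) / 2 by rewrite divr_gt0 // lt_def lm cn_ge0.
have [d d0 hd] := hl _ e0; have [d' d0' hd'] := hm _ e0.
pose h : R := Num.min d d' / 2; have h0 : 0 < h by rewrite divr_gt0 // lt_min d0.
have hh : `|h| < Num.min d d'.
  rewrite gtr0_norm // /h; have : 0 < Num.min d d' by rewrite lt_min d0.
  by move: (Num.min d d'); clear => x x0; lra.
move: hh; rewrite lt_min => /andP[h1 h2].
have := hd h (lt0r_neq0 h0) h1; have := hd' h (lt0r_neq0 h0) h2.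
move: (difference_quotient F z v h) => q.
have : cn (l - m) <= cn (q - l) + cn (q - m) by rewrite (cnB q l); exact: cn_triangle.
by norm_lra.
Qed.

Lemma has_derive_derivable F z v l : has_derive F z v l -> real_derivable F z v.
Proof. by move=> h; apply/cvg_ex; exists l. Qed.

Lemma has_derive_eq F z v l : has_derive F z v l -> real_derive v F z = l.
Proof.
by move=> h; exact: (has_derive_unique (has_derive_derivable h) h).
Qed.

Lemma derivable_has_derive F z v : real_derivable F z v -> has_derive F z v (real_derive v F z).
Proof. by []. Qed.

Lemma real_complex_cvg0 : (fun h : R => h%:C : C) h @[h --> 0^'] --> (0 : C).
Proof.
move=> A /nbhs_cnP[e e0 he]; rewrite /nbhs /=; exists e => //= x; rewrite /ball_ /= sub0r normrN => xe _.
by apply: he; rewrite sub0r cnN cn_real.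
Qed.

Lemma difference_quotientK F z v (h : R) : F (z + h%:C *: v) = F z + h%:C * difference_quotient F z v h.
Proof.
rewrite /difference_quotient; have [->|h0] := eqVneq h 0; first by rewrite scale0r addr0 mul0r addr0.
by rewrite mulrA mulfV ?fmorph_eq0 // mul1r addrCA subrr addr0.
Qed.

Lemma has_derive_along F z v l : has_derive F z v l -> F (z + h%:C *: v) @[h --> (0 : R)^'] --> F z.
Proof.
move=> Fl; rewrite -[X in _ --> X]addr0 -[X in _ --> _ + X](mul0r l).
have -> : (fun h : R => F (z + h%:C *: v)) = (fun h => F z + h%:C * difference_quotient F z v h).
  by apply/funext => h; exact: difference_quotientK.
by apply: limD; [exact: lim_cst|apply: limM; [exact: real_complex_cvg0|exact: Fl]].
Qed.

Lemma has_derive_cst (c : C) z v : has_derive (fun=> c) z v 0.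
Proof.
rewrite /has_derive (_ : difference_quotient _ _ _ = fun=> 0); first exact: cvg_cst.
by apply/funext => h; rewrite /difference_quotient subrr mulr0.
Qed.

Lemma has_derive_coord (j : 'I_k.+1) z v : has_derive (fun y : V => y 0 j) z v (v 0 j).
Proof.
apply/has_deriveP => e e0; exists 1 => // h h0 _.
rewrite /difference_quotient !mxE addrC.
have hc : h%:C != 0 :> C by rewrite fmorph_eq0.
have -> : h%:C^-1 * (h%:C * v 0 j + z 0 j - z 0 j) = v 0 j by field.
by rewrite subrr cn0.
Qed.

Lemma has_deriveD F G z v l m : has_derive F z v l -> has_derive G z v m ->
  has_derive (fun y => F y + G y) z v (l + m).
Proof.
move=> Fl Gm; have h0 := limD Fl Gm; rewrite /has_derive.
suff -> : difference_quotient (fun y => F y + G y) z v = (fun h => difference_quotient F z v h + difference_quotient G z v h) by exact: h0.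
by apply/funext => h; rewrite /= /difference_quotient; move: (h%:C^-1) (F _) (F _) (G _) (G _) => a b c d e'; ring.
Qed.

Lemma has_deriveM F G z v l m : has_derive F z v l -> has_derive G z v m ->
  has_derive (fun y => F y * G y) z v (l * G z + F z * m).
Proof.
move=> Fl Gm; have h1 : difference_quotient F z v h * G (z + h%:C *: v) @[h --> (0 : R)^'] --> l * G z.
  exact: (limM Fl (has_derive_along Gm)).
have h2 : F z * difference_quotient G z v h @[h --> 0^'] --> F z * m by apply: limM; [exact: lim_cst|exact: Gm].
have h3 : difference_quotient F z v h * G (z + h%:C *: v) + F z * difference_quotient G z v h @[h --> (0 : R)^']
   --> l * G z + F z * m by exact: (limD h1 h2).
rewrite /has_derive.
suff -> : difference_quotient (fun y => F y * G y) z v =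
  (fun h => difference_quotient F z v h * G (z + h%:C *: v) + F z * difference_quotient G z v h) by exact: h3.
apply/funext => h; rewrite /difference_quotient.
by move: (h%:C^-1) (F _) (F _) (G _) (G _) => a b c d e'; ring.
Qed.

Lemma has_derive_conj F z v l : has_derive F z v l -> has_derive (fun y => conjc (F y)) z v (conjc l).
Proof.
move=> Fl; rewrite /has_derive.
have h0 := lim_conj Fl.
suff -> : difference_quotient (fun y => conjc (F y)) z v = fun h => conjc (difference_quotient F z v h) by exact: h0.
apply/funext => h; rewrite /difference_quotient rmorphM rmorphB; congr (_ * _).
by rewrite -fmorphV /= oppr0.
Qed.

Lemma has_derive_local F G z v l : (\forall y \near nbhs z, F y = G y) -> has_derive F z v l -> has_derive G z v l.
Proof.
move=> /nbhs_vnP[d d0 hd] /has_deriveP Fl; apply/has_deriveP => e e0.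
have [d' d0' hd'] := Fl e e0; have v0 := vn_ge0 v.
exists (Num.min d' (d / (vn v + 1))); first by rewrite lt_min d0' divr_gt0 //; lra.
move=> h h0; rewrite lt_min => /andP[h1 h2].
have -> : difference_quotient G z v h = difference_quotient F z v h.
  rewrite /difference_quotient hd ?hd ?subrr ?vn0 //.
  rewrite opprD addNKr vnN vnZ cn_real.
  apply: le_lt_trans (_ : `|h| * (vn v + 1) < d); first by rewrite ler_wpM2l // lerDl.
  by rewrite -ltr_pdivlMr //; lra.
exact: hd'.
Qed.

Lemma has_deriveV F z v l : F z != 0 -> has_derive F z v l ->
  has_derive (fun y => (F y)^-1) z v (- l * (F z)^-1 * (F z)^-1).
Proof.
move=> Fz Fl.
have ha := has_derive_along Fl.
have h1 : - difference_quotient F z v h * (F z)^-1 * (F (z + h%:C *: v))^-1 @[h --> (0 : R)^']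
    --> - l * (F z)^-1 * (F z)^-1.
  apply: limM; last exact: (limV Fz ha).
  by apply: limM; [exact: (limN Fl)|exact: lim_cst].
apply: lim_near h1.
have hn : nbhs (F z) [set y | y != 0].
  apply/nbhs_cnP; exists (cn (F z)); rewrite ?cn_gt0 // => y; apply: contraTneq => ->.
  by rewrite subr0 ltxx.
have hA : \forall h \near (0 : R)^', F (z + h%:C *: v) != 0 by exact: (ha _ hn).
apply: filterS hA => h hF; rewrite /difference_quotient.
by move: (h%:C^-1) (F z) (F (z + h%:C *: v)) Fz hF => a b c b0 c0; field; rewrite c0 b0.
Qed.

Lemma has_derive_shift F w z v l : has_derive F (z + w) v l -> has_derive (fun y => F (y + w)) z v l.
Proof.
rewrite /has_derive; suff -> : difference_quotient (fun y => F (y + w)) z v = difference_quotient F (z + w) v by [].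
by apply/funext => h; rewrite /difference_quotient addrAC.
Qed.

Lemma has_derive_scale F z v l (c : R) : has_derive F z v l -> has_derive F z (c%:C *: v) (c%:C * l).
Proof.
move=> /has_deriveP Fl; apply/has_deriveP => e e0.
have [->|c0] := eqVneq c 0.
  by exists 1 => // h h0 _; rewrite /difference_quotient scale0r scaler0 addr0 subrr mulr0 mul0r subrr cn0.
have nc : 0 < `|c| by rewrite normr_gt0.
have [d d0 hd] := Fl (e / `|c|) (divr_gt0 e0 nc).
exists (d / `|c|); first by rewrite divr_gt0.
move=> h h0 hdd.
have hc : `|h * c| < d by rewrite normrM -ltr_pdivlMr.
have -> : difference_quotient F z (c%:C *: v) h = c%:C * difference_quotient F z v (h * c).
  have hc' : h%:C != 0 :> C by rewrite fmorph_eq0.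
  have cc' : c%:C != 0 :> C by rewrite fmorph_eq0.
  rewrite /difference_quotient scalerA (rmorphM (real_complex R)) /=.
  by move: (F _) (F _) => a b; field; rewrite hc' cc'.
have := hd _ (mulf_neq0 h0 c0) hc.
by rewrite -mulrBr cnM cn_real ltr_pdivlMr // mulrC.
Qed.

End DirectionalDerivatives.

#[global] Opaque has_derive.

Section SmoothFunctions.
Variables (R : realType) (k : nat).
Local Notation C := R[i].
Local Notation V := 'rV[C]_k.+1.
Implicit Types (F G : V -> C) (z v : V) (S : set (V -> C)) (O : set V).

Record smooth_on O F : Prop := SmoothOn { smooth_on_iter : forall (vs : seq V) z, O z ->
  {for z, continuous (iter_derive vs F)} /\ forall v, real_derivable (iter_derive vs F) z v }.

Definition derivable_class O S S' := forall F, S F -> (forall z, O z -> {for z, continuous F}) /\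
  forall v, exists2 G, S' G & forall z, O z -> has_derive F z v (G z).

(** The algebra generated by [S]. By the product rule it is stable under derivation as soon as it
    contains the derivatives of the members of [S]. *)
Inductive generated S : (V -> C) -> Prop :=
| GenBase F of S F : generated S F
| GenCst c : generated S (fun=> c)
| GenAdd F G of generated S F & generated S G : generated S (fun z => F z + G z)
| GenMul F G of generated S F & generated S G : generated S (fun z => F z * G z).

Lemma open_near O z (P : V -> Prop) : open O -> O z -> (forall y, O y -> P y) -> \forall y \near nbhs z, P y.
Proof. by move=> oO Oz OP; apply: (@filterS _ (nbhs z) _ O) => //; apply: open_nbhs_nbhs. Qed.

Lemma continuous_near F G z : (\forall y \near nbhs z, F y = G y) -> {for z, continuous F} -> {for z, continuous G}.
Proof.
move=> FG cF; have e : F z = G z by exact: (nbhs_singleton FG).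
rewrite /prop_for /continuous_at -e; exact: lim_near FG cF.
Qed.

(** Every iterated derivative agrees on [O] with a member of [S], so smoothness follows without
    computing the iterated derivatives. *)
Lemma smooth_coinduction O S F : open O -> derivable_class O S S -> S F -> smooth_on O F.
Proof.
move=> oO SS SF; have main vs : exists2 G, S G & forall z, O z -> G z = iter_derive vs F z.
  elim: vs => [|v vs [G SG GF]]; first by exists F.
  have [_ /(_ v)[H SH hH]] := SS G SG; exists H => // z Oz.
  apply/esym/has_derive_eq; apply: has_derive_local (hH z Oz); exact: open_near GF.
split=> vs z Oz; have [G SG GF] := main vs; have GFz := open_near oO Oz GF.
have [cG dG] := SS G SG; split; first exact: continuous_near GFz (cG z Oz).
move=> v; have [H _ hH] := dG v; apply: has_derive_derivable.
exact: has_derive_local GFz (hH z Oz).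
Qed.

Lemma generated_class O S : derivable_class O S (generated S) -> derivable_class O (generated S) (generated S).
Proof.
move=> SS F; elim=> {F} [F SF|c|F G _ [cF dF] _ [cG dG]|F G gF [cF dF] gG [cG dG]].
- exact: SS.
- split=> [z _|v]; first exact: cst_continuous.
  by exists (fun=> 0); [exact: GenCst|move=> z _; exact: has_derive_cst].
- split=> [z Oz|v]; first by apply: continuousDC; [exact: cF|exact: cG].
  have [F' gF' hF'] := dF v; have [G' gG' hG'] := dG v.
  by exists (fun z => F' z + G' z); [exact: GenAdd|move=> z Oz; apply: has_deriveD; [exact: hF'|exact: hG']].
split=> [z Oz|v]; first by apply: continuousMC; [exact: cF|exact: cG].
have [F' gF' hF'] := dF v; have [G' gG' hG'] := dG v.
exists (fun z => F' z * G z + F z * G' z); first by apply: GenAdd; apply: GenMul.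
by move=> z Oz; apply: has_deriveM; [exact: hF'|exact: hG'].
Qed.

Lemma smooth_generated O S F : open O -> derivable_class O S (generated S) -> generated S F -> smooth_on O F.
Proof. by move=> oO SS; apply: smooth_coinduction => //; exact: generated_class. Qed.

Lemma iter_derive_rcons vs v F : iter_derive (rcons vs v) F = iter_derive vs (real_derive v F).
Proof. by rewrite /iter_derive foldr_rcons. Qed.

Lemma smooth_on_derive O F v : smooth_on O F -> smooth_on O (real_derive v F).
Proof. by move=> sF; split=> vs z Oz; rewrite -iter_derive_rcons; exact: (smooth_on_iter sF (rcons vs v) Oz). Qed.

Lemma smooth_on_has_derive O F z v : smooth_on O F -> O z -> has_derive F z v (real_derive v F z).
Proof. by move=> sF Oz; exact: (smooth_on_iter sF [::] Oz).2. Qed.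

Lemma smooth_on_continuous O F z : smooth_on O F -> O z -> {for z, continuous F}.
Proof. by move=> sF Oz; exact: (smooth_on_iter sF [::] Oz).1. Qed.

Lemma smooth_on_sub O O' F : O' `<=` O -> smooth_on O F -> smooth_on O' F.
Proof. by move=> OO sF; split=> vs z /OO; exact: smooth_on_iter. Qed.

Lemma smooth_on_class O S : smooth_on O `<=` S -> derivable_class O (smooth_on O) S.
Proof.
move=> sS F sF; split=> [z Oz|v]; first exact: smooth_on_continuous Oz.
exists (real_derive v F); first by apply: sS; exact: smooth_on_derive.
by move=> z Oz; exact: smooth_on_has_derive Oz.
Qed.

Lemma smooth_on_generated O F : open O -> generated (smooth_on O) F -> smooth_on O F.
Proof.
move=> oO; apply: smooth_generated => //; apply: smooth_on_class => G; exact: GenBase.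
Qed.

Lemma smooth_on_cst O c : open O -> smooth_on O (fun=> c).
Proof. by move=> oO; apply: smooth_on_generated => //; exact: GenCst. Qed.

Lemma smooth_onD O F G : open O -> smooth_on O F -> smooth_on O G -> smooth_on O (fun z => F z + G z).
Proof. by move=> oO sF sG; apply: smooth_on_generated => //; apply: GenAdd; exact: GenBase. Qed.

Lemma smooth_onM O F G : open O -> smooth_on O F -> smooth_on O G -> smooth_on O (fun z => F z * G z).
Proof. by move=> oO sF sG; apply: smooth_on_generated => //; apply: GenMul; exact: GenBase. Qed.

Lemma smooth_on_sum O (I : Type) (r : seq I) (P : pred I) (F : I -> V -> C) : open O ->
  (forall i, P i -> smooth_on O (F i)) -> smooth_on O (fun z => \sum_(i <- r | P i) F i z).
Proof.
move=> oO sF; elim: r => [|i r IH].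
  by rewrite (_ : (fun z => _) = fun=> 0); [exact: smooth_on_cst|apply/funext => z; rewrite big_nil].
have [Pi|Pi] := boolP (P i).
  rewrite (_ : (fun z => _) = fun z => F i z + \sum_(j <- r | P j) F j z).
    by apply: smooth_onD => //; exact: sF.
  by apply/funext => z; rewrite big_cons Pi.
rewrite (_ : (fun z => _) = fun z => \sum_(j <- r | P j) F j z) //.
by apply/funext => z; rewrite big_cons (negPf Pi).
Qed.

Lemma smooth_on_prod O (I : Type) (r : seq I) (P : pred I) (F : I -> V -> C) : open O ->
  (forall i, P i -> smooth_on O (F i)) -> smooth_on O (fun z => \prod_(i <- r | P i) F i z).
Proof.
move=> oO sF; elim: r => [|i r IH].
  by rewrite (_ : (fun z => _) = fun=> 1); [exact: smooth_on_cst|apply/funext => z; rewrite big_nil].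
have [Pi|Pi] := boolP (P i).
  rewrite (_ : (fun z => _) = fun z => F i z * \prod_(j <- r | P j) F j z).
    by apply: smooth_onM => //; exact: sF.
  by apply/funext => z; rewrite big_cons Pi.
rewrite (_ : (fun z => _) = fun z => \prod_(j <- r | P j) F j z) //.
by apply/funext => z; rewrite big_cons (negPf Pi).
Qed.

Lemma smooth_on_conj O F : open O -> smooth_on O F -> smooth_on O (fun z => conjc (F z)).
Proof.
move=> oO sF; pose S G := exists2 H, smooth_on O H & G = fun z => conjc (H z).
apply: (@smooth_coinduction _ S) => //; last by exists F.
move=> _ [H sH ->]; split=> [z Oz|v].
  exact: (lim_conj (smooth_on_continuous sH Oz)).
exists (fun z => conjc (real_derive v H z)).
  by exists (real_derive v H) => //; exact: smooth_on_derive.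
by move=> z Oz; apply: has_derive_conj; exact: smooth_on_has_derive Oz.
Qed.

(** The derivatives of [1 / F] belong to the algebra generated by [1 / F] and the smooth
    functions. *)
Lemma smooth_on_inv O F : open O -> (forall z, O z -> F z != 0) -> smooth_on O F -> smooth_on O (fun z => (F z)^-1).
Proof.
move=> oO F0 sF; pose S G := smooth_on O G \/ G = fun z => (F z)^-1.
apply: (@smooth_generated _ S) => //; last by apply: GenBase; right.
move=> G [sG|->].
  by apply: smooth_on_class sG => H sH; apply: GenBase; left.
split=> [z Oz|v].
  exact: (limV (F0 z Oz) (smooth_on_continuous sF Oz)).
exists (fun z => (-1 * real_derive v F z) * (F z)^-1 * (F z)^-1); last first.
  by move=> z Oz; rewrite mulN1r; apply: has_deriveV; [exact: F0|exact: smooth_on_has_derive Oz].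
have gi : generated S (fun z => (F z)^-1) by apply: GenBase; right.
apply: (GenMul _ gi); apply: (GenMul _ gi); apply: GenMul; first exact: GenCst.
by apply: GenBase; left; exact: smooth_on_derive.
Qed.

Lemma smooth_on_eq O F G : open O -> (forall z, O z -> F z = G z) -> smooth_on O F -> smooth_on O G.
Proof.
move=> oO FG sF; have e vs : forall z, O z -> iter_derive vs F z = iter_derive vs G z.
  elim: vs => [//|v vs IH] z Oz; apply/esym/has_derive_eq.
  apply: has_derive_local (open_near oO Oz IH) _; exact: (smooth_on_iter sF vs Oz).2.
split=> vs z Oz; have n := open_near oO Oz (e vs); split.
  exact: continuous_near n (smooth_on_iter sF vs Oz).1.
by move=> v; apply: has_derive_derivable; apply: has_derive_local n _; exact: (smooth_on_iter sF vs Oz).2.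
Qed.

Lemma smooth_on_coord O (j : 'I_k.+1) : open O -> smooth_on O (fun z : V => z 0 j).
Proof.
move=> oO; pose S G := (exists c, G = fun=> c) \/ G = fun z : V => z 0 j.
apply: (@smooth_coinduction _ S) => //; last by right.
move=> _ [[c ->]|->].
  split=> [z _|v]; first exact: cst_continuous.
  by exists (fun=> 0); [left; exists 0|move=> z _; exact: has_derive_cst].
split=> [z _|v]; last by exists (fun=> v 0 j); [left; exists (v 0 j)|move=> z _; exact: has_derive_coord].
have := @meval_continuous R k.+1 (mpolyX C (mnm1 j)) z.
by rewrite (_ : (fun z => _) = fun z : V => z 0 j) //; apply/funext => y; rewrite mevalXU.
Qed.

Lemma smooth_on_meval O (p : mpoly k.+1 C) : open O -> smooth_on O (fun z : V => meval (z ord0) p).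
Proof.
move=> oO; elim/mpoly_ring_ind: p => [c|i|p q sp sq|p q sp sq].
- rewrite (_ : (fun z => _) = fun=> c); first exact: smooth_on_cst.
  by apply/funext => z; rewrite mevalC.
- rewrite (_ : (fun z => _) = fun z : V => z 0 i); first exact: smooth_on_coord.
  by apply/funext => z; rewrite mevalXU.
- rewrite (_ : (fun z => _) = fun z : V => meval (z ord0) p + meval (z ord0) q); first exact: smooth_onD.
  by apply/funext => z; rewrite mevalD.
rewrite (_ : (fun z => _) = fun z : V => meval (z ord0) p * meval (z ord0) q); first exact: smooth_onM.
by apply/funext => z; rewrite mevalM.
Qed.

End SmoothFunctions.

(** * Total derivatives, the chain rule and Clairaut's theorem *)

Section TotalDerivative.
Variables (R : realType) (k : nat).
Local Notation C := R[i].
Local Notation V := 'rV[C]_k.+1.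
Implicit Types (F G : V -> C) (z v : V) (O : set V).

Lemma Re_le_cn (x : C) : `|complex.Re x| <= cn x.
Proof.
have <- : complex.Re `|x| = cn x by rewrite cnE.
case: x => a b; rewrite normc_def /=.
by rewrite -[leLHS]sqrtr_sqr ler_wsqrtr // lerDl sqr_ge0.
Qed.

Lemma cn_i : cn ('i%C : C) = 1.
Proof. by apply: (@complexI R); rewrite -cnE normc_def /= expr0n expr1n add0r sqrtr1. Qed.

Lemma cn_le_ReIm (x : C) : cn x <= `|complex.Re x| + `|complex.Im x|.
Proof.
by rewrite {1}[x]complexE; apply: le_trans (cnD _ _) _; rewrite cnM !cn_real cn_i mul1r.
Qed.

Lemma Re_mulNi (x : C) : complex.Re (- 'i%C * x) = complex.Im x.
Proof. by case: x => a b /=; rewrite oppr0 mul0r sub0r mulN1r opprK. Qed.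

Lemma has_derive_Re F z v l (t : R) : has_derive F (z + t%:C *: v) v l ->
  is_derive t 1 (fun s : R => complex.Re (F (z + s%:C *: v)) : R^o) (complex.Re l).
Proof.
move=> /has_deriveP Fl.
have h : h^-1 *: (complex.Re (F (z + (h *: 1 + t)%:C *: v)) - complex.Re (F (z + t%:C *: v)))
   @[h --> (0 : R)^'] --> (complex.Re l : R^o).
  apply/cvgrPdist_lt => e e0; have [d d0 hd] := Fl e e0.
  rewrite /nbhs /=; exists d => //= h; rewrite /ball_ /= sub0r normrN => hdd h0.
  have := hd h h0 hdd; apply: le_lt_trans; rewrite distrC; apply: le_trans (Re_le_cn _).
  have -> : complex.Re (difference_quotient F (z + t%:C *: v) v h - l) =
    complex.Re (difference_quotient F (z + t%:C *: v) v h) - complex.Re l by rewrite raddfB.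
  suff -> : complex.Re (difference_quotient F (z + t%:C *: v) v h) =
    h^-1 *: (complex.Re (F (z + (h *: 1 + t)%:C *: v)) - complex.Re (F (z + t%:C *: v))) by [].
  rewrite /difference_quotient -addrA -scalerDl -rmorphD [h *: 1]mulr1 (addrC t).
  rewrite -fmorphV; move: (F _) (F _) => [a b] [a' b'] /=.
  by rewrite mul0r subr0.
by apply: DeriveDef; [apply/cvg_ex; exists (complex.Re l)|apply: cvg_lim h].
Qed.

Lemma mean_value_Re F z v l (eta : R) :
  (forall t : R, 0 <= t <= 1 -> exists2 m, has_derive F (z + t%:C *: v) v m & cn (m - l) <= eta) ->
  `|complex.Re (F (z + v) - F z - l)| <= eta.
Proof.
move=> /= hyp; have /choice[m hm] : forall t : R, exists m, 0 <= t <= 1 ->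
    has_derive F (z + t%:C *: v) v m /\ cn (m - l) <= eta.
  by move=> t; have [/hyp[m h1 h2]|_] := boolP (0 <= t <= 1); [exists m|exists 0].
have der (t : R) : 0 <= t <= 1 -> is_derive t 1 (fun s : R => complex.Re (F (z + s%:C *: v)) : R^o) (complex.Re (m t)).
  by move=> /hm[h _]; exact: has_derive_Re.
have [||c] := @MVT R (fun s : R => complex.Re (F (z + s%:C *: v)) : R^o) (fun t => complex.Re (m t)) 0 1 (@ltr01 R).
- by move=> t; rewrite in_itv /= => /andP[t0 t1]; apply: der; rewrite !ltW.
- apply: derivable_within_continuous => t; rewrite in_itv /= => /der[]; by [].
rewrite in_itv /= => /andP[c0 c1]; rewrite subr0 mulr1 scale0r addr0 scale1r => e.
have c01 : 0 <= c <= 1 by rewrite !ltW.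
have [_ h] := hm c c01.
apply: le_trans (le_trans (Re_le_cn _) h).
by rewrite !raddfB /= e.
Qed.

(** The mean value theorem is applied to the real and imaginary parts separately, whence the factor
    2; the imaginary part of [x] is the real part of [- i x]. *)
Lemma mean_value F z v l (eta : R) :
  (forall t : R, 0 <= t <= 1 -> exists2 m, has_derive F (z + t%:C *: v) v m & cn (m - l) <= eta) ->
  cn (F (z + v) - F z - l) <= 2 * eta.
Proof.
move=> hyp; have h1 := mean_value_Re hyp.
have h2 : `|complex.Re (- 'i%C * F (z + v) - - 'i%C * F z - - 'i%C * l)| <= eta.
  apply: (@mean_value_Re (fun y => - 'i%C * F y)) => t /hyp[m hm ml]; exists (- 'i%C * m).
    by have := has_deriveM (has_derive_cst (- 'i%C) _ _) hm; rewrite mul0r add0r.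
  rewrite -mulrBr cnM cnN; by rewrite cn_i mul1r.
apply: le_trans (cn_le_ReIm _) _.
have -> : `|complex.Im (F (z + v) - F z - l)| = `|complex.Re (- 'i%C * F (z + v) - - 'i%C * F z - - 'i%C * l)|.
  by rewrite -!mulrBr Re_mulNi.
lra.
Qed.

Definition ebase (b : 'I_k.+1 * bool) : V := (if b.2 then 'i%C else 1) *: delta_mx 0 b.1.
Definition rcoord (b : 'I_k.+1 * bool) (x : V) : R := if b.2 then complex.Im (x 0 b.1) else complex.Re (x 0 b.1).

Lemma rcoord_sum (x : V) : x = \sum_b (rcoord b x)%:C *: ebase b.
Proof.
rewrite -(pair_big xpredT xpredT (fun a e => (rcoord (a, e) x)%:C *: ebase (a, e))) /=.
rewrite [LHS]row_sum_delta; apply: eq_bigr => a _.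
rewrite big_bool /rcoord /ebase /= !scalerA mulr1 -scalerDl addrC; congr (_ *: _).
by rewrite [LHS]complexE mulrC.
Qed.

Lemma rcoord_le b (x : V) : `|rcoord b x| <= vn x.
Proof.
apply: le_trans (vn_coord x 0 b.1); rewrite /rcoord; case: b.2; last exact: Re_le_cn.
have := Re_le_cn (- 'i%C * x 0 b.1); by rewrite cnM cnN cn_i mul1r Re_mulNi.
Qed.

Lemma ebase_le b : vn (ebase b) <= 1.
Proof.
rewrite /ebase vnZ; have -> : cn (if b.2 then 'i%C else 1 : C) = 1 :> R.
  by case: b.2; [exact: cn_i|exact: cn1].
rewrite mul1r; apply/vn_leP => // i j; rewrite mxE.
by case: (_ && _); rewrite ?cn1 // cn0 ler01.
Qed.

(** Continuity of the partial derivatives suffices: the increment is made one real coordinate at a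
    time, and the mean value theorem compares each step with the partial derivative at [y]. *)
Lemma total_derivative O F y (eps : R) : open O -> smooth_on O F -> O y -> 0 < eps ->
  exists2 d : R, 0 < d & forall x : V, vn x < d ->
    cn (F (y + x) - F y - \sum_b (rcoord b x)%:C * real_derive (ebase b) F y) <= eps * vn x.
Proof.
move=> oO sF Oy eps0.
pose n := #|{: 'I_k.+1 * bool}|.
have n0 : 0 < n%:R :> R by rewrite ltr0n; apply/card_gt0P; exists (ord0, true).
pose eta : R := eps / (2 * n%:R); have eta0 : 0 < eta by rewrite divr_gt0 // mulr_gt0.
have [d d0 hd] : exists2 d : R, 0 < d & forall y' : V, vn (y - y') < d -> O y' /\
    forall b, cn (real_derive (ebase b) F y' - real_derive (ebase b) F y) <= eta.
  have /choice[db hdb] : forall b, exists d : R, 0 < d /\ forall y' : V, vn (y - y') < d ->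
      cn (real_derive (ebase b) F y' - real_derive (ebase b) F y) <= eta.
    move=> b; have c := smooth_on_continuous (smooth_on_derive (ebase b) sF) Oy.
    have hn : nbhs (real_derive (ebase b) F y) [set w : C | cn (real_derive (ebase b) F y - w) < eta].
      by apply/nbhs_cnP; exists eta.
    have /nbhs_vnP[d d0 hd] := c _ hn; exists d; split=> // y' /hd; rewrite cnB; exact: ltW.
  have [d1 d10 hd1] := positive_lower_bound (fun b => (hdb b).1).
  have /nbhs_vnP[d2 d20 hd2] : nbhs y O by exact: open_nbhs_nbhs.
  exists (Num.min d1 d2); first by rewrite lt_min d10.
  move=> y'; rewrite lt_min => /andP[h1 h2]; split; first exact: hd2.
  by move=> b; apply: (hdb b).2; apply: lt_le_trans h1 (hd1 b).
exists (d / n%:R); first by rewrite divr_gt0.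
move=> x; rewrite ltr_pdivlMr // => xd; have x0 := vn_ge0 x.
have partial (r : seq ('I_k.+1 * bool)) : (size r <= n)%N ->
    vn (\sum_(b <- r) (rcoord b x)%:C *: ebase b) <= (size r)%:R * vn x /\
    cn (F (y + \sum_(b <- r) (rcoord b x)%:C *: ebase b) - F y - \sum_(b <- r) (rcoord b x)%:C * real_derive (ebase b) F y)
     <= (size r)%:R * (2 * (eta * vn x)).
  elim: r => [|b r IH] /= rn.
    by rewrite !big_nil vn0 addr0 !subrr cn0 !mul0r.
  have [IH1 IH2] := IH (ltnW rn); rewrite !big_cons.
  set s : V := \sum_(b <- r) _ in IH1 IH2 *; set D := \sum_(b <- r) _ in IH2 *.
  have hb : vn ((rcoord b x)%:C *: ebase b) <= vn x.
    rewrite vnZ cn_real -[leRHS]mulr1; apply: ler_pM; rewrite ?vn_ge0 ?normr_ge0 ?rcoord_le ?ebase_le //.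
  split.
    apply: le_trans (vnD _ _) _; rewrite -natr1 mulrDl mul1r addrC; exact: lerD.
  have step : cn (F (y + s + (rcoord b x)%:C *: ebase b) - F (y + s) - (rcoord b x)%:C * real_derive (ebase b) F y) <= 2 * (eta * vn x).
    apply: mean_value => t /andP[t0 t1].
    have hy : vn (y - (y + s + t%:C *: ((rcoord b x)%:C *: ebase b))) < d.
      have -> : y - (y + s + t%:C *: ((rcoord b x)%:C *: ebase b)) = - (s + t%:C *: ((rcoord b x)%:C *: ebase b)).
        by rewrite -addrA opprD addrA subrr sub0r.
      rewrite vnN; apply: le_lt_trans (vnD _ _) _; rewrite (vnZ t%:C) cn_real ger0_norm //.
      apply: le_lt_trans xd; rewrite [leRHS]mulrC.
      apply: (@le_trans _ _ ((size r).+1%:R * vn x)).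
        rewrite -natr1 mulrDl; apply: lerD => //; apply: ler_pM => //; exact: vn_ge0.
      by apply: ler_wpM2r => //; rewrite ler_nat.
    have [Oy' hD] := hd _ hy.
    exists ((rcoord b x)%:C * real_derive (ebase b) F (y + s + t%:C *: ((rcoord b x)%:C *: ebase b))).
      apply: has_derive_scale; exact: smooth_on_has_derive Oy'.
    by rewrite -mulrBr cnM cn_real mulrC; apply: ler_pM; rewrite ?cn_ge0 ?normr_ge0 ?rcoord_le.
  have -> : F (y + ((rcoord b x)%:C *: ebase b + s)) - F y - ((rcoord b x)%:C * real_derive (ebase b) F y + D) =
    (F (y + s + (rcoord b x)%:C *: ebase b) - F (y + s) - (rcoord b x)%:C * real_derive (ebase b) F y) + (F (y + s) - F y - D).
    rewrite [_ + s in LHS]addrC addrA; by move: (F _) (F _) (F _) (_ * _) (D) => a1 a2 a3 a4 a5; ring.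
  apply: le_trans (cnD _ _) _; rewrite -natr1 mulrDl mul1r addrC; exact: lerD.
have sz : size (index_enum ('I_k.+1 * bool)%type) = n by rewrite /n cardE enumT.
have [|_ h] := partial (index_enum _); first by rewrite sz.
rewrite -rcoord_sum in h; apply: le_trans h _; rewrite sz /eta le_eqVlt; apply/orP; left; apply/eqP.
by field; rewrite gt_eqF.
Qed.

(** Transposed, because tangent vectors are rows: the image of [v] is [v *m jac Q z]. *)
Definition jac (Q : 'I_k.+1 -> mpoly k.+1 C) z : 'M[C]_k.+1 := (\matrix_(i, j) meval (z ord0) (mderiv j (Q i)))^T.

Lemma jac_coord Q z v j : (v *m jac Q z) 0 j = \sum_i v 0 i * meval (z ord0) (mderiv i (Q j)).
Proof. by rewrite mxE; apply: eq_bigr => i _; rewrite !mxE. Qed.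

Lemma has_derive_pmap Q F O z v : open O -> smooth_on O F -> O (pmap Q z) ->
  has_derive (fun y => F (pmap Q y)) z v (\sum_b (rcoord b (v *m jac Q z))%:C * real_derive (ebase b) F (pmap Q z)).
Proof.
move=> oO sF Oy; set y := pmap Q z; set u : V := v *m jac Q z.
have linL (x x' : V) (h : R) : \sum_b (rcoord b (x - h%:C *: x'))%:C * real_derive (ebase b) F y =
  \sum_b (rcoord b x)%:C * real_derive (ebase b) F y - h%:C * \sum_b (rcoord b x')%:C * real_derive (ebase b) F y.
  rewrite mulr_sumr -sumrB; apply: eq_bigr => b _; rewrite mulrA -mulrBl; congr (_ * _).
  rewrite -rmorphM -rmorphB; congr (_%:C); rewrite /rcoord !mxE; case: b.2; rewrite raddfB /=; congr (_ - _);
    by case: (x' 0 b.1) => a c /=; rewrite !mul0r ?subr0 ?addr0.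
apply/has_deriveP => e e0.
pose nu := vn u; have nu0 : 0 <= nu := vn_ge0 u.
pose nv := vn v; have nv0 : 0 <= nv := vn_ge0 v.
pose LD : R := \sum_b cn (real_derive (ebase b) F y).
have LD0 : 0 <= LD by apply: sumr_ge0 => b _; exact: cn_ge0.
have Lb (x : V) : cn (\sum_b (rcoord b x)%:C * real_derive (ebase b) F y) <= vn x * LD.
  apply: le_trans (cn_sum _ _ _) _; rewrite mulr_sumr; apply: ler_sum => b _.
  by rewrite cnM cn_real ler_wpM2r ?cn_ge0 // rcoord_le.
pose e1 : R := e / (2 * (nu + 1)); have e10 : 0 < e1 by rewrite divr_gt0 // mulr_gt0 //; lra.
have [d1 d10 hd1] := total_derivative oO sF Oy e10.
(* The first bound limits the contribution of the error of [Q] to [e / 4]; the second keeps the norm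
   of the increment [x] below [|h| (nu + 1)]. *)
pose e2 : R := Num.min (e / (4 * (LD + 1) * (nv + 1))) (1 / (nv + 1)).
have e20 : 0 < e2 by rewrite lt_min !divr_gt0 // ?mulr_gt0 //; lra.
have [d2 d20 hd2] := @pmap_strict R _ Q z e2 e20.
pose d : R := Num.min (d1 / (nu + 1)) (d2 / (nv + 1)).
have d0 : 0 < d by rewrite lt_min !divr_gt0 //; lra.
exists d => // h h0; rewrite lt_min => /andP[]; rewrite !ltr_pdivlMr ?ltr_wpDl // => h1 h2.
have hn : 0 < `|h| by rewrite normr_gt0.
pose x : V := pmap Q (z + h%:C *: v) - y.
have hx : vn (x - h%:C *: u) <= e2 * (`|h| * nv).
  have := hd2 (z + h%:C *: v) z; rewrite subrr vn0 addrAC subrr add0r vnZ cn_real => /(_ _ d20).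
  have -> : h%:C *: v *m (\matrix_(i, j) meval (z ord0) (mderiv j (Q i)))^T = h%:C *: u by rewrite -scalemxAl.
  by apply; apply: le_lt_trans h2; rewrite ler_wpM2l // lerDl.
have e2nv : e2 * nv <= 1.
  apply: (@le_trans _ _ (1 / (nv + 1) * nv)); first by rewrite ler_wpM2r // ge_min lexx orbT.
  by rewrite div1r ler_pdivrMl ?ltr_wpDl // mulr1 lerDl.
have e2LD : e2 * nv * LD <= e / 4.
  apply: (@le_trans _ _ (e / (4 * (LD + 1) * (nv + 1)) * (nv + 1) * (LD + 1))).
    apply: ler_pM => //; [by rewrite mulr_ge0 // ltW| |lra].
    by apply: ler_pM => //; [exact: ltW|rewrite ge_min lexx|lra].
  rewrite le_eqVlt; apply/orP; left; apply/eqP; field; rewrite !gt_eqF //; lra.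
have xn : vn x <= `|h| * (nu + 1).
  have -> : x = (x - h%:C *: u) + h%:C *: u by rewrite subrK.
  apply: le_trans (vnD _ _) _; rewrite vnZ cn_real mulrDr mulr1 addrC lerD2l.
  apply: le_trans hx _; rewrite mulrCA -[leRHS]mulr1 ler_pM2l //.
have hF := hd1 x (le_lt_trans xn h1).
rewrite /difference_quotient.
have -> : h%:C^-1 * (F (pmap Q (z + h%:C *: v)) - F (pmap Q z)) - \sum_b (rcoord b u)%:C * real_derive (ebase b) F y =
  h%:C^-1 * ((F (y + x) - F y - \sum_b (rcoord b x)%:C * real_derive (ebase b) F y)
     + \sum_b (rcoord b (x - h%:C *: u))%:C * real_derive (ebase b) F y).
  have -> : y + x = pmap Q (z + h%:C *: v) by rewrite /x addrCA subrr addr0.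
  rewrite linL; have hc : h%:C != 0 :> C by rewrite fmorph_eq0.
  move: (F _) (F _) (\sum_b _) (\sum_b _) => a1 a2 a3 a4; by field.
rewrite cnM -fmorphV cn_real normfV ltr_pdivrMl //.
apply: le_lt_trans (cnD _ _) _.
apply: (@le_lt_trans _ _ (e1 * (`|h| * (nu + 1)) + `|h| * (e / 4))).
  apply: lerD; first by apply: le_trans hF _; rewrite ler_pM2l.
  apply: le_trans (Lb _) _; apply: le_trans (ler_wpM2r LD0 hx) _.
  by rewrite mulrCA -mulrA mulrA -(mulrA `|h|) ler_pM2l // mulrA.
have -> : e1 * (`|h| * (nu + 1)) = `|h| * (e / 2).
  by rewrite /e1; field; rewrite gt_eqF //; lra.
rewrite -mulrDr ltr_pM2l //; lra.
Qed.

(** Two applications of the mean value theorem, along [u] and then along [v]; each costs a factor 2,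
    whence [eps / 4] in the proof. The iterated difference is symmetric in [u] and [v], from which
    [clairaut] follows. *)
Lemma second_difference O F z u v (eps : R) : open O -> smooth_on O F -> O z -> 0 < eps ->
  exists2 d : R, 0 < d & forall s : R, 0 < s -> s < d ->
    cn (F (z + s%:C *: u + s%:C *: v) - F (z + s%:C *: u) - (F (z + s%:C *: v) - F z)
      - (s%:C * s%:C) * real_derive v (real_derive u F) z) <= eps * s * s.
Proof.
move=> oO sF Oz eps0; set l := real_derive v (real_derive u F) z.
have sFu := smooth_on_derive u sF; have sFuv := smooth_on_derive v sFu.
have e40 : 0 < eps / 4 by rewrite divr_gt0.
have [r r0 hr] : exists2 r : R, 0 < r & forall y : V, vn (z - y) < r -> O y /\ cn (real_derive v (real_derive u F) y - l) <= eps / 4.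
  have hn : nbhs l [set w : C | cn (l - w) < eps / 4] by apply/nbhs_cnP; exists (eps / 4).
  have /nbhs_vnP[d1 d10 hd1] := smooth_on_continuous sFuv Oz hn.
  have /nbhs_vnP[d2 d20 hd2] : nbhs z O by exact: open_nbhs_nbhs.
  exists (Num.min d1 d2); first by rewrite lt_min d10.
  move=> y; rewrite lt_min => /andP[h1 h2]; split; first exact: hd2.
  by rewrite cnB; apply: ltW; exact: (hd1 y h1).
have nu0 := vn_ge0 u; have nv0 := vn_ge0 v.
exists (r / (vn u + vn v + 1)); first by rewrite divr_gt0 // ltr_wpDl // addr_ge0.
move=> s s0; rewrite ltr_pdivlMr ?ltr_wpDl ?addr_ge0 // => sr.
have ball (t t' : R) : 0 <= t <= 1 -> 0 <= t' <= 1 -> vn (z - (z + t%:C *: (s%:C *: u) + t'%:C *: (s%:C *: v))) < r.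
  move=> /andP[t0 t1] /andP[t0' t1'].
  rewrite -addrA opprD addrA subrr sub0r vnN; apply: le_lt_trans (vnD _ _) _.
  rewrite !vnZ !cn_real !ger0_norm //; try exact: ltW.
  apply: le_lt_trans sr; rewrite !mulrDr mulr1; apply: ler_wpDr; first exact: ltW.
  apply: lerD; rewrite -[leRHS]mul1r; apply: ler_pM => //; by rewrite mulr_ge0 // ltW.
have -> : eps * s * s = 2 * (2 * (s * (s * (eps / 4)))) by field.
have key := @mean_value (fun y => F (y + s%:C *: v) - F y) z (s%:C *: u) ((s%:C * s%:C) * l) (2 * (s * (s * (eps / 4)))).
apply: key => t t01.
have [Oy _] : O (z + t%:C *: (s%:C *: u)) /\ True.
  by have := hr _ (ball t 0 t01 _); rewrite lexx ler01 scale0r addr0 => /(_ isT)[].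
have [Oy' _] : O (z + t%:C *: (s%:C *: u) + s%:C *: v) /\ True.
  by have := hr _ (ball t 1 t01 _); rewrite lexx ler01 scale1r => /(_ isT)[].
set y := z + t%:C *: (s%:C *: u) in Oy Oy' *.
exists (s%:C * real_derive u F (y + s%:C *: v) + -1 * (s%:C * real_derive u F y)).
  have h1 : has_derive (fun y => F (y + s%:C *: v)) y (s%:C *: u) (s%:C * real_derive u F (y + s%:C *: v)).
    by apply: has_derive_shift; apply: has_derive_scale; exact: smooth_on_has_derive Oy'.
  have h2 : has_derive F y (s%:C *: u) (s%:C * real_derive u F y).
    by apply: has_derive_scale; exact: smooth_on_has_derive Oy.
  have h3 := has_deriveM (has_derive_cst (-1) y (s%:C *: u)) h2; rewrite mul0r add0r in h3.
  have := has_deriveD h1 h3.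
  by congr has_derive; apply/funext => x; rewrite mulN1r.
have -> : s%:C * real_derive u F (y + s%:C *: v) + -1 * (s%:C * real_derive u F y) - s%:C * s%:C * l =
  s%:C * (real_derive u F (y + s%:C *: v) - real_derive u F y - s%:C * l).
  by move: (real_derive u F _) (real_derive u F _) => a b; ring.
rewrite cnM cn_real ger0_norm; last exact: ltW.
rewrite (mulrCA 2) ler_pM2l //.
apply: mean_value => t' t01'.
have [Oyt hyt] := hr _ (ball t t' t01 t01'); rewrite -/y in Oyt hyt.
exists (s%:C * real_derive v (real_derive u F) (y + t'%:C *: (s%:C *: v))).
  by apply: has_derive_scale; exact: smooth_on_has_derive Oyt.
rewrite -mulrBr cnM cn_real ger0_norm; last exact: ltW.
by rewrite ler_pM2l.
Qed.

Lemma clairaut O F z u v : open O -> smooth_on O F -> O z ->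
  real_derive u (real_derive v F) z = real_derive v (real_derive u F) z.
Proof.
move=> oO sF Oz; apply/eqP; rewrite -subr_eq0 -cn_eq0; apply/negPn/negP => n0.
set a := real_derive u _ z in n0 *; set b := real_derive v _ z in n0 *.
have n1 : 0 < cn (a - b) by rewrite lt_def n0 cn_ge0.
have e0 : 0 < cn (a - b) / 4 by rewrite divr_gt0.
have [d d0 hd] := second_difference u v oO sF Oz e0.
have [d' d0' hd'] := second_difference v u oO sF Oz e0.
pose m : R := Num.min d d'; have m0 : 0 < m by rewrite lt_min d0.
pose s : R := m / 2; have s0 : 0 < s by rewrite divr_gt0.
have sm : s < m by rewrite /s; lra.
have [s1 s2] : s < d /\ s < d' by move: sm; rewrite /m lt_min => /andP[].
have h1 := hd s s0 s1; have h2 := hd' s s0 s2; rewrite -/b in h1.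
rewrite -/a (addrAC z (s%:C *: v) (s%:C *: u)) in h2; move: h1 h2.
move: (F (z + _ + _)) (F (z + s%:C *: u)) (F (z + s%:C *: v)) (F z) => p q t r h1 h2.
have X0 : 0 < s * s * cn (a - b) by rewrite !mulr_gt0.
have Xe : cn (a - b) / 4 * s * s = (s * s * cn (a - b)) / 4 by field.
rewrite Xe in h1 h2.
have h3 : cn ((s%:C * s%:C) * (a - b)) <= s * s * cn (a - b) / 4 + s * s * cn (a - b) / 4.
  have -> : (s%:C * s%:C) * (a - b) = (p - q - (t - r) - (s%:C * s%:C) * b) - (p - t - (q - r) - (s%:C * s%:C) * a) by ring.
  apply: le_trans (cnD _ _) _; rewrite cnN; exact: (lerD h1 h2).
rewrite cnM cnM cn_real gtr0_norm // in h3.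
by move: X0 h3; move: (s * s * cn (a - b)); clear => x; lra.
Qed.

Lemma smooth_on_Re O F : open O -> smooth_on O F -> smooth_on O (fun z => (complex.Re (F z))%:C).
Proof.
move=> oO sF; apply: (@smooth_on_eq R k O (fun z => (2^-1 : R)%:C * (F z + conjc (F z)))) => // [z _|].
  case: (F z) => a b; apply/eqP; rewrite eq_complex /=.
  by rewrite subrr !mul0r mulr0 subr0 addr0 eqxx andbT; apply/eqP; field.
apply: smooth_onM => //; first exact: smooth_on_cst.
by apply: smooth_onD => //; exact: smooth_on_conj.
Qed.

Lemma smooth_on_Im O F : open O -> smooth_on O F -> smooth_on O (fun z => (complex.Im (F z))%:C).
Proof.
move=> oO sF; apply: (@smooth_on_eq R k O (fun z => (complex.Re (- 'i%C * F z))%:C)) => // [z _|].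
  by rewrite Re_mulNi.
by apply: smooth_on_Re => //; apply: smooth_onM => //; exact: smooth_on_cst.
Qed.

Lemma smooth_on_rcoord O (f : V -> V) b : open O -> (forall j, smooth_on O (fun z => f z 0 j)) ->
  smooth_on O (fun z => (rcoord b (f z))%:C).
Proof.
move=> oO sf; rewrite /rcoord; case: b => j [] /=; [exact: smooth_on_Im|exact: smooth_on_Re].
Qed.

Lemma smooth_on_jac O Q v j : open O -> smooth_on O (fun z => (v *m jac Q z) 0 j).
Proof.
move=> oO; rewrite (_ : (fun z => _) = fun z => \sum_i v 0 i * meval (z ord0) (mderiv i (Q j))).
  apply: smooth_on_sum => // i _; apply: smooth_onM => //; [exact: smooth_on_cst|exact: smooth_on_meval].
by apply/funext => z; rewrite jac_coord.
Qed.

Lemma generated_sum (S : set (V -> C)) (I : Type) (r : seq I) (F : I -> V -> C) :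
  (forall i, generated S (F i)) -> generated S (fun z => \sum_(i <- r) F i z).
Proof.
move=> gF; elim: r => [|i r IH].
  by rewrite (_ : (fun z => _) = fun=> 0); [exact: GenCst|apply/funext => z; rewrite big_nil].
rewrite (_ : (fun z => _) = fun z => F i z + \sum_(j <- r) F j z); first exact: GenAdd.
by apply/funext => z; rewrite big_cons.
Qed.

(** By the chain rule, the derivatives of a composition with [Q] are combinations of compositions
    with [Q], with smooth coefficients. *)
Lemma smooth_on_pmap O O' Q F : open O -> open O' -> (forall z, O' z -> O (pmap Q z)) -> smooth_on O F ->
  smooth_on O' (fun z => F (pmap Q z)).
Proof.
move=> oO oO' OO sF; pose S G := smooth_on O' G \/ exists2 H, smooth_on O H & G = fun z => H (pmap Q z).
apply: (@smooth_generated _ _ O' S) => //; last by apply: GenBase; right; exists F.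
move=> G [sG|[H sH ->]].
  by apply: smooth_on_class sG => H sH; apply: GenBase; left.
split=> [z Oz|v].
  have cQ : {for z, continuous (pmap Q)} by exact: pmap_continuous.
  by have := continuous_comp cQ (smooth_on_continuous sH (OO z Oz)).
exists (fun z => \sum_b (rcoord b (v *m jac Q z))%:C * real_derive (ebase b) H (pmap Q z)).
  apply: generated_sum => b; apply: GenMul; apply: GenBase.
    by left; apply: smooth_on_rcoord => // j; exact: smooth_on_jac.
  by right; exists (real_derive (ebase b) H) => //; exact: smooth_on_derive.
by move=> z Oz; apply: has_derive_pmap sH _ => //; exact: OO.
Qed.

Definition idpoly (j : 'I_k.+1) : mpoly k.+1 C := mpolyX C (mnm1 j).

Lemma pmap_id (x : V) : pmap idpoly x = x.
Proof. by apply/rowP => j; rewrite mxE mevalXU. Qed.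

Lemma jac_id (x : V) : jac idpoly x = 1%:M.
Proof.
apply/matrixP => i j; rewrite !mxE mderivX mnm1E -mul_mpolyC mevalM mevalC.
have [->|ij] := eqVneq j i; last by rewrite mul0r.
by rewrite mul1r -[X in mnm_sub X _]addm0 addmC addmK mpolyX0 meval1.
Qed.

Lemma real_derive_pmap O Q F z v : open O -> smooth_on O F -> O (pmap Q z) ->
  real_derive v (fun y => F (pmap Q y)) z = real_derive (v *m jac Q z) F (pmap Q z).
Proof.
move=> oO sF Oy; rewrite (has_derive_eq (has_derive_pmap (v := v) oO sF Oy)).
set u := v *m _; set y := pmap Q z.
(* The same formula for the identity map recognises the sum over the real basis as the derivative in
   the direction [u]. *)
have OX : O (pmap idpoly y) by rewrite pmap_id.
have := has_derive_eq (has_derive_pmap (v := u) oO sF OX); rewrite jac_id mulmx1 pmap_id.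
by rewrite (_ : (fun y => F (pmap idpoly y)) = F) //; apply/funext => x; rewrite pmap_id.
Qed.

End TotalDerivative.

(** * Forms and pull-back *)

Section MultilinearExpansion.
Variables (R : realType) (p : nat).
Local Notation C := R[i].
Local Notation V := 'rV[C]_p.

Lemma sum_ffun_recl (A : nmodType) (B : finType) n (G : {ffun 'I_n.+1 -> B} -> A) :
  \sum_f G f = \sum_(b : B) \sum_(g : {ffun 'I_n -> B}) G [ffun i => oapp g b (unlift ord0 i)].
Proof.
rewrite pair_big /=.
rewrite (reindex (fun q : B * {ffun 'I_n -> B} => [ffun i => oapp q.2 q.1 (unlift ord0 i)])) //=.
exists (fun f => (f ord0, [ffun j => f (lift ord0 j)])) => [[b g] _|f _] /=.
  rewrite ffunE unlift_none /=; congr (_, _); apply/ffunP => j; by rewrite !ffunE liftK.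
by apply/ffunP => i; rewrite ffunE; case: unliftP => [j ->|->] //=; rewrite ffunE.
Qed.

Lemma row'_eqP n (X W : 'M[C]_(n, p)) i : row' i X = row' i W <-> forall j, j != i -> row j X = row j W.
Proof.
split=> [h j|h]; last first.
  apply/row_matrixP => j; apply/rowP => a; rewrite !mxE.
  have ji : lift i j != i by rewrite eq_sym neq_lift.
  by have := congr1 (fun x : V => x 0 a) (h _ ji); rewrite !mxE.
rewrite eq_sym => /unlift_some[j' -> _]; apply/rowP => a; rewrite !mxE.
by have := congr1 (fun x : 'M[C]_(n.-1, p) => x j' a) h; rewrite !mxE.
Qed.

(** Linearity over the reals only, as for complex-valued differential forms. *)
Definition multilinear n (Phi : 'M[C]_(n, p) -> C) := forall W X Y (i : 'I_n) (b c : R),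
  row i W = b%:C *: row i X + c%:C *: row i Y -> (forall j, j != i -> row j X = row j W) ->
  (forall j, j != i -> row j Y = row j W) -> Phi W = b%:C * Phi X + c%:C * Phi Y.

Definition upd_row n (W : 'M[C]_(n, p)) i (x : V) : 'M[C]_(n, p) := \matrix_j (if j == i then x else row j W).

Lemma row_upd n (W : 'M[C]_(n, p)) i x j : row j (upd_row W i x) = if j == i then x else row j W.
Proof. by rewrite rowK. Qed.

Lemma upd_row_id n (W : 'M[C]_(n, p)) i : upd_row W i (row i W) = W.
Proof. by apply/row_matrixP => j; rewrite row_upd; case: eqP => [->|]. Qed.

Lemma multilinear_upd n (Phi : 'M[C]_(n, p) -> C) W i (x y : V) (b c : R) : multilinear Phi ->
  Phi (upd_row W i (b%:C *: x + c%:C *: y)) = b%:C * Phi (upd_row W i x) + c%:C * Phi (upd_row W i y).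
Proof. move=> ml; apply: (ml _ _ _ i) => [|j ji|j ji]; rewrite !row_upd ?eqxx // (negPf ji) //. Qed.

Lemma multilinear_upd0 n (Phi : 'M[C]_(n, p) -> C) W i : multilinear Phi -> Phi (upd_row W i 0) = 0.
Proof.
move=> ml; have := multilinear_upd W i 0 0 0 0 ml.
by rewrite !scale0r addr0 => ->; rewrite !mul0r addr0.
Qed.

Lemma multilinear_sum n (Phi : 'M[C]_(n, p) -> C) W i (I : Type) (r : seq I) (c : I -> R) (x : I -> V) : multilinear Phi ->
  Phi (upd_row W i (\sum_(b <- r) (c b)%:C *: x b)) = \sum_(b <- r) (c b)%:C * Phi (upd_row W i (x b)).
Proof.
move=> ml; elim: r => [|b r IH]; first by rewrite !big_nil multilinear_upd0.
rewrite !big_cons -IH; have := multilinear_upd W i (x b) (\sum_(b <- r) (c b)%:C *: x b) (c b) 1 ml.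
by rewrite scale1r mul1r.
Qed.

Lemma multilinear_expand n (Phi : 'M[C]_(n, p) -> C) (B : finType) (c : 'I_n -> B -> R) (x : 'I_n -> B -> V) :
  multilinear Phi -> Phi (\matrix_i \sum_b (c i b)%:C *: x i b) =
  \sum_(f : {ffun 'I_n -> B}) (\prod_i (c i (f i))%:C) * Phi (\matrix_i x i (f i)).
Proof.
elim: n Phi c x => [|n IH] Phi c x ml.
  have e : all_equal_to ([ffun i : 'I_0 => match i with Ordinal m lt => False_rect B (Bool.diff_false_true lt) end] : {ffun 'I_0 -> B}).
    by move=> f; apply/ffunP => -[].
  rewrite (eq_bigr (fun _ => Phi (\matrix_i \sum_b (c i b)%:C *: x i b))); last first.
    by move=> f _; rewrite big_ord0 mul1r; congr Phi; apply/matrixP => -[].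
  by rewrite sumr_const card_ffun card_ord expn0.
pose W := \matrix_i \sum_b (c i b)%:C *: x i b.
rewrite -/W -[W](upd_row_id W ord0) [row ord0 W]rowK multilinear_sum // sum_ffun_recl.
apply: eq_bigr => b _.
pose cons (X : 'M[C]_(n, p)) : 'M[C]_(n.+1, p) := \matrix_i oapp (fun j => row j X) (x ord0 b) (unlift ord0 i).
have lift_cons X j : row (lift ord0 j) (cons X) = row j X by rewrite rowK liftK.
have cons0 X : row ord0 (cons X) = x ord0 b by rewrite rowK unlift_none.
have mlc : multilinear (fun X => Phi (cons X)).
  have consE (X Y : 'M[C]_(n, p)) i : (forall j, j != i -> row j X = row j Y) ->
      forall j, j != lift ord0 i -> row j (cons X) = row j (cons Y).
    move=> XY j; case: (unliftP ord0 j) => [j' ->|->]; last by rewrite !cons0.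
    by rewrite (inj_eq (@lift_inj _ ord0)) !lift_cons; exact: XY.
  move=> Y X Z i b' c' eY eX eZ; apply: (ml _ _ _ (lift ord0 i)); first by rewrite !lift_cons.
    exact: consE.
  exact: consE.
have -> : upd_row W ord0 (x ord0 b) = cons (\matrix_j \sum_b' (c (lift ord0 j) b')%:C *: x (lift ord0 j) b').
  apply/row_matrixP => i; rewrite row_upd; case: (unliftP ord0 i) => [j ->|->].
    by rewrite eq_sym (negPf (neq_lift _ _)) lift_cons !rowK.
  by rewrite eqxx cons0.
rewrite (IH _ (fun j => c (lift ord0 j)) (fun j => x (lift ord0 j)) mlc) mulr_sumr; apply: eq_bigr => g _.
rewrite mulrA big_ord_recl ffunE unlift_none /=; congr (_ * _ * Phi _).
  by apply: eq_bigr => i _; rewrite ffunE liftK.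
apply/row_matrixP => i; rewrite rowK ffunE; case: (unliftP ord0 i) => [j ->|->].
  by rewrite lift_cons rowK /= ?liftK.
by rewrite cons0 ?unlift_none.
Qed.

End MultilinearExpansion.

Section Forms.
Variables (R : realType) (k : nat).
Local Notation C := R[i].
Local Notation V := 'rV[C]_k.+1.
Local Notation nz := ([set z : V | z != 0]).
Implicit Types (Q : 'I_k.+1 -> mpoly k.+1 C).

Lemma open_nz : open nz.
Proof.
rewrite openE => z /= z0; apply/nbhs_vnP; exists (vn z); first by rewrite vn_gt0.
by move=> y; apply: contraTneq => ->; rewrite subr0 ltxx.
Qed.

Lemma smoothP (F : V -> C) : smooth F <-> smooth_on nz F.
Proof. by split=> [sF|[sF]]; [split|]. Qed.

Lemma form_smooth_on n (phi : preform R k n) W : is_form phi -> smooth_on nz (phi^~ W).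
Proof. by move=> h; apply/smoothP; exact: form_smooth. Qed.

Lemma form_multilinearP n (phi : preform R k n) z : is_form phi -> z != 0 -> multilinear (phi z).
Proof.
move=> h z0 W X Y i b c e eX eY; apply: (form_multilinear h z0 e); exact/row'_eqP.
Qed.

Lemma is_formP n (phi : preform R k n) : (forall W, smooth_on nz (phi^~ W)) ->
  (forall z, z != 0 -> multilinear (phi z)) ->
  (forall z W (i j : 'I_n), z != 0 -> i != j -> row i W = row j W -> phi z W = 0) ->
  (forall z W (c : C), z != 0 -> c != 0 -> phi (c *: z) (c *: W) = phi z W) ->
  (forall z W (i : 'I_n) (c : C), z != 0 -> row i W = c *: z -> phi z W = 0) -> is_form phi.
Proof.
move=> h1 h2 h3 h4 h5; split=> // [W|z W X Y i b c z0 e eX eY]; first exact/smoothP.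
by apply: (h2 z z0 _ _ _ i) => //; exact/row'_eqP.
Qed.

Lemma form_add n (c : C) (phi psi : preform R k n) : is_form phi -> is_form psi ->
  is_form (fun z W => c * phi z W + psi z W).
Proof.
move=> hp hq; apply: is_formP => [W|z z0 W X Y i b c' e eX eY|z W i j z0 ij e|z W c' z0 c0|z W i c' z0 e].
- have sc : smooth_on nz (fun=> c) := smooth_on_cst c open_nz.
  have s1 := form_smooth_on W hp; have s2 := form_smooth_on W hq.
  exact: (smooth_onD open_nz (smooth_onM open_nz sc s1) s2).
- rewrite (form_multilinearP hp z0 e eX eY) (form_multilinearP hq z0 e eX eY).
  by move: (phi z X) (phi z Y) (psi z X) (psi z Y) => a1 a2 a3 a4; ring.
- by rewrite (form_alternating hp z0 ij e) (form_alternating hq z0 ij e) mulr0 addr0.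
- by rewrite (form_invariant hp) ?(form_invariant hq).
- by rewrite (form_horizontal hp z0 e) (form_horizontal hq z0 e) mulr0 addr0.
Qed.

Lemma form_zero n : is_form (fun (_ : V) (_ : 'M[C]_(n, k.+1)) => 0).
Proof.
split=> //; last by move=> *; rewrite !mulr0 addr0.
by move=> W; apply/smoothP; exact: smooth_on_cst open_nz.
Qed.

(* A degree-0 form is a smooth function on P^k. *)
Lemma form_scale n (u : V -> C) (phi : preform R k n) : smooth_on nz u ->
  (forall z (c : C), z != 0 -> c != 0 -> u (c *: z) = u z) -> is_form phi -> is_form (fun z W => u z * phi z W).
Proof.
move=> su iu hp; apply: is_formP => [W|z z0 W X Y i b c' e eX eY|z W i j z0 ij e|z W c' z0 c0|z W i c' z0 e].
- exact: (smooth_onM open_nz su (form_smooth_on W hp)).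
- rewrite (form_multilinearP hp z0 e eX eY).
  by move: (phi z X) (phi z Y) (u z) => a1 a2 a3; ring.
- by rewrite (form_alternating hp z0 ij e) mulr0.
- by rewrite (form_invariant hp) // iu.
- by rewrite (form_horizontal hp z0 e) mulr0.
Qed.

Lemma form_sum n (I : Type) (r : seq I) (phi : I -> preform R k n) : (forall i, is_form (phi i)) ->
  is_form (fun z W => \sum_(i <- r) phi i z W).
Proof.
move=> hp; elim: r => [|i r IH].
  by rewrite (_ : (fun z W => _) = fun _ _ => 0); [exact: form_zero|apply/funext => z; apply/funext => W; rewrite big_nil].
rewrite (_ : (fun z W => _) = fun z W => 1 * phi i z W + \sum_(j <- r) phi j z W); first exact: form_add.
by apply/funext => z; apply/funext => W; rewrite big_cons mul1r.
Qed.

Lemma form_conj n (phi : preform R k n) : is_form phi -> is_form (fun z W => conjc (phi z W)).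
Proof.
move=> hp; apply: is_formP => [W|z z0 W X Y i b c' e eX eY|z W i j z0 ij e|z W c' z0 c0|z W i c' z0 e].
- exact: (smooth_on_conj open_nz (form_smooth_on W hp)).
- by rewrite (form_multilinearP hp z0 e eX eY) rmorphD !rmorphM /= !oppr0.
- by rewrite (form_alternating hp z0 ij e) rmorph0.
- by rewrite (form_invariant hp).
- by rewrite (form_horizontal hp z0 e) rmorph0.
Qed.

Lemma form_expand n (phi : preform R k n) z W : is_form phi -> z != 0 ->
  phi z W = \sum_(f : {ffun 'I_n -> 'I_k.+1 * bool})
    (\prod_i (rcoord (f i) (row i W))%:C) * phi z (\matrix_i ebase R (f i)).
Proof.
move=> hp z0; rewrite -(multilinear_expand (fun i b => rcoord b (row i W)) (fun _ b => ebase R b) (form_multilinearP hp z0)).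
by congr (phi z); apply/row_matrixP => i; rewrite rowK -rcoord_sum.
Qed.

(** Expansion along the real basis replaces vectors that depend on [z] by constant ones, for which
    smoothness is part of [is_form]. *)
Lemma form_smooth_comp n (phi : preform R k n) Q (M : V -> 'M[C]_(n, k.+1)) : is_form phi ->
  (forall z, z != 0 -> pmap Q z != 0) -> (forall i j, smooth_on nz (fun z => M z i j)) ->
  smooth_on nz (fun z => phi (pmap Q z) (M z)).
Proof.
move=> hp Q0 sM.
apply: (@smooth_on_eq _ _ _ (fun z => \sum_(f : {ffun 'I_n -> 'I_k.+1 * bool})
    (\prod_i (rcoord (f i) (row i (M z)))%:C) * phi (pmap Q z) (\matrix_i ebase R (f i)))).
- exact: open_nz.
- by move=> z z0; rewrite -form_expand //; exact: Q0.
apply: smooth_on_sum => [|f _]; first exact: open_nz.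
apply: smooth_onM; first exact: open_nz.
  apply: smooth_on_prod => [|i _]; first exact: open_nz.
  apply: smooth_on_rcoord => [|j]; first exact: open_nz.
  by rewrite (_ : (fun z => _) = fun z => M z i j); [exact: sM|apply/funext => z; rewrite mxE].
exact: (smooth_on_pmap open_nz open_nz Q0 (form_smooth_on _ hp)).
Qed.

End Forms.

(** * Alternating sums over permutations *)

Section Alternation.
Variables (R : realType) (p : nat).
Local Notation C := R[i].
Local Notation V := 'rV[C]_p.

(** The alternation without normalisation, for an arbitrary function of [n] vectors; the forms of
    the proof are built in this way from products of kernels. *)
Definition alt n (K : ('I_n -> V) -> C) (W : 'M[C]_(n, p)) : C :=
  \sum_(s : 'S_n) (-1) ^+ s * K (fun i => row (s i) W).

Lemma alt_ext n (K K' : ('I_n -> V) -> C) W : (forall y, K y = K' y) -> alt K W = alt K' W.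
Proof. by move=> KK; apply: eq_bigr => s _; rewrite KK. Qed.

Lemma alt_perm n (K : ('I_n -> V) -> C) (t : 'S_n) W : alt (fun y => K (y \o t)) W = (-1) ^+ t * alt K W.
Proof.
rewrite /alt mulr_sumr [RHS](reindex_inj (mulgI t)) /=; apply: eq_bigr => s _.
rewrite odd_permM signr_addb !mulrA -expr2 sqrr_sign mul1r; congr (_ * K _).
by apply/funext => i; rewrite /= permM.
Qed.

Lemma alt_sum n (I : Type) (r : seq I) (K : I -> ('I_n -> V) -> C) W :
  alt (fun y => \sum_(i <- r) K i y) W = \sum_(i <- r) alt (K i) W.
Proof. by rewrite /alt exchange_big; apply: eq_bigr => s _; rewrite mulr_sumr. Qed.

Lemma alt_scale n (c : C) (K : ('I_n -> V) -> C) W : alt (fun y => c * K y) W = c * alt K W.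
Proof. by rewrite /alt mulr_sumr; apply: eq_bigr => s _; rewrite mulrCA. Qed.

(** The cancellations in the exterior calculus below reduce to this one. *)
Lemma alt_invariant n (K : ('I_n -> V) -> C) (t : 'S_n) W : odd_perm t -> (forall y, K (y \o t) = K y) -> alt K W = 0.
Proof.
move=> ot Kt; have := alt_perm K t W; rewrite (alt_ext _ Kt) ot expr1 mulN1r => /eqP.
by rewrite -addr_eq0 -mulr2n mulrn_eq0 /= => /eqP.
Qed.

Lemma row_row_perm n (t : 'S_n) (X : 'M[C]_(n, p)) i : row i (row_perm t X) = row (t i) X.
Proof. by apply/rowP => a; rewrite !mxE. Qed.

Definition antisymmetric n (Phi : 'M[C]_(n, p) -> C) := forall (s : 'S_n) X, Phi (row_perm s X) = (-1) ^+ s * Phi X.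

Lemma lift_perm_bijective n (a0 : 'I_n.+1) : bijective (fun q : 'I_n.+1 * 'S_n => lift_perm a0 q.1 q.2).
Proof.
apply: inj_card_bij => [[i s] [j t] /= e|]; last by rewrite card_prod !card_ord card_Sn card_Sn factS.
have ij : i = j by have := congr1 (fun u : 'S_n.+1 => u a0) e; rewrite /= !lift_perm_id.
subst j; congr (_, _); apply/perm.permP => a; apply: (@lift_inj _ i).
by rewrite -!(lift_perm_lift a0) e.
Qed.

(** A permutation of [n.+1] elements amounts to the image of the first one and a permutation of the
    others; by antisymmetry the latter contributes [n!] equal terms. This rewrites the formula of
    [ext_derivative] as an alternation. *)
Lemma sum_alt n (Psi : V -> 'M[C]_(n, p) -> C) (W : 'M[C]_(n.+1, p)) : (forall w, antisymmetric (Psi w)) ->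
  \sum_(i < n.+1) (-1) ^+ i * Psi (row i W) (row' i W) =
  (n`!%:R)^-1 * alt (fun y => Psi (y ord0) (\matrix_j y (lift ord0 j))) W.
Proof.
move=> aP; rewrite /alt (reindex _ (onW_bij _ (lift_perm_bijective ord0))) /=.
rewrite -(pair_big xpredT xpredT (fun i s => (-1) ^+ (lift_perm ord0 i s) *
  Psi (row (lift_perm ord0 i s ord0) W) (\matrix_j row (lift_perm ord0 i s (lift ord0 j)) W))) /=.
rewrite mulr_sumr; apply: eq_bigr => i _.
rewrite (eq_bigr (fun _ => (-1) ^+ i * Psi (row i W) (row' i W))) => [|s _].
  set X := (-1) ^+ i * _; rewrite sumr_const card_Sn.
  have -> : X *+ n`! = n`!%:R * X by rewrite mulr_natl.
  by rewrite mulrA mulVf ?mul1r // pnatr_eq0 -lt0n fact_gt0.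
rewrite odd_lift_perm /= signr_addb signr_odd lift_perm_id.
have -> : \matrix_j row (lift_perm ord0 i s (lift ord0 j)) W = row_perm s (row' i W).
  by apply/matrixP => a b; rewrite !mxE lift_perm_lift.
by rewrite aP mulrA -(mulrA ((-1) ^+ i)) -expr2 sqrr_sign mulr1.
Qed.

Lemma alternating_antisymmetric n (Phi : 'M[C]_(n, p) -> C) : multilinear Phi ->
  (forall W (i j : 'I_n), i != j -> row i W = row j W -> Phi W = 0) -> antisymmetric Phi.
Proof.
move=> ml al.
have swap (i j : 'I_n) X : i != j -> Phi (row_perm (tperm i j) X) = - Phi X.
  move=> ij; set x := row i X; set y := row j X.
  pose U a b := upd_row (upd_row X i a) j b.
  have Ui a b : row i (U a b) = a by rewrite !row_upd (negPf ij) eqxx.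
  have Uj a b : row j (U a b) = b by rewrite row_upd eqxx.
  have Uo a b l : l != i -> l != j -> row l (U a b) = row l X by move=> li lj; rewrite !row_upd (negPf li) (negPf lj).
  have l1 a b c : Phi (U (a + b) c) = Phi (U a c) + Phi (U b c).
    rewrite -[Phi (U a c)]mul1r -[Phi (U b c)]mul1r; apply: (ml _ _ _ i 1 1) => [|l li|l li].
    - by rewrite !Ui !scale1r.
    - by have [->|lj] := eqVneq l j; rewrite ?Uj ?Uo.
    - by have [->|lj] := eqVneq l j; rewrite ?Uj ?Uo.
  have l2 a b c : Phi (U a (b + c)) = Phi (U a b) + Phi (U a c).
    rewrite -[Phi (U a b)]mul1r -[Phi (U a c)]mul1r; apply: (ml _ _ _ j 1 1) => [|l lj|l lj].
    - by rewrite !Uj !scale1r.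
    - by have [->|li] := eqVneq l i; rewrite ?Ui ?Uo.
    - by have [->|li] := eqVneq l i; rewrite ?Ui ?Uo.
  have eq0 a : Phi (U a a) = 0 by apply: (al _ i j) => //; rewrite Ui Uj.
  have eX : U x y = X.
    apply/row_matrixP => l; have [->|lj] := eqVneq l j; first by rewrite Uj.
    by have [->|li] := eqVneq l i; rewrite ?Ui ?Uo.
  have eY : U y x = row_perm (tperm i j) X.
    apply/row_matrixP => l; rewrite row_row_perm; case: tpermP => [->|->|/eqP li /eqP lj].
    - by rewrite Ui.
    - by rewrite Uj.
    - by rewrite Uo.
  have := eq0 (x + y); rewrite l1 !l2 !eq0 add0r addr0 eX eY => /eqP.
  by rewrite addr_eq0 => /eqP ->; rewrite opprK.
move=> s; have [ts -> dts] := prod_tpermP s; elim: ts dts => [_ X|t ts IH /= /andP[dt dts] X].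
  by rewrite big_nil odd_perm1 expr0 mul1r row_perm1.
by rewrite big_cons row_permM swap // IH // odd_permM odd_tperm dt signr_addb expr1 mulN1r mulNr.
Qed.

End Alternation.

(** * Pull-back of forms by homogeneous polynomial maps *)

Section Pullback.
Variables (R : realType) (k : nat).
Local Notation C := R[i].
Local Notation V := 'rV[C]_k.+1.
Local Notation nz := ([set z : V | z != 0]).
Implicit Types (Q : 'I_k.+1 -> mpoly k.+1 C).

Lemma form_antisymmetric n (phi : preform R k n) z : is_form phi -> z != 0 -> antisymmetric (phi z).
Proof.
move=> hp z0; apply: alternating_antisymmetric; first exact: form_multilinearP.
by move=> W i j; exact: form_alternating hp _ _ _ _ z0.
Qed.

Lemma euler_homog e (p : mpoly k.+1 C) (x : V) : p \is ishomog1 e mdeg ->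
  \sum_i x 0 i * meval (x ord0) (mderiv i p) = e%:R * meval (x ord0) p.
Proof.
move=> /dhomogP hp.
have -> : \sum_i x 0 i * meval (x ord0) (mderiv i p) =
  \sum_i \sum_(m <- msupp p) mcoeff m p * ((m i)%:R * meval (x ord0) (mpolyX C m)).
  apply: eq_bigr => i _.
  transitivity (x 0 i * meval (x ord0) (mderiv i (\sum_(m <- msupp p) mcoeff m p *: mpolyX C m))); first by rewrite -mpolyE.
  rewrite (linear_sum (mderiv i)) /= raddf_sum mulr_sumr; apply: eq_bigr => m _ /=.
  rewrite mderivZ mderivX scalerA !mevalZ -!mulrA mulrCA; congr (_ * _).
  have [m0|m0] := eqVneq (m i) 0%N; first by rewrite m0 !mul0r mulr0.
  rewrite mulrCA; congr (_ * _).
  have {2}-> : m = mnm_add (mnm1 i) (mnm_sub m (mnm1 i)).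
    by rewrite addmC submK // lep1mP.
  by rewrite mpolyXD mevalM mevalXU.
transitivity (e%:R * meval (x ord0) (\sum_(m <- msupp p) mcoeff m p *: mpolyX C m)); last by rewrite -mpolyE.
rewrite exchange_big raddf_sum mulr_sumr big_seq [RHS]big_seq; apply: eq_bigr => m mp /=.
rewrite mevalZ -mulr_sumr mulrCA; congr (_ * _).
by rewrite -mulr_suml -natr_sum -mdegE; congr (_%:R * _); exact: hp.
Qed.

Lemma mderiv_homog e (p : mpoly k.+1 C) i : p \is ishomog1 e mdeg -> mderiv i p \is ishomog1 e.-1 mdeg.
Proof.
move=> /dhomogP hp; apply/dhomogP => m; rewrite mcoeff_msupp mcoeff_mderiv => h.
have mi : mnm_add m (mnm1 i) \in msupp p by rewrite mcoeff_msupp; apply: contra_neq h => ->; rewrite mul0rn.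
by have := hp _ mi; rewrite /= mdegD mdeg1 addn1 => <-.
Qed.

Lemma jac_homog e Q (c : C) (z : V) : (forall j, Q j \is ishomog1 e mdeg) -> jac Q (c *: z) = c ^+ e.-1 *: jac Q z.
Proof.
move=> hQ; apply/matrixP => i j; rewrite !mxE -(meval_dhomog _ _ (mderiv_homog i (hQ j))).
by apply: meval_eq => l; rewrite mxE.
Qed.

(** Radial vectors go to radial vectors; this is why the pull-back of a horizontal form is
    horizontal. *)
Lemma euler_jac e Q (z : V) : (forall j, Q j \is ishomog1 e mdeg) -> z *m jac Q z = e%:R *: pmap Q z.
Proof. by move=> hQ; apply/rowP => j; rewrite jac_coord (euler_homog _ (hQ j)) !mxE. Qed.

Definition pull Q n (phi : preform R k n) : preform R k n := fun z W => phi (pmap Q z) (W *m jac Q z).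

Lemma nondeg_pmap e Q (z : V) : nondegenerate e Q -> z != 0 -> pmap Q z != 0.
Proof. by move=> [_ _ h] z0; apply: contra_neq z0 => /h. Qed.

Lemma smooth_on_mul_jac Q n (W : 'M[C]_(n, k.+1)) i j : smooth_on nz (fun z => (W *m jac Q z) i j).
Proof.
rewrite (_ : (fun z => _) = fun z => (row i W *m jac Q z) 0 j).
  by apply: smooth_on_jac; exact: open_nz.
by apply/funext => z; rewrite -row_mul [RHS]mxE.
Qed.

Lemma pull_form e Q n (phi : preform R k n) : nondegenerate e Q -> is_form phi -> is_form (pull Q phi).
Proof.
move=> nd hp; have Q0 z := nondeg_pmap (z := z) nd; have hQ := nondeg_homog nd.
apply: is_formP => [W|z z0 W X Y i b c' eW eX eY|z W i j z0 ij eW|z W c' z0 c0|z W i c' z0 eW]; rewrite /pull.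
- by apply: form_smooth_comp => // i j; exact: smooth_on_mul_jac.
- apply: (form_multilinearP hp (Q0 z z0) (i := i)) => [|j ji|j ji].
  + by rewrite !row_mul eW mulmxDl -!scalemxAl.
  + by rewrite !row_mul eX.
  + by rewrite !row_mul eY.
- by apply: (form_alternating hp (Q0 z z0) ij); rewrite !row_mul eW.
- rewrite (pmap_homog hQ) (jac_homog _ _ hQ) -scalemxAl -scalemxAr scalerA -exprS prednK ?(nondeg_gt0 nd) //.
  by rewrite (form_invariant hp) ?Q0 // expf_neq0.
apply: (form_horizontal hp (i := i) (c := c' * e%:R) (Q0 z z0)).
by rewrite row_mul eW -scalemxAl (euler_jac _ hQ) scalerA.
Qed.

Lemma has_derive_sum (I : Type) (r : seq I) (F : I -> V -> C) z v (l : I -> C) :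
  (forall i, has_derive (F i) z v (l i)) -> has_derive (fun y => \sum_(i <- r) F i y) z v (\sum_(i <- r) l i).
Proof.
move=> hF; elim: r => [|i r IH].
  rewrite big_nil (_ : (fun y => _) = fun=> 0); first exact: has_derive_cst.
  by apply/funext => y; rewrite big_nil.
rewrite big_cons (_ : (fun y => _) = fun y => F i y + \sum_(j <- r) F j y); first exact: (has_deriveD (hF i) IH).
by apply/funext => y; rewrite big_cons.
Qed.

Lemma has_derive_prod n (F : 'I_n -> V -> C) z v (l : 'I_n -> C) :
  (forall i, has_derive (F i) z v (l i)) ->
  has_derive (fun y => \prod_i F i y) z v (\sum_j \prod_i (if i == j then l i else F i z)).
Proof.
elim: n F l => [|n IH] F l hF.
  rewrite big_ord0 (_ : (fun y => _) = fun=> 1); first exact: has_derive_cst.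
  by apply/funext => y; rewrite big_ord0.
rewrite (_ : (fun y => _) = fun y => F ord0 y * \prod_i F (lift ord0 i) y); last first.
  by apply/funext => y; rewrite big_ord_recl.
have h := has_deriveM (hF ord0) (IH _ _ (fun i => hF (lift ord0 i))).
suff -> : \sum_j \prod_i (if i == j then l i else F i z) = l ord0 * \prod_(i < n) F (lift ord0 i) z +
    F ord0 z * \sum_(j < n) \prod_(i < n) (if i == j then l (lift ord0 i) else F (lift ord0 i) z) by exact: h.
rewrite big_ord_recl; congr (_ + _).
  by rewrite big_ord_recl eqxx; congr (_ * _); apply: eq_bigr => i _; rewrite eq_sym (negPf (neq_lift _ _)).
rewrite mulr_sumr; apply: eq_bigr => j _; rewrite big_ord_recl (negPf (neq_lift _ _)); congr (_ * _).
Qed.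

Lemma has_derive_meval (p : mpoly k.+1 C) (z v : V) :
  has_derive (fun y : V => meval (y ord0) p) z v (\sum_i v 0 i * meval (z ord0) (mderiv i p)).
Proof.
elim/mpoly_ring_ind: p => [c|i|p q hp hq|p q hp hq].
- rewrite (_ : (fun z => _) = fun=> c); last by apply/funext => y; rewrite mevalC.
  rewrite big1 => [|i _]; first exact: has_derive_cst.
  by rewrite mderivC meval0 mulr0.
- rewrite (_ : (fun z => _) = fun z : V => z 0 i); last by apply/funext => y; rewrite mevalXU.
  suff -> : \sum_i0 v 0 i0 * meval (z ord0) (mderiv i0 (mpolyX C (mnm1 i))) = v 0 i by exact: has_derive_coord.
  by have := jac_coord (@idpoly R k) z v i; rewrite jac_id mulmx1 => ->.
- rewrite (_ : (fun z => _) = fun z : V => meval (z ord0) p + meval (z ord0) q); last first.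
    by apply/funext => y; rewrite mevalD.
  rewrite (eq_bigr (fun i => v 0 i * meval (z ord0) (mderiv i p) + v 0 i * meval (z ord0) (mderiv i q))).
    by rewrite big_split; exact: (has_deriveD hp hq).
  by move=> i _; rewrite mderivD mevalD mulrDr.
rewrite (_ : (fun z => _) = fun z : V => meval (z ord0) p * meval (z ord0) q); last first.
  by apply/funext => y; rewrite mevalM.
rewrite (eq_bigr (fun i => v 0 i * meval (z ord0) (mderiv i p) * meval (z ord0) q +
    meval (z ord0) p * (v 0 i * meval (z ord0) (mderiv i q)))).
  by rewrite big_split /= -mulr_suml -mulr_sumr; exact: (has_deriveM hp hq).
move=> i _; rewrite mderivM mevalD !mevalM.
by move: (meval _ _) (meval _ _) (meval _ _) (meval _ _) (v 0 i) => a1 a2 a3 a4 a5; ring.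
Qed.

Lemma has_derive_rcoord (f : V -> V) z v (l : V) b : (forall j, has_derive (fun y => f y 0 j) z v (l 0 j)) ->
  has_derive (fun y => (rcoord b (f y))%:C) z v (rcoord b l)%:C.
Proof.
move=> hf; have ReE (x : C) : (2^-1 : R)%:C * (x + conjc x) = (complex.Re x)%:C.
  case: x => a c; apply/eqP; rewrite eq_complex /=.
  by rewrite subrr !mul0r mulr0 subr0 addr0 eqxx andbT; apply/eqP; field.
have hRe (F : V -> C) (m : C) : has_derive F z v m -> has_derive (fun y => (complex.Re (F y))%:C) z v (complex.Re m)%:C.
  move=> hF; rewrite -ReE (_ : (fun y => _) = fun y => (2^-1 : R)%:C * (F y + conjc (F y))); last first.
    by apply/funext => y; rewrite ReE.
  have := has_deriveM (has_derive_cst (2^-1 : R)%:C z v) (has_deriveD hF (has_derive_conj hF)).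
  by rewrite mul0r add0r.
rewrite /rcoord; case: b => j [] /=; last exact: hRe.
rewrite -Re_mulNi (_ : (fun y => _) = fun y => (complex.Re (- 'i%C * f y 0 j))%:C); last first.
  by apply/funext => y; rewrite Re_mulNi.
by apply: hRe; have := has_deriveM (has_derive_cst (- 'i%C) z v) (hf j); rewrite mul0r add0r.
Qed.

Lemma multilinear_real_derive n (phi : preform R k n) z w : is_form phi -> z != 0 ->
  multilinear (fun X => real_derive w (phi^~ X) z).
Proof.
move=> hp z0 W X Y i b c eW eX eY.
have hX := smooth_on_has_derive (v := w) (form_smooth_on X hp) z0.
have hY := smooth_on_has_derive (v := w) (form_smooth_on Y hp) z0.
have h1 := has_deriveD (has_deriveM (has_derive_cst b%:C z w) hX) (has_deriveM (has_derive_cst c%:C z w) hY).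
rewrite !mul0r !add0r in h1; apply: has_derive_eq; apply: has_derive_local h1.
by apply: (open_near (@open_nz R k) z0) => y y0; rewrite (form_multilinearP hp y0 eW eX eY).
Qed.

(** Differentiating the expansion along the real basis separates the variation of the base point
    from that of each row. *)
Lemma has_derive_form_comp n (phi : preform R k n) Q (M : V -> 'M[C]_(n, k.+1)) (M' : 'M[C]_(n, k.+1)) z w :
  is_form phi -> (forall z, z != 0 -> pmap Q z != 0) -> z != 0 ->
  (forall i j, has_derive (fun y => M y i j) z w (M' i j)) ->
  has_derive (fun y => phi (pmap Q y) (M y)) z w (real_derive (w *m jac Q z) (phi^~ (M z)) (pmap Q z) +
    \sum_j phi (pmap Q z) (upd_row (M z) j (row j M'))).
Proof.
move=> hp Q0 z0 hM; have y0 := Q0 z z0.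
pose E (f : {ffun 'I_n -> 'I_k.+1 * bool}) : 'M[C]_(n, k.+1) := \matrix_i ebase R (f i).
have hr (f : {ffun 'I_n -> 'I_k.+1 * bool}) i : has_derive (fun y => (rcoord (f i) (row i (M y)))%:C) z w (rcoord (f i) (row i M'))%:C.
  apply: has_derive_rcoord => j; rewrite mxE.
  by rewrite (_ : (fun y => _) = fun y => M y i j) //; apply/funext => y; rewrite mxE.
have hphi (f : {ffun 'I_n -> 'I_k.+1 * bool}) : has_derive (fun y => phi (pmap Q y) (E f)) z w (real_derive (w *m jac Q z) (phi^~ (E f)) (pmap Q z)).
  have sE := form_smooth_on (E f) hp.
  rewrite -(real_derive_pmap w (@open_nz R k) sE y0).
  exact: smooth_on_has_derive (smooth_on_pmap (@open_nz R k) (@open_nz R k) Q0 sE) z0.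
have h := has_derive_sum (r := index_enum _) (fun f : {ffun 'I_n -> 'I_k.+1 * bool} => has_deriveM (has_derive_prod (hr f)) (hphi f)).
have near_eq : \forall y \near nbhs z, \sum_(f : {ffun 'I_n -> 'I_k.+1 * bool}) (\prod_i (rcoord (f i) (row i (M y)))%:C) * phi (pmap Q y) (E f) = phi (pmap Q y) (M y).
  by apply: (open_near (@open_nz R k) z0) => y yn; rewrite -form_expand //; exact: Q0.
have := has_derive_local near_eq h; congr has_derive.
rewrite big_split /= addrC; congr (_ + _).
  rewrite -(multilinear_expand (fun i b => rcoord b (row i (M z))) (fun _ b => ebase R b) (multilinear_real_derive (w *m jac Q z) hp y0)).
  have -> : \matrix_i \sum_b (rcoord b (row i (M z)))%:C *: ebase R b = M z.
    by apply/row_matrixP => i; rewrite rowK -rcoord_sum.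
  by [].
under eq_bigr => f _ do rewrite mulr_suml.
rewrite exchange_big; apply: eq_bigr => j _ /=.
rewrite (form_expand (upd_row (M z) j (row j M')) hp y0); apply: eq_bigr => f _; congr (_ * _).
by apply: eq_bigr => i _; rewrite row_upd; case: eqP => [->|].
Qed.

Definition hess Q (z v x : V) : V := \row_a \sum_b \sum_c v 0 c * x 0 b * meval (z ord0) (mderiv c (mderiv b (Q a))).

Lemma hessC Q z v x : hess Q z v x = hess Q z x v.
Proof.
apply/rowP => a; rewrite !mxE exchange_big; apply: eq_bigr => b _; apply: eq_bigr => c _.
by rewrite mderiv_comm (mulrC (v 0 b)).
Qed.

Lemma has_derive_mul_jac n Q (X : 'M[C]_(n, k.+1)) z w i j :
  has_derive (fun y => (X *m jac Q y) i j) z w ((\matrix_l hess Q z w (row l X)) i j).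
Proof.
rewrite !mxE (_ : (fun y => _) = fun y : V => \sum_b X i b * meval (y ord0) (mderiv b (Q j))); last first.
  by apply/funext => y; rewrite mxE; apply: eq_bigr => b _; rewrite !mxE.
apply: has_derive_sum => b.
have := has_deriveM (has_derive_cst (X i b) z w) (@has_derive_meval (mderiv b (Q j)) z w).
rewrite mul0r add0r mulr_sumr; congr has_derive; apply: eq_bigr => c _.
by rewrite mxE mulrCA mulrA.
Qed.

(** Besides the pull-back of the derivative there appear terms with a second derivative of [Q] in
    one row. They are symmetric in the two vectors concerned and disappear by alternation. *)
Lemma ext_derivative_pull e Q n (phi : preform R k n) z W : nondegenerate e Q -> is_form phi -> z != 0 ->
  ext_derivative (pull Q phi) z W = pull Q (ext_derivative phi) z W.
Proof.
move=> nd hp z0; have Q0 y := nondeg_pmap (z := y) nd; have y0 := Q0 z z0.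
pose S (u : V) (X : 'M[C]_(n, k.+1)) := \sum_j phi (pmap Q z) (upd_row (X *m jac Q z) j (hess Q z u (row j X))).
have dE w X : real_derive w ((pull Q phi)^~ X) z = real_derive (w *m jac Q z) (phi^~ (X *m jac Q z)) (pmap Q z) + S w X.
  apply: has_derive_eq; have := has_derive_form_comp hp Q0 z0 (@has_derive_mul_jac n Q X z w).
  by congr has_derive; congr (_ + _); apply: eq_bigr => j _; rewrite rowK.
rewrite /ext_derivative /pull /ext_derivative; under eq_bigr => i _ do rewrite dE mulrDr.
rewrite big_split /= -[RHS]addr0; congr (_ + _).
  apply: eq_bigr => i _; rewrite row_mul; congr (_ * real_derive _ (phi^~ _) _).
  by rewrite !row'Esub mul_rowsub_mx.
have aS w : antisymmetric (S w).
  move=> s X; rewrite /S mulr_sumr [RHS](reindex_inj (@perm_inj _ s)); apply: eq_bigr => j _.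
  rewrite -(form_antisymmetric hp y0); congr (phi _); apply/row_matrixP => l.
  rewrite [RHS]row_row_perm !row_upd (inj_eq (@perm_inj _ s)); case: eqP => _; first by rewrite row_row_perm.
  by rewrite !row_mul row_row_perm.
rewrite (sum_alt W aS) /S alt_sum big1 ?mulr0 // => j _.
apply: (alt_invariant (t := tperm ord0 (lift ord0 j))); first by rewrite odd_tperm neq_lift.
move=> y; rewrite /= tpermL rowK; congr (phi _); rewrite rowK tpermR hessC.
apply/row_matrixP => l; rewrite !row_upd; case: eqP => // /eqP lj.
rewrite !row_mul !rowK /= tpermD // ?neq_lift // (inj_eq (@lift_inj _ ord0)) eq_sym.
exact: lj.
Qed.

End Pullback.

(** * Standard positive forms *)

Section StandardForms.
Variables (R : realType) (k : nat).
Local Notation C := R[i].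
Local Notation V := 'rV[C]_k.+1.
Local Notation nz := ([set z : V | z != 0]).

Definition herm (v w : V) : C := \sum_a v 0 a * conjc (w 0 a).

Lemma herm_conj v w : conjc (herm v w) = herm w v.
Proof. by rewrite /herm rmorph_sum; apply: eq_bigr => a _; case: (v 0 a) (w 0 a) => x1 x2 [y1 y2]; apply/eqP; rewrite eq_complex /=; apply/andP; split; apply/eqP; ring. Qed.

Lemma hermZl (c : C) v w : herm (c *: v) w = c * herm v w.
Proof. by rewrite mulr_sumr; apply: eq_bigr => a _; rewrite mxE mulrA. Qed.

Lemma hermZr (c : C) v w : herm v (c *: w) = conjc c * herm v w.
Proof. by rewrite mulr_sumr; apply: eq_bigr => a _; rewrite mxE rmorphM mulrCA. Qed.

Lemma hermBl u v w : herm (u - v) w = herm u w - herm v w.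
Proof. by rewrite -sumrB; apply: eq_bigr => a _; rewrite !mxE mulrBl. Qed.

Lemma hermBr u v w : herm w (u - v) = herm w u - herm w v.
Proof. by rewrite -sumrB; apply: eq_bigr => a _; rewrite !mxE rmorphB mulrBr. Qed.

Lemma mul_conjc (x : C) : x * conjc x = (cn x ^+ 2)%:C.
Proof.
by rewrite rmorphXn /= -cnE sqr_normc.
Qed.

(** The square of the Euclidean norm, since the sup norm [vn] is not smooth. *)
Definition nsq (z : V) : R := \sum_a cn (z 0 a) ^+ 2.

Lemma herm_nsq z : herm z z = (nsq z)%:C.
Proof. by rewrite /herm rmorph_sum; apply: eq_bigr => a _; rewrite mul_conjc. Qed.

Lemma nsq_gt0 z : z != 0 -> 0 < nsq z.
Proof.
move=> z0; have h a : 0 <= cn (z 0 a) ^+ 2 by rewrite exprn_ge0 // cn_ge0.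
rewrite lt_def sumr_ge0 // andbT; apply: contra z0; rewrite psumr_eq0 // => /allP h0.
apply/eqP/rowP => a; rewrite mxE; apply/eqP; rewrite -cn_eq0.
by have := h0 a (mem_index_enum _); rewrite sqrf_eq0.
Qed.

Lemma nsq_neq0 z : z != 0 -> (nsq z)%:C != 0 :> C.
Proof. by move=> /nsq_gt0 h; rewrite fmorph_eq0 gt_eqF. Qed.

Lemma nsqZ (c : C) z : (nsq (c *: z))%:C = c * conjc c * (nsq z)%:C.
Proof. by rewrite -!herm_nsq hermZl hermZr mulrA. Qed.

Lemma nsq_le z : nsq z <= k.+1%:R * vn z ^+ 2.
Proof.
rewrite /nsq; apply: (@le_trans _ _ (\sum_(a < k.+1) vn z ^+ 2)).
  by apply: ler_sum => a _; apply: lerXn2r; rewrite ?nnegrE ?cn_ge0 ?vn_ge0 ?vn_coord.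
by rewrite sumr_const card_ord mulr_natl.
Qed.

(* The orthogonal projection along [z], acting on row vectors *)
Definition hproj (z : V) : 'M[C]_k.+1 := 1%:M - ((nsq z)%:C)^-1 *: ((map_mx conjc z)^T *m z).

Lemma mul_hproj (w z : V) : w *m hproj z = w - (herm w z / (nsq z)%:C) *: z.
Proof.
rewrite mulmxBr mulmx1 -scalemxAr mulmxA mulrC -scalerA; congr (_ - _ *: _).
have -> : w *m (map_mx conjc z)^T = (herm w z)%:M.
  by apply/matrixP => i j; rewrite !ord1 !mxE eqxx mulr1n; apply: eq_bigr => a _; rewrite !mxE.
by rewrite mul_scalar_mx.
Qed.

Lemma hproj_self z : z != 0 -> z *m hproj z = 0.
Proof. by move=> z0; rewrite mul_hproj herm_nsq divff ?nsq_neq0 // scale1r subrr. Qed.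

#[local] Opaque hproj nsq herm.

Lemma mul_hprojZ (c : C) (w z : V) : c != 0 -> w *m hproj (c *: z) = w *m hproj z.
Proof.
move=> c0; have cc : conjc c != 0 by rewrite conjc_eq0.
have e1 := mul_hproj w (c *: z); have e2 := mul_hproj w z.
refine (etrans e1 (etrans _ (esym e2))); congr (w - _); rewrite (scalerA _ c z); congr (_ *: z).
rewrite (hermZr c w z) (nsqZ c z) (invfM (c * _)) (invfM c).
move: (herm _ _) ((nsq z)%:C)^-1 => x y.
transitivity (x * y * (c * c^-1) * (conjc c * (conjc c)^-1)); last by rewrite (mulfV c0) (mulfV cc) !mulr1.
by move: (c^-1) (conjc c)^-1 (conjc c) => c1 c2 c3; ring.
Qed.

Lemma hprojZ (c : C) (z : V) : c != 0 -> hproj (c *: z) = hproj z.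
Proof.
move=> c0; apply/row_matrixP => a.
exact: etrans (rowE a _) (etrans (mul_hprojZ (delta_mx 0 a) z c0) (esym (rowE a _))).
Qed.

Lemma smooth_on_nsq : smooth_on nz (fun z => (nsq z)%:C).
Proof.
rewrite (_ : (fun z => _) = fun z : V => \sum_a z 0 a * conjc (z 0 a)); last first.
  by apply/funext => z; rewrite -herm_nsq.
apply: smooth_on_sum (@open_nz R k) _ => a _.
have sa := smooth_on_coord a (@open_nz R k).
exact: (smooth_onM (@open_nz R k) sa (smooth_on_conj (@open_nz R k) sa)).
Qed.

Lemma smooth_on_nsqV : smooth_on nz (fun z => ((nsq z)%:C)^-1).
Proof. exact: (smooth_on_inv (@open_nz R k) nsq_neq0 smooth_on_nsq). Qed.

Lemma smooth_on_herm (w : V) : smooth_on nz (herm w).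
Proof.
rewrite (_ : herm w = fun z : V => \sum_a w 0 a * conjc (z 0 a)) //.
apply: smooth_on_sum (@open_nz R k) _ => a _.
have sa := smooth_on_coord a (@open_nz R k).
exact: (smooth_onM (@open_nz R k) (smooth_on_cst _ (@open_nz R k)) (smooth_on_conj (@open_nz R k) sa)).
Qed.

Lemma smooth_on_hproj m (W : 'M[C]_(m, k.+1)) i j : smooth_on nz (fun z => (W *m hproj z) i j).
Proof.
rewrite (_ : (fun z => _) = fun z : V => row i W 0 j + -1 * (herm (row i W) z * ((nsq z)%:C)^-1 * z 0 j)); last first.
  apply/funext => z; have -> : (W *m hproj z) i j = (row i W *m hproj z) 0 j by rewrite -row_mul [RHS]mxE.
  by rewrite mul_hproj !mxE mulN1r.
have o := @open_nz R k; have sa := smooth_on_coord j o.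
have s1 := smooth_onM o (smooth_onM o (smooth_on_herm (row i W)) smooth_on_nsqV) sa.
exact: (smooth_onD o (smooth_on_cst (row i W 0 j) o) (smooth_onM o (smooth_on_cst (-1) o) s1)).
Qed.

Lemma smooth_on_det m (A : V -> 'M[C]_m) : (forall i j, smooth_on nz (fun z => A z i j)) -> smooth_on nz (fun z => \det (A z)).
Proof.
move=> sA; apply: smooth_on_sum (@open_nz R k) _ => s _.
apply: smooth_onM (@open_nz R k) (smooth_on_cst _ (@open_nz R k)) _.
by apply: smooth_on_prod (@open_nz R k) _ => i _; exact: sA.
Qed.

Variable l : nat.

Definition wedge_mx (P P' : 'M[C]_(k.+1, l)) (z : V) (W : 'M[C]_(l + l, k.+1)) : 'M[C]_(l + l) :=
  row_mx (W *m hproj z *m P) (map_mx conjc (W *m hproj z *m P')).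

(* Up to the factor [i^(l^2) |z|^(-2l)], the form
   P_1 /\ ... /\ P_l /\ conj P'_1 /\ ... /\ conj P'_l on the projected vectors *)
Definition wedge (P P' : 'M[C]_(k.+1, l)) : preform R k (l + l) := fun z W =>
  'i%C ^+ (l ^ 2) * ((nsq z)%:C)^-1 ^+ l * \det (wedge_mx P P' z W).

Definition kernel (P P' : 'M[C]_(k.+1, l)) z (j : 'I_l) (v w : V) : C :=
  (v *m hproj z *m P) 0 j * conjc ((w *m hproj z *m P') 0 j).

(** A product of kernels. The first [l] vectors fill the linear slots and the last [l] the conjugate
    linear ones, vector [j] being paired with vector [l + j]. *)
Definition pairs (h : 'I_l -> V -> V -> C) (y : 'I_(l + l) -> V) : C :=
  \prod_j h j (y (lshift l j)) (y (rshift l j)).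

Lemma wedge_alt P P' z W : wedge P P' z W =
  'i%C ^+ (l ^ 2) * ((nsq z)%:C)^-1 ^+ l * alt (pairs (kernel P P' z)) W.
Proof.
rewrite /wedge /wedge_mx; congr (_ * _); rewrite -det_tr /alt; apply: eq_bigr => s _; congr (_ * _).
rewrite big_split_ord /= -big_split /=; apply: eq_bigr => j _; rewrite /kernel.
have e1 (x : 'I_(l + l)) : (W *m hproj z *m P) x j = (row x W *m hproj z *m P) 0 j by rewrite -!row_mul [RHS]mxE.
have e2 (x : 'I_(l + l)) : (W *m hproj z *m P') x j = (row x W *m hproj z *m P') 0 j by rewrite -!row_mul [RHS]mxE.
by rewrite ![_^T _ _]mxE row_mxEl row_mxEr [map_mx _ _ _ _]mxE e1 e2.
Qed.

Lemma row_wedge_mx P P' z W i :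
  row i (wedge_mx P P' z W) = row_mx (row i W *m hproj z *m P) (map_mx conjc (row i W *m hproj z *m P')).
Proof. by rewrite /wedge_mx row_row_mx -map_row !row_mul. Qed.

Lemma row_wedge_mxD P P' z W X Y i (b c : R) : row i W = b%:C *: row i X + c%:C *: row i Y ->
  row i (wedge_mx P P' z W) = b%:C *: row i (wedge_mx P P' z X) + c%:C *: row i (wedge_mx P P' z Y).
Proof.
move=> eW; have e (B : 'M[C]_(k.+1, l)) : row i W *m hproj z *m B = b%:C *: (row i X *m hproj z *m B) + c%:C *: (row i Y *m hproj z *m B).
  by rewrite eW mulmxDl mulmxDl -!scalemxAl.
rewrite !row_wedge_mx (e P) (e P') scale_row_mx scale_row_mx add_row_mx; congr row_mx.
by rewrite map_mxD map_mxZ map_mxZ /= !oppr0.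
Qed.

Lemma wedge_mxZ P P' (z : V) W (c : C) : c != 0 ->
  wedge_mx P P' (c *: z) (c *: W) = wedge_mx P P' z W *m block_mx c%:M 0 0 (conjc c)%:M.
Proof.
move=> c0; rewrite /wedge_mx mul_row_block !mulmx0 addr0 add0r !mul_mx_scalar (hprojZ z c0).
congr row_mx; first by rewrite -scalemxAl -scalemxAl.
by rewrite -map_mxZ -scalemxAl -scalemxAl.
Qed.

Lemma wedge_form P P' : is_form (wedge P P').
Proof.
apply: is_formP => [W|z z0 W X Y i b c eW eX eY|z W i j z0 ij eW|z W c z0 c0|z W i c z0 eW]; rewrite /wedge.
- have o := @open_nz R k.
  have s1 : smooth_on nz (fun z => ((nsq z)%:C)^-1 ^+ l).
    rewrite (_ : (fun z => _) = fun z => \prod_(i < l) ((nsq z)%:C)^-1); last by apply/funext => z; rewrite prodr_const card_ord.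
    by apply: smooth_on_prod => [|i _]; [exact: (@open_nz R k)|]; exact: smooth_on_nsqV.
  have sP (B : 'M[C]_(k.+1, l)) i j : smooth_on nz (fun z => (W *m hproj z *m B) i j).
    rewrite (_ : (fun z => _) = fun z => \sum_a (W *m hproj z) i a * B a j); last by apply/funext => z; rewrite mxE.
    apply: smooth_on_sum => [|a _]; [exact: (@open_nz R k)|]; exact: (smooth_onM (@open_nz R k) (smooth_on_hproj W i a) (smooth_on_cst _ (@open_nz R k))).
  have s2 : smooth_on nz (fun z => \det (wedge_mx P P' z W)).
    apply: smooth_on_det => i j; rewrite /wedge_mx; case: (split_ordP j) => j' ->.
      by rewrite (_ : (fun z => _) = fun z => (W *m hproj z *m P) i j') //; apply/funext => z; rewrite row_mxEl.
    rewrite (_ : (fun z => _) = fun z => conjc ((W *m hproj z *m P') i j')); first exact: (smooth_on_conj (@open_nz R k) (sP P' i j')).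
    by apply/funext => z; rewrite row_mxEr mxE.
  exact: (smooth_onM o (smooth_onM o (smooth_on_cst _ o) s1) s2).
- have r' Z : (forall j, j != i -> row j Z = row j W) -> row' i (wedge_mx P P' z Z) = row' i (wedge_mx P P' z W).
    by move=> eZ; apply/row'_eqP => j ji; rewrite !row_wedge_mx eZ.
  have e := determinant_multilinear (row_wedge_mxD P P' z eW) (r' X eX) (r' Y eY).
  rewrite e; move: (\det _) (\det _) ('i%C ^+ _) (_ ^+ l) => a1 a2 a3 a4; ring.
- suff -> : \det (wedge_mx P P' z W) = 0 by rewrite mulr0.
  apply: (determinant_alternate ij) => a.
  have := congr1 (fun x : 'rV_(l + l) => x 0 a) (row_wedge_mx P P' z W i).
  have := congr1 (fun x : 'rV_(l + l) => x 0 a) (row_wedge_mx P P' z W j).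
  by rewrite eW ![(row _ _) 0 a]mxE => -> ->.
(* Rescaling multiplies the determinant by [|c|^(2l)], which the power of [nsq] compensates. *)
- have en := nsqZ c z; rewrite (wedge_mxZ P P' z W c0) en det_mulmx det_ublock !det_scalar.
  rewrite (invfM (c * _)) (invfM c) !exprMn.
  have cc : conjc c != 0 by rewrite conjc_eq0.
  have e1 : c^-1 ^+ l * c ^+ l = 1 by rewrite -exprMn mulVf // expr1n.
  have e2 : (conjc c)^-1 ^+ l * conjc c ^+ l = 1 by rewrite -exprMn mulVf // expr1n.
  move: e1 e2; move: (c^-1 ^+ l) (c ^+ l) ((conjc c)^-1 ^+ l) (conjc c ^+ l) (\det _) ('i%C ^+ _) ((nsq z)%:C^-1 ^+ l).
  move=> a1 a2 a3 a4 a5 a6 a7 e1 e2.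
  have -> : a6 * (a1 * a3 * a7) * (a5 * (a2 * a4)) = a6 * a7 * a5 * (a1 * a2) * (a3 * a4) by ring.
  by rewrite e1 e2 !mulr1.
suff -> : \det (wedge_mx P P' z W) = 0 by rewrite mulr0.
have A0 : row i (wedge_mx P P' z W) = 0.
  by rewrite row_wedge_mx eW -scalemxAl hproj_self // scaler0 !mul0mx map_mx0 row_mx0.
have := @determinant_multilinear _ _ (wedge_mx P P' z W) (wedge_mx P P' z W) (wedge_mx P P' z W) i 0 0.
by rewrite !mul0r addr0; apply => //; rewrite A0 !scaler0 addr0.
Qed.

(** The matrices [hproj z *m P i] kill [z], and the power of [nsq] is absorbed by the nonnegative
    coefficients. *)
Lemma wedge_positive (I : finType) (c : I -> R) (P : I -> 'M[C]_(k.+1, l)) (phi : preform R k (l + l)) z : z != 0 ->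
  (forall i, 0 <= c i) -> (forall W, phi z W = \sum_i (c i)%:C * wedge (P i) (P i) z W) ->
  exists (N : nat) (c : 'I_N -> R) (A : 'I_N -> 'M[C]_(k.+1, l)),
  [/\ forall s, 0 <= c s, forall s, z *m A s = 0 &
      forall W, phi z W = \sum_(s < N) (c s)%:C *
        ('i%C ^+ (l ^ 2) * \det (row_mx (W *m A s) (map_mx conjc (W *m A s))))].
Proof.
move=> z0 c0 hphi.
exists #|I|, (fun s => c (enum_val s) * (nsq z)^-1 ^+ l), (fun s => hproj z *m P (enum_val s)); split.
- by move=> s; rewrite mulr_ge0 // exprn_ge0 // invr_ge0 ltW // nsq_gt0.
- by move=> s; rewrite mulmxA hproj_self // mul0mx.
move=> W; rewrite hphi (reindex (@enum_val _ I)) /=; last by apply: onW_bij; exact: enum_val_bij.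
apply: eq_bigr => s _; rewrite /wedge /wedge_mx mulmxA rmorphM rmorphXn /= fmorphV.
by move: (\det _) ('i%C ^+ _) (_ ^+ l) => a1 a2 a3; ring.
Qed.

Definition unit_cols (a : {ffun 'I_l -> 'I_k.+1}) : 'M[C]_(k.+1, l) := \matrix_(i, j) (i == a j)%:R.

(** Up to a constant factor, the [l]-th power of the Fubini-Study form, as a sum over all choices of
    [l] coordinates, repetitions allowed. *)
Definition Theta : preform R k (l + l) := fun z W => \sum_a wedge (unit_cols a) (unit_cols a) z W.

Lemma Theta_form : is_form Theta.
Proof. by apply: form_sum => a; exact: wedge_form. Qed.

(** The Hermitian form of the Fubini-Study metric, that is, the Levi form of log |z|^2. *)
Definition hermH (z v w : V) : C := herm (v *m hproj z) (w *m hproj z) / (nsq z)%:C.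

Lemma mul_unit_cols a m (X : 'M[C]_(m, k.+1)) i j : (X *m unit_cols a) i j = X i (a j).
Proof.
have u x : unit_cols a x j = (x == a j)%:R by rewrite mxE.
rewrite mxE (bigD1 (a j)) //= u eqxx mulr1 big1 ?addr0 // => x xa.
by rewrite u (negPf xa) mulr0.
Qed.

(** A product of [l] sums defining [herm] expands into a sum over the maps [a], one for each term of
    [Theta]. *)
Lemma Theta_alt z W : Theta z W = 'i%C ^+ (l ^ 2) * alt (pairs (fun _ => hermH z)) W.
Proof.
rewrite /Theta (eq_bigr _ (fun a _ => wedge_alt (unit_cols a) (unit_cols a) z W)) -mulr_sumr -mulrA; congr (_ * _).
rewrite -alt_sum -alt_scale; apply: alt_ext => y.
have -> : pairs (fun _ => hermH z) y = ((nsq z)%:C)^-1 ^+ l *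
    \prod_(j < l) herm (y (lshift l j) *m hproj z) (y (rshift l j) *m hproj z).
  rewrite /pairs /hermH big_split /= mulrC; congr (_ * _).
  by rewrite prodr_const card_ord.
congr (_ * _); with_strategy transparent [herm] rewrite /herm; rewrite bigA_distr_bigA /=; apply: eq_bigr => a _; apply: eq_bigr => j _; rewrite /kernel.
by rewrite !mul_unit_cols.
Qed.

End StandardForms.

(** * Domination by the standard form *)

Section TypeDecomposition.
Variables (R : realType) (k : nat).
Local Notation C := R[i].
Local Notation V := 'rV[C]_k.+1.
Local Notation nz := ([set z : V | z != 0]).

Definition tw (g : bool) (x : C) : C := if g then x else conjc x.
Definition unitb (e : bool) : C := if e then 'i%C else 1.
(** The coefficients in [(phi(v) - i phi(i v)) / 2] and [(phi(v) + i phi(i v)) / 2], the complex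
    linear part ([g] true) and the conjugate linear part ([g] false) of a real linear map; [e] tells
    whether the vector is multiplied by [i]. *)
Definition kap (e g : bool) : C := (2^-1 : R)%:C * (if e then (if g then - 'i%C else 'i%C) else 1).
Definition reim (x : C) (d : bool) : R := if d then complex.Im x else complex.Re x.

Lemma reim_sum x : x = \sum_d (reim x d)%:C * unitb d.
Proof. by rewrite big_bool /=; case: x => a b; apply/eqP; rewrite eq_complex /=; apply/andP; split; apply/eqP; ring. Qed.

Lemma kap_reim g d c : \sum_e kap e g * (reim (unitb e * c) d)%:C = tw g c * kap d g.
Proof.
rewrite big_bool /kap; move: (2^-1 : R) => h; case: c => a b.
by case: g; case: d; apply/eqP; rewrite eq_complex /=; apply/andP; split; apply/eqP; ring.
Qed.

Lemma sum_kap e : \sum_g kap e g = (~~ e)%:R.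
Proof.
rewrite big_bool /= /kap -mulrDr; case: e => /=; first by rewrite addNr mulr0.
by apply/eqP; rewrite eq_complex /=; apply/andP; split; apply/eqP; field.
Qed.

Lemma cn_kap e g : cn (kap e g) = 2^-1.
Proof.
rewrite /kap cnM cn_real ger0_norm ?invr_ge0 ?ler0n //.
by case: e; case: g; rewrite ?cnN ?cn_i ?cn1 mulr1.
Qed.

Lemma cn_unitb e : cn (unitb e) = 1.
Proof. by case: e; rewrite ?cn_i ?cn1. Qed.

Variable n : nat.
Implicit Types (phi : preform R k n) (g : {ffun 'I_n -> bool}).

Definition turn (e : {ffun 'I_n -> bool}) (W : 'M[C]_(n, k.+1)) : 'M[C]_(n, k.+1) := \matrix_i (unitb (e i) *: row i W).

(* The part of [phi] that is complex linear in the rows marked true and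
   conjugate linear in the others *)
Definition typed g phi : preform R k n := fun z W =>
  \sum_(e : {ffun 'I_n -> bool}) (\prod_i kap (e i) (g i)) * phi z (turn e W).

Lemma typed_sum phi z W : phi z W = \sum_g typed g phi z W.
Proof.
rewrite exchange_big /=.
have h (e : {ffun 'I_n -> bool}) : \sum_(g : {ffun 'I_n -> bool}) (\prod_i kap (e i) (g i)) * phi z (turn e W) = (e == [ffun=> false])%:R * phi z (turn e W).
  rewrite -mulr_suml -(bigA_distr_bigA (fun i b => kap (e i) b)); congr (_ * _).
  under eq_bigr => i _ do rewrite sum_kap.
  case: eqP => [->|/eqP ne]; first by rewrite big1 // => i _; rewrite ffunE.
  have [i ei] : exists i, e i.
    apply/existsP; rewrite -[X in is_true X]negbK negb_exists; apply: contra ne => /forallP ne.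
    by apply/eqP/ffunP => i; rewrite ffunE; apply/negbTE; exact: ne.
  by rewrite (bigD1 i) //= ei mul0r.
rewrite (eq_bigr _ (fun e _ => h e)) (bigD1 [ffun=> false]) //= eqxx mul1r big1 ?addr0.
  by congr (phi z); apply/row_matrixP => i; rewrite rowK ffunE scale1r.
by move=> e /negPf ->; rewrite mul0r.
Qed.

Lemma sum_pair_ffun (B D : finType) (A : nmodType) (G : {ffun 'I_n -> B * D} -> A) :
  \sum_F G F = \sum_(f : {ffun 'I_n -> B}) \sum_(e : {ffun 'I_n -> D}) G [ffun i => (f i, e i)].
Proof.
rewrite pair_big /= (reindex (fun q : {ffun 'I_n -> B} * {ffun 'I_n -> D} => [ffun i => (q.1 i, q.2 i)])) //=.
exists (fun F : {ffun 'I_n -> B * D} => ([ffun i => (F i).1], [ffun i => (F i).2])) => [[f e] _|F _] /=.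
  by congr (_, _); apply/ffunP => i; rewrite !ffunE.
by apply/ffunP => i; rewrite !ffunE -surjective_pairing.
Qed.

(** Expand over the reals, then collect the real and imaginary parts of each coefficient by
    [kap_reim]: it comes out linearly or conjugated according to the type. *)
Lemma typed_expand g phi z (B : finType) (c : 'I_n -> B -> C) (x : 'I_n -> B -> V) : is_form phi -> z != 0 ->
  typed g phi z (\matrix_i \sum_b c i b *: x i b) =
  \sum_(f : {ffun 'I_n -> B}) (\prod_i tw (g i) (c i (f i))) * typed g phi z (\matrix_i x i (f i)).
Proof.
move=> hp z0.
have h (e : {ffun 'I_n -> bool}) : phi z (turn e (\matrix_i \sum_b c i b *: x i b)) =
    \sum_(F : {ffun 'I_n -> B * bool}) (\prod_i (reim (unitb (e i) * c i (F i).1) (F i).2)%:C) *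
      phi z (\matrix_i (unitb (F i).2 *: x i (F i).1)).
  rewrite -(multilinear_expand (fun i (b : B * bool) => reim (unitb (e i) * c i b.1) b.2)
    (fun i b => unitb b.2 *: x i b.1) (form_multilinearP hp z0)); congr (phi z).
  apply/row_matrixP => i; rewrite !rowK scaler_sumr.
  rewrite -(pair_big xpredT xpredT (fun b d => (reim (unitb (e i) * c i b) d)%:C *: (unitb d *: x i b))) /=.
  apply: eq_bigr => b _; rewrite scalerA [X in X *: _]reim_sum scaler_suml.
  by apply: eq_bigr => d _; rewrite scalerA.
rewrite /typed; under eq_bigr => e _ do rewrite h mulr_sumr.
rewrite exchange_big /= sum_pair_ffun; apply: eq_bigr => f _; rewrite mulr_sumr; apply: eq_bigr => d _.
have -> : \matrix_i (unitb ([ffun i0 => (f i0, d i0)] i).2 *: x i ([ffun i0 => (f i0, d i0)] i).1) = turn d (\matrix_i x i (f i)).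
  by apply/row_matrixP => i; rewrite !rowK ffunE.
under eq_bigr => e _ do rewrite mulrA -big_split /=.
rewrite -mulr_suml mulrA; congr (_ * _); rewrite -big_split /=.
rewrite -(bigA_distr_bigA (fun i e => kap e (g i) * (reim (unitb e * c i ([ffun i0 => (f i0, d i0)] i).1) ([ffun i0 => (f i0, d i0)] i).2)%:C)).
by apply: eq_bigr => i _; rewrite kap_reim ffunE.
Qed.

Lemma typedZ g phi z (c : C) W : is_form phi -> z != 0 ->
  typed g phi z (c *: W) = c ^+ (\sum_i g i) * conjc c ^+ (\sum_i ~~ g i) * typed g phi z W.
Proof.
move=> hp z0.
have e0 : c *: W = \matrix_i \sum_(b < 1) c *: row i W by apply/row_matrixP => i; rewrite rowK big_ord1 linearZ.
rewrite e0 (typed_expand g (fun i (_ : 'I_1) => c) (fun i _ => row i W) hp z0).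
have -> : \matrix_i row i W = W by apply/row_matrixP => i; rewrite rowK.
rewrite sumr_const card_ffun card_ord exp1n mulr1n; congr (_ * _).
by rewrite -!prodrXr -big_split /=; apply: eq_bigr => i _; case: (g i); rewrite /tw /= expr1 expr0 ?mulr1 ?mul1r.
Qed.

Lemma row_turn e W i : row i (turn e W) = unitb (e i) *: row i W.
Proof. by rewrite rowK. Qed.

Lemma turnZ e W (c : C) : turn e (c *: W) = c *: turn e W.
Proof. by apply/row_matrixP => i; rewrite row_turn !linearZ /= row_turn !scalerA mulrC. Qed.

(** There are [2 ^ n] terms, whose coefficients have modulus [2 ^ (- n)]. *)
Lemma typed_le g phi z (M : R) W : (forall W, vn W <= 1 -> cn (phi z W) <= M) -> vn W <= 1 -> cn (typed g phi z W) <= M.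
Proof.
move=> hM hW; apply: le_trans (cn_sum _ _ _) _.
have h (e : {ffun 'I_n -> bool}) : cn ((\prod_i kap (e i) (g i)) * phi z (turn e W)) <= 2^-1 ^+ n * M.
  rewrite cnM; apply: ler_pM; rewrite ?cn_ge0 //.
    have -> : cn (\prod_i kap (e i) (g i)) = \prod_(i < n) cn (kap (e i) (g i)).
      by elim/big_ind2: _ => [|x1 x2 y1 y2 <- <-|//]; rewrite ?cn1 ?cnM.
    by rewrite (eq_bigr (fun=> 2^-1)) ?prodr_const ?card_ord // => i _; rewrite cn_kap.
  apply: hM; apply/vn_leP => // i j; have := vn_coord (row i (turn e W)) 0 j.
  rewrite mxE => /le_trans; apply; rewrite row_turn vnZ cn_unitb mul1r.
  by apply/vn_leP => // a b; rewrite mxE; apply: le_trans (vn_coord _ _ _) _.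
apply: le_trans (ler_sum _ (fun e _ => h e)) _.
rewrite sumr_const card_ffun card_bool card_ord -mulrnAl -mulr_natl natrX -exprMn mulfV ?expr1n ?mul1r //.
Qed.

(** The component of bidegree ([j], [n - j]). *)
Definition part j phi : preform R k n := fun z W => \sum_(g : {ffun 'I_n -> bool} | (\sum_i g i)%N == j) typed g phi z W.

Lemma part_sum phi z W : phi z W = \sum_(j < n.+1) part j phi z W.
Proof.
rewrite [LHS]typed_sum /part (partition_big (fun g : {ffun 'I_n -> bool} => inord (\sum_i g i) : 'I_n.+1) xpredT) //=.
apply: eq_bigr => j _; apply: eq_bigl => g; rewrite -val_eqE /= inordK // ltnS.
have h : (\sum_(i < n) g i <= \sum_(i < n) 1)%N by apply: leq_sum => i _; case: (g i).
by move: h; rewrite sum1_card card_ord.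
Qed.

Lemma multilinear_typed g phi z : is_form phi -> z != 0 -> multilinear (typed g phi z).
Proof.
move=> hp z0 W X Y i b c eW eX eY; rewrite /typed !mulr_sumr -big_split; apply: eq_bigr => e _ /=.
rewrite (form_multilinearP hp z0 (W := turn e W) (X := turn e X) (Y := turn e Y) (i := i) (b := b) (c := c)).
- by move: (phi z _) (phi z _) (\prod_i _) => a1 a2 a3; ring.
- by rewrite !row_turn eW scalerDr !scalerA ![unitb _ * _]mulrC.
- by move=> j ji; rewrite !row_turn eX.
- by move=> j ji; rewrite !row_turn eY.
Qed.

Lemma part_form j phi : is_form phi -> is_form (part j phi).
Proof.
move=> hp; apply: is_formP => [W|z z0 W X Y i b c eW eX eY|z W a b z0 ab eW|z W c z0 c0|z W i c z0 eW]; rewrite /part.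
- apply: smooth_on_sum => [|g _]; first exact: (@open_nz R k).
  apply: smooth_on_sum => [|e _]; first exact: (@open_nz R k).
  have s1 := form_smooth_on (turn e W) hp.
  exact: (smooth_onM (@open_nz R k) (smooth_on_cst _ (@open_nz R k)) s1).
- rewrite !mulr_sumr -big_split /=; apply: eq_bigr => g _.
  exact: (multilinear_typed g hp z0 eW eX eY).
(* Exchanging the rows [a] and [b] permutes the types and the multipliers without changing the
   number of linear rows, so the sum equals its opposite. *)
- pose sw (g : {ffun 'I_n -> bool}) : {ffun 'I_n -> bool} := [ffun i => g (tperm a b i)].
  have swK : involutive sw by move=> g; apply/ffunP => i; rewrite !ffunE tpermK.
  have sumsw g : (\sum_i sw g i = \sum_i g i)%N.
    by rewrite [RHS](reindex_inj (@perm_inj _ (tperm a b))); apply: eq_bigr => i _; rewrite ffunE.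
  set S := \sum_(_ | _) _; suff : S = - S.
    by move=> /eqP; rewrite -addr_eq0 -mulr2n mulrn_eq0 /= => /eqP.
  rewrite {1}/S (reindex_inj (inv_inj swK)) /= -sumrN.
  apply: eq_big => [g|g _]; first by rewrite sumsw.
  rewrite /typed (reindex_inj (inv_inj swK)) /= -sumrN; apply: eq_bigr => e _.
  rewrite -mulrN; congr (_ * _).
    by rewrite [RHS](reindex_inj (@perm_inj _ (tperm a b))); apply: eq_bigr => i _; rewrite !ffunE.
  have -> : turn (sw e) W = row_perm (tperm a b) (turn e W).
    apply/row_matrixP => i; rewrite row_turn ffunE row_row_perm row_turn; congr (_ *: _).
    by case: tpermP => [->|->|//].
  by rewrite (form_antisymmetric hp z0) odd_tperm ab expr1 mulN1r.
- apply: eq_bigr => g _; apply: eq_bigr => e _; rewrite turnZ.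
  by rewrite (form_invariant hp).
- apply: big1 => g _; apply: big1 => e _.
  by rewrite (form_horizontal hp (i := i) (c := unitb (e i) * c) z0) ?mulr0 // row_turn eW scalerA.
Qed.

Lemma part_bidegree j phi : is_form phi -> (j <= n)%N -> bidegree j (n - j) (part j phi).
Proof.
move=> hp jn; split=> [|z W c z0]; first by rewrite subnKC.
rewrite /part mulr_sumr; apply: eq_bigr => g /eqP gj; rewrite typedZ // gj; congr (_ * _ ^+ _ * _).
have : (\sum_i (g i + ~~ g i) = n)%N.
  by rewrite (eq_bigr (fun=> 1%N)) ?sum1_card ?card_ord // => i _; case: (g i).
by rewrite big_split /= gj => h; apply/eqP; rewrite -(eqn_add2l j) h subnKC.
Qed.

End TypeDecomposition.

(** * Polarisation of products of coordinate covectors *)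

Section Polarisation.
Variables (R : realType) (k l : nat).
Local Notation C := R[i].
Local Notation V := 'rV[C]_k.+1.
Local Notation nz := ([set z : V | z != 0]).
Implicit Types (a b : {ffun 'I_l -> 'I_k.+1}) (m : {ffun 'I_l -> 'I_4}).

Local Notation ucols := (@unit_cols R k l).

(** With [m j] running over the four powers of [i], these columns polarise the pairs of coordinates
    [a j] and [b j]. *)
Definition mixed a b m : 'M[C]_(k.+1, l) := \matrix_(x, j) (ucols a x j + 'i%C ^+ m j * ucols b x j).

Lemma mul_mixed a b m (x : V) j : (x *m mixed a b m) 0 j = x 0 (a j) + 'i%C ^+ m j * x 0 (b j).
Proof.
rewrite -(mul_unit_cols a x 0 j) -(mul_unit_cols b x 0 j) mxE [X in X + _]mxE [X in _ * X]mxE mulr_sumr -big_split.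
by apply: eq_bigr => y _; rewrite mxE mulrDr mulrCA.
Qed.

Lemma polar_scalar (p p' q q' : C) : \sum_(m < 4) 'i%C ^+ m * ((p + 'i%C ^+ m * p') * conjc (q + 'i%C ^+ m * q')) = 4 * (p * conjc q').
Proof.
rewrite !big_ord_recl big_ord0 /= /bump /=.
by case: p p' q q' => p1 p2 [p3 p4] [q1 q2] [q3 q4]; apply/eqP; rewrite eq_complex /=; apply/andP; split; apply/eqP; ring.
Qed.

Lemma parallelogram_scalar (p p' q q' : C) : \sum_(m < 4) (p + 'i%C ^+ m * p') * conjc (q + 'i%C ^+ m * q') = 4 * (p * conjc q + p' * conjc q').
Proof.
rewrite !big_ord_recl big_ord0 /= /bump /=.
by case: p p' q q' => p1 p2 [p3 p4] [q1 q2] [q3 q4]; apply/eqP; rewrite eq_complex /=; apply/andP; split; apply/eqP; ring.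
Qed.

Lemma kernel_unit a b z j (v w : V) : kernel (ucols a) (ucols b) z j v w = (v *m hproj z) 0 (a j) * conjc ((w *m hproj z) 0 (b j)).
Proof. by rewrite /kernel !mul_unit_cols. Qed.

Lemma kernel_mixed a b m z j (v w : V) : kernel (mixed a b m) (mixed a b m) z j v w =
  ((v *m hproj z) 0 (a j) + 'i%C ^+ m j * (v *m hproj z) 0 (b j)) *
  conjc ((w *m hproj z) 0 (a j) + 'i%C ^+ m j * (w *m hproj z) 0 (b j)).
Proof. by rewrite /kernel !mul_mixed. Qed.

(** The polarisation identity in each of the [l] factors. It writes a wedge of two different
    families by diagonal wedges, which are strongly positive. *)
Lemma wedge_polar a b z W : wedge (ucols a) (ucols b) z W =
  \sum_(m : {ffun 'I_l -> 'I_4}) ((4^-1) ^+ l * \prod_j 'i%C ^+ m j) * wedge (mixed a b m) (mixed a b m) z W.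
Proof.
under eq_bigr => m _ do rewrite wedge_alt mulrCA.
rewrite -mulr_sumr wedge_alt; congr (_ * _).
under eq_bigr => m _ do rewrite -alt_scale.
rewrite -alt_sum; apply: alt_ext => y.
pose G j (r : 'I_4) := 'i%C ^+ r * (((y (lshift l j) *m hproj z) 0 (a j) + 'i%C ^+ r * (y (lshift l j) *m hproj z) 0 (b j)) *
   conjc ((y (rshift l j) *m hproj z) 0 (a j) + 'i%C ^+ r * (y (rshift l j) *m hproj z) 0 (b j))).
transitivity (\sum_(m : {ffun 'I_l -> 'I_4}) 4^-1 ^+ l * \prod_j G j (m j)); last first.
  apply: eq_bigr => m _; rewrite -mulrA /pairs -big_split /=; congr (_ * _); apply: eq_bigr => j _.
  by rewrite kernel_mixed.
rewrite -mulr_sumr -(bigA_distr_bigA G).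
under eq_bigr => j _ do rewrite polar_scalar.
rewrite big_split /= prodr_const card_ord mulrA -exprMn mulVf ?expr1n ?mul1r ?pnatr_eq0 //.
by apply: eq_bigr => j _; rewrite kernel_unit.
Qed.

(** The parallelogram identity in each of the [l] factors. The right-hand side consists of terms of
    [Theta], which is how the diagonal wedges will be bounded. *)
Lemma wedge_parallelogram a b z W : \sum_(m : {ffun 'I_l -> 'I_4}) wedge (mixed a b m) (mixed a b m) z W =
  4 ^+ l * \sum_(c : {ffun 'I_l -> bool}) wedge (ucols [ffun j => if c j then a j else b j]) (ucols [ffun j => if c j then a j else b j]) z W.
Proof.
under eq_bigr => m _ do rewrite wedge_alt.
under [in RHS]eq_bigr => m _ do rewrite wedge_alt.
rewrite -!mulr_sumr mulrCA; congr (_ * _).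
rewrite -!alt_sum -alt_scale; apply: alt_ext => y.
pose G j (r : 'I_4) := ((y (lshift l j) *m hproj z) 0 (a j) + 'i%C ^+ r * (y (lshift l j) *m hproj z) 0 (b j)) *
   conjc ((y (rshift l j) *m hproj z) 0 (a j) + 'i%C ^+ r * (y (rshift l j) *m hproj z) 0 (b j)).
pose H j (c : bool) := (y (lshift l j) *m hproj z) 0 (if c then a j else b j) * conjc ((y (rshift l j) *m hproj z) 0 (if c then a j else b j)).
transitivity (\sum_(m : {ffun 'I_l -> 'I_4}) \prod_j G j (m j)).
  by apply: eq_bigr => m _; apply: eq_bigr => j _; rewrite kernel_mixed.
transitivity (4 ^+ l * \sum_(c : {ffun 'I_l -> bool}) \prod_j H j (c j)); last first.
  by congr (_ * _); apply: eq_bigr => m _; apply: eq_bigr => j _; rewrite kernel_unit !ffunE.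
rewrite -(bigA_distr_bigA G) -(bigA_distr_bigA H).
under eq_bigr => j _ do rewrite parallelogram_scalar.
rewrite big_split /= prodr_const card_ord; congr (_ * _).
by apply: eq_bigr => j _; rewrite big_bool.
Qed.

(** Conjugation exchanges the two blocks of columns, with sign [(-1)^l], and multiplies [i^(l^2)] by
    [(-1)^(l^2)]; the two signs are equal. *)
Lemma wedge_real (B : 'M[C]_(k.+1, l)) z W : conjc (wedge B B z W) = wedge B B z W.
Proof.
rewrite /wedge /wedge_mx; set A := W *m hproj z *m B.
have e : conjc (\det (row_mx A (map_mx conjc A))) = (-1) ^+ l * \det (row_mx A (map_mx conjc A)).
  have -> : conjc (\det (row_mx A (map_mx conjc A))) = \det (row_mx (map_mx conjc A) A).
    rewrite -det_map_mx map_row_mx; congr (\det (row_mx _ _)).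
    by apply/matrixP => i j; rewrite 2!mxE; exact: conjcK.
  (* The exchange of the two blocks as a product of triangular matrices, from which its determinant
     is read off. *)
  pose J1 : 'M[C]_(l + l) := block_mx 1%:M 1%:M 0 1%:M.
  pose J2 : 'M[C]_(l + l) := block_mx (- 1%:M) 0 1%:M 1%:M.
  pose J3 : 'M[C]_(l + l) := block_mx 1%:M (- 1%:M) 0 1%:M.
  have -> : row_mx (map_mx conjc A) A = row_mx A (map_mx conjc A) *m (J1 *m J2 *m J3).
    rewrite /J1 /J2 /J3 !mulmx_block mul_row_block.
    rewrite !(mul1mx, mulmx1, mul0mx, mulmx0, mulNmx, mulmxN, addr0, add0r, subr0, subrr, opprK, addNr).
    by rewrite ?mul1mx ?addNr ?mulmx0 ?add0r ?mulmx1 ?addr0.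
  rewrite !det_mulmx /J1 /J2 /J3 !det_ublock det_lblock !det1 !mul1r !mulr1 mulrC; congr (_ * _).
  by rewrite -scaleN1r detZ det1 mulr1.
have cM (x y : C) : conjc (x * y) = conjc x * conjc y := rmorphM _ x y.
have cX (x : C) n : conjc (x ^+ n) = conjc x ^+ n := rmorphXn _ n x.
rewrite !cM !cX e; have -> : conjc ((nsq z)%:C^-1) = (nsq z)%:C^-1 :> C.
  by rewrite -fmorphV /= oppr0.
have -> : conjc ('i%C : C) = - 'i%C by apply/eqP; rewrite eq_complex /= oppr0 !eqxx.
have s1 : (-1 : C) ^+ (l ^ 2) * (-1) ^+ l = 1.
  by rewrite -exprD -signr_odd oddD oddX /= addbb.
have iN : (- 'i%C) ^+ (l ^ 2) = (-1) ^+ (l ^ 2) * 'i%C ^+ (l ^ 2) :> C := exprNn _ _.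
rewrite iN; move: s1; clear.
set a1 := (-1) ^+ (l ^ 2); set a2 := (-1) ^+ l; set a3 := 'i%C ^+ _; set a4 := _^-1 ^+ l; set a5 := \det _ => s1.

transitivity (a3 * a4 * a5 * (a1 * a2)); first by ring.
by rewrite s1 mulr1.
Qed.

(** A permutation [p] moves the [l] complex linear slots to the front, after which the determinant
    is that of a wedge of coordinate covectors; the constant is made of signs and powers of [i]. *)
Lemma det_wedge (g : {ffun 'I_(l + l) -> bool}) (f : {ffun 'I_(l + l) -> 'I_k.+1}) : (\sum_i g i)%N = l ->
  exists (c : C) a b, cn c <= 1 /\ forall z W, z != 0 ->
    \det (\matrix_(i, j) tw (g i) ((W *m hproj z) j (f i))) = c * (nsq z)%:C ^+ l * wedge (ucols a) (ucols b) z W.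
Proof.
move=> gl.
have [p hp] : exists p : 'S_(l + l), forall j, g (p j) = (j < l)%N.
  pose t1 := [tuple (j < l)%N | j < l + l]; pose t2 := [tuple g j | j < l + l].
  have st : perm_eq t1 t2.
    have s12 : size t1 = size t2 by rewrite !size_tuple.
    have c12 : count id t1 = count id t2.
      have cnt (h : 'I_(l + l) -> bool) : count id [tuple h j | j < l + l] = (\sum_i h i)%N.
        by rewrite /= count_map -sum1_count big_mkcond /= big_enum /=; apply: eq_bigr => i _; case: (h i).
      rewrite !cnt gl big_split_ord /= (eq_bigr (fun=> 1%N)) => [|i _]; last by rewrite ltn_ord.
      rewrite sum1_card card_ord big1 ?addn0 // => i _; by rewrite ltnNge leq_addr.
    apply/seq.permP => P.
    have cP (s : seq bool) : count P s = (P true * count id s + P false * (size s - count id s))%N.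
      rewrite -(count_predC id s) addKn; elim: s => [|x s IH] /=; first by rewrite !muln0.
      by rewrite IH; case: x => /=; lia.
    by rewrite !cP s12 c12.
  have [p ep] := tuple_permP st.
  exists p => j; have := congr1 (fun t => nth false t j) ep.
  by rewrite -!tnth_nth !tnth_mktuple => ->.
pose a : {ffun 'I_l -> 'I_k.+1} := [ffun j => f (p (lshift l j))].
pose b : {ffun 'I_l -> 'I_k.+1} := [ffun j => f (p (rshift l j))].
exists ((-1) ^+ p * (- 'i%C) ^+ (l ^ 2)), a, b; split.
  by rewrite cnM !cnX !cnN cn_i cn1 !expr1n mulr1.
move=> z W z0; set D := \matrix_(i, j) _.
have eD : \det D = (-1) ^+ p * \det (wedge_mx (ucols a) (ucols b) z W).
  have -> : \det (wedge_mx (ucols a) (ucols b) z W) = \det (row_perm p D).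
    rewrite -det_tr; congr (\det _); apply/matrixP => i j; rewrite [LHS]mxE [RHS]mxE [RHS]mxE hp /wedge_mx.
    case: (split_ordP i) => i' -> /=; rewrite ?ltn_ord ?(ltnNge (l + i')) ?leq_addr /=.
      by rewrite row_mxEl mul_unit_cols ffunE.
    by rewrite row_mxEr [LHS]mxE mul_unit_cols ffunE.
  by rewrite row_permE det_mulmx det_perm mulrA -expr2 sqrr_sign mul1r.
have n1 : (nsq z)%:C ^+ l * ((nsq z)%:C)^-1 ^+ l = 1 :> C by rewrite -exprMn mulfV ?expr1n // nsq_neq0.
have i1 : (- 'i%C) ^+ (l ^ 2) * 'i%C ^+ (l ^ 2) = 1 :> C.
  by rewrite -exprMn mulNr -expr2 sqr_i opprK expr1n.
rewrite eD /wedge; move: n1 i1; move: (_ ^+ l) (_ ^+ l) ((- 'i%C) ^+ _) ('i%C ^+ _) ((-1) ^+ p) (\det _) => a1 a2 a3 a4 a5 a6 n1 i1.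
transitivity (a5 * a6 * (a1 * a2) * (a3 * a4)); last by ring.
by rewrite (mulrC a1) n1 i1 !mulr1.
Qed.

End Polarisation.

Section Domination.
Variables (R : realType) (k : nat).
Local Notation C := R[i].
Local Notation V := 'rV[C]_k.+1.
Local Notation nz := ([set z : V | z != 0]).

(** Each row is the sum of its projection and of a radial vector, and every term with a radial
    vector vanishes by horizontality. *)
Lemma form_hproj n (phi : preform R k n) z W : is_form phi -> z != 0 -> phi z (W *m hproj z) = phi z W.
Proof.
move=> hp z0; pose x i (b : bool) := if b then row i (W *m hproj z) else (herm (row i W) z / (nsq z)%:C) *: z.
have eW : W = \matrix_i \sum_b (1 : R)%:C *: x i b.
  apply/row_matrixP => i; rewrite rowK big_bool /x /= !scale1r row_mul mul_hproj subrK //.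
rewrite [in RHS]eW (multilinear_expand (fun _ _ => 1) x (form_multilinearP hp z0)).
rewrite (bigD1 [ffun=> true]) //= big1 ?mul1r => [|i _]; last by [].
rewrite [X in _ + X]big1 ?addr0 => [|f /negP nf].
  by congr (phi z); apply/row_matrixP => i; rewrite rowK ffunE.
have [i fi] : exists i, f i = false.
  have : ~~ [forall i, f i] by apply/negP => /forallP fT; apply: nf; apply/eqP/ffunP => i; rewrite ffunE fT.
  by rewrite negb_forall => /existsP[i /negbTE fi]; exists i.
rewrite (form_horizontal hp (i := i) (c := herm (row i W) z / (nsq z)%:C) z0) ?mulr0 //.
by rewrite rowK fi.
Qed.

Variable l : nat.
Local Notation ucols := (@unit_cols R k l).
Local Notation I := (({ffun 'I_l -> 'I_k.+1} * {ffun 'I_l -> 'I_k.+1}) * {ffun 'I_l -> 'I_4})%type.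

Definition mixed3 (t : I) : 'M[C]_(k.+1, l) := mixed R t.1.1 t.1.2 t.2.

Definition spanned z (Psi : 'M[C]_(l + l, k.+1) -> C) (M : R) :=
  exists2 c : I -> C, (forall t, cn (c t) <= M) & forall W, Psi W = \sum_t c t * wedge (mixed3 t) (mixed3 t) z W.

Lemma spanned_wedge a b z : spanned z (wedge (ucols a) (ucols b) z) 1.
Proof.
exists (fun t : I => if t.1 == (a, b) then (4^-1) ^+ l * \prod_j 'i%C ^+ t.2 j else 0) => [t|W].
  case: ifP => _; last by rewrite cn0 ler01.
  have -> : cn ((4^-1) ^+ l * \prod_j 'i%C ^+ t.2 j : C) = (4^-1) ^+ l :> R.
    rewrite cnM cnX -(rmorph_nat (real_complex R)) -fmorphV cn_real ger0_norm ?invr_ge0 ?ler0n //.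
    have -> : cn (\prod_j 'i%C ^+ t.2 j : C) = 1; last by rewrite mulr1.
    by elim/big_ind: _ => [|x y hx hy|j _]; rewrite ?cn1 // ?cnM ?hx ?hy ?mulr1 // cnX cn_i expr1n.
  by apply: exprn_ile1; rewrite ?invr_ge0 ?ler0n // invf_le1 ?ler1n ?ltr0n.
rewrite wedge_polar -(pair_big xpredT xpredT (fun ab (m : {ffun 'I_l -> 'I_4}) => (if ab == (a, b) then (4^-1) ^+ l * \prod_j 'i%C ^+ m j else 0) * wedge (mixed R ab.1 ab.2 m) (mixed R ab.1 ab.2 m) z W)) /=.
rewrite (bigD1 (a, b)) //= eqxx [X in _ + X]big1 ?addr0 // => ab /negPf ->.
by rewrite big1 // => m _; rewrite mul0r.
Qed.

Lemma spanned0 z (M : R) : 0 <= M -> spanned z (fun=> 0) M.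
Proof. by move=> M0; exists (fun=> 0) => [t|W]; rewrite ?cn0 // big1 // => t _; rewrite mul0r. Qed.

Lemma spannedZ z Psi (M N : R) (x : C) : spanned z Psi M -> cn x <= N -> spanned z (fun W => x * Psi W) (N * M).
Proof.
move=> [c hc e] xN; exists (fun t => x * c t) => [t|W].
  by rewrite cnM; apply: ler_pM; rewrite ?cn_ge0.
by rewrite e mulr_sumr; apply: eq_bigr => t _; rewrite mulrA.
Qed.

Lemma spannedD z Psi Psi' (M M' : R) : spanned z Psi M -> spanned z Psi' M' -> spanned z (fun W => Psi W + Psi' W) (M + M').
Proof.
move=> [c hc e] [c' hc' e']; exists (fun t => c t + c' t) => [t|W].
  by apply: le_trans (cnD _ _) _; apply: lerD.
by rewrite e e' -big_split; apply: eq_bigr => t _; rewrite mulrDl.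
Qed.

Lemma spanned_sum z (J : finType) (Psi : J -> 'M[C]_(l + l, k.+1) -> C) (M : R) : 0 <= M -> (forall j, spanned z (Psi j) M) ->
  spanned z (fun W => \sum_j Psi j W) (#|J|%:R * M).
Proof.
move=> M0 h; have -> : #|J| = size (index_enum J) by rewrite cardT enumT.
elim: (index_enum J) => [|j r IH].
  have -> : (fun W => \sum_(j <- [::]) Psi j W) = fun=> 0 by apply/funext => W; rewrite big_nil.
  by apply: spanned0; rewrite mul0r.
have -> : (fun W => \sum_(j <- j :: r) Psi j W) = fun W => Psi j W + \sum_(j <- r) Psi j W.
  by apply/funext => W; rewrite big_cons.
by rewrite /= -natr1 addrC mulrDl mul1r; apply: spannedD.
Qed.

(** The expansion in complex coordinates yields products of coordinates; summing over the
    permutations of the rows, as antisymmetry permits, turns them into determinants. *)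
Lemma part_expand (phi : preform R k (l + l)) z W : is_form phi -> z != 0 ->
  part l phi z W = ((l + l)`!%:R)^-1 * \sum_(g : {ffun 'I_(l + l) -> bool} | (\sum_i g i)%N == l)
    \sum_(f : {ffun 'I_(l + l) -> 'I_k.+1}) typed g phi z (\matrix_i delta_mx 0 (f i)) *
      \det (\matrix_(i, j) tw (g i) ((W *m hproj z) j (f i))).
Proof.
move=> hp z0; have hpart := part_form l hp.
have e1 X : part l phi z X = \sum_(g : {ffun 'I_(l + l) -> bool} | (\sum_i g i)%N == l)
    \sum_(f : {ffun 'I_(l + l) -> 'I_k.+1}) (\prod_i tw (g i) ((X *m hproj z) i (f i))) * typed g phi z (\matrix_i delta_mx 0 (f i)).
  rewrite -(form_hproj X hpart z0); apply: eq_bigr => g _.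
  rewrite -(typed_expand g (fun i a => (X *m hproj z) i a) (fun _ a => delta_mx 0 a) hp z0).
  congr (typed g phi z _); apply/row_matrixP => i; rewrite rowK [LHS]row_sum_delta.
  by apply: eq_bigr => a _; rewrite mxE.
have e2 : (l + l)`!%:R * part l phi z W = \sum_(s : 'S_(l + l)) (-1) ^+ s * part l phi z (row_perm s W).
  rewrite (eq_bigr (fun=> part l phi z W)) ?sumr_const ?card_Sn ?mulr_natl // => s _.
  by rewrite (form_antisymmetric hpart z0) mulrA -expr2 sqrr_sign mul1r.
have n0 : (l + l)`!%:R != 0 :> C by rewrite pnatr_eq0 -lt0n fact_gt0.
apply: (mulfI n0); rewrite e2 mulrA mulfV // mul1r.
under eq_bigr => s _ do rewrite e1 mulr_sumr.
rewrite exchange_big /=; apply: eq_bigr => g _.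
under eq_bigr => s _ do rewrite mulr_sumr.
rewrite exchange_big /=; apply: eq_bigr => f _.
rewrite /determinant mulr_sumr; apply: eq_bigr => s _.
rewrite mulrA mulrC; congr (_ * (_ * _)); apply: eq_bigr => i _; rewrite [RHS]mxE; congr (tw _ _).
have e (X : 'M[C]_(l + l, k.+1)) x y : (X *m hproj z) x y = (row x X *m hproj z) 0 y by rewrite -row_mul [RHS]mxE.
by rewrite e row_row_perm -e.
Qed.

Lemma strongly_positive_unit (phi : preform R k (l + l)) : is_form phi ->
  (forall z : V, vn z = 1 -> exists (N : nat) (c : 'I_N -> R) (A : 'I_N -> 'M[C]_(k.+1, l)),
  [/\ forall s, 0 <= c s, forall s, z *m A s = 0 &
      forall W, phi z W = \sum_(s < N) (c s)%:C *
        ('i%C ^+ (l ^ 2) * \det (row_mx (W *m A s) (map_mx conjc (W *m A s))))]) -> strongly_positive phi.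
Proof.
move=> hp h z z0; have n0 : (vn z)%:C != 0 :> C by rewrite fmorph_eq0 vn_eq0.
have nV : (vn z)%:C^-1 != 0 :> C by rewrite invr_eq0.
have [|N [c [A [hc hA e]]]] := h ((vn z)%:C^-1 *: z).
  by rewrite vnZ -fmorphV cn_real ger0_norm ?invr_ge0 ?vn_ge0 // mulVf // vn_eq0.
exists N, c, (fun s => (vn z)%:C^-1 *: A s); split=> // [s|W].
  by rewrite -scalemxAr scalemxAl hA.
rewrite -(form_invariant hp W z0 nV) e; apply: eq_bigr => s _.
by rewrite -scalemxAr scalemxAl.
Qed.

(** Each determinant of [part_expand] is a wedge by [det_wedge], hence a combination of diagonal
    wedges by polarisation. The coefficients are bounded by numerical constants times the bound on
    [phi]. *)
Lemma part_spanned : exists2 K : R, 0 <= K & forall (phi : preform R k (l + l)) (M : R) (z : V), is_form phi -> 0 <= M -> vn z = 1 ->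
  (forall W, vn W <= 1 -> cn (phi z W) <= M) -> spanned z (part l phi z) (K * M).
Proof.
pose n := (l + l)%N; pose K1 : R := k.+1%:R ^+ l.
exists (cn ((l + l)`!%:R^-1) * (#|{: {ffun 'I_n -> bool}}|%:R * (#|{: {ffun 'I_n -> 'I_k.+1}}|%:R * K1))).
  by rewrite !mulr_ge0 ?cn_ge0 ?ler0n ?exprn_ge0.
move=> phi M z hp M0 z1 hM; have z0 : z != 0 by rewrite -vn_eq0 z1 oner_eq0.
have -> : part l phi z = fun W => ((l + l)`!%:R)^-1 * \sum_(g : {ffun 'I_(l + l) -> bool}) if (\sum_i g i)%N == l then
    \sum_(f : {ffun 'I_(l + l) -> 'I_k.+1}) typed g phi z (\matrix_i delta_mx 0 (f i)) *
      \det (\matrix_(i, j) tw (g i) ((W *m hproj z) j (f i))) else 0.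
  by apply/funext => W; rewrite part_expand // big_mkcond.
have K0 : 0 <= K1 by rewrite exprn_ge0.
rewrite -!mulrA; apply: spannedZ => //.
apply: spanned_sum => [|g]; first by rewrite !mulr_ge0.
case: eqP => gl; last by apply: spanned0; rewrite !mulr_ge0.
apply: spanned_sum => [|f]; first by rewrite mulr_ge0.
have [c [a [b [c1 e]]]] := det_wedge R f gl.
have -> : (fun W => typed g phi z (\matrix_i delta_mx 0 (f i)) * \det (\matrix_(i, j) tw (g i) ((W *m hproj z) j (f i)))) =
  fun W => (typed g phi z (\matrix_i delta_mx 0 (f i)) * (c * (nsq z)%:C ^+ l)) * wedge (ucols a) (ucols b) z W.
  by apply/funext => W; rewrite e // !mulrA.
rewrite -[K1 * M]mulr1; apply: spannedZ; first exact: spanned_wedge.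
rewrite cnM mulrC; apply: ler_pM; rewrite ?cn_ge0 //.
  rewrite cnM cnX -[K1]mul1r; apply: ler_pM; rewrite ?cn_ge0 ?exprn_ge0 ?cn_ge0 //.
  apply: lerXn2r; rewrite ?nnegrE ?cn_ge0 // cn_real ger0_norm.
    by have := nsq_le z; rewrite z1 expr1n mulr1.
  by apply: ltW; exact: nsq_gt0.
apply: (typed_le g hM); apply/vn_leP => // i j.
by rewrite !mxE; case: (_ && _); rewrite ?cn1 ?cn0.
Qed.

(** Positive closed currents without the continuity, which [domination] gives back. Extensionality
    is listed apart: the values of a form at the origin must not matter, and without continuity this
    is no longer a consequence. *)
Record good (T : preform R k (l + l) -> C) : Prop := Good {
  good_linear : forall (c : C) phi psi, is_form phi -> is_form psi ->
    T (fun z W => c * phi z W + psi z W) = c * T phi + T psi;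
  good_ext : forall phi psi, is_form phi -> is_form psi -> (forall z W, z != 0 -> phi z W = psi z W) -> T phi = T psi;
  good_bidim : bidimension T;
  good_positive : positive T;
  good_closed : current_closed T }.

Section GoodFunctional.
Variables (T : preform R k (l + l) -> C) (gT : good T).

Lemma good0 : T (fun _ _ => 0) = 0.
Proof.
have := good_linear gT (- 1) (form_zero R k (l + l)) (form_zero R k (l + l)).
have -> : -1 * T (fun _ _ => 0) + T (fun _ _ => 0) = 0 by rewrite mulN1r addNr.
move=> h; rewrite -[RHS]h; congr T.
by apply/funext => z; apply/funext => W; rewrite mulr0 addr0.
Qed.

Lemma goodZ (c : C) phi : is_form phi -> T (fun z W => c * phi z W) = c * T phi.
Proof.
move=> hp; have := good_linear gT c hp (form_zero R k (l + l)); rewrite good0 addr0 => <-.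
by congr T; apply/funext => z; apply/funext => W; rewrite addr0.
Qed.

Lemma goodD phi psi : is_form phi -> is_form psi -> T (fun z W => phi z W + psi z W) = T phi + T psi.
Proof.
move=> hp hq; have := good_linear gT 1 hp hq; rewrite mul1r => <-.
by congr T; apply/funext => z; apply/funext => W; rewrite mul1r.
Qed.

Lemma good_sum (J : Type) (r : seq J) (phi : J -> preform R k (l + l)) : (forall j, is_form (phi j)) ->
  T (fun z W => \sum_(j <- r) phi j z W) = \sum_(j <- r) T (phi j).
Proof.
move=> hp; elim: r => [|j r IH].
  by rewrite big_nil -[RHS]good0; congr T; apply/funext => z; apply/funext => W; rewrite big_nil.
rewrite big_cons -IH -goodD //; last exact: form_sum.
by congr T; apply/funext => z; apply/funext => W; rewrite big_cons.
Qed.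

Lemma form_scalar n (c : C) (phi : preform R k n) : is_form phi -> is_form (fun z W => c * phi z W).
Proof.
move=> hp; have := form_add c hp (form_zero R k n).
by congr is_form; apply/funext => z; apply/funext => W; rewrite addr0.
Qed.

Lemma form_plus n (phi psi : preform R k n) : is_form phi -> is_form psi -> is_form (fun z W => phi z W + psi z W).
Proof.
move=> hp hq; have := form_add 1 hp hq.
by congr is_form; apply/funext => z; apply/funext => W; rewrite mul1r.
Qed.

Lemma good_part phi : is_form phi -> T phi = T (part l phi).
Proof.
move=> hp; transitivity (T (fun z W => \sum_(j < (l + l).+1) part j phi z W)).
  by congr T; apply/funext => z; apply/funext => W; exact: part_sum.
rewrite good_sum => [|j]; last exact: part_form.
have lt : (l < (l + l).+1)%N by rewrite ltnS leq_addr.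
rewrite (bigD1 (Ordinal lt)) //= [X in _ + X]big1 ?addr0 // => j jl.
apply: (good_bidim gT (part_form j hp) (part_bidegree hp _)); first by rewrite -ltnS.
by move=> [jl' _]; move/eqP: jl; apply; apply: val_inj.
Qed.

Lemma strong_wedges (J : finType) (c : J -> R) (B : J -> 'M[C]_(k.+1, l)) : (forall j, 0 <= c j) ->
  strongly_positive (fun z W => \sum_j (c j)%:C * wedge (B j) (B j) z W).
Proof.
move=> c0 z z0.
exact: (wedge_positive (c := c) (P := B) (phi := fun z W => \sum_j (c j)%:C * wedge (B j) (B j) z W) z0).
Qed.

#[local] Opaque wedge.

Lemma good_wedge_ge0 B : 0 <= T (wedge B B).
Proof.
apply: (good_positive gT); first exact: wedge_form.
have := @strong_wedges 'I_1 (fun=> 1) (fun=> B) (fun=> ler01).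
by congr strongly_positive; apply/funext => z; apply/funext => W; rewrite big_ord1 mul1r.
Qed.

Lemma good_Theta : T (@Theta R k l) = \sum_a T (wedge (ucols a) (ucols a)).
Proof. exact: (good_sum (index_enum _) (fun a => wedge_form (ucols a) (ucols a))). Qed.

(** Positivity bounds one diagonal wedge by the whole parallelogram sum, and each of the [2 ^ l]
    terms of that sum by [Theta]. *)
Lemma good_mixed_le t : T (wedge (mixed3 t) (mixed3 t)) <= 4 ^+ l * (2 ^+ l * T (@Theta R k l)).
Proof.
case: t => [[a b] m]; rewrite /mixed3 /=.
have h1 : T (wedge (mixed R a b m) (mixed R a b m)) <= \sum_(m : {ffun 'I_l -> 'I_4}) T (wedge (mixed R a b m) (mixed R a b m)).
  by rewrite (bigD1 m) //= lerDl sumr_ge0 // => m' _; exact: good_wedge_ge0.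
apply: le_trans h1 _; rewrite -good_sum => [|m']; last exact: wedge_form.
have -> : (fun z W => \sum_(m : {ffun 'I_l -> 'I_4}) wedge (mixed R a b m) (mixed R a b m) z W) =
  fun z W => 4 ^+ l * \sum_(c : {ffun 'I_l -> bool}) wedge (ucols [ffun j => if c j then a j else b j]) (ucols [ffun j => if c j then a j else b j]) z W.
  by apply/funext => z; apply/funext => W; exact: wedge_parallelogram.
rewrite goodZ; last by apply: form_sum => c; exact: wedge_form.
rewrite good_sum => [|c]; last exact: wedge_form.
apply: ler_wpM2l; first by rewrite exprn_ge0 // ler0n.
apply: le_trans (ler_sum (G := fun=> T (@Theta R k l)) _ _) _ => [c _|].
  rewrite good_Theta (bigD1 [ffun j => if c j then a j else b j]) //= lerDl sumr_ge0 // => a' _.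
  exact: good_wedge_ge0.
rewrite sumr_const; have -> : #|{ffun 'I_l -> bool}| = (2 ^ l)%N by rewrite card_ffun card_bool card_ord.
by rewrite -[leLHS]mulr_natl natrX.
Qed.

Lemma cn_le_Re (x y : C) : 0 <= y + x -> 0 <= y - x -> cn x <= complex.Re y.
Proof.
case: x y => x1 x2 [y1 y2]; rewrite !lecE /= => /andP[/eqP e1 h1] /andP[/eqP e2 h2].
have e0 : x2 = 0 by lra.
have -> : (x1 +i* x2)%C = x1%:C by rewrite e0.
by rewrite cn_real ler_norml; apply/andP; split; lra.
Qed.

(** Adding [psi] or its opposite to [N] times the sum of all diagonal wedges gives a strongly
    positive form. *)
Lemma real_dominated (psi : preform R k (l + l)) (N : R) : is_form psi ->
  (forall z, vn z = 1 -> exists2 r : I -> R, (forall t, `|r t| <= N) & forall W, psi z W = \sum_t (r t)%:C * wedge (mixed3 t) (mixed3 t) z W) ->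
  cn (T psi) <= N * complex.Re (T (fun z W => \sum_t wedge (mixed3 t) (mixed3 t) z W)).
Proof.
move=> hp h; have hW : is_form (fun z W => \sum_t wedge (mixed3 t) (mixed3 t) z W) by apply: form_sum => t; exact: wedge_form.
set S := T (fun z W => \sum_t wedge (mixed3 t) (mixed3 t) z W).
have pos (s : R) : `|s| = 1 -> 0 <= s%:C * T psi + N%:C * S.
  move=> s1; rewrite -(goodZ N%:C hW) -(good_linear gT s%:C hp (form_scalar N%:C hW)).
  have hf := form_add s%:C hp (form_scalar N%:C hW).
  apply: (good_positive gT hf); apply: strongly_positive_unit hf _ => z z1.
  have z0 : z != 0 by rewrite -vn_eq0 z1 oner_eq0.
  have [r hr e] := h z z1.
  apply: (wedge_positive (c := fun t => s * r t + N) (P := mixed3)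
    (phi := fun z W => s%:C * psi z W + N%:C * \sum_t wedge (mixed3 t) (mixed3 t) z W) z0) => [t|W].
    by have := hr t; rewrite -(mul1r `|r t|) -s1 -normrM ler_norml => /andP[h1 _]; lra.
  rewrite e !mulr_sumr -big_split; apply: eq_bigr => t _ /=.
  by rewrite rmorphD rmorphM mulrDl mulrA.
have -> : N * complex.Re S = complex.Re (N%:C * S) by case: (S) => a b /=; ring.
apply: cn_le_Re.
  by have := pos 1 (normr1 _); rewrite mul1r addrC.
by have := pos (-1) (normrN1 _); rewrite rmorphN rmorph1 mulN1r addrC.
Qed.

End GoodFunctional.

Lemma cn_le_cn (N : R) (c : C) : cn c <= N -> `|complex.Re c| <= N /\ `|complex.Im c| <= N.
Proof.
move=> cN; split; apply: le_trans cN; first exact: Re_le_cn.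
by rewrite -Re_mulNi; apply: le_trans (Re_le_cn _) _; rewrite cnM cnN cn_i mul1r.
Qed.

(** By bidimension only the part of bidegree ([l], [l]) counts. Its real and imaginary parts are
    real combinations of diagonal wedges, as these are real; they are bounded separately, whence the
    factor 2. *)
Lemma domination : exists2 K : R, 0 <= K & forall T, good T -> forall phi (M : R), is_form phi -> 0 <= M ->
  (forall z W, vn z = 1 -> vn W <= 1 -> cn (phi z W) <= M) -> cn (T phi) <= K * M * complex.Re (T (@Theta R k l)).
Proof.
have [K1 K0 sp] := part_spanned.
exists (2 * K1 * (#|{: I}|%:R * (4 ^+ l * 2 ^+ l))); first by rewrite !mulr_ge0 ?exprn_ge0 ?ler0n.
move=> T gT phi M hp M0 hM; rewrite (good_part gT hp).
have hl := part_form l hp; have hc := form_conj hl; set N := K1 * M.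
have N0 : 0 <= N by rewrite mulr_ge0.
set th := complex.Re (T (@Theta R k l)).
have th' : complex.Re (T (fun z W => \sum_t wedge (mixed3 t) (mixed3 t) z W)) <= #|{: I}|%:R * (4 ^+ l * 2 ^+ l) * th.
  rewrite (good_sum gT (index_enum _) (fun t => wedge_form (mixed3 t) (mixed3 t))).
  have : \sum_t T (wedge (mixed3 t) (mixed3 t)) <= \sum_(t : I) (4 ^+ l * (2 ^+ l * T (@Theta R k l))).
    by apply: ler_sum => t _; exact: good_mixed_le.
  rewrite sumr_const lecE => /andP[_]; congr (_ <= _).
  have ReZ (r : R) (x : C) : complex.Re (r%:C * x) = r * complex.Re x by case: x => x y /=; rewrite mul0r subr0.
  rewrite /th -ReZ; congr complex.Re; rewrite -[LHS]mulr_natl mulrA mulrA; congr (_ * _).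
  by rewrite !rmorphM !rmorphXn !rmorph_nat mulrA.
pose re z W := (2^-1 : R)%:C * (part l phi z W + conjc (part l phi z W)).
pose im z W := ((2^-1 : R)%:C * - 'i%C) * (1 * part l phi z W + -1 * conjc (part l phi z W)).
have hre : is_form re by apply: form_scalar; apply: form_plus.
have him : is_form im by apply: form_scalar; apply: form_plus; apply: form_scalar.
have b1 : cn (T re) <= N * (#|{: I}|%:R * (4 ^+ l * 2 ^+ l) * th).
  apply: le_trans (real_dominated gT (N := N) hre _) _; last exact: ler_wpM2l.
  move=> z z1; have [c cN e] := sp phi M z hp M0 z1 (fun W => hM z W z1).
  exists (fun t => complex.Re (c t)) => [t|W]; first by have [] := cn_le_cn (cN t).
  rewrite /re e rmorph_sum -big_split mulr_sumr; apply: eq_bigr => t _ /=.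
  rewrite rmorphM /= wedge_real -mulrDl mulrA; congr (_ * _).
  by case: (c t) => x y; apply/eqP; rewrite eq_complex /=; apply/andP; split; apply/eqP; field.
have b2 : cn (T im) <= N * (#|{: I}|%:R * (4 ^+ l * 2 ^+ l) * th).
  apply: le_trans (real_dominated gT (N := N) him _) _; last exact: ler_wpM2l.
  move=> z z1; have [c cN e] := sp phi M z hp M0 z1 (fun W => hM z W z1).
  exists (fun t => complex.Im (c t)) => [t|W]; first by have [] := cn_le_cn (cN t).
  rewrite /im e rmorph_sum !mulr_sumr -big_split mulr_sumr; apply: eq_bigr => t _ /=.
  rewrite rmorphM /= wedge_real; move: (wedge _ _ _ _) => w.
  rewrite (_ : 1 * (c t * w) + -1 * ((c t)^*%C * w) = (c t - (c t)^*%C) * w); last by move: (c t)^*%C => c'; ring.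
  rewrite mulrA; congr (_ * _).
  by case: (c t) => x y; apply/eqP; rewrite eq_complex /=; apply/andP; split; apply/eqP; field.
have -> : part l phi = fun z W => 'i%C * im z W + re z W.
  apply/funext => z; apply/funext => W; rewrite /im /re; case: (part l phi z W) => x y.
  by apply/eqP; rewrite eq_complex /=; apply/andP; split; apply/eqP; field.
rewrite (good_linear gT _ him hre); apply: le_trans (cnD _ _) _; rewrite cnM cn_i mul1r.
apply: le_trans (lerD b2 b1) _; rewrite le_eqVlt; apply/orP; left; apply/eqP; rewrite /N.
by move: (4 ^+ l) (2 ^+ l) (#|_|%:R) => x1 x2 x3; ring.
Qed.

End Domination.

(** * Stokes and the mass of the pull-back *)

Section KernelForms.
Variables (R : realType) (k : nat).
Local Notation C := R[i].
Local Notation V := 'rV[C]_k.+1.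
Local Notation nz := ([set z : V | z != 0]).

Definition slot_linear n (Psi : ('I_n -> V) -> C) := forall y u v i (b c : R), y i = b%:C *: u i + c%:C *: v i ->
  (forall j, j != i -> u j = y j) -> (forall j, j != i -> v j = y j) -> Psi y = b%:C * Psi u + c%:C * Psi v.

(** The conditions, short of alternation, under which alternating a function of [n] vectors gives a
    form. *)
Record kform n (Psi : V -> ('I_n -> V) -> C) : Prop := KForm {
  kform_smooth : forall y, smooth_on nz (Psi^~ y);
  kform_linear : forall z, z != 0 -> slot_linear (Psi z);
  kform_invariant : forall z y (c : C), z != 0 -> c != 0 -> Psi (c *: z) (fun i => c *: y i) = Psi z y;
  kform_horizontal : forall z y i (c : C), z != 0 -> y i = c *: z -> Psi z y = 0 }.

Lemma form_eq n (phi psi : preform R k n) : (forall z W, z != 0 -> phi z W = psi z W) -> is_form phi -> is_form psi.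
Proof.
move=> e hp; apply: is_formP => [W|z z0 W X Y i b c eW eX eY|z W i j z0 ij eW|z W c z0 c0|z W i c z0 eW].
- apply: smooth_on_eq (form_smooth_on W hp); first exact: (@open_nz R k).
  by move=> z z0; exact: e.
- by rewrite -!e //; exact: (form_multilinearP hp z0 eW eX eY).
- by rewrite -e //; exact: (form_alternating hp z0 ij eW).
- by rewrite -!e ?(form_invariant hp) // scaler_eq0 negb_or c0.
- by rewrite -e //; exact: (form_horizontal hp z0 eW).
Qed.

Lemma alt_form n (Psi : V -> ('I_n -> V) -> C) : kform Psi -> is_form (fun z W => alt (Psi z) W).
Proof.
move=> hp; apply: is_formP => [W|z z0 W X Y i b c eW eX eY|z W i j z0 ij eW|z W c z0 c0|z W i c z0 eW].
- apply: smooth_on_sum => [|s _]; first exact: (@open_nz R k).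
  exact: (smooth_onM (@open_nz R k) (smooth_on_cst _ (@open_nz R k)) (kform_smooth hp (fun a => row (s a) W))).
- rewrite /alt !mulr_sumr -big_split; apply: eq_bigr => s _ /=.
  have inv a : a != (s^-1)%g i -> s a != i by apply: contra_neq => <-; rewrite permK.
  rewrite (kform_linear hp z0 (y := fun a => row (s a) W) (u := fun a => row (s a) X) (v := fun a => row (s a) Y)
    (i := (s^-1)%g i) (b := b) (c := c)).
  + by move: (Psi z _) (Psi z _) ((-1) ^+ s) => a1 a2 a3; ring.
  + by rewrite permKV.
  + by move=> a /inv /eX.
  + by move=> a /inv /eY.
- set S := alt _ _; suff : S = - S.
    by move=> /eqP; rewrite -addr_eq0 -mulr2n mulrn_eq0 /= => /eqP.
  rewrite {1}/S /alt (reindex_inj (mulIg (tperm i j))) /= -sumrN; apply: eq_bigr => s _.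
  rewrite odd_permM odd_tperm ij addbT -mulNr; congr (_ * Psi z _); first by case: (odd_perm s); rewrite ?expr1 ?expr0 ?opprK.
  by apply/funext => a; rewrite permM; case: tpermP => [->|->|//].
- by apply: eq_bigr => s _; congr (_ * _); rewrite -(kform_invariant hp _ z0 c0); congr (Psi _ _); apply/funext => a; rewrite linearZ.
- apply: big1 => s _; rewrite (kform_horizontal hp (i := (s^-1)%g i) (c := c) z0) ?mulr0 //.
  by rewrite permKV.
Qed.

(** The direction of differentiation is allowed in any slot [p], at the price of a sign. *)
Lemma ext_alt n (p : 'I_n.+1) (Psi : V -> ('I_n -> V) -> C) z W : kform Psi -> z != 0 ->
  alt (fun y => real_derive (y p) (Psi^~ (y \o lift p)) z) W = (-1) ^+ p * ext_derivative (fun z W => alt (Psi z) W) z W.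
Proof.
move=> hp z0; rewrite /ext_derivative mulr_sumr /alt (reindex _ (onW_bij _ (lift_perm_bijective p))) /=.
rewrite -(pair_big xpredT xpredT (fun i s => (-1) ^+ (lift_perm p i s) *
  real_derive (row (lift_perm p i s p) W) (Psi^~ ((fun a => row (lift_perm p i s a) W) \o lift p)) z)) /=.
apply: eq_bigr => i _.
have -> : real_derive (row i W) (fun z => \sum_(s : 'S_n) (-1) ^+ s * Psi z (fun a => row (s a) (row' i W))) z =
  \sum_(s : 'S_n) (-1) ^+ s * real_derive (row i W) (Psi^~ (fun a => row (s a) (row' i W))) z.
  apply: has_derive_eq; apply: has_derive_sum => s.
  have h := smooth_on_has_derive (v := row i W) (kform_smooth hp (fun a => row (s a) (row' i W))) z0.
  have := has_deriveM (has_derive_cst ((-1) ^+ s) z (row i W)) h.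
  by rewrite mul0r add0r.
rewrite !mulr_sumr; apply: eq_bigr => s _.
rewrite odd_lift_perm /= !signr_addb !signr_odd lift_perm_id !mulrA; congr (_ * _); congr (real_derive _ _ _).
apply/funext => x; congr (Psi x _); apply/funext => a /=; rewrite lift_perm_lift.
by apply/rowP => b; rewrite !mxE.
Qed.

Variable l : nat.
Implicit Types (h : V -> 'I_l -> V -> V -> C).

Lemma pairs_linear (h : 'I_l -> V -> V -> C) (y u v : 'I_(l + l) -> V) a (b c : R) :
  (forall j, a = lshift l j -> forall x x' w : V, h j (b%:C *: x + c%:C *: x') w = b%:C * h j x w + c%:C * h j x' w) ->
  (forall j, a = rshift l j -> forall x x' w : V, h j w (b%:C *: x + c%:C *: x') = b%:C * h j w x + c%:C * h j w x') ->
  y a = b%:C *: u a + c%:C *: v a -> (forall j, j != a -> u j = y j) -> (forall j, j != a -> v j = y j) ->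
  pairs h y = b%:C * pairs h u + c%:C * pairs h v.
Proof.
move=> h1 h2 ya ua va.
have P0 (x : 'I_(l + l) -> V) j0 : (a = lshift l j0 \/ a = rshift l j0) -> (forall j, j != a -> x j = y j) ->
    pairs h x = h j0 (x (lshift l j0)) (x (rshift l j0)) * \prod_(j | j != j0) h j (y (lshift l j)) (y (rshift l j)).
  move=> aj xy; rewrite /pairs (bigD1 j0) //=; congr (_ * _); apply: eq_bigr => j jj.
  have [ne1 ne2] : lshift l j != a /\ rshift l j != a.
    by case: aj => ->; rewrite ?eq_lrshift ?eq_rlshift ?(inj_eq (@lshift_inj _ _)) ?(inj_eq (@rshift_inj _ _)) jj.
  by rewrite (xy _ ne1) (xy _ ne2).
case: (split_ordP a) => j0 ea.
- have o := or_introl ea : a = lshift l j0 \/ a = rshift l j0.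
  have ra : rshift l j0 != a by rewrite ea eq_rlshift.
  rewrite (P0 y j0 o) // (P0 u j0 o) // (P0 v j0 o) // -!ea ya (h1 j0 ea) (ua _ ra) (va _ ra).
  by move: (h _ _ _) (h _ _ _) (\prod_(_ | _) _) => a1 a2 a3; ring.
- have o := or_intror ea : a = lshift l j0 \/ a = rshift l j0.
  have ra : lshift l j0 != a by rewrite ea eq_lrshift.
  rewrite (P0 y j0 o) // (P0 u j0 o) // (P0 v j0 o) // -!ea ya (h2 j0 ea) (ua _ ra) (va _ ra).
  by move: (h _ _ _) (h _ _ _) (\prod_(_ | _) _) => a1 a2 a3; ring.
Qed.

Record kernel2 (h : V -> V -> V -> C) : Prop := Kernel2 {
  kernel2_smooth : forall v w, smooth_on nz (fun z => h z v w);
  kernel2_linearl : forall z (x x' w : V) (b c : R), z != 0 -> h z (b%:C *: x + c%:C *: x') w = b%:C * h z x w + c%:C * h z x' w;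
  kernel2_linearr : forall z (x x' w : V) (b c : R), z != 0 -> h z w (b%:C *: x + c%:C *: x') = b%:C * h z w x + c%:C * h z w x';
  kernel2_invariant : forall z v w (c : C), z != 0 -> c != 0 -> h (c *: z) (c *: v) (c *: w) = h z v w;
  kernel2_horizontall : forall z w (c : C), z != 0 -> h z (c *: z) w = 0;
  kernel2_horizontalr : forall z w (c : C), z != 0 -> h z w (c *: z) = 0 }.

Lemma pairs_kform (h : 'I_l -> V -> V -> V -> C) : (forall j, kernel2 (h j)) -> kform (fun z => pairs (fun j => h j z)).
Proof.
move=> hk; split=> [y|z z0 y u v i b c yi ui vi|z y c z0 c0|z y i c z0 yi].
- apply: smooth_on_prod => [|j _]; first exact: (@open_nz R k).
  exact: kernel2_smooth.
- by apply: (pairs_linear (a := i)) => // j _ x x' w; [exact: kernel2_linearl|exact: kernel2_linearr].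
- by apply: eq_bigr => j _; exact: kernel2_invariant.
rewrite /pairs; case: (split_ordP i) => j0 ea; rewrite (bigD1 j0) //= -ea yi.
  by rewrite kernel2_horizontall // mul0r.
by rewrite kernel2_horizontalr // mul0r.
Qed.

(* Modulo symmetric kernels, only the antisymmetric part matters. *)
Lemma alt_pairs_slot (h : 'I_l -> V -> V -> C) m (s : V -> V -> C) W : (forall v w, s v w = s w v) ->
  alt (pairs (fun j v w => if j == m then s v w else h j v w)) W = 0.
Proof.
move=> sC; apply: (alt_invariant (t := tperm (lshift l m) (rshift l m))) => [|y]; first by rewrite odd_tperm eq_lrshift.
apply: eq_bigr => j _ /=; case: (eqVneq j m) => [->|jm]; first by rewrite tpermL tpermR sC.
by rewrite !tpermD // ?eq_lrshift ?eq_rlshift // eq_sym ?(inj_eq (@lshift_inj _ _)) ?(inj_eq (@rshift_inj _ _)).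
Qed.

(** Passing from [h] to [h'] one factor at a time, so that the difference of the two products
    telescopes. *)
Definition hybrid (h h' : 'I_l -> V -> V -> C) (m : nat) (j : 'I_l) : V -> V -> C := if (j < m)%N then h' j else h j.

Lemma pairs_hybrid_step (h h' : 'I_l -> V -> V -> C) (m : 'I_l) y :
  pairs (hybrid h h' m.+1) y - pairs (hybrid h h' m) y =
  pairs (fun j v w => if j == m then h' m v w - h m v w else hybrid h h' m j v w) y.
Proof.
have E (P : 'I_l -> V -> V -> C) : (forall j, j != m -> P j = hybrid h h' m j) ->
    pairs P y = P m (y (lshift l m)) (y (rshift l m)) * \prod_(j | j != m) hybrid h h' m j (y (lshift l j)) (y (rshift l j)).
  by move=> e; rewrite /pairs (bigD1 m) //=; congr (_ * _); apply: eq_bigr => j jm; rewrite e.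
rewrite (E (hybrid h h' m.+1)) => [|j jm]; last by rewrite /hybrid ltnS leq_eqVlt val_eqE (negPf jm).
rewrite (E (hybrid h h' m)) // (E (fun j v w => if j == m then _ else _)) => [|j /negPf ->] //.
by rewrite eqxx /hybrid ltnSn ltnn mulrBl.
Qed.

Lemma hybrid0 (h h' : 'I_l -> V -> V -> C) y : pairs (hybrid h h' 0) y = pairs h y.
Proof. by []. Qed.

Lemma hybridl (h h' : 'I_l -> V -> V -> C) y : pairs (hybrid h h' l) y = pairs h' y.
Proof. by apply: eq_bigr => j _; rewrite /hybrid ltn_ord. Qed.

Lemma altB n (K K' : ('I_n -> V) -> C) W : alt (fun y => K y - K' y) W = alt K W - alt K' W.
Proof. by rewrite /alt -sumrB; apply: eq_bigr => s _; rewrite mulrBr. Qed.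

Lemma alt_pairs_symmetric (h h' : 'I_l -> V -> V -> C) W :
  (forall j v w, h' j v w - h j v w = h' j w v - h j w v) -> alt (pairs h') W = alt (pairs h) W.
Proof.
move=> hC; have H m : (m <= l)%N -> alt (pairs (hybrid h h' m)) W = alt (pairs h) W.
  elim: m => [//|m IH ml]; rewrite -IH 1?ltnW //; apply/eqP; rewrite -subr_eq0 -altB; apply/eqP.
  rewrite (alt_ext _ (pairs_hybrid_step h h' (Ordinal ml))).
  exact: (@alt_pairs_slot _ (Ordinal ml) (fun v w => h' (Ordinal ml) v w - h (Ordinal ml) v w)).
by rewrite -(H l) // (alt_ext _ (hybridl h h')).
Qed.

Record covector (g : V -> V -> C) : Prop := Covector {
  covector_smooth : forall w, smooth_on nz (g^~ w);
  covector_linear : forall z (x x' : V) (b c : R), z != 0 -> g z (b%:C *: x + c%:C *: x') = b%:C * g z x + c%:C * g z x';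
  covector_invariant : forall z w (c : C), z != 0 -> c != 0 -> g (c *: z) (c *: w) = g z w;
  covector_horizontal : forall z (c : C), z != 0 -> g z (c *: z) = 0 }.

(* [h z v w] is, up to a kernel symmetric in [v] and [w], of the form
   D_v (beta_w) z: then D_u (h z v w) vanishes after alternation, by Clairaut. *)
Definition closed_kernel (h : V -> V -> V -> C) := exists P : V -> V -> V -> V -> C,
  (forall z u v w, z != 0 -> P z u v w = P z v u w) /\
  (forall z u v w, z != 0 -> real_derive u (fun z => h z v w) z - P z u v w = real_derive u (fun z => h z w v) z - P z u w v).

End KernelForms.

(** * Exactness of a product with one differentiated factor *)

Section Stokes.
Variables (R : realType) (k l' : nat).
Local Notation C := R[i].
Local Notation V := 'rV[C]_k.+1.
Local Notation nz := ([set z : V | z != 0]).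
Local Notation l := l'.+1.
Variables (h : 'I_l -> V -> V -> V -> C) (g : V -> V -> C) (m : 'I_l).
Hypotheses (hk : forall j, kernel2 (h j)) (hc : forall j, closed_kernel (h j)) (gc : covector g).

Let p : 'I_(l' + l).+1 := lshift l m.
(** The 0 is a placeholder in slot [p], reserved for the direction of differentiation: the factor
    [m] of [hm] reads only its second vector. *)
Let fill (x : 'I_(l' + l) -> V) (a : 'I_(l' + l).+1) : V := oapp x 0 (unlift p a).
Let hm (z : V) (j : 'I_l) (v w : V) : C := if j == m then g z w else h j z v w.
Let Psi (z : V) (x : 'I_(l' + l) -> V) : C := pairs (hm z) (fill x).

Let fill_lift x i : fill x (lift p i) = x i.
Proof. by rewrite /fill liftK. Qed.

Let Psi_kform : kform Psi.
Proof.
split=> [y|z z0 y u v i b c yi ui vi|z y c z0 c0|z y i c z0 yi].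
- apply: smooth_on_prod => [|j _]; first exact: (@open_nz R k).
  rewrite /hm; case: eqP => _; [exact: covector_smooth|exact: kernel2_smooth].
- have fE x : (forall j, j != i -> x j = y j) -> forall j, j != lift p i -> fill x j = fill y j.
    move=> xy j ji; rewrite /fill; case: unliftP => [j' ej|//] /=.
    by apply: xy; apply: contra_neq ji => <-.
  refine (@pairs_linear R k l (hm z) (fill y) (fill u) (fill v) (lift p i) b c _ _ _ _ _) => [j ej x x' w|j ej x x' w||j|j]; rewrite ?fill_lift //.
  + rewrite /hm; case: eqP => [jm|_]; last exact: kernel2_linearl.
    by move: (neq_lift p i); rewrite ej jm /p eqxx.
  + by rewrite /hm; case: eqP => _; [exact: covector_linear|exact: kernel2_linearr].
  + exact: fE.
  + exact: fE.
- have fc a : fill (fun i => c *: y i) a = c *: fill y a by rewrite /fill; case: unliftP => [j _|_] //=; rewrite scaler0.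
  apply: eq_bigr => j _; rewrite !fc /hm; case: eqP => _; [exact: covector_invariant|exact: kernel2_invariant].
have yi' : fill y (lift p i) = c *: z by rewrite fill_lift.
rewrite /Psi /pairs; move: (neq_lift p i) yi'; case: (split_ordP (lift p i : 'I_(l + l))) => j0 -> pi yj; rewrite (bigD1 j0) //= yj.
  rewrite /hm; case: eqP => [jm|_]; last by rewrite kernel2_horizontall // mul0r.
  by move: pi; rewrite jm /p eqxx.
by rewrite /hm; case: eqP => _; [rewrite covector_horizontal ?mul0r|rewrite kernel2_horizontalr // mul0r].
Qed.

Let Psi_lift z (y : 'I_(l + l) -> V) : Psi z (y \o lift p) = pairs (hm z) y.
Proof.
apply: eq_bigr => j _; rewrite /hm.
have e (a : 'I_(l + l)) : a != p -> fill (y \o lift p) a = y a.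
  by move=> ap; rewrite /fill; case: unliftP => [a' ->//|ap']; move: ap; rewrite ap' eqxx.
case: eqP => [_|/eqP jm]; rewrite ?e //; rewrite /p ?eq_rlshift //.
Qed.

(** By the product rule the exterior derivative is a sum over the factors, and the factor [m] gives
    the left-hand side. For any other factor [j], [closed_kernel] splits the derivative of [h j]
    into a part symmetric in the direction and the first vector of the pair, and a part symmetric in
    the two vectors of the pair; both vanish by alternation. *)
Lemma stokes_kernel : exists2 psi : preform R k (l' + l), is_form psi & forall z (W : 'M[C]_(l + l, k.+1)), z != 0 ->
  alt (pairs (fun j v w => if j == m then real_derive v (g^~ w) z else h j z v w)) W = (-1) ^+ p * ext_derivative psi z W.
Proof.
exists (fun z W => alt (Psi z) W); first exact: (alt_form Psi_kform).
move=> z W z0; rewrite -(ext_alt p W Psi_kform z0).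
pose F j y x := hm x j (y (lshift l j)) (y (rshift l j)).
pose D (y : 'I_(l + l) -> V) j := real_derive (y p) (F j y) z.
have dP (y : 'I_(l + l) -> V) : real_derive (y p) (Psi^~ (y \o lift p)) z = \sum_j \prod_i (if i == j then D y i else F i y z).
  rewrite (_ : (fun x => Psi x _) = fun x => \prod_j F j y x); last by apply/funext => x; rewrite Psi_lift.
  apply: has_derive_eq; apply: has_derive_prod => j; rewrite /D.
  apply: (smooth_on_has_derive (O := nz)) => //; rewrite /F /hm; case: eqP => _; [exact: covector_smooth|exact: kernel2_smooth].
rewrite (alt_ext _ dP) alt_sum (bigD1 m) //= [X in _ + X]big1 ?addr0 => [|j jm].
  apply: alt_ext => y; rewrite /pairs; apply: eq_bigr => j _; rewrite /D /F /hm.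
  by case: eqP => [->|_]; rewrite ?eqxx.
have [P [Psym Ssym]] := hc j.
pose S (y : 'I_(l + l) -> V) := D y j - P z (y p) (y (lshift l j)) (y (rshift l j)).
have Dj (y : 'I_(l + l) -> V) : D y j = real_derive (y p) (fun z => h j z (y (lshift l j)) (y (rshift l j))) z.
  by rewrite /D /F /hm (negPf jm).
have lr a b : lshift l a != rshift l b by rewrite eq_lrshift.
have ll a b : a != b -> lshift l a != lshift l b by move=> ab; rewrite (inj_eq (@lshift_inj _ _)).
have lm : lshift l j != p by rewrite /p (inj_eq (@lshift_inj _ _)).
have rp i : rshift l i != p by rewrite /p eq_rlshift.
have E (y : 'I_(l + l) -> V) (x : C) : \prod_i (if i == j then x else F i y z) = x * \prod_(i | i != j) F i y z.
  by rewrite (bigD1 j) //= eqxx; congr (_ * _); apply: eq_bigr => i /negPf ->.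
pose K1 (y : 'I_(l + l) -> V) := \prod_i (if i == j then P z (y p) (y (lshift l j)) (y (rshift l j)) else F i y z).
pose K2 (y : 'I_(l + l) -> V) := \prod_i (if i == j then S y else F i y z).
rewrite (alt_ext (K' := fun y => \sum_(b : bool) if b then K1 y else K2 y)); last first.
  move=> y; rewrite big_bool /= /K1 /K2 !E -mulrDl [_ + S y]addrC subrK -E; apply: eq_bigr => i _ /=.
  by have [->|] := eqVneq i j.
rewrite alt_sum big_bool /=.
have -> : alt K1 W = 0.
  apply: (alt_invariant (t := tperm p (lshift l j))) => [|y]; first by rewrite odd_tperm eq_sym.
  rewrite /K1; apply: eq_bigr => i _ /=; have [_|ij] := eqVneq i j.
    have tr : tperm p (lshift l j) (rshift l j) = rshift l j.
      by apply: tpermD; [rewrite eq_sym; exact: rp|exact: lr].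
    by rewrite tpermL tpermR tr Psym.
  rewrite /F /hm /= [tperm _ _ (rshift l i)]tpermD; [|by rewrite eq_sym|by rewrite eq_lrshift].
  have [//|im] := eqVneq i m.
  have tl : tperm p (lshift l j) (lshift l i) = lshift l i.
    by apply: tpermD; rewrite eq_sym; exact: ll.
  by rewrite tl.
have -> : alt K2 W = 0; last by rewrite addr0.
apply: (alt_invariant (t := tperm (lshift l j) (rshift l j))) => [|y]; first by rewrite odd_tperm eq_lrshift.
rewrite /K2; apply: eq_bigr => i _ /=; have [_|ij] := eqVneq i j.
  by rewrite /S !Dj /= tpermL tpermR tpermD //; exact/esym/Ssym.
have tl : tperm (lshift l j) (rshift l j) (lshift l i) = lshift l i.
  by rewrite tpermD ?eq_rlshift // (inj_eq (@lshift_inj _ _)) eq_sym.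
have tr : tperm (lshift l j) (rshift l j) (rshift l i) = rshift l i.
  by rewrite tpermD ?eq_lrshift // (inj_eq (@rshift_inj _ _)) eq_sym.
by rewrite /F /hm /= tl tr.
Qed.

End Stokes.

(** * The Levi form of log |Q|^2 and its potential *)

Section Mass.
Variables (R : realType) (k : nat).
Local Notation C := R[i].
Local Notation V := 'rV[C]_k.+1.
Local Notation nz := ([set z : V | z != 0]).
Implicit Types (Q : 'I_k.+1 -> mpoly k.+1 C).

Lemma hermH_expand (z v w : V) : z != 0 -> hermH z v w =
  herm v w * ((nsq z)%:C)^-1 - herm v z * herm z w * ((nsq z)%:C)^-1 * ((nsq z)%:C)^-1.
Proof.
move=> z0; have N0 := nsq_neq0 z0; rewrite /hermH !mul_hproj hermBl !hermBr !hermZl !hermZr herm_nsq.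
have -> : conjc (herm w z / (nsq z)%:C) = herm z w / (nsq z)%:C.
  have e (x y : C) : conjc (x * y) = conjc x * conjc y := rmorphM _ x y.
  by rewrite e herm_conj -fmorphV /= oppr0.
by move: (herm v w) (herm v z) (herm z w) N0; move: ((nsq z)%:C) => N a b c N0; field.
Qed.

Lemma smooth_on_herm2 (A B : V -> V) : (forall j, smooth_on nz (fun z => A z 0 j)) -> (forall j, smooth_on nz (fun z => B z 0 j)) ->
  smooth_on nz (fun z => herm (A z) (B z)).
Proof.
move=> sA sB; apply: smooth_on_sum => [|j _]; first exact: (@open_nz R k).
exact: (smooth_onM (@open_nz R k) (sA j) (smooth_on_conj (@open_nz R k) (sB j))).
Qed.

Lemma has_derive_herm (A B : V -> V) z v (A' B' : V) : (forall j, has_derive (fun y => A y 0 j) z v (A' 0 j)) ->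
  (forall j, has_derive (fun y => B y 0 j) z v (B' 0 j)) ->
  has_derive (fun y => herm (A y) (B y)) z v (herm A' (B z) + herm (A z) B').
Proof.
move=> hA hB; rewrite /herm -big_split /=; apply: has_derive_sum => j.
exact: (has_deriveM (hA j) (has_derive_conj (hB j))).
Qed.

(** The part of type (1,0) of the differential of log |Q|^2, applied to [w]. *)
Definition eta Q (w : V) (z : V) : C := herm (w *m jac Q z) (pmap Q z) * ((nsq (pmap Q z))%:C)^-1.

(** The Levi form of log |Q|^2. *)
Definition levi Q (z v w : V) : C := hermH (pmap Q z) (v *m jac Q z) (w *m jac Q z).

Section OneMap.
Variables (e : nat) (Q : 'I_k.+1 -> mpoly k.+1 C).
Hypothesis nd : nondegenerate e Q.

Let Q0 z := nondeg_pmap (z := z) nd.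

Lemma smooth_on_pmap_coord j : smooth_on nz (fun z => pmap Q z 0 j).
Proof.
rewrite (_ : (fun z => _) = fun z : V => meval (z ord0) (Q j)); first exact: smooth_on_meval (@open_nz R k).
by apply/funext => z; rewrite mxE.
Qed.

Lemma smooth_on_nsq_pmapV : smooth_on nz (fun z => ((nsq (pmap Q z))%:C)^-1).
Proof. exact: (smooth_on_pmap (@open_nz R k) (@open_nz R k) Q0 (@smooth_on_nsqV R k)). Qed.

Lemma smooth_on_eta w : smooth_on nz (eta Q w).
Proof.
apply: (smooth_onM (@open_nz R k) _ smooth_on_nsq_pmapV).
by apply: smooth_on_herm2 => j; [exact: smooth_on_mul_jac|exact: smooth_on_pmap_coord].
Qed.

Lemma smooth_on_levi v w : smooth_on nz (fun z => levi Q z v w).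
Proof.
have sJ (x : V) j := smooth_on_mul_jac Q x 0 j.
have s1 := smooth_on_herm2 (sJ v) (sJ w).
have s2 := smooth_on_herm2 (sJ v) smooth_on_pmap_coord.
have s3 := smooth_on_herm2 smooth_on_pmap_coord (sJ w).
have sN := smooth_on_nsq_pmapV; have o := @open_nz R k.
have s4 := smooth_onM o (smooth_on_cst (-1) o) (smooth_onM o (smooth_onM o (smooth_onM o s2 s3) sN) sN).
apply: smooth_on_eq (smooth_onD o (smooth_onM o s1 sN) s4); first exact: o.
by move=> z z0; rewrite /levi (hermH_expand _ _ (Q0 z0)) mulN1r.
Qed.

Lemma real_derive_eta z v w : z != 0 -> real_derive v (eta Q w) z =
  (herm (hess Q z v w) (pmap Q z) + herm (w *m jac Q z) (v *m jac Q z)) * ((nsq (pmap Q z))%:C)^-1 -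
  herm (w *m jac Q z) (pmap Q z) * (herm (v *m jac Q z) (pmap Q z) + herm (pmap Q z) (v *m jac Q z)) *
    ((nsq (pmap Q z))%:C)^-1 * ((nsq (pmap Q z))%:C)^-1.
Proof.
move=> z0; have N0 := nsq_neq0 (Q0 z0).
have dF j : has_derive (fun y => pmap Q y 0 j) z v ((v *m jac Q z) 0 j).
  rewrite jac_coord (_ : (fun y => _) = fun y : V => meval (y ord0) (Q j)); first exact: has_derive_meval.
  by apply/funext => y; rewrite mxE.
have dJ j : has_derive (fun y => (w *m jac Q y) 0 j) z v (hess Q z v w 0 j).
  have := @has_derive_mul_jac R k 1 Q w z v 0 j; rewrite mxE.
  by have -> : row 0 w = w by apply/rowP => a; rewrite mxE.
have dN : has_derive (fun y => (nsq (pmap Q y))%:C) z v (herm (v *m jac Q z) (pmap Q z) + herm (pmap Q z) (v *m jac Q z)).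
  rewrite (_ : (fun y => _) = fun y => herm (pmap Q y) (pmap Q y)); last by apply/funext => y; rewrite herm_nsq.
  exact: (has_derive_herm dF dF).
have h := has_deriveM (has_derive_herm dJ dF) (has_deriveV N0 dN).
rewrite (has_derive_eq h); move: (herm _ _) (herm _ _) (herm _ _) (herm _ _) (herm _ _) (_^-1) => a1 a2 a3 a4 a5 a6; ring.
Qed.

#[local] Opaque herm nsq hess jac pmap real_derive.

(** The exterior derivative of [eta] is the alternated Levi form up to sign: the terms with second
    derivatives of [Q] are symmetric in [v] and [w], and so is what the product rule leaves besides
    the Levi form. *)
Lemma eta_levi z v w : z != 0 ->
  real_derive v (eta Q w) z + levi Q z v w = real_derive w (eta Q v) z + levi Q z w v.
Proof.
move=> z0; have e1 := hermH_expand (v *m jac Q z) (w *m jac Q z) (Q0 z0).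
have e2 := hermH_expand (w *m jac Q z) (v *m jac Q z) (Q0 z0).
rewrite (real_derive_eta v w z0) (real_derive_eta w v z0) (hessC Q z w v) /levi e1 e2.
move: (herm (hess _ _ _ _) _) (herm (v *m _) (w *m _)) (herm (w *m _) (v *m _)) (herm (v *m _) (pmap _ _)) (herm (w *m _) (pmap _ _))
  (herm (pmap _ _) (v *m _)) (herm (pmap _ _) (w *m _)) (_^-1) => a1 a2 a3 a4 a5 a6 a7 a8; ring.
Qed.

Lemma etaZ (c : C) z w : z != 0 -> c != 0 -> eta Q (c *: w) (c *: z) = eta Q w z.
Proof.
move=> z0 c0; have hQ := nondeg_homog nd; have e0 := nondeg_gt0 nd.
have cc : conjc c != 0 by rewrite conjc_eq0.
have eJ : (c *: w) *m jac Q (c *: z) = c ^+ e *: (w *m jac Q z).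
  by rewrite (jac_homog _ _ hQ) -scalemxAl -scalemxAr scalerA -exprS prednK.
rewrite /eta eJ (pmap_homog hQ) hermZl hermZr nsqZ.
have n1 : c ^+ e * conjc (c ^+ e) != 0 by rewrite mulf_neq0 // ?conjc_eq0 expf_neq0.
have N0 := nsq_neq0 (Q0 z0); move: n1; move: (c ^+ e) (conjc (c ^+ e)) (herm _ _) ((nsq _)%:C) N0 => a b x N N0 n1.
have := n1; rewrite mulf_eq0 negb_or => /andP[a0 b0].
by field; rewrite a0 b0 N0.
Qed.

Lemma leviZ (c : C) z v w : z != 0 -> c != 0 -> levi Q (c *: z) (c *: v) (c *: w) = levi Q z v w.
Proof.
move=> z0 c0; have hQ := nondeg_homog nd; have e0 := nondeg_gt0 nd.
have eJ (x : V) : (c *: x) *m jac Q (c *: z) = c ^+ e *: (x *m jac Q z).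
  by rewrite (jac_homog _ _ hQ) -scalemxAl -scalemxAr scalerA -exprS prednK.
have ce : c ^+ e != 0 by rewrite expf_neq0.
rewrite /levi (eJ v) (eJ w) (pmap_homog hQ) /hermH (hprojZ _ ce) -!scalemxAl hermZl hermZr nsqZ.
have n1 : c ^+ e * conjc (c ^+ e) != 0 by rewrite mulf_neq0 // ?conjc_eq0.
have N0 := nsq_neq0 (Q0 z0); move: n1; move: (c ^+ e) (conjc (c ^+ e)) (herm _ _) ((nsq _)%:C) N0 => a b x N N0 n1.
have := n1; rewrite mulf_eq0 negb_or => /andP[a0 b0].
by field; rewrite a0 b0 N0.
Qed.

(** [eta] is nonzero on radial vectors, so it does not descend to P^k; but its value there depends
    on [Q] only through the degree. *)
Lemma eta_self (c : C) z : z != 0 -> eta Q (c *: z) z = e%:R * c.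
Proof.
move=> z0; have hQ := nondeg_homog nd; rewrite /eta -scalemxAl (euler_jac _ hQ) scalerA hermZl herm_nsq.
by rewrite -mulrA mulfV ?(nsq_neq0 (Q0 z0)) // mulr1 mulrC.
Qed.

Lemma herm0l (w : V) : herm 0 w = 0.
Proof. by have := hermZl 0 0 w; rewrite scale0r mul0r. Qed.

Lemma herm0r (w : V) : herm w 0 = 0.
Proof. by have := hermZr 0 w 0; rewrite scale0r rmorph0 mul0r. Qed.

Lemma hermDl (u v w : V) : herm (u + v) w = herm u w + herm v w.
Proof. by have := hermBl (u + v) v w; rewrite addrK => ->; rewrite subrK. Qed.

Lemma hermDr (u v w : V) : herm w (u + v) = herm w u + herm w v.
Proof. by have := hermBr (u + v) v w; rewrite addrK => ->; rewrite subrK. Qed.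

Lemma kernel2_levi (c : C) : kernel2 (fun z v w => c * levi Q z v w).
Proof.
have hQ := nondeg_homog nd.
split=> [v w|z x x' w b b' z0|z x x' w b b' z0|z v w b z0 b0|z w b z0|z w b z0].
- exact: (smooth_onM (@open_nz R k) (smooth_on_cst c (@open_nz R k)) (smooth_on_levi v w)).
- rewrite /levi /hermH !mulmxDl -!scalemxAl hermDl !hermZl.
  by move: (herm _ _) (herm _ _) (_^-1) => a1 a2 a3; ring.
- rewrite /levi /hermH !mulmxDl -!scalemxAl hermDr !hermZr.
  have -> : conjc b%:C = b%:C :> C by rewrite /= oppr0.
  have -> : conjc b'%:C = b'%:C :> C by rewrite /= oppr0.
  by move: (herm _ _) (herm _ _) (_^-1) => a1 a2 a3; ring.
- by rewrite leviZ.
- rewrite /levi /hermH -scalemxAl (euler_jac _ hQ) scalerA -[_ *m hproj _]scalemxAl (hproj_self (Q0 z0)) scaler0 herm0l.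
  by rewrite mul0r mulr0.
- rewrite /levi /hermH -scalemxAl (euler_jac _ hQ) scalerA -[in X in herm _ X]scalemxAl (hproj_self (Q0 z0)) scaler0 herm0r.
  by rewrite mul0r mulr0.
Qed.

Lemma real_deriveD (F G : V -> C) z u (c : C) : smooth_on nz F -> smooth_on nz G -> z != 0 ->
  real_derive u (fun z => F z + c * G z) z = real_derive u F z + c * real_derive u G z.
Proof.
move=> sF sG z0; apply: has_derive_eq.
have hF := smooth_on_has_derive (v := u) sF z0; have hG := smooth_on_has_derive (v := u) sG z0.
have := has_deriveD hF (has_deriveM (has_derive_cst c z u) hG).
by rewrite mul0r add0r.
Qed.

Lemma real_derive_near (F G : V -> C) z u : smooth_on nz F -> z != 0 -> (forall y, y != 0 -> F y = G y) ->
  real_derive u F z = real_derive u G z.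
Proof.
move=> sF z0 FG; apply/esym/has_derive_eq.
by apply: has_derive_local (smooth_on_has_derive (v := u) sF z0); exact: (open_near (@open_nz R k) z0).
Qed.

(** [P] is the opposite of a second derivative of [eta], symmetric by Clairaut's theorem. What
    remains is the derivative of the expression that [eta_levi] shows to be symmetric in [v] and
    [w]. *)
Lemma closed_levi (c : C) : closed_kernel (fun z v w => c * levi Q z v w).
Proof.
exists (fun z u v w => - c * real_derive u (real_derive v (eta Q w)) z); split=> z u v w z0.
  by rewrite (clairaut _ _ (@open_nz R k) (smooth_on_eta w) z0).
have o := @open_nz R k.
have sl x y : smooth_on nz (fun z => c * levi Q z x y) := smooth_onM o (smooth_on_cst c o) (smooth_on_levi x y).
have sd x y : smooth_on nz (real_derive x (eta Q y)) := smooth_on_derive x (smooth_on_eta y).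
have r1 := real_deriveD u c (sl v w) (sd v w) z0; have r2 := real_deriveD u c (sl w v) (sd w v) z0.
have sF := smooth_onD o (sl v w) (smooth_onM o (smooth_on_cst c o) (sd v w)).
have pe y : y != 0 -> c * levi Q y v w + c * real_derive v (eta Q w) y = c * levi Q y w v + c * real_derive w (eta Q v) y.
  by move=> y0; have h := eta_levi v w y0; rewrite -(mulrDr c (levi _ _ _ _)) -(mulrDr c (levi _ _ _ _)) addrC h addrC.
have h := real_derive_near u sF z0 pe.
have e0 (x y : C) : x - - c * y = x + c * y by rewrite mulNr opprK.
exact: etrans (etrans (e0 _ _) (esym r1)) (etrans h (esym (etrans (e0 _ _) (esym r2)))).
Qed.

End OneMap.

Lemma alt_mul n (K : ('I_n -> V) -> C) (W : 'M[C]_(n, k.+1)) (M : 'M[C]_k.+1) : alt K (W *m M) = alt (fun y => K (fun i => y i *m M)) W.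
Proof.
apply: eq_bigr => s _; congr (_ * K _); apply/funext => i; exact: row_mul.
Qed.

Variable l : nat.

Lemma pull_Theta_alt Q z W : pull Q (@Theta R k l) z W = 'i%C ^+ (l ^ 2) * alt (pairs (fun _ : 'I_l => levi Q z)) W.
Proof. by rewrite /pull Theta_alt alt_mul. Qed.

End Mass.

Section MassPullback.
Variables (R : realType) (k : nat) (e : nat) (Q : 'I_k.+1 -> mpoly k.+1 R[i]).
Hypothesis nd : nondegenerate e Q.
Local Notation C := R[i].
Local Notation V := 'rV[C]_k.+1.
Local Notation nz := ([set z : V | z != 0]).
Local Notation idp := (@idpoly R k).

Lemma nondegenerate_id : nondegenerate 1 idp.
Proof.
split=> // [j|z]; last by rewrite pmap_id.
by rewrite dhomogX /= mdeg1.
Qed.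

Lemma levi_id z v w : levi idp z v w = hermH z v w.
Proof. by rewrite /levi pmap_id jac_id !mulmx1. Qed.

Variables (me : C) (meE : me = - e%:R).

#[local] Opaque herm nsq hess jac pmap real_derive.

(** As [me] is [- e], the values of the two potentials on radial vectors cancel, and the combination
    descends to P^k. *)
Definition gam (z w : V) : C := eta Q w z + me * eta idp w z.

Lemma covector_gam : covector gam.
Proof.
have o := @open_nz R k.
split=> [w|z x x' b c z0|z w c z0 c0|z c z0]; rewrite /gam.
- exact: (smooth_onD o (smooth_on_eta nd w) (smooth_onM o (smooth_on_cst _ o) (smooth_on_eta nondegenerate_id w))).
- have etaD Q' : eta Q' (b%:C *: x + c%:C *: x') z = b%:C * eta Q' x z + c%:C * eta Q' x' z.
    rewrite /eta (mulmxDl (b%:C *: x)) -!scalemxAl hermDl !hermZl.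
    by move: (herm _ _) (herm _ _) (_^-1) => a1 a2 a3; ring.
  rewrite !etaD.
  by move: (eta _ _ _) (eta _ _ _) (eta _ _ _) (eta _ _ _) => a1 a2 a3 a4; ring.
- by rewrite (etaZ nd w z0 c0) (etaZ nondegenerate_id w z0 c0).
- by rewrite (eta_self nd c z0) (eta_self nondegenerate_id c z0) mul1r meE mulNr subrr.
Qed.

Variable l' : nat.
Local Notation l := l'.+1.

(** The first [m] factors come from [Q], the others from the identity with weight [e], all with a
    minus sign: then the change in one factor is, modulo symmetric kernels, the derivative of
    [gam]. *)
Definition levi_chain (m : nat) : preform R k (l + l) := fun z W =>
  alt (pairs (hybrid (fun _ : 'I_l => fun v w => me * levi idp z v w) (fun _ v w => -1 * levi Q z v w) m)) W.

Lemma kernel2_hybrid m (j : 'I_l) : kernel2 (fun z => hybrid (fun _ : 'I_l => fun v w => me * levi idp z v w) (fun _ v w => -1 * levi Q z v w) m j).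
Proof. by rewrite /hybrid; case: (j < m)%N; [exact: (kernel2_levi nd (-1))|exact: (kernel2_levi nondegenerate_id me)]. Qed.

Lemma closed_hybrid m (j : 'I_l) : closed_kernel (fun z => hybrid (fun _ : 'I_l => fun v w => me * levi idp z v w) (fun _ v w => -1 * levi Q z v w) m j).
Proof. by rewrite /hybrid; case: (j < m)%N; [exact: (closed_levi nd (-1))|exact: (closed_levi nondegenerate_id me)]. Qed.

Lemma levi_chain_form m : is_form (levi_chain m).
Proof. exact: (alt_form (pairs_kform (kernel2_hybrid m))). Qed.

Lemma good_levi_chain (T : preform R k (l + l) -> C) m : good T -> (m < l)%N -> T (levi_chain m.+1) = T (levi_chain m).
Proof.
move=> gT ml; pose mo := Ordinal ml.
have [psi hpsi epsi] := stokes_kernel mo (kernel2_hybrid m) (closed_hybrid m) covector_gam.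
set s := (-1) ^+ _ in epsi.
have ss : s * s = 1 by rewrite /s -expr2 sqrr_sign.
have step z W : z != 0 -> levi_chain m.+1 z W - levi_chain m z W = s * ext_derivative psi z W.
  move=> z0; rewrite -(epsi z W z0) /levi_chain -altB (alt_ext _ (pairs_hybrid_step _ _ mo)).
  apply: alt_pairs_symmetric => j v w; case: eqP => [_|_]; last by rewrite !subrr.
  have dg x y : real_derive x (gam^~ y) z = real_derive x (eta Q y) z + me * real_derive x (eta idp y) z.
    exact: (real_deriveD x _ (smooth_on_eta nd y) (smooth_on_eta nondegenerate_id y) z0).
  rewrite !dg; have h1 := eta_levi nd v w z0; have h2 := eta_levi nondegenerate_id v w z0.
  move: h1 h2; move: (real_derive _ _ _) (real_derive _ _ _) (real_derive _ _ _) (real_derive _ _ _) (levi Q z v w) (levi Q z w v) (levi idp z v w) (levi idp z w v).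
  move=> a1 a2 a3 a4 b1 b2 b3 b4 h1 h2.
  have -> : b1 = a3 + b2 - a4 by rewrite -h1; ring.
  have -> : b3 = a1 + b4 - a2 by rewrite -h2; ring.
  by ring.
(* The exterior derivative is a form because it is a combination of two consecutive chains, the sign
   [s] being its own inverse. *)
have hext : is_form (ext_derivative psi).
  apply: form_eq (form_add s (levi_chain_form m.+1) (form_scalar (- s) (levi_chain_form m))) => z W z0.
  by rewrite mulNr -mulrBr step // mulrA ss mul1r.
have Text : T (ext_derivative psi) = 0 by move: (good_closed gT) => cl; exact: (cl psi hpsi).
transitivity (T (fun z W => s * ext_derivative psi z W + levi_chain m z W)).
  apply: (good_ext gT (levi_chain_form _) (form_add s hext (levi_chain_form m))) => z W z0.
  by rewrite -step // subrK.
by rewrite (good_linear gT _ hext (levi_chain_form m)) Text mulr0 add0r.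
Qed.

End MassPullback.

Section MassTheorem.
Variables (R : realType) (k : nat) (e l : nat) (Q : 'I_k.+1 -> mpoly k.+1 R[i]).
Hypothesis nd : nondegenerate e Q.
Local Notation C := R[i].

#[local] Opaque herm nsq hess jac pmap real_derive.

Lemma alt_pairs_scale n (c : C) (h : 'I_n -> 'rV[C]_k.+1 -> 'rV[C]_k.+1 -> C) W : alt (pairs (fun j v w => c * h j v w)) W = c ^+ n * alt (pairs h) W.
Proof.
rewrite -alt_scale; apply: alt_ext => y; rewrite /pairs big_split /= prodr_const card_ord //.
Qed.

Lemma signed_scale (i x y r : C) n : i != 0 -> (-1) ^+ n / i * x = (- r) ^+ n / i * y -> x = r ^+ n * y.
Proof.
move=> i0; rewrite (exprNn r) => h; have s0 : (-1) ^+ n / i != 0 by rewrite mulf_neq0 ?signr_eq0 // invr_eq0.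
apply: (mulfI s0); rewrite h; move: ((-1) ^+ n) (i^-1) (r ^+ n) => x1 x2 x3; ring.
Qed.

(* By Stokes, as the levi forms of [Q] and of [e] times the identity differ by an exact form. *)
Lemma good_pull_Theta (T : preform R k (l + l) -> C) : good T -> T (pull Q (@Theta R k l)) = e%:R ^+ l * T (@Theta R k l).
Proof.
case: l T => [|l'] T gT.
  (* For [l = 0] both products of kernels are empty. *)
  rewrite expr0 mul1r; have -> // : pull Q (@Theta R k 0) = @Theta R k 0.
  apply/funext => z; apply/funext => W; rewrite pull_Theta_alt Theta_alt; congr (_ * _); apply: alt_ext => y.
  by rewrite /pairs !big_ord0.
have H m : (m <= l'.+1)%N -> T (@levi_chain R k Q (- e%:R) l' m) = T (@levi_chain R k Q (- e%:R) l' 0).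
  by elim: m => [//|m IH] ml; rewrite (good_levi_chain nd (erefl _) gT ml) IH // ltnW.
have := H l'.+1 (leqnn _).
have e1 : @levi_chain R k Q (- e%:R) l' l'.+1 = fun z W => ((-1) ^+ l'.+1 * 'i%C ^- (l'.+1 ^ 2)) * pull Q (@Theta R k l'.+1) z W.
  apply/funext => z; apply/funext => W; rewrite pull_Theta_alt /levi_chain (alt_ext _ (hybridl _ _)) alt_pairs_scale.
  by rewrite mulrA mulfVK // expf_neq0 // neq0Ci.
have e2 : @levi_chain R k Q (- e%:R) l' 0 = fun z W => ((- e%:R) ^+ l'.+1 * 'i%C ^- (l'.+1 ^ 2)) * @Theta R k l'.+1 z W.
  apply/funext => z; apply/funext => W; rewrite Theta_alt /levi_chain (alt_ext _ (hybrid0 _ _)) alt_pairs_scale.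
  rewrite mulrA mulfVK ?expf_neq0 ?neq0Ci //; congr (_ * _); apply: alt_ext => y; apply: eq_bigr => j _.
  by rewrite levi_id.
have t1 := goodZ gT ((-1) ^+ l'.+1 * 'i%C ^- (l'.+1 ^ 2)) (pull_form nd (Theta_form R k l'.+1)).
have t2 := goodZ gT ((- e%:R) ^+ l'.+1 * 'i%C ^- (l'.+1 ^ 2)) (Theta_form R k l'.+1).
move=> h; have i0 : 'i%C ^+ (l'.+1 ^ 2) != 0 :> C by rewrite expf_neq0 // neq0Ci.
exact: (signed_scale i0 (etrans (esym (etrans (congr1 T e1) t1)) (etrans h (etrans (congr1 T e2) t2)))).
Qed.

End MassTheorem.

(** * Limits of currents *)

Section Currents.
Variables (R : realType) (k l : nat).
Local Notation C := R[i].
Local Notation V := 'rV[C]_k.+1.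
Local Notation nz := ([set z : V | z != 0]).
Local Notation functional := (preform R k (l + l) -> C).
Implicit Types (Q : 'I_k.+1 -> mpoly k.+1 C) (T S : functional).

#[local] Opaque Theta hermH wedge.

Lemma iter_derive_eq (O : set V) (F G : V -> C) vs z : open O -> (forall z, O z -> F z = G z) -> smooth_on O F -> O z ->
  iter_derive vs F z = iter_derive vs G z.
Proof.
move=> oO FG sF; elim: vs z => [z Oz|v vs IH z Oz]; first exact: FG.
apply/esym/has_derive_eq.
apply: has_derive_local (open_near oO Oz IH) _; exact: (derivable_has_derive ((smooth_on_iter sF vs Oz).2 v)).
Qed.

Lemma iter_derive0 vs (z : V) : iter_derive vs (fun=> 0 : C) z = 0.
Proof.
elim: vs z => [//|v vs IH] z; apply: has_derive_eq.
have e0 : iter_derive vs (fun=> 0 : C) = fun=> 0 by apply/funext => y; exact: IH.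
by have := has_derive_cst (0 : C) z v; rewrite -{1}e0.
Qed.

(** Extensionality comes from continuity: if two forms agree off the origin, all derivatives of
    their difference vanish on the unit sphere, and the bound applies with [M = 0]. *)
Lemma current_good T : is_current T -> bidimension T -> positive T -> current_closed T -> good T.
Proof.
move=> cT bT pT clT; split=> //; first exact: current_linear.
move=> phi psi hp hq e; apply/eqP; rewrite -subr_eq0; apply/eqP.
have [N [K hK]] := current_continuous cT.
have hd := form_add (-1) hq hp; have := current_linear cT (-1) hq hp.
have := hK _ 0 hd; rewrite mulr0 => h0 eT.
have : `|T (fun z W => -1 * psi z W + phi z W)| <= 0.
  apply: h0 => z vs W z1 _ _ _.
  have z0 : z != 0 by apply: contra_eq_neq z1 => ->; rewrite normr0 eq_sym oner_eq0.
  rewrite (_ : iter_derive vs _ z = 0) ?normr0 //.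
  rewrite (iter_derive_eq (O := nz) (G := fun=> 0) vs (@open_nz R k) _ (form_smooth_on W hd) z0) ?iter_derive0 //.
  by move=> y y0; rewrite e // mulN1r addNr.
by rewrite normr_le0 eT mulN1r addrC => /eqP.
Qed.

(** The coefficients along the real basis are continuous off the origin, hence bounded on the unit
    sphere. *)
Lemma form_bounded n (phi : preform R k n) : is_form phi ->
  exists2 M : R, 0 <= M & forall z W, vn z = 1 -> vn W <= 1 -> cn (phi z W) <= M.
Proof.
move=> hp; pose E (f : {ffun 'I_n -> 'I_k.+1 * bool}) : 'M[C]_(n, k.+1) := \matrix_i ebase R (f i).
have bE f : exists2 M : R, 0 <= M & forall z, vn z = 1 -> cn (phi z (E f)) <= M.
  have := @compact_ind _ _ (fun S : set V => exists2 M : R, 0 <= M & forall x : V, S x -> vn x = 1 -> cn (phi x (E f)) <= M)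
    (@vn_ball_compact R k.+1 0 1).
  case=> [|B B' [M M0 h] [M' M0' h']|B B' BB [M M0 h]|x _|M M0 hM].
  - by exists 0.
  - exists (M + M'); first by rewrite addr_ge0.
    by move=> x [/h Bx|/h' Bx] /Bx {}Bx; apply: le_trans Bx _; rewrite ?lerDl ?lerDr.
  - by exists M => // x /BB; exact: h.
  (* Compactness runs over the unit ball; near its centre there is no point of the sphere, so
     nothing is to be bounded. *)
  - have [x1|x1] := eqVneq (vn x) 0.
      exists [set y | vn (x - y) < 1]; first by apply/nbhs_vnP; exists 1.
      exists 0 => // y h1 h2; have h3 : vn (x - y) < 1 by exact: h1.
      have := vn_le_sub y x; rewrite (vnB y x) h2 x1 add0r => h4.
      by move: (lt_le_trans h3 h4); rewrite ltxx.
    have x0 : x != 0 by rewrite -vn_eq0.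
    have c := smooth_on_continuous (form_smooth_on (E f) hp) x0.
    have hn : nbhs (phi x (E f)) [set w : C | cn (phi x (E f) - w) < 1] by apply/nbhs_cnP; exists 1.
    exists [set y | cn (phi x (E f) - phi y (E f)) < 1]; first exact: c _ hn.
    exists (cn (phi x (E f)) + 1); first by rewrite addr_ge0 ?cn_ge0.
    move=> y h1 _; have h2 : cn (phi x (E f) - phi y (E f)) < 1 by exact: h1.
    have h3 : cn (phi y (E f)) <= cn (phi x (E f)) + cn (phi x (E f) - phi y (E f)).
      by rewrite (cnB (phi x (E f))); exact: cn_le_sub.
    by move: h2 h3; norm_lra.
  by exists M => // z z1; apply: hM => //; change (vn (z - 0) <= 1); rewrite subr0 z1.
have /choice[M hM] : forall f, exists M : R, 0 <= M /\ forall z, vn z = 1 -> cn (phi z (E f)) <= M.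
  by move=> f; have [M M0 h] := bE f; exists M.
exists (\sum_f M f); first by apply: sumr_ge0 => f _; exact: (hM f).1.
move=> z W z1 W1; have z0 : z != 0 by rewrite -vn_eq0 z1 oner_eq0.
rewrite (form_expand W hp z0); apply: le_trans (cn_sum _ _ _) _; apply: ler_sum => f _.
rewrite cnM -[leRHS]mul1r; apply: ler_pM; rewrite ?cn_ge0 //; last exact: (hM f).2.
elim/big_ind: _ => [|x y hx hy|i _]; first by rewrite cn1.
  by rewrite cnM -[leRHS]mul1r; apply: ler_pM; rewrite ?cn_ge0.
rewrite cn_real; apply: le_trans (rcoord_le _ _) _.
by apply/vn_leP => // a b; rewrite mxE; apply: le_trans (vn_coord _ _ _) _.
Qed.

(** By [domination] the functional is continuous of order 0. The bound [M] is nonnegative because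
    the unit sphere is not empty. *)
Lemma good_current S : good S -> is_current S.
Proof.
move=> gS; split; first exact: good_linear.
have [K K0 dom] := domination R k l.
exists 0%N, (K * complex.Re (S (@Theta R k l))) => phi M hp hM.
have hM' z W : vn z = 1 -> vn W <= 1 -> cn (phi z W) <= M.
  move=> z1 W1; have h1 : `|z| = 1 by rewrite vnE z1.
  have h2 : `|W| <= 1 by rewrite vnE lecR.
  by have := hM z [::] W h1 isT isT h2; rewrite /= cnE lecR.
have M0 : 0 <= M.
  have [z z1] : exists z : V, vn z = 1.
    have n0 : (const_mx 1 : V) != 0 by apply/negP => /eqP/rowP/(_ 0); rewrite !mxE => /eqP; rewrite oner_eq0.
    have [z] := unit_representative (pclass (mkpunctured n0)).
    by move=> z1 _; exists (pval z).
  by apply: le_trans (cn_ge0 _) (hM' z 0 z1 _); rewrite vn0.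
rewrite cnE lecR; apply: le_trans (dom S gS phi M hp M0 hM') _.
by rewrite mulrAC.
Qed.

(** The value is 0 on functions that are not forms, so that [current_closed], which evaluates at
    [ext_derivative psi], can be checked by cases. *)
Definition on_forms n (T : preform R k n -> C) (phi : preform R k n) : C := if `[< is_form phi >] then T phi else 0.

Lemma on_formsE n (T : preform R k n -> C) phi : is_form phi -> on_forms T phi = T phi.
Proof. by move=> h; rewrite /on_forms asboolT. Qed.

Lemma pull_bidegree e Q n a b (phi : preform R k n) : nondegenerate e Q -> bidegree a b phi -> bidegree a b (pull Q phi).
Proof.
move=> nd [ab h]; split=> // z W c z0; rewrite /pull -scalemxAl h //; exact: nondeg_pmap nd z0.
Qed.

Lemma pull_positive e Q (phi : preform R k (l + l)) : nondegenerate e Q -> strongly_positive phi -> strongly_positive (pull Q phi).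
Proof.
move=> nd pp z z0; have [N [c [A [hc hA h]]]] := pp _ (nondeg_pmap nd z0).
exists N, c, (fun s => jac Q z *m A s); split=> // [s|W].
  by rewrite mulmxA (euler_jac _ (nondeg_homog nd)) -scalemxAl hA scaler0.
by rewrite /pull h; apply: eq_bigr => s _; rewrite mulmxA.
Qed.

Lemma closed_on_pull e Q n (T : preform R k n -> C) : nondegenerate e Q ->
  (forall phi psi, is_form phi -> is_form psi -> (forall z W, z != 0 -> phi z W = psi z W) -> T phi = T psi) ->
  current_closed T -> current_closed (on_forms (fun phi => T (pull Q phi))).
Proof.
move=> nd; case: n T => [//|n] T eT cT psi hp; rewrite /on_forms; case: asboolP => // hd.
have hpd := pull_form nd hd.
have e0 z W : z != 0 -> pull Q (ext_derivative psi) z W = ext_derivative (pull Q psi) z W.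
  by move=> z0; rewrite (ext_derivative_pull W nd hp z0).
rewrite (eT _ _ hpd (form_eq e0 hpd) e0); exact: cT (pull_form nd hp).
Qed.

Lemma good_on_pull e Q T : nondegenerate e Q -> good T -> good (on_forms (fun phi => T (pull Q phi))).
Proof.
move=> nd gT; have pf n (phi : preform R k n) : is_form phi -> is_form (pull Q phi) := pull_form nd.
split=> [c phi psi hp hq|phi psi hp hq e0|a b phi hp hb ab|phi hp pp|].
- rewrite !on_formsE //; last exact: form_add.
  exact: (good_linear gT c (pf _ _ hp) (pf _ _ hq)).
- rewrite !on_formsE //; apply: (good_ext gT (pf _ _ hp) (pf _ _ hq)) => z W z0.
  by rewrite /pull e0 //; exact: nondeg_pmap nd z0.
- rewrite on_formsE //; apply: (good_bidim gT (pf _ _ hp) _ ab).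
  exact: pull_bidegree nd hb.
- rewrite on_formsE //; apply: (good_positive gT (pf _ _ hp)); exact: pull_positive nd pp.
exact: (closed_on_pull nd (good_ext gT) (good_closed gT)).
Qed.

End Currents.

(** * Limits of functionals along an ultrafilter *)

Section LimitCurrent.
Variables (R : realType) (k l : nat).
Local Notation C := R[i].
Local Notation V := 'rV[C]_k.+1.
Local Notation functional := (preform R k (l + l) -> C).
Implicit Types (Q : 'I_k.+1 -> mpoly k.+1 C) (T S : functional).

#[local] Opaque Theta hermH wedge.

Definition tends (G : set_system nat) (u : nat -> C) (a : C) : Prop := u @ G --> a.

Lemma bounded_ultra (G : set_system nat) (u : nat -> C) (B : R) : UltraFilter G -> (forall n, cn (u n) <= B) -> exists a, tends G u a.
Proof.
move=> UG hu; have PG : ProperFilter G by case: UG.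
have PF : ProperFilter (u @ G) by exact: fmap_proper_filter.
have [|a [_ ca]] := @disk_compact R 0 B (u @ G) PF.
  by apply: (@filterS _ G _ setT) => [n _|]; [rewrite /= subr0; exact: hu|exact: filterT].
exists a => A aA; have [//|nA] := in_ultra_setVsetC (u @^-1` A) UG.
have [x [nAx Ax]] := ca (~` A) A nA aA.
by exfalso; exact: nAx.
Qed.

Lemma lim_unique (G : set_system nat) (u : nat -> C) (a b : C) : ProperFilter G -> tends G u a -> tends G u b -> a = b.
Proof. by move=> PG; exact: (cvg_unique (@norm_hausdorff _ C)). Qed.

Lemma tends_cst (G : set_system nat) (a : C) : ProperFilter G -> tends G (fun=> a) a.
Proof. by move=> PG; exact: cvg_cst. Qed.

Lemma tends_linear (G : set_system nat) (u v : nat -> C) (a b c : C) : ProperFilter G -> tends G u a -> tends G v b ->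
  tends G (fun n => c * u n + v n) (c * a + b).
Proof.
move=> PG ua vb; have FG : Filter G by exact: _.
have h := @limM _ _ G FG (fun=> c) u c a (@tends_cst G c PG) ua.
exact: (@limD _ _ G FG _ v _ b h vb).
Qed.

Lemma lim_ge0 (G : set_system nat) (u : nat -> C) (a : C) : ProperFilter G -> (forall n, 0 <= u n) -> tends G u a -> 0 <= a.
Proof.
move=> PG u0 ua; suff -> : a = (cn a)%:C by rewrite lecR cn_ge0.
apply/eqP; rewrite -subr_eq0 -cn_eq0; apply/negPn/negP => n0.
have e0 : 0 < cn (a - (cn a)%:C) by rewrite lt_def n0 cn_ge0.
have hn : nbhs a [set w | cn (a - w) < cn (a - (cn a)%:C) / 2].
  by apply/nbhs_cnP; exists (cn (a - (cn a)%:C) / 2) => //; rewrite divr_gt0.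
have hG : G [set n | cn (a - u n) < cn (a - (cn a)%:C) / 2] := ua _ hn.
have [n hna] := filter_ex hG.
have {}hna : cn (a - u n) < cn (a - (cn a)%:C) / 2 by exact: hna.
have un : u n = (cn (u n))%:C by rewrite -cnE ger0_norm.
have h1 : cn (u n - (cn a)%:C) <= cn (a - u n).
  rewrite {1}un -rmorphB cn_real ler_norml.
  have h2 := cn_le_sub a (u n); have h3 := cn_le_sub (u n) a; rewrite (cnB (u n) a) in h3.
  by apply/andP; split; lra.
have h4 := cn_triangle (u n) a (cn a)%:C.
by move: hna h1 h4; lra.
Qed.

Lemma closed_limit n (T : nat -> preform R k n -> C) (S : preform R k n -> C) : (forall phi, ~ is_form phi -> S phi = 0) ->
  (forall phi a, is_form phi -> (forall j, T j phi = a) -> S phi = a) -> (forall j, current_closed (T j)) -> current_closed S.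
Proof.
case: n T S => [//|n] T S nS cst cl psi hp; have [hd|] := pselect (is_form (ext_derivative psi)); last exact: nS.
by apply: cst => // j; exact: cl.
Qed.

Lemma limit_functional (T : nat -> functional) (B : R) : (forall n, good (T n)) -> (forall n, complex.Re (T n (@Theta R k l)) <= B) ->
  exists S, [/\ good S, forall a, (forall n, T n (@Theta R k l) = a) -> S (@Theta R k l) = a &
    forall phi, is_form phi -> (exists N, forall n, (N <= n)%N -> T n phi = 0) -> S phi = 0].
Proof.
move=> gT hB; have [G [UG sG]] := ultraFilterLemma eventually_filter.
have PG : ProperFilter G by case: UG.
have [K K0 dom] := domination R k l.
have /choice[S hS] : forall phi, exists a : C, (is_form phi -> tends G (T ^~ phi) a) /\ (~ is_form phi -> a = 0).
  move=> phi; have [hp|np] := pselect (is_form phi); last by exists 0.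
  have [M M0 hM] := form_bounded hp.
  have [a ha] : exists a, tends G (T ^~ phi) a; last by exists a.
  apply: (@bounded_ultra _ _ (K * M * B)) => // n.
  apply: le_trans (dom _ (gT n) phi M hp M0 hM) _.
  by apply: ler_wpM2l => //; rewrite mulr_ge0.
have lS phi : is_form phi -> tends G (T ^~ phi) (S phi) := (hS phi).1.
have nS phi : ~ is_form phi -> S phi = 0 := (hS phi).2.
have cst phi a : is_form phi -> (forall n, T n phi = a) -> S phi = a.
  move=> hp h; apply: (lim_unique PG (lS _ hp)).
  by rewrite (_ : T ^~ phi = fun=> a); [exact: tends_cst|apply/funext].
exists S; split; last first.
- move=> phi hp [N hN]; apply: (lim_unique PG (lS _ hp)).
  apply: (@lim_near _ _ _ _ (fun=> 0)); last exact: tends_cst.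
  apply: sG; exists N => // n /= Nn; by rewrite hN.
- move=> a h; exact: (cst _ _ (Theta_form R k l) h).
split=> [c phi psi hp hq|phi psi hp hq e|a b phi hp hb ab|phi hp pp|].
- have hf := form_add c hp hq.
  apply: (lim_unique PG (lS _ hf)).
  rewrite (_ : T ^~ _ = fun n => c * T n phi + T n psi); last by apply/funext => n; exact: (good_linear (gT n)).
  exact: (@tends_linear _ _ _ _ _ c PG (lS _ hp) (lS _ hq)).
- apply: (lim_unique PG (lS _ hp)); rewrite (_ : T ^~ phi = T ^~ psi); first exact: lS.
  by apply/funext => n; exact: (good_ext (gT n)).
- by apply: cst => // n; exact: (good_bidim (gT n) hp hb).
- by apply: (lim_ge0 PG _ (lS _ hp)) => n; exact: (good_positive (gT n) hp pp).
exact: closed_limit nS cst (fun n => good_closed (gT n)).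
Qed.

End LimitCurrent.

(** * Cutoff functions *)

Section FlatFunctions.
Variable R : realType.
Local Notation C := R[i].

(* The family is stable under derivation; [flat 0] is a smooth cutoff. *)
Definition flat (j : nat) (x : R) : R := if 0 < x then x^-1 ^+ j * expR (- x^-1) else 0.

(** The derivative as a first-order expansion with remainder, convenient for composition and at the
    point 0, where [flat] is defined by cases. *)
Definition rdiff (g : R -> R) (x a : R) := forall e : R, 0 < e -> exists2 d : R, 0 < d &
  forall h : R, `|h| < d -> `|g (x + h) - g x - a * h| <= e * `|h|.

Lemma flat_ge0 j x : 0 <= flat j x.
Proof.
by rewrite /flat; case: ifP => // x0; rewrite mulr_ge0 ?expR_ge0 // exprn_ge0 // invr_ge0 ltW.
Qed.

(** With [y = 1 / x] and [m = j + 2], this is the inequality [(y / m)^m <= exp y]. *)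
Lemma flat_le_square j (x : R) : flat j x <= j.+2%:R ^+ j.+2 * x ^+ 2.
Proof.
rewrite /flat; case: ifP => x0; last first.
  by apply: mulr_ge0; [exact: exprn_ge0|exact: sqr_ge0].
have m0 : 0 < j.+2%:R :> R by rewrite ltr0n.
have xV : 0 < x^-1 by rewrite invr_gt0.
have h : (x^-1 / j.+2%:R) ^+ j.+2 <= expR x^-1.
  have -> : expR x^-1 = expR (x^-1 / j.+2%:R) ^+ j.+2.
    by rewrite -expRM_natl mulrCA mulfV ?mulr1 // gt_eqF.
  have t0 : 0 <= x^-1 / j.+2%:R by rewrite divr_ge0 // ltW.
  have t1 : x^-1 / j.+2%:R <= expR (x^-1 / j.+2%:R) by apply: le_trans (expR_ge1Dx _); rewrite lerDr ler01.
  by apply: lerXn2r; rewrite ?nnegrE ?expR_ge0.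
have E0 := expR_gt0 x^-1; rewrite expRN ler_pdivrMr //; apply: le_trans (ler_wpM2l _ h); last by apply: mulr_ge0; [exact: exprn_ge0|exact: sqr_ge0].
rewrite le_eqVlt; apply/orP; left; apply/eqP; rewrite exprMn (exprVn j.+2%:R).
have -> : x^-1 ^+ j.+2 = x^-1 ^+ j * x^-1 ^+ 2 by rewrite -exprD addn2.
have mn : j.+2%:R ^+ j.+2 != 0 :> R by rewrite expf_neq0 // gt_eqF.
have xn : x != 0 by rewrite gt_eqF.
move: mn; move: (j.+2%:R ^+ j.+2) (x^-1 ^+ j) => m y mn; by field; rewrite mn xn.
Qed.

Lemma rdiff_is_derive (g : R -> R) (x a : R) : is_derive x (1 : R) g a -> rdiff g x a.
Proof.
move=> [dg <-] e e0.
have /cvgrPdist_le /(_ e e0) := dg; rewrite near_withinE => -[d /= d0 hd].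
exists d => // h hdd; have [->|h0] := eqVneq h 0; first by rewrite addr0 subrr mulr0 subrr normr0 mulr0.
have := hd h; rewrite /= sub0r normrN => /(_ hdd h0).
rewrite /GRing.scale /= mulr1 => hh.
have -> : g (x + h) - g x - 'D_1 g x * h = - (('D_1 g x - h^-1 * (g (h + x) - g x)) * h).
  by rewrite mulrBl [h^-1 * _]mulrC mulfVK // [h + x]addrC opprB.
by rewrite normrN normrM; apply: ler_wpM2r.
Qed.

Lemma rdiff_lip (f : R -> R) (x a : R) : rdiff f x a -> exists2 d : R, 0 < d & forall h, `|h| < d -> `|f (x + h) - f x| <= (`|a| + 1) * `|h|.
Proof.
move=> /(_ 1 ltr01)[d d0 hd]; exists d => // h /hd; rewrite mul1r => h1.
have := ler_normD (f (x + h) - f x - a * h) (a * h); rewrite subrK normrM mulrDl mul1r; lra.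
Qed.

Lemma rdiff_comp (f g : R -> R) (x a b : R) : rdiff f x a -> rdiff g (f x) b -> rdiff (g \o f) x (b * a).
Proof.
move=> hf hg e e0; have a0 := normr_ge0 a; have b0 := normr_ge0 b.
pose A : R := `|a| + 1; pose B : R := `|b| + 1; have A0 : 0 < A by rewrite /A; lra. have B0 : 0 < B by rewrite /B; lra.
have e20 : 0 < e / (2 * A) by rewrite divr_gt0 // mulr_gt0.
have e10 : 0 < e / (2 * B) by rewrite divr_gt0 // mulr_gt0.
have [d1 d10 h1] := hf _ e10; have [d2 d20 h2] := hg _ e20; have [d3 d30 h3] := rdiff_lip hf.
exists (Num.min d1 (Num.min d3 (d2 / A))) => [|h]; first by rewrite !lt_min d10 d30 divr_gt0.
rewrite !lt_min => /and3P[k1 k2 k3].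
pose D := f (x + h) - f x; have hD : `|D| <= A * `|h| := h3 h k2.
have gD : `|g (f x + D) - g (f x) - b * D| <= e / (2 * A) * `|D|.
  by apply: h2; apply: le_lt_trans hD _; rewrite mulrC -ltr_pdivlMr.
have eD : f x + D = f (x + h) by rewrite /D addrC subrK.
rewrite eD in gD; have fD : `|D - a * h| <= e / (2 * B) * `|h| := h1 h k1.
have -> : (g \o f) (x + h) - (g \o f) x - b * a * h = (g (f (x + h)) - g (f x) - b * D) + b * (D - a * h) by rewrite /=; ring.
apply: le_trans (ler_normD _ _) _; rewrite normrM.
have i1 : e / (2 * A) * `|D| <= e / 2 * `|h|.
  apply: (@le_trans _ _ (e / (2 * A) * (A * `|h|))); first by apply: ler_wpM2l => //; exact: ltW.
  by rewrite le_eqVlt; apply/orP; left; apply/eqP; field; rewrite gt_eqF.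
have i2 : `|b| * `|D - a * h| <= e / 2 * `|h|.
  apply: (@le_trans _ _ (B * (e / (2 * B) * `|h|))); first by apply: ler_pM => //; rewrite /B; lra.
  by rewrite le_eqVlt; apply/orP; left; apply/eqP; field; rewrite gt_eqF.
by apply: le_trans (lerD (le_trans gD i1) i2) _; lra.
Qed.

Lemma rdiffM (f g : R -> R) (x a b : R) : rdiff f x a -> rdiff g x b -> rdiff (fun y => f y * g y) x (a * g x + f x * b).
Proof.
move=> hf hg e e0; have a0 := normr_ge0 a; have b0 := normr_ge0 b; have f0 := normr_ge0 (f x); have g0 := normr_ge0 (g x).
pose A : R := `|a| + 1; pose B : R := `|b| + 1; pose F : R := `|f x| + 1; pose G : R := `|g x| + 1.
have A0 : 0 < A by rewrite /A; lra. have B0 : 0 < B by rewrite /B; lra.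
have F0 : 0 < F by rewrite /F; lra. have G0 : 0 < G by rewrite /G; lra.
have [d1 d10 h1] := hf (e / (3 * G)) (divr_gt0 e0 (mulr_gt0 (ltr0n _ 3) G0)).
have [d2 d20 h2] := hg (e / (3 * F)) (divr_gt0 e0 (mulr_gt0 (ltr0n _ 3) F0)).
have [d3 d30 h3] := rdiff_lip hf; have [d4 d40 h4] := rdiff_lip hg.
have AB0 : 0 < 3 * (A * B) by rewrite !mulr_gt0.
exists (Num.min (Num.min d1 d2) (Num.min (Num.min d3 d4) (e / (3 * (A * B))))) => [|h].
  by rewrite !lt_min d10 d20 d30 d40 divr_gt0.
rewrite !lt_min => /andP[/andP[k1 k2] /andP[/andP[k3 k4] k5]].
have -> : f (x + h) * g (x + h) - f x * g x - (a * g x + f x * b) * h =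
  (f (x + h) - f x - a * h) * g x + f x * (g (x + h) - g x - b * h) + (f (x + h) - f x) * (g (x + h) - g x) by ring.
apply: le_trans (ler_normD _ _) _; apply: le_trans (lerD (ler_normD _ _) (lexx _)) _; rewrite !normrM.
have i1 : `|f (x + h) - f x - a * h| * `|g x| <= e / 3 * `|h|.
  apply: (@le_trans _ _ (e / (3 * G) * `|h| * G)); first by apply: ler_pM => //; [exact: h1|rewrite /G; lra].
  by rewrite le_eqVlt; apply/orP; left; apply/eqP; field; rewrite gt_eqF.
have i2 : `|f x| * `|g (x + h) - g x - b * h| <= e / 3 * `|h|.
  apply: (@le_trans _ _ (F * (e / (3 * F) * `|h|))); first by apply: ler_pM => //; [rewrite /F; lra|exact: h2].
  by rewrite le_eqVlt; apply/orP; left; apply/eqP; field; rewrite gt_eqF.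
have i3 : `|f (x + h) - f x| * `|g (x + h) - g x| <= e / 3 * `|h|.
  apply: (@le_trans _ _ (A * `|h| * (B * `|h|))); first by apply: ler_pM => //; [exact: h3|exact: h4].
  apply: (@le_trans _ _ (A * (B * `|h|) * (e / (3 * (A * B))))).
    rewrite (_ : A * `|h| * (B * `|h|) = A * (B * `|h|) * `|h|); last by ring.
    by apply: ler_wpM2l (ltW k5); rewrite !mulr_ge0 // ltW.
  by rewrite le_eqVlt; apply/orP; left; apply/eqP; field; rewrite !gt_eqF.
by apply: le_trans (lerD (lerD i1 i2) i3) _; lra.
Qed.

Lemma rdiff_inv (x : R) : 0 < x -> rdiff (fun y => y^-1) x (- x^-1 ^+ 2).
Proof.
move=> x0 e e0; have x20 : 0 < x ^+ 3 / 2 by rewrite divr_gt0 // exprn_gt0.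
exists (Num.min (x / 2) (e * (x ^+ 3 / 2))) => [|h]; first by rewrite lt_min divr_gt0 // mulr_gt0.
rewrite lt_min => /andP[h1 h2].
have xh : x / 2 < x + h by have := ler_norm (- h); rewrite normrN; lra.
have xh0 : 0 < x + h by apply: lt_trans xh; rewrite divr_gt0.
have xn : x != 0 by rewrite gt_eqF. have xhn : x + h != 0 by rewrite gt_eqF.
have -> : (x + h)^-1 - x^-1 - - x^-1 ^+ 2 * h = h * h / (x ^+ 2 * (x + h)) by field; rewrite xn xhn.
rewrite normrM normrM normfV mulrAC; apply: ler_wpM2r => //.
have p0 : 0 < x ^+ 2 * (x + h) by rewrite mulr_gt0 // exprn_gt0.
rewrite (gtr0_norm p0) ler_pdivrMr //; apply: le_trans (ltW h2) _; apply: ler_wpM2l; first exact: ltW.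
rewrite exprSr -mulrA; apply: ler_wpM2l; [by rewrite exprn_ge0 // ltW|exact: ltW].
Qed.

Lemma rdiff_expVN (x : R) : 0 < x -> rdiff (fun y => expR (- y^-1)) x (x^-1 ^+ 2 * expR (- x^-1)).
Proof.
move=> x0; have h1 : rdiff (fun y : R => - y) x^-1 (-1).
  by move=> e e0; exists 1 => // h _; rewrite (_ : _ - _ - _ = 0) ?normr0 ?mulr_ge0 // ?ltW //; ring.
have h2 := rdiff_comp (rdiff_comp (rdiff_inv x0) h1) (rdiff_is_derive (is_derive_expR (- x^-1))).
by move: h2; rewrite mulN1r opprK mulrC.
Qed.

Lemma rdiff_Vexp (x : R) j : 0 < x -> rdiff (fun y => y^-1 ^+ j) x (- j%:R * x^-1 ^+ j.+1).
Proof.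
move=> x0; elim: j => [|j IH].
  move=> e e0; exists 1 => // h _; rewrite !expr0 subrr mulNr mul0r oppr0 mul0r subr0 normr0.
  by rewrite mulr_ge0 // ltW.
have := rdiffM (rdiff_inv x0) IH; congr rdiff; last by rewrite -natr1 !exprS; ring.
by apply/funext => y; rewrite exprS.
Qed.

(** For positive [x] this is the product rule; at 0 the quadratic bound [flat_le_square] makes the
    derivative vanish. *)
Lemma flat_rdiff j x : rdiff (flat j) x (flat j.+2 x - j%:R * flat j.+1 x).
Proof.
have [x0|x0|->] := ltgtP x 0.
- move=> e e0; exists (- x) => [|h hx]; first by rewrite oppr_gt0.
  have xh : x + h < 0 by have := ler_norm h; lra.
  have f0 i y : y < 0 -> flat i y = 0 by move=> y0; rewrite /flat ltNge ltW.
  by rewrite !f0 // mulr0 !subr0 mul0r subr0 normr0 mulr_ge0 // ltW.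
- have H : rdiff (fun y => y^-1 ^+ j * expR (- y^-1)) x (flat j.+2 x - j%:R * flat j.+1 x).
    have := rdiffM (rdiff_Vexp j x0) (rdiff_expVN x0); congr rdiff.
    by rewrite /flat x0 !exprS; ring.
  move=> e e0; have [d d0 hd] := H e e0; exists (Num.min d x) => [|h]; first by rewrite lt_min d0.
  rewrite lt_min => /andP[h1 h2]; have := hd h h1.
  have xh : 0 < x + h by have := ler_norm (- h); rewrite normrN; lra.
  by rewrite /flat x0 xh.
move=> e e0; have m0 : 0 < j.+2%:R ^+ j.+2 :> R by rewrite exprn_gt0 // ltr0n.
exists (e / j.+2%:R ^+ j.+2) => [|h he]; first by rewrite divr_gt0.
have f0 i : flat i 0 = 0 by rewrite /flat ltxx.
rewrite !f0 mulr0 !subr0 mul0r subr0 add0r ger0_norm ?flat_ge0 //.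
apply: le_trans (flat_le_square _ _) _; rewrite -real_normK ?num_real // expr2 mulrA.
apply: ler_wpM2r => //; rewrite mulrC -ler_pdivlMr //; exact: ltW.
Qed.

End FlatFunctions.

Section RealComposition.
Variables (R : realType) (k : nat).
Local Notation C := R[i].
Local Notation V := 'rV[C]_k.+1.

Lemma has_derive_rcomp (g : R -> R) (u : V -> R) z v (a : R) (L : C) : rdiff g (u z) a ->
  has_derive (fun y => (u y)%:C) z v L -> has_derive (fun y => (g (u y))%:C) z v (a%:C * L).
Proof.
move=> hg /has_deriveP hu; apply/has_deriveP => e e0.
pose e2 : R := e / (3 * (cn L + 1)); pose e1 : R := Num.min 1 (e / (3 * (`|a| + 1))).
have L0 := cn_ge0 L; have a0 := normr_ge0 a.
have e20 : 0 < e2 by rewrite divr_gt0 // mulr_gt0 //; lra.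
have e10 : 0 < e1 by rewrite lt_min ltr01 divr_gt0 // mulr_gt0 //; lra.
have [d d0 hd] := hg e2 e20; have [d' d'0 hd'] := hu e1 e10.
exists (Num.min d' (d / (cn L + 2))) => [|h h0]; first by rewrite lt_min d'0 divr_gt0 //; lra.
rewrite lt_min => /andP[h1 h2]; have := hd' h h0 h1.
pose D := u (z + h%:C *: v) - u z.
have hC : h%:C != 0 :> C by rewrite fmorph_eq0.
have -> : difference_quotient (fun y => (u y)%:C) z v h = (D / h)%:C.
  by rewrite /difference_quotient -rmorphB mulrC -fmorphV -rmorphM.
move=> hq; have q1 : cn ((D / h)%:C - L) < 1 by apply: lt_le_trans hq _; rewrite ge_min lexx.
have q2 : cn ((D / h)%:C - L) < e / (3 * (`|a| + 1)) by apply: lt_le_trans hq _; rewrite ge_min lexx orbT.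
have qn : `|D / h| < cn L + 1.
  by have := cn_le_sub (D / h)%:C L; rewrite cn_real; lra.
have hp : 0 < `|h| by rewrite normr_gt0.
have Dn : `|D| < d.
  have eD : `|D| = `|D / h| * `|h| by rewrite -normrM mulfVK.
  rewrite eD; apply: (@lt_trans _ _ ((cn L + 2) * `|h|)); first by rewrite ltr_pM2r //; lra.
  by rewrite mulrC -ltr_pdivlMr //; lra.
have gD := hd _ Dn.
have eu : u z + D = u (z + h%:C *: v) by rewrite /D addrC subrK.
rewrite eu in gD.
pose E := g (u (z + h%:C *: v)) - g (u z) - a * D.
have -> : difference_quotient (fun y => (g (u y))%:C) z v h - a%:C * L = (E / h)%:C + a%:C * ((D / h)%:C - L).
  have -> : E / h = (g (u (z + h%:C *: v)) - g (u z)) / h - a * (D / h) by rewrite /E mulrBl mulrA.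
  rewrite /difference_quotient -rmorphB [_ * (_)%:C]mulrC -fmorphV -rmorphM (rmorphB _ _ (a * _)) (rmorphM _ a).
  rewrite /real_complex_def; move: (_ / h) (D / h) => x1 x2; case: (L) => l1 l2.
  by apply/eqP; rewrite eq_complex /=; apply/andP; split; apply/eqP; ring.
apply: le_lt_trans (cnD _ _) _; rewrite cnM !cn_real.
have E1 : `|E / h| <= e / 3.
  have : `|E / h| <= e2 * `|D / h|.
    rewrite !normrM normfV mulrA; apply: ler_wpM2r; first by rewrite invr_ge0.
    exact: gD.
  move=> /le_trans; apply; apply: (@le_trans _ _ (e2 * (cn L + 1))); first by apply: ler_wpM2l; lra.
  rewrite /e2 invfM mulrA -mulrA mulVf ?mulr1 //; lra.
have E2 : `|a| * cn ((D / h)%:C - L) <= e / 3.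
  apply: (@le_trans _ _ ((`|a| + 1) * (e / (3 * (`|a| + 1))))).
    by apply: ler_pM => //; [exact: cn_ge0|lra|exact: ltW].
  rewrite le_eqVlt; apply/orP; left; apply/eqP; field; lra.
by apply: le_lt_trans (lerD E1 E2) _; lra.
Qed.

(** The derivative of [flat j] is a combination of [flat j.+2] and [flat j.+1], so the compositions
    with [u], together with the smooth functions, generate an algebra stable under derivation. *)
Lemma smooth_on_flat O (u : V -> R) j : open O -> smooth_on O (fun z => (u z)%:C) -> smooth_on O (fun z => (flat j (u z))%:C).
Proof.
move=> oO su; pose S G := smooth_on O G \/ exists j, G = fun z => (flat j (u z))%:C.
apply: (@smooth_generated _ _ O S) => //; last by apply: GenBase; right; exists j.
move=> F [sF|[i ->]].
  split=> [z Oz|v]; first exact: smooth_on_continuous sF Oz.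
  exists (real_derive v F); first by apply: GenBase; left; exact: smooth_on_derive.
  by move=> z Oz; exact: (smooth_on_has_derive sF Oz).
split=> [z Oz|v].
  move=> A /nbhs_cnP[e e0 he]; have c := smooth_on_continuous su Oz.
  have [d d0 hd] := flat_rdiff i (u z) ltr01.
  set a := flat i.+2 (u z) - _ in hd.
  have a0 : 0 < `|a| + 1 by have := normr_ge0 a; lra.
  have hn : nbhs (u z)%:C [set w : C | cn ((u z)%:C - w) < Num.min d (e / (`|a| + 1))].
    by apply/nbhs_cnP; exists (Num.min d (e / (`|a| + 1))) => //; rewrite lt_min d0 divr_gt0.
  apply: (@filterS _ (nbhs z) _ _ _ _ (c _ hn)) => y hy; apply: he.
  have {}hy : cn ((u z)%:C - (u y)%:C) < Num.min d (e / (`|a| + 1)) by exact: hy.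
  move: hy; rewrite -rmorphB cn_real lt_min distrC => /andP[h1 h2].
  have := hd _ h1; rewrite [u z + _]addrC subrK mul1r => h3.
  rewrite -rmorphB cn_real distrC.
  have h4 : `|flat i (u y) - flat i (u z)| <= (`|a| + 1) * `|u y - u z|.
    have := ler_normD (flat i (u y) - flat i (u z) - a * (u y - u z)) (a * (u y - u z)).
    rewrite subrK normrM => h5; apply: le_trans h5 _; rewrite (mulrDl `|a| 1) mul1r addrC lerD2l //.
  apply: le_lt_trans h4 _; by rewrite mulrC -ltr_pdivlMr.
exists (fun z => ((flat i.+2 (u z))%:C + (- i%:R) * (flat i.+1 (u z))%:C) * real_derive v (fun z => (u z)%:C) z).
  apply: GenMul; last by apply: GenBase; left; exact: smooth_on_derive.
  apply: GenAdd; first by apply: GenBase; right; exists i.+2.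
  by apply: GenMul; [exact: GenCst|apply: GenBase; right; exists i.+1].
move=> z Oz; have := has_derive_rcomp (flat_rdiff i (u z)) (smooth_on_has_derive (v := v) su Oz).
by congr has_derive; congr (_ * _); rewrite rmorphB rmorphM rmorph_nat mulNr.
Qed.

End RealComposition.

(** * Bump functions on P^k and supports *)

Section Bump.
Variables (R : realType) (k : nat).
Local Notation C := R[i].
Local Notation V := 'rV[C]_k.+1.
Local Notation Pk := (projective_space R k).
Local Notation nz := ([set z : V | z != 0]).
Implicit Types (z a : V).

(** [e] minus the squared sine of the angle between the lines of [a] and [z]. *)
Definition cap_height (e : R) (a z : V) : R := e - nsq (z *m hproj a) / nsq z.

#[local] Opaque nsq herm hproj.

Lemma cap_heightZ e a (c : C) z : z != 0 -> c != 0 -> cap_height e a (c *: z) = cap_height e a z.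
Proof.
move=> z0 c0; rewrite /cap_height; congr (_ - _).
have cc : c * conjc c = (cn c ^+ 2)%:C := mul_conjc c.
have n1 (x : V) : nsq (c *: x) = cn c ^+ 2 * nsq x.
  have h : (nsq (c *: x))%:C = (cn c ^+ 2 * nsq x)%:C :> C by rewrite nsqZ cc -rmorphM.
  exact: complexI h.
rewrite -scalemxAl !n1 invfM mulrACA mulfV ?mul1r // expf_neq0 // cn_eq0 //.
Qed.

Lemma smooth_on_cap_height e a : smooth_on nz (fun z => (cap_height e a z)%:C).
Proof.
have o := @open_nz R k.
have sP j : smooth_on nz (fun z => (z *m hproj a) 0 j).
  rewrite (_ : (fun z => _) = fun z => \sum_i z 0 i * hproj a i j); last by apply/funext => z; rewrite mxE.
  apply: smooth_on_sum => [|i _]; first exact: o.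
  exact: (smooth_onM o (smooth_on_coord i o) (smooth_on_cst _ o)).
have s1 := smooth_onM o (smooth_on_cst (-1) o) (smooth_onM o (smooth_on_herm2 sP sP) (@smooth_on_nsqV R k)).
apply: smooth_on_eq (smooth_onD o (smooth_on_cst e%:C o) s1); first exact: o.
by move=> z z0; rewrite /cap_height rmorphB rmorphM fmorphV herm_nsq mulN1r.
Qed.

Lemma nsq_ge0 z : 0 <= nsq z.
Proof. by with_strategy transparent [nsq] rewrite /nsq; apply: sumr_ge0 => i _; rewrite exprn_ge0 // cn_ge0. Qed.

Lemma vn_le_nsq z : vn z ^+ 2 <= nsq z.
Proof.
have h : vn z <= Num.sqrt (nsq z).
  apply/vn_leP => [|i j]; first exact: sqrtr_ge0.
  rewrite -[leLHS]ger0_norm ?cn_ge0 // -sqrtr_sqr ler_wsqrtr // ord1.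
  with_strategy transparent [nsq] rewrite /nsq; rewrite (bigD1 j) //= lerDl.
  by apply: sumr_ge0 => l _; rewrite exprn_ge0 // cn_ge0.
by rewrite -(sqr_sqrtr (nsq_ge0 z)); apply: lerXn2r; rewrite ?nnegrE ?vn_ge0 ?sqrtr_ge0.
Qed.

Lemma pythagoras a z : a != 0 -> nsq z = nsq (z *m hproj a) + cn (herm z a / (nsq a)%:C) ^+ 2 * nsq a.
Proof.
move=> a0; have N0 := nsq_neq0 a0.
suff h : (nsq z)%:C = (nsq (z *m hproj a) + cn (herm z a / (nsq a)%:C) ^+ 2 * nsq a)%:C :> C by exact: complexI h.
have e1 (A B N : R) : (A + B * N)%:C = A%:C + B%:C * N%:C :> C by rewrite rmorphD rmorphM.
rewrite e1 -mul_conjc; set c := herm z a / _; rewrite -!herm_nsq.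
have -> : z *m hproj a = z - c *: a by rewrite mul_hproj.
rewrite hermBl !hermBr !hermZl !hermZr.
have -> : herm z a = c * herm a a by rewrite /c herm_nsq mulfVK.
have -> : herm a z = conjc c * herm a a.
  by rewrite -(herm_conj z a) -(herm_conj a a) -rmorphM; congr conjc; rewrite /c herm_nsq mulfVK.
by move: (conjc c) (herm z z) (herm a a) => c' x y; ring.
Qed.

Lemma cap_small (a : punctured R k) (U : set Pk) : nbhs (pclass a) U -> exists2 e : R, 0 < e &
  forall z : punctured R k, 0 <= cap_height e (pval a) (pval z) -> U (pclass z).
Proof.
move=> /nbhs_pclassP[e e0 he]; have a0 := punctured_neq0 a; have Na := nsq_gt0 a0.
(* The first bound gives the component of [z] along [a] at least half of [nsq z], hence makes it
   nonzero; the second brings the multiple of [z] with component [a] within [e] of [a]. *)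
pose eps : R := Num.min (1 / 2) (e ^+ 2 / (4 * nsq (pval a))).
exists eps => [|z].
  by rewrite lt_min !divr_gt0 // ?exprn_gt0 // mulr_gt0.
have z0 := punctured_neq0 z; have Nz := nsq_gt0 z0.
rewrite /cap_height subr_ge0 ler_pdivrMr // => h.
have py := pythagoras (pval z) a0; set c := herm _ _ / _ in py.
have e1 : eps <= 1 / 2 by rewrite ge_min lexx.
have e2 : eps * (4 * nsq (pval a)) <= e ^+ 2 by rewrite -ler_pdivlMr ?mulr_gt0 // ge_min lexx orbT.
have hhalf : nsq (pval z *m hproj (pval a)) <= nsq (pval z) / 2.
  by apply: le_trans h _; rewrite mulrC; apply: ler_wpM2l; lra.
have hc : nsq (pval z) <= 2 * (cn c ^+ 2 * nsq (pval a)) by lra.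
have c0 : c != 0.
  by apply/eqP => c00; move: hc; rewrite c00 cn0 expr0n mul0r mulr0; lra.
have cn0' : 0 < cn c by rewrite cn_gt0.
have w0 : c^-1 *: pval z != 0 by rewrite scaler_eq0 negb_or invr_eq0 c0.
have -> : pclass z = pclass (mkpunctured w0).
  by apply/pclass_eq; exists c => //; rewrite scalerA mulfV // scale1r.
apply: he; change (vn (pval a - c^-1 *: pval z) < e).
have -> : pval a - c^-1 *: pval z = - (c^-1 *: (pval z *m hproj (pval a))).
  by rewrite mul_hproj -/c scalerBr scalerA mulVf // scale1r opprB.
rewrite vnN vnZ; have -> : cn c^-1 = (cn c)^-1.
  by apply: (@mulfI _ (cn c)); rewrite ?gt_eqF // -cnM !mulfV ?cn1 // gt_eqF.
rewrite mulrC ltr_pdivrMr //.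
have hv := vn_le_nsq (pval z *m hproj (pval a)).
have h2 : vn (pval z *m hproj (pval a)) ^+ 2 < (e * cn c) ^+ 2.
  apply: le_lt_trans hv _; apply: le_lt_trans h _.
  apply: (@le_lt_trans _ _ (eps * (2 * (cn c ^+ 2 * nsq (pval a))))).
    by apply: ler_wpM2l => //; rewrite le_min !divr_ge0 ?exprn_ge0 ?ltW // mulr_gt0.
  rewrite exprMn; have e2' : eps * (4 * nsq (pval a)) * cn c ^+ 2 <= e ^+ 2 * cn c ^+ 2.
    by apply: ler_wpM2r => //; rewrite exprn_ge0 // ltW.
  have p0 : 0 < e ^+ 2 * cn c ^+ 2 by rewrite mulr_gt0 // exprn_gt0.
  by move: e2' p0; clear; move: (cn c ^+ 2) (nsq _) (e ^+ 2) eps => x y u v; lra.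
rewrite -(ltr_pXn2r (n := 2)) ?nnegrE ?vn_ge0 // mulr_ge0 ?ltW //.
Qed.

Record cutoff (b : V -> R) : Prop := Cutoff {
  cutoff_smooth : smooth_on nz (fun z => (b z)%:C);
  cutoff_invariant : forall (c : C) z, z != 0 -> c != 0 -> b (c *: z) = b z;
  cutoff_ge0 : forall z, 0 <= b z }.

(** [flat 0] of the cap height; its support stays in the region of nonnegative height, which
    [cap_small] places inside [U]. *)
Lemma bump (a : punctured R k) (U : set Pk) : nbhs (pclass a) U ->
  exists b, [/\ cutoff b, 0 < b (pval a) & closure [set pclass z | z in [set z : punctured R k | b (pval z) != 0]] `<=` U].
Proof.
move=> /cap_small[e e0 he]; have a0 := punctured_neq0 a.
exists (fun z => flat 0 (cap_height e (pval a) z)); split.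
- split=> [|c z z0 c0|z]; last exact: flat_ge0.
    exact: (smooth_on_flat 0 (@open_nz R k) (smooth_on_cap_height e (pval a))).
  by rewrite cap_heightZ.
- have -> : cap_height e (pval a) (pval a) = e.
    rewrite /cap_height hproj_self //; have -> : nsq (0 : V) = 0.
      by with_strategy transparent [nsq] rewrite /nsq; apply: big1 => i _; rewrite mxE cn0 expr0n.
    by rewrite mul0r subr0.
  by rewrite /flat e0 expr0 mul1r expR_gt0.
move=> q; have [z <-] := pclass_surj q => cl; apply: he; rewrite leNgt; apply/negP => hz.
have z0 := punctured_neq0 z; have c := smooth_on_continuous (smooth_on_cap_height e (pval a)) z0.
set r := cap_height _ _ _ in hz.
have hn : nbhs (cap_height e (pval a) (pval z))%:C [set w : C | cn (r%:C - w) < - r].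
  by apply/nbhs_cnP; exists (- r); rewrite ?oppr_gt0.
have /nbhs_vnP[d d0 hd] := c _ hn.
have [|_ [[y /= hy <-] hyz]] := cl [set p | exists2 y : punctured R k, pclass y = p & vn (pval z - pval y) < d].
  by apply/nbhs_pclassP; exists d => // w wd; exists w.
case: hyz => w wy hw; have {}hw : cn (r%:C - (cap_height e (pval a) (pval w))%:C) < - r by exact: hd.
have eyw : cap_height e (pval a) (pval y) = cap_height e (pval a) (pval w).
  move/pclass_eq: wy => [t t0 ->]; rewrite cap_heightZ //; exact: punctured_neq0.
move: hy; rewrite eyw => /eqP; apply; rewrite /flat ltNge (_ : cap_height _ _ _ <= 0) //.
move: hw; rewrite -rmorphB cn_real; have := ler_norm (- (r - cap_height e (pval a) (pval w))); rewrite normrN; lra.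
Qed.

Variable l : nat.
Variables (T : preform R k (l + l) -> C).
Hypothesis gT : good T.

#[local] Opaque Theta hermH wedge.

Lemma cutoff_form n b (phi : preform R k n) : cutoff b -> is_form phi -> is_form (fun z W => (b z)%:C * phi z W).
Proof.
move=> cb hp; apply: form_scale hp; first exact: cutoff_smooth.
by move=> z c z0 c0; rewrite cutoff_invariant.
Qed.

(* By a partition of unity, [phi] is a sum of forms with small supports. *)
Lemma support_vanish (phi : preform R k (l + l)) : is_form phi ->
  (forall p, form_support phi p -> ~ current_support T p) -> T phi = 0.
Proof.
move=> hp hsupp.
(* Compactness adds up local bumps to a cutoff [chi], positive on the support of [phi], whose
   product with any form is killed by [T]. *)
pose P (S : set Pk) := exists chi, [/\ cutoff chi, forall psi, is_form psi -> T (fun z W => (chi z)%:C * psi z W) = 0 &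
  forall z : punctured R k, S (pclass z) -> 0 < chi (pval z)].
have clF : closed (form_support phi) by exact: closed_closure.
have cF : compact (form_support phi) by apply: (subclosed_compact clF (@projective_compact R k)).
have o := @open_nz R k.
have : P (form_support phi).
  apply: (compact_ind cF) => [|B B' [x [cx Tx xp]] [x' [cx' Tx' xp']]|B B' BB [x [cx Tx xp]]|p Fp].
  - exists (fun=> 0); split=> [|psi hq|z []]; last first.
      by rewrite (goodZ gT 0 hq) mul0r.
    by split=> //; exact: smooth_on_cst.
  - exists (fun z => x z + x' z); split=> [|psi hq|z].
    + split=> [|c z z0 c0|z]; last by rewrite addr_ge0 // cutoff_ge0.
        apply: smooth_on_eq (smooth_onD o (cutoff_smooth cx) (cutoff_smooth cx')) => //.
        by move=> z _; rewrite rmorphD.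
      by rewrite !cutoff_invariant.
    + have h1 := cutoff_form cx hq; have h2 := cutoff_form cx' hq.
      rewrite (_ : (fun z W => _) = fun z W => (x z)%:C * psi z W + (x' z)%:C * psi z W).
        by rewrite (goodD gT h1 h2) Tx // Tx' // addr0.
      by apply/funext => z; apply/funext => W; rewrite rmorphD mulrDl.
    + move=> [/xp h|/xp' h]; [apply: ltr_wpDr h|apply: ltr_wpDl h]; exact: cutoff_ge0.
  - exists x; split=> // z Bz; apply: xp; exact: BB.
  have [z zp] := pclass_surj p; have := hsupp p Fp; rewrite /current_support /= -zp => nT.
  have [U [oU Uz TU]] : exists U, [/\ open U, U (pclass z) & forall psi, is_form psi -> form_support psi `<=` U -> T psi = 0].
    apply: contrapT => nU; apply: nT => U oU Uz; apply: contrapT => nphi; apply: nU; exists U; split=> // psi hq qU.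
    by apply/eqP/negPn/negP => Tq; apply: nphi; exists psi.
  have [b [cb b0 bU]] := bump (open_nbhs_nbhs (conj oU Uz)).
  exists [set pclass y | y in [set y : punctured R k | 0 < b (pval y)]].
    have c := smooth_on_continuous (cutoff_smooth cb) (punctured_neq0 z).
    have hn : nbhs (b (pval z))%:C [set w : C | cn ((b (pval z))%:C - w) < b (pval z)] by apply/nbhs_cnP; exists (b (pval z)).
    have /nbhs_vnP[d d0 hd] := c _ hn; apply/nbhs_pclassP; exists d => // w /hd hw; exists w => //=.
    have {}hw : cn ((b (pval z))%:C - (b (pval w))%:C) < b (pval z) by exact: hw.
    by move: hw; rewrite -rmorphB cn_real; have := ler_norm (b (pval z) - b (pval w)); lra.
  exists b; split=> // [psi hq|w [y /= hy /pclass_eq[t t0 e]]].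
    apply: TU; first exact: cutoff_form.
    apply: subset_trans bU; apply: closure_subset => _ [y [W hy] <-]; exists y => //=.
    by apply/eqP => by0; move: hy; rewrite by0 mul0r eqxx.
  by move: hy; rewrite e cutoff_invariant // punctured_neq0.
move=> [chi [cchi Tchi chip]].
pose O1 := [set z : V | z != 0 /\ chi z != 0].
pose O2 := [set z : V | exists2 z0 : z != 0, ~ form_support phi (pclass (mkpunctured z0)) & True].
have phi0 z W : O2 z -> phi z W = 0.
  move=> [z0 nF _]; apply/eqP/negPn/negP => n0; apply: nF.
  by apply: subset_closure; exists (mkpunctured z0) => //; exists W.
have O1o : open O1.
  rewrite openE => z [z0 cz]; have c := smooth_on_continuous (cutoff_smooth cchi) z0.
  have cz' : 0 < chi z by rewrite lt_def cz cutoff_ge0.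
  have hn : nbhs (chi z)%:C [set w : C | cn ((chi z)%:C - w) < chi z] by apply/nbhs_cnP; exists (chi z).
  have h1 : nbhs z [set y | cn ((chi z)%:C - (chi y)%:C) < chi z] := c _ hn.
  have h2 : nbhs z nz by exact: (open_nbhs_nbhs (conj o z0)).
  suff : nbhs z O1 by [].
  apply: (@filterS _ (nbhs z) _ _ _ _ (filterI h1 h2)) => y [hy y0]; split=> //; apply/eqP => e0.
  have {}hy : cn ((chi z)%:C - (chi y)%:C) < chi z by exact: hy.
  by move: hy; rewrite e0 rmorph0 subr0 cn_real ger0_norm ?ltxx // ltW.
have O2o : open O2.
  rewrite openE => z [z0 nF _].
  have : nbhs (pclass (mkpunctured z0)) (~` form_support phi).
    by apply: open_nbhs_nbhs; split=> //; exact: closed_openC.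
  move=> /nbhs_pclassP[e e0 he]; have h1 : nbhs z [set y | vn (z - y) < e] by apply/nbhs_vnP; exists e.
  have h2 : nbhs z nz by exact: (open_nbhs_nbhs (conj o z0)).
  suff : nbhs z O2 by [].
  apply: (@filterS _ (nbhs z) _ _ _ _ (filterI h1 h2)) => y [hy y0]; exists y0 => //; exact: (he (mkpunctured y0)).
have cover z : z != 0 -> O1 z \/ O2 z.
  move=> z0; have [F|nF] := pselect (form_support phi (pclass (mkpunctured z0))); last by right; exists z0.
  by left; split=> //; rewrite gt_eqF // (chip (mkpunctured z0)).
have O12 z : O2 z -> z != 0 by move=> [z0 _ _].
(* [phi] is [chi] times [psi]. The quotient is smooth, because [phi] vanishes near every point where
   [chi] does. *)
pose psi (z : V) (W : 'M[C]_(l + l, k.+1)) := ((chi z)%:C)^-1 * phi z W.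
have hpsi : is_form psi.
  apply: is_formP => [W|z z0 W X Y i b c' e eX eY|z W i j z0 ij e|z W c' z0 c0|z W i c' z0 e]; rewrite /psi.
  - have s1 : smooth_on O1 (psi^~ W).
      have sc : smooth_on O1 (fun z => (chi z)%:C) by apply: smooth_on_sub (cutoff_smooth cchi) => z [].
      have sp : smooth_on O1 (phi^~ W) by apply: smooth_on_sub (form_smooth_on W hp) => z [].
      apply: (smooth_onM O1o (smooth_on_inv O1o _ sc) sp) => z [_ cz]; by rewrite fmorph_eq0.
    have s2 : smooth_on O2 (psi^~ W).
      apply: (smooth_on_eq O2o _ (smooth_on_cst 0 O2o)) => z z2; by rewrite /psi phi0 // mulr0.
    split=> vs z z0; case: (cover z z0) => [h|h]; [exact: (smooth_on_iter s1 vs h)|exact: (smooth_on_iter s2 vs h)].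
  - rewrite (form_multilinearP hp z0 e eX eY).
    by move: (phi z X) (phi z Y) (_^-1) => a1 a2 a3; ring.
  - by rewrite (form_alternating hp z0 ij e) mulr0.
  - by rewrite (form_invariant hp) // cutoff_invariant.
  - by rewrite (form_horizontal hp z0 e) mulr0.
rewrite -(Tchi psi hpsi); apply: (good_ext gT hp (cutoff_form cchi hpsi)) => z W z0.
rewrite /psi mulrA; have [cz|cz] := eqVneq (chi z) 0; last by rewrite mulfV ?fmorph_eq0 // mul1r.
rewrite cz rmorph0 !mul0r; apply: phi0; case: (cover z z0) => // -[_]; by rewrite cz eqxx.
Qed.

End Bump.

(** * Openness *)

Section LimitOnAttractingSet.
Variables (R : realType) (k : nat).
Local Notation C := R[i].
Local Notation V := 'rV[C]_k.+1.
Local Notation Pk := (projective_space R k).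
Implicit Types (Q : 'I_k.+1 -> mpoly k.+1 C) (f : Pk -> Pk) (U A : set Pk).

#[local] Opaque Theta hermH wedge.

Lemma good_scale l (T : preform R k (l + l) -> C) (c : C) : 0 <= c -> good T -> good (fun phi => c * T phi).
Proof.
move=> c0 gT; split=> [b phi psi hp hq|phi psi hp hq e|a b phi hp hb ab|phi hp pp|].
- rewrite (good_linear gT b hp hq); move: (T phi) (T psi) => x y; ring.
- by rewrite (good_ext gT hp hq e).
- by rewrite (good_bidim gT hp hb ab) mulr0.
- by rewrite mulr_ge0 // (good_positive gT).
have cl n (S : preform R k n -> C) : current_closed S -> current_closed (fun phi => c * S phi).
  by case: n S => [//|n] S cS psi hp; rewrite cS // mulr0.
exact: cl (good_closed gT).
Qed.

Lemma form_support_pull Q f n (phi : preform R k n) q : lifts Q f -> form_support (pull Q phi) q -> form_support phi (f q).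
Proof.
move=> Qf; have cf := lifts_continuous Qf.
have cl : closed (f @^-1` form_support phi) by apply: closed_comp => [x _|]; [exact: cf|exact: closed_closure].
have sub : [set pclass z | z in [set z : punctured R k | exists W, pull Q phi (val z) W != 0]] `<=` f @^-1` form_support phi.
  move=> _ [z [W hz] <-]; have [w ew fw] := Qf z; rewrite /= fw; apply: subset_closure; exists w => //=.
  by exists (W *m jac Q (pval z)); rewrite -[val w]/(pval w) ew.
by move=> h; have := closure_subset sub h; rewrite -(closure_id _).1.
Qed.

Lemma supports_limit d Q f U A l : (0 < d)%N -> (forall j, Q j \is ishomog1 d mdeg) -> lifts Q f ->
  closure (f @` U) `<=` U -> A `<=` U -> supports_current A l -> supports_current (\bigcap_n (iter n f @` U)) l.
Proof.
move=> d0 hQ Qf fU AU [T [[cT bT pT clT] [[phi0 hphi0 T0] sT]]].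
have gT := current_good cT bT pT clT.
have nd n : nondegenerate (d ^ n) (iter_poly Q n) := lifts_iter_nondegenerate n d0 hQ Qf.
have dl0 n : (d ^ n)%:R ^+ l != 0 :> C by rewrite expf_neq0 // pnatr_eq0 -lt0n expn_gt0 d0.
pose Tn n := fun phi => ((d ^ n)%:R ^+ l)^-1 * on_forms (fun phi => T (pull (iter_poly Q n) phi)) phi.
have gTn n : good (Tn n).
  by apply: good_scale (good_on_pull (nd n) gT); rewrite invr_ge0 exprn_ge0 // ler0n.
have hTheta := Theta_form R k l.
have TnTheta n : Tn n (@Theta R k l) = T (@Theta R k l).
  have e1 := etrans (on_formsE (fun phi => T (pull (iter_poly Q n) phi)) hTheta) (good_pull_Theta (nd n) gT).
  have cancel (a x y : C) : a != 0 -> x = a * y -> a^-1 * x = y by move=> a0 ->; rewrite mulKf.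
  exact: cancel (dl0 n) e1.
have TnRe n : complex.Re (Tn n (@Theta R k l)) <= complex.Re (T (@Theta R k l)) by rewrite TnTheta.
have [S [gS STheta Sv]] := limit_functional gTn TnRe.
exists S; split; first by split; [exact: good_current|exact: good_bidim|exact: good_positive|exact: good_closed].
split.
  (* By [domination], a [T] vanishing on [Theta] would vanish on all forms. *)
  exists (@Theta R k l) => //; rewrite (STheta _ TnTheta); apply: contra_neq T0 => Th0.
  have [K K0 dom] := domination R k l; have [M M0 hM] := form_bounded hphi0.
  have := dom T gT phi0 M hphi0 M0 hM; rewrite Th0 mulr0 => h.
  by apply/eqP; rewrite -cn_eq0 eq_le h cn_ge0.
have fUU x : U x -> U (f x) by move=> Ux; apply: fU; apply: subset_closure; exists x.
have itU j x : U x -> U (iter j f x) by move=> Ux; elim: j => [//|j IH]; rewrite iterS; exact: fUU.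
move=> p Sp m _; apply: contrapT => npm.
(* With the closure, [K] is compact, so its complement is open; and [K] is still contained in the
   [m]-th image of [U]. *)
pose K := iter m f @` closure (f @` U).
have cK : compact K.
  apply: continuous_compact.
    by apply: continuous_subspaceT => x; exact: (lifts_continuous (lifts_iter m Qf)).
  exact: (subclosed_compact (@closed_closure _ _) (@projective_compact R k)).
have clK : closed K := compact_closed (@projective_hausdorff R k) cK.
have pK : (~` K) p by move=> [x /fU Ux e]; apply: npm; exists x.
have [phi [hp supp /eqP]] := Sp _ (closed_openC clK) pK; apply.
(* For [n > m] the [n]-th iterate sends the support of [T] into [K], as its last [m] steps start
   from a point of [f(U)]. So the support of the pulled-back form avoids that of [T]. *)
apply: Sv => //; exists m.+1 => n mn; rewrite /Tn (on_formsE _ hp).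
rewrite (support_vanish gT (pull_form (nd n) hp)) ?mulr0 // => q hq hTq.
have Uq : U q by apply: AU; exact: sT.
apply: (supp _ (form_support_pull (lifts_iter n Qf) hq)).
have -> : iter n f q = iter m f (f (iter (n - m.+1) f q)).
  by rewrite -iterS -iterD addnS -addSn subnKC.
exists (f (iter (n - m.+1) f q)) => //; apply: subset_closure; exists (iter (n - m.+1) f q) => //.
exact: itU.
Qed.

End LimitOnAttractingSet.

Section Openness.
Variables (R : realType) (k d : nat).
Local Notation C := R[i].
Local Notation Pk := (projective_space R k).

Lemma component_homog (F : homogeneous_map R k d) j : component F j \is ishomog1 d mdeg.
Proof. by rewrite /component; case: (F j). Qed.

Lemma is_lift_lifts (F : homogeneous_map R k d) (f : Pk -> Pk) : is_lift F f -> lifts (component F) f.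
Proof. by move=> h z; have [w e fw] := h z; exists w. Qed.

Lemma interpolate_open (K U : set Pk) : closed K -> open U -> K `<=` U -> exists U', [/\ open U', K `<=` U' & closure U' `<=` U].
Proof.
move=> cK oU KU.
have nbU : set_nbhs K U by move=> x Kx; exact: (open_nbhs_nbhs (conj oU (KU x Kx))).
have [W WK WU] := compact_normal (@projective_hausdorff R k) (@projective_compact R k) cK nbU.
exists (interior W); split; [exact: open_interior|by move=> x Kx; exact: WK|].
by apply: subset_trans WU; apply: closure_subset; exact: interior_subset.
Qed.

Lemma nearby_endomorphism (F : homogeneous_map R k d) (f : Pk -> Pk) A (m : nat) (U : set Pk) : (0 < d)%N -> is_lift F f ->
  trapping_region f A U -> attracting_dim A (k - m) -> asymptotically_small_topological_degree f d (k - m) U ->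
  exists2 e : R, 0 < e & forall (g : Pk -> Pk) (G : homogeneous_map R k d), is_lift G g ->
    (forall j m, `|mcoeff m (component G j) - mcoeff m (component F j)| < e%:C) ->
    exists U', [/\ trapping_region g (\bigcap_n (iter n g @` U')) U', attracting_dim (\bigcap_n (iter n g @` U')) (k - m) &
      asymptotically_small_topological_degree g d (k - m) U'].
Proof.
move=> d0 Ff [oU cfU fU AE] [sA nA] small.
have Qf := is_lift_lifts Ff; have hQ := component_homog F.
have [U' [oU' fU' U'U]] := interpolate_open (@closed_closure _ _) oU fU.
have cU' : compact (closure U') by exact: (subclosed_compact (@closed_closure _ _) (@projective_compact R k)).
have [|del del0 hdel] := near_compact_image Qf cU' oU'.
  by move=> x /U'U Ux; apply: fU'; apply: subset_closure; exists x.
have [e1 e10 h1] := coef_near_maps (ler0n R 2) del0 hQ.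
have D0 : 0 < (d ^ (k - m))%:R :> R by rewrite ltr0n expn_gt0 d0.
have [e2 e20 h2] := small_degree_stable d0 D0 hQ Qf cU' (@subset_closure _ _) U'U small.
exists (Num.min e1 e2) => [|g G Gg near]; first by rewrite lt_min e10.
have Qg := is_lift_lifts Gg; have hG := component_homog G.
have c12 : coef_near (Num.min e1 e2) (component F) (component G).
  by move=> j mo; have := near j mo; rewrite cnE ltcR.
have c1 : coef_near e1 (component F) (component G) by move=> j mo; apply: lt_le_trans (c12 j mo) _; rewrite ge_min lexx.
have c2 : coef_near e2 (component F) (component G) by move=> j mo; apply: lt_le_trans (c12 j mo) _; rewrite ge_min lexx orbT.
have gU' x : closure U' x -> U' (g x) := hdel _ _ Qg (h1 _ hG c1) x.
have cg : compact (g @` closure U').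
  by apply: continuous_compact cU'; apply: continuous_subspaceT => x; exact: (lifts_continuous Qg).
have clg : closure (g @` U') `<=` U'.
  have cl : closed (g @` closure U') := compact_closed (@projective_hausdorff R k) cg.
  have sub : g @` U' `<=` g @` closure U' by apply: image_subset; exact: subset_closure.
  move=> x /(closure_subset sub); rewrite -(closure_id _).1 // => -[y hy <-]; exact: gU'.
have fUU : f @` U `<=` U' by apply: subset_trans fU'; exact: subset_closure.
exists U'; split.
- split=> //; exact: (subclosed_compact (@closed_closure _ _) (@projective_compact R k)).
- split=> [|l kl sl].
    (* The attracting set of [f] lies in the first image [f(U)], hence in [U']; so a current that it
       supports can be pushed forward by [g]. *)
    apply: (supports_limit d0 hG Qg clg _ sA) => x; rewrite AE => /(_ 1%N I) [y Uy <-].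
    by apply: fUU; exists y.
  (* Conversely, the attracting set of [g] lies in [U'], hence in [U], and its currents can be
     pushed forward by [f]. *)
  apply: (nA l kl); rewrite AE; apply: (supports_limit d0 hQ Qf fU _ sl) => x /(_ 0%N I) [y U'y <-] /=.
  by apply: U'U; exact: subset_closure.
by apply: (h2 _ _ hG Qg c2) => x U'x; apply: gU'; exact: subset_closure.
Qed.

End Openness.

Theorem proposition2p4 (R : realType) (k d : nat)
  (hk : (1 <= k)%N) (hd : (2 <= d)%N) :
  open_endomorphisms d
    (fun f : projective_space R k -> projective_space R k =>
       endomorphism d f /\
       exists A, attracting_set f A /\ small_topological_degree f d A).
Proof.
have d0 : (0 < d)%N by apply: leq_trans hd.
split=> [f []//|f F [_ [A [_ [m [U [mk dimA trap small]]]]]] Ff].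
have [e e0 he] := nearby_endomorphism d0 Ff trap dimA small.
exists e => // g G Gg near; have [U' [trap' dim' small']] := he g G Gg near.
split; first by exists G.
exists (\bigcap_n (iter n g @` U')); split; first by exists U'.
by exists m, U'.
Qed.
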